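(* Let $\mathbb{K}\subseteq\mathbb{C}$ be a subfield, let $X\subseteq\mathbb{R}^m$ be a (globally) subanalytic set, let $n\ge 1$ and let $h\in\mathcal{C}^{\mathbb{K}}(X\times\mathbb{R}^n)$ be a $\mathbb{K}$-power-constructible function. Then there exists $H\in\mathcal{C}^{\mathbb{K}}(X)$ such that $$\forall x\in\mathrm{Int}(h;X),\quad \int_{\mathbb{R}^n}h(x,y)\,\mathrm{d}y=H(x),$$ where $\mathrm{Int}(h;X):=\{x\in X:\ y\longmapsto h(x,y)\in L^1(\mathbb{R}^n)\}$.
   Context: ''Subanalytic'' means globally subanalytic, i.e. definable in the o-minimal structure $\mathbb{R}_{\mathrm{an}}$ (the real field with all restricted analytic functions). For $X\subseteq\mathbb{R}^m$ subanalytic, $\mathcal{S}(X)$ is the set of functions $X\to\mathbb{R}$ whose graph is subanalytic, and $\mathcal{S}_+(X)=\{f\in\mathcal{S}(X): f(X)\subseteq(0,+\infty)\}$. For a subfield $\mathbb{K}\subseteq\mathbb{C}$, let $\mathbb{F}_{\mathbb{K}}=\mathbb{R}$ if $\mathbb{K}\subseteq\mathbb{R}$ and $\mathbb{F}_{\mathbb{K}}=\mathbb{C}$ otherwise. The $\mathbb{F}_{\mathbb{K}}$-algebra of $\mathbb{K}$-power-constructible functions on $X$ is $$\mathcal{C}^{\mathbb{K}}(X)=\Big\{\sum_{i=1}^{N}c_i\prod_{j=1}^{M}f_{i,j}^{\alpha_{i,j}}\log g_{i,j}:\ M,N\in\mathbb{N}^{\times},\ f_{i,j},g_{i,j}\in\mathcal{S}_+(X),\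 \alpha_{i,j}\in\mathbb{K},\ c_i\in\mathbb{F}_{\mathbb{K}}\Big\}.$$ *)

(* Defs.v *)
From HB Require Import structures.
From mathcomp Require Import all_boot all_order all_algebra.
From mathcomp Require Import complex.
From mathcomp Require Import all_classical all_reals all_analysis.
Import Order.TTheory GRing.Theory Num.Theory.
Import numFieldNormedType.Exports.

Set Implicit Arguments.
Unset Strict Implicit.
Unset Printing Implicit Defensive.

Local Open Scope classical_set_scope.
Local Open Scope ring_scope.
Local Open Scope complex_scope.

(* Points of R^n are row vectors 'rV[R]_n, and R^m * R^n is 'rV[R]_(m + n).  A
   function on a subset X of R^n is a total function on 'rV[R]_n of which only
   the values on X matter. *)

Section Analytic.
Variables (R : realType) (k : nat).
Implicit Types (F f : 'rV[R]_k -> R) (c : ('I_k -> nat) -> R) (a y : 'rV[R]_k).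

(* The term of multi-index e of the power series with coefficients c,
   centred at a. *)
Definition monomial_term c a y (e : 'I_k -> nat) : R :=
  c e * \prod_(i < k) (y 0 i - a 0 i) ^+ e i.

(* Sum over the multi-indices e with e i < N for all i; u is a term indexed by
   multi-indices. *)
Definition box_sum (u : ('I_k -> nat) -> R) (N : nat) : R :=
  \sum_(e : {ffun 'I_k -> 'I_N}) u (fun i => e i : nat).

(* The first conjunct is absolute convergence of the multi-indexed series; the
   sum of the series is then the limit of its sums over boxes. *)
Definition analytic_at F a : Prop :=
  exists c (r : R), 0 < r /\
    forall y, (forall i, `|y 0 i - a 0 i| < r) ->
      (exists M : R, forall N,
         box_sum (fun e => `|monomial_term c a y e|) N <= M) /\
      box_sum (monomial_term c a y) @ \oo --> F y.

Definition unit_cube : set 'rV[R]_k := [set x | forall i, -1 <= x 0 i <= 1].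

Definition restricted_analytic f : Prop :=
  exists (U : set 'rV[R]_k) F,
    [/\ open U, unit_cube `<=` U, (forall a, U a -> analytic_at F a),
        (forall x, unit_cube x -> f x = F x) &
        (forall x, ~ unit_cube x -> f x = 0)].

End Analytic.

(* First-order syntax of R_an, with parameters from R.  A formula of type
   an_formula n has its free variables among n variables, and an_exists binds
   the last one. *)
Inductive an_term (R : realType) (n : nat) : Type :=
| an_var of 'I_n
| an_const of R
| an_add of an_term R n & an_term R n
| an_mul of an_term R n & an_term R n
| an_fun k (f : 'rV[R]_k -> R) of restricted_analytic f & ('I_k -> an_term R n).

Inductive an_formula (R : realType) : nat -> Type :=
| an_eq n of an_term R n & an_term R n : an_formula R n
| an_lt n of an_term R n & an_term R n : an_formula R n
| an_not n of an_formula R n : an_formula R n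
| an_and n of an_formula R n & an_formula R n : an_formula R n
| an_exists n of an_formula R (n + 1) : an_formula R n.

Fixpoint an_eval (R : realType) n (x : 'rV[R]_n) (t : an_term R n) : R :=
  match t with
  | an_var i => x 0 i
  | an_const c => c
  | an_add t u => an_eval x t + an_eval x u
  | an_mul t u => an_eval x t * an_eval x u
  | an_fun k f _ ts => f (\row_i an_eval x (ts i))
  end.

Fixpoint an_holds (R : realType) n (phi : an_formula R n) : 'rV[R]_n -> Prop :=
  match phi in an_formula _ n return 'rV[R]_n -> Prop with
  | an_eq _ t u => fun x => an_eval x t = an_eval x u
  | an_lt _ t u => fun x => an_eval x t < an_eval x u
  | an_not _ phi => fun x => ~ an_holds phi x
  | an_and _ phi psi => fun x => an_holds phi x /\ an_holds psi x
  | an_exists _ phi => fun x => exists y : R, an_holds phi (row_mx x y%:M)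
  end.

Section Constructible.
Variable R : realType.

Definition subanalytic n (A : set 'rV[R]_n) : Prop :=
  exists phi : an_formula R n, A = [set x | an_holds phi x].

Definition graph_on n (X : set 'rV[R]_n) (f : 'rV[R]_n -> R) :
    set 'rV[R]_(n + 1) :=
  [set row_mx x (f x)%:M | x in X].

Definition subanalytic_fun n (X : set 'rV[R]_n) (f : 'rV[R]_n -> R) : Prop :=
  subanalytic (graph_on X f).

Definition pos_subanalytic_fun n (X : set 'rV[R]_n) (f : 'rV[R]_n -> R) : Prop :=
  subanalytic_fun X f /\ forall x, X x -> 0 < f x.

(* a ^ z = exp (z * log a), for a > 0. *)
Definition cpow (a : R) (z : R[i]) : R[i] :=
  let r := expR (complex.Re z * ln a) in
  let t := complex.Im z * ln a in
  (r * cos t) +i* (r * sin t).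

(* A subfield of the complex numbers is a divringClosed predicate on R[i]. *)
Definition coef_field (K : divringClosed R[i]) : set R[i] :=
  if `[< forall z, z \in K -> complex.Im z = 0 >]
  then [set c | complex.Im c = 0] else [set: R[i]].

Definition power_constructible (K : divringClosed R[i]) n (X : set 'rV[R]_n)
    (h : 'rV[R]_n -> R[i]) : Prop :=
  exists (N M : nat) (c : 'I_N -> R[i]) (alpha : 'I_N -> 'I_M -> R[i])
      (f g : 'I_N -> 'I_M -> 'rV[R]_n -> R),
    [/\ (0 < N)%N /\ (0 < M)%N,
        (forall i, coef_field K (c i)),
        (forall i j, alpha i j \in K),
        (forall i j, pos_subanalytic_fun X (f i j) /\
                     pos_subanalytic_fun X (g i j)) &
        forall x, X x -> h x =
          \sum_(i < N) c i *
            \prod_(j < M) (cpow (f i j x) (alpha i j) * (ln (g i j x))%:C)].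

End Constructible.

(* Lebesgue measure on R^n, on the product sigma-algebra of n.-tuple R. *)
Section LebesgueTuple.
Variable R : realType.
Local Notation MR := (measurableTypeR R).

Definition cons_pair n (p : MR * n.-tuple MR) : n.+1.-tuple MR :=
  [tuple of p.1 :: p.2].

Lemma measurable_cons_pair n : measurable_fun [set: _] (@cons_pair n).
Proof. exact: measurable_cons. Qed.

Definition uncons_tuple n (t : n.+1.-tuple MR) : MR * n.-tuple MR :=
  (thead t, [tuple of behead t]).

Lemma cons_pairK n : cancel (@cons_pair n) (@uncons_tuple n).
Proof. by case=> a t; congr (_, _); apply/val_inj. Qed.

Lemma measurable_uncons_tuple n : measurable_fun [set: _] (@uncons_tuple n).
Proof.
apply/measurable_fun_pairP; split; first exact: measurable_tnth.
exact: measurable_behead.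
Qed.

Section Step.
Variables (n : nat) (mu : {sigma_finite_measure set (n.-tuple MR) -> \bar R}).

Definition lebesgue_cons : set (n.+1.-tuple MR) -> \bar R :=
  pushforward (lebesgue_measure \x mu)%E (@cons_pair n).

HB.instance Definition _ := Measure.copy lebesgue_cons
  (measure_function_pushforward__canonical__measure_function_Measure
    (lebesgue_measure \x mu)%E (@measurable_cons_pair n)).

Lemma lebesgue_cons_sigma_finite : sigma_finite setT lebesgue_cons.
Proof.
have /sigma_finiteP[F [FT Fnd Foo]] := sigma_finiteT (@lebesgue_measure R).
have /sigma_finiteP[G [GT Gnd Goo]] := sigma_finiteT mu.
exists (fun k => @uncons_tuple n @^-1` (F k `*` G k)).
  rewrite -preimage_bigcup (_ : \bigcup_k _ = setT) ?preimage_setT//.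
  apply/seteqP; split=> // -[x y] _.
  have [i _ Fx] : (\bigcup_k F k) x by rewrite -FT.
  have [j _ Gy] : (\bigcup_k G k) y by rewrite -GT.
  exists (maxn i j) => //; split => /=.
    by move: x Fx; exact/subsetPset/Fnd/leq_maxl.
  by move: y Gy; exact/subsetPset/Gnd/leq_maxr.
move=> k; have [mF Ffin] := Foo k; have [mG Gfin] := Goo k; split.
  rewrite -[X in measurable X]setTI; apply: measurable_uncons_tuple => //.
  exact: measurableX.
rewrite /lebesgue_cons /pushforward -comp_preimage.
rewrite (_ : _ \o _ = id); last by apply/funext => p /=; rewrite cons_pairK.
by rewrite preimage_id product_measure1E// lte_mul_pinfty// ge0_fin_numE.
Qed.

HB.instance Definition _ := Measure_isSigmaFinite.Build _ _ _ lebesgue_cons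
  lebesgue_cons_sigma_finite.

End Step.

Fixpoint lebesgue_tuple n : {sigma_finite_measure set (n.-tuple MR) -> \bar R} :=
  match n with
  | 0 => dirac [tuple]
  | n'.+1 => lebesgue_cons (lebesgue_tuple n')
  end.

Lemma lebesgue_tuple_box n (A : 'I_n -> set MR) :
  (forall i, measurable (A i)) ->
  lebesgue_tuple n [set t | forall i, A i (tnth t i)] =
  (\prod_(i < n) lebesgue_measure (A i))%E.
Proof.
elim: n A => [|n IHn] A mA.
  rewrite big_ord0 /= (_ : [set _ | _] = setT) ?diracT//.
  by apply/seteqP; split=> // t _ [].
rewrite big_ord_recl -IHn// -product_measure1E//=; last first.
  rewrite (_ : [set _ | _] =
      \bigcap_(i in [set: 'I_n]) ((@tnth _ MR ^~ i) @^-1` A (lift ord0 i))).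
    apply: fin_bigcap_measurable => // i _.
    by rewrite -[X in measurable X]setTI; exact: measurable_tnth.
  by apply/seteqP; split=> t /= tA i *; exact: (tA i).
rewrite /lebesgue_cons /pushforward; congr product_measure1.
apply/seteqP; split=> -[a t] /=.
  by move=> tA; split=> [|i]; [exact: (tA ord0)|have := tA (lift ord0 i); rewrite tnthS].
by move=> [Aa At] i; case: (unliftP ord0 i) => [j ->|->//]; rewrite tnthS.
Qed.

End LebesgueTuple.

Section ComplexIntegral.
Variables (R : realType) (n : nat).
Local Notation mu := (lebesgue_tuple R n).
Implicit Type f : 'rV[R]_n -> R[i].

Definition row_of_tuple (t : n.-tuple (measurableTypeR R)) : 'rV[R]_n :=
  \row_i tnth t i.

Definition L1 f : Prop :=
  mu.-integrable [set: _] (EFin \o (@complex.Re R \o f \o row_of_tuple)) /\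
  mu.-integrable [set: _] (EFin \o (@complex.Im R \o f \o row_of_tuple)).

Definition cintegral f : R[i] :=
  (\int[mu]_(t in [set: _]) complex.Re (f (row_of_tuple t))) +i*
  (\int[mu]_(t in [set: _]) complex.Im (f (row_of_tuple t))).

End ComplexIntegral.

Section Fibres.
Variables (R : realType) (m n : nat).

Definition prod_Rn (X : set 'rV[R]_m) : set 'rV[R]_(m + n) :=
  [set z | X (lsubmx z)].

Definition Int_locus (h : 'rV[R]_(m + n) -> R[i]) (X : set 'rV[R]_m) :
    set 'rV[R]_m :=
  [set x | X x /\ L1 (fun y : 'rV[R]_n => h (row_mx x y))].

End Fibres.
Arguments prod_Rn {R m} n X.

(* Main.v *)
(* The functions obtained from coordinates and constants by ring operations,
   inverses, roots and restricted analytic functions ("D-functions") are closed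
   under definability, and this is proved without Weierstrass preparation.  Along
   an ultrafilter of R^(n+1), the germs of D-functions of the first n coordinates
   form a Hausdorff field.  Adjoining the last coordinate y gives again such a
   field, and its elements are all of the form a z^r W(c, A z^(1/p), B z^(-1/p)),
   with z = |y - th|, W analytic, and th, a, c, A, B in the smaller field; the
   role of Noetherianity is played by the property that a whole analytic family,
   evaluated at infinitesimals of the field, can be divided by one of its
   elements so as to become analytic and nonzero at 0.  By compactness of the
   space of ultrafilters, R^(n+1) is covered by finitely many cells with bounds
   given by D-functions on which given D-functions have this form.  This yields
   quantifier elimination, so subanalytic functions are D-functions.

   On such a cell a power-constructible function is a finite sum of terms
   P(x) z^la (ln z)^k S(D(x) z^(1/p)) or P(x) z^la (ln z)^k S(D(x) z^(-1/p)),
   with S a power series whose coefficients are analytic in functions of x, and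
   it has an explicit termwise primitive of the same shape, without constant
   term.  At an end of the cell where z tends to 0 or to infinity, convergence of
   the integral forces this primitive to have a limit, which is 0 because the
   sequences z^n n^k with |z| >= 1 are linearly independent modulo null
   sequences.  The integral is therefore the difference of the values of the
   primitive at those ends where z has a finite positive limit, and these are
   power-constructible in x.  Fubini's theorem reduces n variables to one. *)

Require Import Defs.
From HB Require Import structures.
From mathcomp Require Import all_boot all_order all_algebra.
From mathcomp Require Import complex.
From mathcomp Require Import all_classical all_reals all_analysis.
From mathcomp Require Import measurable_realfun.
From mathcomp Require Import ring lra zify.
Import Order.TTheory GRing.Theory Num.Theory.
Import numFieldNormedType.Exports.

Set Implicit Arguments.
Unset Strict Implicit.
Unset Printing Implicit Defensive.

Local Open Scope classical_set_scope.
Local Open Scope ring_scope.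

(** * Convergent power series *)

(** Power series are measured by weighted l^1 norms of their coefficients, so products, compositions
    and the implicit function theorem are norm estimates over the reals. Families carry one radius
    and one bound over an arbitrary index type: the coefficients of a family in one variable then
    form a family again, indexed by [A * nat], and can all be divided at once. A division property
    for finite families only would not survive the passage to the next variable.

    Bounded germs of a field have real limits, so a new variable [y] outside the field leaves two
    cases: some [|y - th|] is infinitely far in size from the whole field, or every [y - th] is
    asymptotic to an element of it. In the second case the order of a family in [y] is lowered by
    recentring and rescaling.

    Germs are taken along the filter generated by the cells of an ultrafilter, not along the
    ultrafilter, so that each eventual identity holds on a cell. The set of integrability is never
    described: the candidate for the integral is defined for every [x], and integrability over the
    line passes to the cells. *)

Section Usum.
Variable R : realType.
Implicit Types I J : choiceType.

Definition es I (f : I -> R) : \bar R := (\esum_(i in [set: I]) (f i)%:E)%E.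
(* The unordered sum of an absolutely summable [f], and junk otherwise. *)
Definition usum I (f : I -> R) : R :=
  fine (es (fun i => (f i + `|f i|)%R)) - fine (es (fun i => (`|f i|)%R)).
Definition l1 I (C : R) (f : I -> R) := (es (fun i => (`|f i|)%R) <= C%:E)%E.

Lemma es_ge0 I (f : I -> R) : (forall i, 0 <= f i) -> (0 <= es f)%E.
Proof. by move=> f0; apply: esum_ge0 => i _; rewrite lee_fin. Qed.

Lemma le_es I (f g : I -> R) : (forall i, f i <= g i) -> (es f <= es g)%E.
Proof. by move=> fg; apply: le_esum => i _; rewrite lee_fin. Qed.

Lemma esD I (f g : I -> R) : (forall i, 0 <= f i) -> (forall i, 0 <= g i) ->
  es (fun i => (f i + g i)%R) = (es f + es g)%E.
Proof.
by move=> f0 g0; rewrite /es -esumD => [//|i _|i _]; rewrite lee_fin.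
Qed.

Lemma es_fin I (f : I -> R) C : (forall i, 0 <= f i) -> (es f <= C%:E)%E ->
  es f \is a fin_num.
Proof.
by move=> f0 fC; rewrite ge0_fin_numE ?es_ge0// (le_lt_trans fC)// ltry.
Qed.

(** The termwise identity [(f + |f|) + h = |f| + g] shows that the value does not depend on how [f]
    is split into nonnegative summable parts. The rules of calculation below choose a convenient
    splitting and quote this lemma. *)
Lemma usumB I (f g h : I -> R) C D : (forall i, 0 <= g i) ->
  (forall i, 0 <= h i) -> (es g <= C%:E)%E -> (es h <= D%:E)%E ->
  (forall i, f i = g i - h i) -> usum f = fine (es g) - fine (es h).
Proof.
move=> g0 h0 gC hD fgh.
have fp i : 0 <= f i + `|f i| by have := ler_norm (- f i); rewrite normrN; lra.
have sN : (es (fun i => (`|f i|)%R) <= (C + D)%:E)%E.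
  rewrite EFinD; apply: le_trans (leeD gC hD); rewrite -esD//.
  apply: le_es => i; rewrite fgh (le_trans (ler_normB _ _))//.
  by rewrite !ger0_norm.
have sP : (es (fun i => (f i + `|f i|)%R) <= ((C + D) + (C + D))%:E)%E.
  rewrite EFinD; apply: le_trans (leeD sN sN); rewrite -esD//.
  by apply: le_es => i; rewrite lerD2r ler_norm.
have := @esD _ (fun i => f i + `|f i|) h fp h0.
have -> : (fun i => f i + `|f i| + h i) = (fun i => `|f i| + g i).
  by apply/funext => i; have := fgh i; lra.
rewrite (esD (fun i => normr_ge0 (f i)) g0) /usum => e; have := congr1 fine e.
rewrite !fineD ?(es_fin _ sN) ?(es_fin _ sP) ?(es_fin _ gC) ?(es_fin _ hD)//.
lra.
Qed.

Lemma es_pm I (f : I -> R) C : l1 C f ->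
  (es (fun i => (f i + `|f i|)%R) <= (C + C)%:E)%E.
Proof.
move=> fC; rewrite EFinD; apply: le_trans (leeD fC fC); rewrite -esD//.
by apply: le_es => i; rewrite lerD2r ler_norm.
Qed.

Lemma pm_ge0 (x : R) : 0 <= x + `|x|.
Proof. by have := ler_norm (- x); rewrite normrN; lra. Qed.

Lemma l1_ge0 I (f : I -> R) C : l1 C f -> 0 <= C.
Proof. by move/(le_trans (es_ge0 (fun i => normr_ge0 (f i)))); rewrite lee_fin. Qed.

Lemma l1_le I (f g : I -> R) C : l1 C f -> (forall i, `|g i| <= `|f i|) -> l1 C g.
Proof. by move=> fC gf; apply: le_trans fC; exact: le_es. Qed.

Lemma l1_leC I (f : I -> R) C D : C <= D -> l1 C f -> l1 D f.
Proof. by move=> CD fC; apply: le_trans fC _; rewrite lee_fin. Qed.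

Lemma l1D I (f g : I -> R) C D : l1 C f -> l1 D g -> l1 (C + D) (fun i => f i + g i).
Proof.
move=> fC gD; rewrite /l1 EFinD; apply: le_trans (leeD fC gD).
by rewrite -esD//; apply: le_es => i; exact: ler_normD.
Qed.

Lemma es0 I : es (fun _ : I => 0) = 0%E.
Proof. exact: esum1. Qed.

Lemma esZ_le I (f : I -> R) a C : (forall i, 0 <= f i) -> 0 <= a ->
  (es f <= C%:E)%E -> (es (fun i => (a * f i)%R) <= (a * C)%:E)%E.
Proof.
move=> f0 a0 fC.
have [->|an0] := eqVneq a 0.
  by rewrite mul0r (_ : (fun i => _) = (fun=> 0)) ?es0//; apply/funext => i; rewrite mul0r.
apply: ge_ereal_sup => _ [X [finX XI]] <-.
rewrite fsbig_finite//= sumEFin -mulr_sumr lee_fin ler_wpM2l//.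
rewrite -lee_fin; apply: le_trans fC; apply: ereal_sup_ubound; exists X => //.
by rewrite fsbig_finite//= sumEFin.
Qed.

Lemma l1Z I (f : I -> R) a C : l1 C f -> l1 (`|a| * C) (fun i => a * f i).
Proof.
move=> fC; rewrite /l1 (_ : (fun i => _) = (fun i => `|a| * `|f i|)); last first.
  by apply/funext => i; rewrite normrM.
exact: esZ_le.
Qed.

Lemma esZ I (f : I -> R) a C : (forall i, 0 <= f i) -> 0 <= a ->
  (es f <= C%:E)%E -> fine (es (fun i => (a * f i)%R)) = a * fine (es f).
Proof.
move=> f0 a0 fC; have ef := es_fin f0 fC.
have af0 i : 0 <= a * f i by exact: mulr_ge0.
have eaf := es_fin af0 (esZ_le f0 a0 fC).
have [->|an0] := eqVneq a 0.
  by rewrite mul0r (_ : (fun i => _) = (fun=> 0)) ?es0//; apply/funext => i; rewrite mul0r.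
apply/eqP; rewrite eq_le; apply/andP; split; rewrite -lee_fin.
  by rewrite fineK// esZ_le// fineK.
rewrite EFinM !fineK// -lee_pdivlMl ?lt_neqAle 1?eq_sym ?an0//.
have : (es (fun i => (a * f i)%R) <= (fine (es (fun i => (a * f i)%R)))%:E)%E by rewrite fineK.
move=> /(@esZ_le _ _ a^-1 _ af0); rewrite invr_ge0 => /(_ a0).
rewrite (_ : (fun i => _) = f); last by apply/funext => i; rewrite mulKf.
by rewrite EFinM fineK.
Qed.

Lemma usumD I (f g : I -> R) C D : l1 C f -> l1 D g ->
  usum (fun i => f i + g i) = usum f + usum g.
Proof.
move=> fC gD; have pf := es_pm fC; have pg := es_pm gD.
rewrite (@usumB _ _ (fun i => (f i + `|f i|) + (g i + `|g i|))
  (fun i => `|f i| + `|g i|) ((C + C) + (D + D)) (C + D)).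
- have qf i : 0 <= f i + `|f i| by exact: pm_ge0.
  have qg i : 0 <= g i + `|g i| by exact: pm_ge0.
  rewrite (esD qf qg) (esD (fun i => normr_ge0 (f i)) (fun i => normr_ge0 (g i))).
  rewrite !fineD ?(es_fin _ fC) ?(es_fin _ pf) ?(es_fin _ gD) ?(es_fin _ pg)//.
  by rewrite /usum; lra.
- by move=> i; rewrite addr_ge0// pm_ge0.
- by move=> i; rewrite addr_ge0.
- rewrite (esD (fun i => pm_ge0 (f i)) (fun i => pm_ge0 (g i))).
  by rewrite EFinD leeD.
- by rewrite (esD (fun i => normr_ge0 (f i)) (fun i => normr_ge0 (g i))) EFinD leeD.
- by move=> i; lra.
Qed.

Lemma usumN I (f : I -> R) C : l1 C f -> usum (fun i => - f i) = - usum f.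
Proof.
move=> fC; have pf := es_pm fC.
rewrite (@usumB _ _ (fun i => `|f i|) (fun i => f i + `|f i|) C (C + C))//.
- by rewrite /usum; lra.
- by move=> i; exact: pm_ge0.
- by move=> i; lra.
Qed.

Lemma usumZ I (f : I -> R) C a : l1 C f -> usum (fun i => a * f i) = a * usum f.
Proof.
move=> fC; have pf := es_pm fC.
have P b g : l1 C g -> 0 <= b -> usum (fun i => b * g i) = b * usum g.
  move=> {fC pf} gC b0; have pg := es_pm gC.
  rewrite (@usumB _ _ (fun i => b * (g i + `|g i|)) (fun i => b * `|g i|)
    (b * (C + C)) (b * C)).
  - rewrite (esZ (fun i => pm_ge0 (g i)) b0 pg).
    by rewrite (esZ (fun i => normr_ge0 (g i)) b0 gC) /usum; lra.
  - by move=> i; rewrite mulr_ge0// pm_ge0.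
  - by move=> i; rewrite mulr_ge0.
  - by apply: esZ_le => // i; exact: pm_ge0.
  - exact: esZ_le.
  - by move=> i; lra.
have [a0|/ltW a0] := leP 0 a; first exact: P.
rewrite (_ : (fun i => _) = (fun i => - a * - f i)); last first.
  by apply/funext => i; rewrite mulrNN.
rewrite P ?oppr_ge0//; first by rewrite (usumN fC) mulrNN.
by apply: l1_le fC _ => i; rewrite normrN.
Qed.

Lemma usum_norm I (f : I -> R) C : l1 C f -> `|usum f| <= C.
Proof.
move=> fC; have pf := es_pm fC; have := fC.
have p0 := es_ge0 (fun i => pm_ge0 (f i)).
rewrite /l1 /usum -[es _ in X in X -> _](fineK (es_fin _ fC))// lee_fin.
set n := fine _ => nC.
have : (es (fun i => (f i + `|f i|)%R) <= (n + n)%:E)%E.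
  by apply: es_pm; rewrite /l1 fineK// (es_fin _ fC).
rewrite -[es _](fineK (es_fin _ pf))//; last by move=> i; exact: pm_ge0.
rewrite lee_fin => h2.
have h3 : 0 <= fine (es (fun i => (f i + `|f i|)%R)) by rewrite fine_ge0.
by rewrite ler_norml; apply/andP; split; lra.
Qed.

Lemma es1 I (f : I -> R) i0 : 0 <= f i0 ->
  es (fun i => (if i == i0 then f i else 0)%R) = (f i0)%:E.
Proof.
move=> f0; rewrite /es -(@esum_set1 _ _ i0 (fun i => (f i)%:E))//.
rewrite [RHS]esum_mkcond; apply: eq_esum => i _.
by have [->|ii0] := eqVneq i i0; [rewrite mem_set|rewrite memNset//=; exact/eqP].
Qed.

Lemma l1_1 I (f : I -> R) i0 : l1 `|f i0| (fun i => if i == i0 then f i else 0).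
Proof.
rewrite /l1 -(@es1 _ (fun i => `|f i|))//; apply: le_es => i.
by case: eqP => // _; rewrite normr0.
Qed.

Lemma usum1 I (f : I -> R) i0 : usum (fun i => if i == i0 then f i else 0) = f i0.
Proof.
rewrite (@usumB _ _ (fun i => if i == i0 then f i + `|f i| else 0)
  (fun i => if i == i0 then `|f i| else 0) (f i0 + `|f i0|) `|f i0|).
- by rewrite !es1//= ?addrK//; exact: pm_ge0.
- by move=> i; case: ifP => // _; exact: pm_ge0.
- by move=> i; case: ifP.
- by rewrite (@es1 _ (fun i => f i + `|f i|))//; exact: pm_ge0.
- by rewrite (@es1 _ (fun i => `|f i|)).
- by move=> i; case: ifP => // _; lra.
Qed.

Lemma usum0 I : usum (fun _ : I => 0) = 0.
Proof.
by rewrite /usum normr0 addr0 subrr.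
Qed.

Definition l11 I J (C : R) (f : I -> J -> R) :=
  (\esum_(i in [set: I]) es (fun j => (`|f i j|)%R) <= C%:E)%E.

Lemma esum_swap I J (f : I -> J -> \bar R) : (forall i j, 0 <= f i j)%E ->
  (\esum_(i in [set: I]) \esum_(j in [set: J]) f i j =
   \esum_(j in [set: J]) \esum_(i in [set: I]) f i j)%E.
Proof.
move=> f0; rewrite !esum_esum//.
rewrite (reindex_esum ([set: J] `*`` (fun=> [set: I])) _ (fun k => (k.2, k.1)))//.
split=> [k //|[a b] [c d] _ _ [-> ->]//|[a b] _ /=].
by exists (b, a).
Qed.

Lemma l11_swap I J C (f : I -> J -> R) : l11 C f -> l11 C (fun j i => f i j).
Proof. by rewrite /l11 /es esum_swap. Qed.

Lemma l11_inner I J C (f : I -> J -> R) i : l11 C f -> l1 C (f i).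
Proof.
apply: le_trans.
apply: (@esum_ge _ _ _ (fun i => es (fun j => (`|f i j|)%R))).
exists [set i]; first by split => //; exact: finite_set1.
by rewrite fsbig_set1.
Qed.

Lemma l11_le I J C (f g : I -> J -> R) : l11 C f ->
  (forall i j, `|g i j| <= `|f i j|) -> l11 C g.
Proof. by move=> fC gf; apply: le_trans fC; apply: le_esum => i _; exact: le_es. Qed.

Lemma fine_esE I J C (f : I -> J -> R) : (forall i j, 0 <= f i j) -> l11 C f ->
  es (fun i => fine (es (f i))) = (\esum_(i in [set: I]) es (fun j => (`|f i j|)%R))%E.
Proof.
move=> f0 fC; apply: eq_esum => i _.
have e : f i = (fun j => `|f i j|) by apply/funext => j; rewrite ger0_norm.
by rewrite fineK -?e// e; apply: (es_fin _ (l11_inner i fC)).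
Qed.

Lemma l11_pm I J C (f : I -> J -> R) : l11 C f ->
  l11 (C + C) (fun i j => f i j + `|f i j|).
Proof.
move=> fC; rewrite /l11 EFinD; apply: le_trans (leeD fC fC).
rewrite -esumD; [|by move=> i _; exact: es_ge0..].
apply: le_esum => i _; rewrite -esD//; apply: le_es => j.
by rewrite (le_trans (ler_normD _ _))// normr_id.
Qed.

Lemma l11_abs I J C (f : I -> J -> R) : l11 C f -> l11 C (fun i j => `|f i j|).
Proof. by move=> fC; apply: l11_le fC _ => i j; rewrite normr_id. Qed.

Lemma l11_outer I J C (f : I -> J -> R) : l11 C f -> l1 C (fun i => usum (f i)).
Proof.
move=> fC; apply: le_trans (fC); apply: le_esum => i _.
have fi := l11_inner i fC.
rewrite -(fineK (es_fin _ fi))// lee_fin; apply: usum_norm.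
by rewrite /l1 fineK// (es_fin _ fi).
Qed.

Lemma usum_usumE I J C (f : I -> J -> R) : l11 C f ->
  usum (fun i => usum (f i)) =
  fine (\esum_(i in [set: I]) es (fun j => (`|f i j + `|f i j| |)%R))%E -
  fine (\esum_(i in [set: I]) es (fun j => (`| `|f i j| |)%R))%E.
Proof.
move=> fC; have pC := l11_pm fC; have aC := l11_abs fC.
have p0 i j : 0 <= f i j + `|f i j| by exact: pm_ge0.
rewrite (@usumB _ _ (fun i => fine (es (fun j => (f i j + `|f i j|)%R)))
  (fun i => fine (es (fun j => (`|f i j|)%R))) (C + C) C).
- by rewrite (fine_esE _ pC)// (fine_esE _ aC).
- by move=> i; rewrite fine_ge0// es_ge0.
- by move=> i; rewrite fine_ge0// es_ge0.
- by rewrite (fine_esE _ pC).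
- by rewrite (fine_esE _ aC).
- by [].
Qed.

(** Both iterated sums are differences of iterated sums of nonnegative terms, whose order can be
    exchanged freely. *)
Lemma usum_swap I J C (f : I -> J -> R) : l11 C f ->
  usum (fun i => usum (f i)) = usum (fun j => usum (fun i => f i j)).
Proof.
move=> fC; rewrite (usum_usumE fC) (usum_usumE (l11_swap fC)).
by congr (fine _ - fine _); rewrite /es esum_swap.
Qed.

Lemma l11_nest I J C (c : I -> R) (f : I -> J -> R) :
  l1 C c -> (forall i, l1 (c i) (f i)) -> l11 C f.
Proof.
move=> cC fc; apply: le_trans cC; apply: le_esum => i _.
by apply: le_trans (fc i) _; rewrite lee_fin ler_norm.
Qed.

(** Spreads [f] over the graph of [p]; exchanging the two sums then regroups [f] along the fibres of
    [p]. *)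
Lemma l11_fiber I J C (p : I -> J) (f : I -> R) : l1 C f ->
  l11 C (fun i j => if j == p i then f i else 0).
Proof.
move=> fC; apply: (@l11_nest _ _ _ (fun i => `|f i|)).
  by apply: l1_le fC _ => i; rewrite normr_id.
by move=> i; exact: (@l1_1 _ (fun=> f i)).
Qed.

End Usum.

(** * Weighted l^1 norms of power series on polydiscs *)

Section Monomials.
Variables (R : realType) (T : finType).
Implicit Types (r s C D : R) (x : T -> R) (e : {ffun T -> nat}) (f g : (T -> R) -> R).

Definition mdeg e := (\sum_t e t)%N.
Definition mono x e : R := \prod_t x t ^+ e t.
Definition small (r : R) x := forall t, `|x t| <= r.
Definition madd e e' : {ffun T -> nat} := [ffun t => (e t + e' t)%N].

Lemma mono_small r x e : small r x -> `|mono x e| <= r ^+ mdeg e.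
Proof.
move=> xr; rewrite /mono /mdeg normr_prod expr_sum; apply: ler_prod => t _.
by rewrite normr_ge0/= normrX lerXn2r// nnegrE// (le_trans _ (xr t)).
Qed.

Lemma monoD x e e' : mono x (madd e e') = mono x e * mono x e'.
Proof. by rewrite /mono -big_split/=; apply: eq_bigr => t _; rewrite ffunE exprD. Qed.

Lemma mdegD e e' : mdeg (madd e e') = (mdeg e + mdeg e')%N.
Proof. by rewrite /mdeg -big_split/=; apply: eq_bigr => t _; rewrite ffunE. Qed.

Lemma mdeg0 e : (mdeg e == 0%N) = (e == [ffun=> 0%N]).
Proof.
apply/idP/eqP => [|->]; last by rewrite /mdeg big1// => t _; rewrite ffunE.
rewrite /mdeg sum_nat_eq0 => /forallP h; apply/ffunP => t; rewrite ffunE.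
by apply/eqP; exact: (implyP (h t)).
Qed.

Lemma mono00 x : mono x [ffun=> 0%N] = 1.
Proof. by rewrite /mono big1// => t _; rewrite ffunE. Qed.

Lemma mono0 e : mono (fun=> 0) e = if e == [ffun=> 0%N] then 1 else 0.
Proof.
case: eqP => [->|/eqP]; first exact: mono00.
rewrite -mdeg0 /mdeg sum_nat_eq0 negb_forall => /existsP[t et].
by rewrite /mono (bigD1 t)//= expr0n; case: (e t) et => // n _; rewrite mul0r.
Qed.

(* [f] is the sum on the polydisc of radius [r] of a power series of weighted
   l^1-norm at most [C]. *)
Definition an1 (r C : R) f := exists v : {ffun T -> nat} -> R,
  l1 C (fun e => v e * r ^+ mdeg e) /\
  forall x, small r x -> f x = usum (fun e => v e * mono x e).

Lemma l1_mono r C v x : 0 < r -> l1 C (fun e => v e * r ^+ mdeg e) -> small r x ->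
  l1 C (fun e => v e * mono x e).
Proof.
move=> r0 vC xr; apply: l1_le vC _ => e; rewrite !normrM ler_wpM2l//.
by rewrite (le_trans (mono_small e xr))// ler_norm.
Qed.

Lemma an1_ext r C f g : (forall x, small r x -> f x = g x) -> an1 r C f -> an1 r C g.
Proof. by move=> fg [v [vC fv]]; exists v; split=> // x xr; rewrite -fg// fv. Qed.

Lemma an1_le r C D f : C <= D -> an1 r C f -> an1 r D f.
Proof. by move=> CD [v [vC fv]]; exists v; split=> //; exact: l1_leC vC. Qed.

Lemma an1_ge0 r C f : an1 r C f -> 0 <= C.
Proof. by move=> [v [/l1_ge0]]. Qed.

Lemma an1_r r s C f : 0 < s -> s <= r -> an1 r C f -> an1 s C f.
Proof.
move=> s0 sr [v [vC fv]]; exists v; split=> [|x xs].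
  apply: l1_le vC _ => e; rewrite !normrM ler_wpM2l// !normrX lerXn2r// ?nnegrE//.
  by rewrite !ger0_norm// ?ltW// (lt_le_trans s0).
by apply: fv => t; exact: le_trans (xs t) sr.
Qed.

Lemma an1_bound r C f x : 0 < r -> an1 r C f -> small r x -> `|f x| <= C.
Proof.
move=> r0 [v [vC fv]] xr; rewrite fv//; apply: usum_norm; exact: l1_mono vC xr.
Qed.

Lemma small0 r : 0 < r -> small r (fun=> 0).
Proof. by move=> r0 t; rewrite normr0 ltW. Qed.

Lemma an1_mono r e : 0 < r -> an1 r 1 (fun x => mono x e / r ^+ mdeg e).
Proof.
move=> r0; exists (fun e' => if e' == e then (r ^+ mdeg e')^-1 else 0); split.
  have -> : (fun e0 => (if e0 == e then (r ^+ mdeg e0)^-1 else 0) * r ^+ mdeg e0) =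
      (fun e0 => if e0 == e then 1 else 0) :> (_ -> R).
    by apply/funext => e'; case: eqP => _; rewrite ?mul0r// mulVf// expf_neq0// gt_eqF.
  by have := @l1_1 R _ (fun=> 1) e; rewrite normr1.
move=> x xr.
rewrite (_ : (fun e' => _) = (fun e' => if e' == e then mono x e' / r ^+ mdeg e' else 0)).
  by rewrite (usum1 (fun e' => mono x e' / r ^+ mdeg e')).
by apply/funext => e'; case: eqP => _; rewrite ?mul0r// mulrC.
Qed.

(** The source of most closure properties: after an exchange of sums the coefficient at [e] is the
    combination of the coefficients of the [f j], and the norm is bounded by the double sum.
    Products, compositions and expansions in one variable are obtained by writing a function as such
    a combination. *)
Lemma an1_usum (J : choiceType) r C D (u : J -> R) (f : J -> (T -> R) -> R) :
  0 < r -> 0 <= D -> l1 C u -> (forall j, an1 r D (f j)) ->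
  an1 r (C * D) (fun x => usum (fun j => u j * f j x)).
Proof.
move=> r0 D0 uC /choice[v vP].
have uv : l11 (C * D) (fun j e => u j * (v j e * r ^+ mdeg e)).
  apply: (@l11_nest _ _ _ _ (fun j => `|u j| * D)).
    have := l1Z D uC; rewrite ger0_norm// mulrC => h.
    by apply: l1_le h _ => i; rewrite !normrM normr_id mulrC.
  by move=> j; have [vD _] := vP j; exact: l1Z.
have rn0 e : r ^+ mdeg e != 0 by rewrite expf_neq0// gt_eqF.
exists (fun e => usum (fun j => u j * (v j e * r ^+ mdeg e)) / r ^+ mdeg e); split.
  rewrite (_ : (fun e => _) =
    (fun e => usum (fun j => u j * (v j e * r ^+ mdeg e)))).
    exact: l11_outer (l11_swap uv).
  by apply/funext => e; rewrite divfK.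
move=> x xr.
rewrite (_ : (fun j => _) = (fun j =>
    usum (fun e => mono x e / r ^+ mdeg e * (u j * (v j e * r ^+ mdeg e))))); last first.
  apply/funext => j; have [vD fE] := vP j; rewrite fE//.
  rewrite -(usumZ _ (l1_mono r0 vD xr)); congr usum; apply/funext => e.
  by have := rn0 e => ?; field.
rewrite (@usum_swap _ _ _ (C * D)); last first.
  apply: l11_le uv _ => j e; rewrite normrM ler_piMl//.
  rewrite normrM normfV ler_pdivrMr ?normr_gt0// mul1r.
  by rewrite (le_trans (mono_small _ xr))// ler_norm.
congr usum; apply/funext => e.
by rewrite (usumZ _ (l11_inner e (l11_swap uv))); ring.
Qed.

Lemma an1_cst r c : 0 < r -> an1 r `|c| (fun=> c).
Proof.
move=> r0; have := @an1_usum unit r `|c| 1 (fun=> c)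
  (fun _ x => mono x [ffun=> 0%N] / r ^+ mdeg ([ffun=> 0%N] : {ffun T -> nat})) r0 ler01.
rewrite mulr1 => h; apply: an1_ext (h _ _) => [x xr||j].
- have -> : mdeg ([ffun=> 0%N] : {ffun T -> nat}) = 0%N by apply/eqP; rewrite mdeg0.
  rewrite (_ : (fun j => _) = (fun j => if j == tt then c else 0)).
    by rewrite (@usum1 _ _ (fun=> c)).
  by apply/funext => -[]; rewrite mono00 expr0 divr1 mulr1.
- rewrite (_ : (fun=> c) = (fun j => if j == tt then c else 0)); last by apply/funext => -[].
  exact: (@l1_1 _ _ (fun=> c)).
- exact: an1_mono.
Qed.

Lemma an1D r C D f g : 0 < r -> an1 r C f -> an1 r D g ->
  an1 r (C + D) (fun x => f x + g x).
Proof.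
move=> r0 [v [vC fv]] [w [wD gw]]; exists (fun e => v e + w e); split.
  by rewrite (_ : (fun e => _) = (fun e => v e * r ^+ mdeg e + w e * r ^+ mdeg e));
    [exact: l1D|apply/funext => e; rewrite mulrDl].
move=> x xr; rewrite fv// gw// -(usumD (l1_mono r0 vC xr) (l1_mono r0 wD xr)).
by congr usum; apply/funext => e; rewrite mulrDl.
Qed.

Lemma an1Z r C a f : 0 < r -> an1 r C f -> an1 r (`|a| * C) (fun x => a * f x).
Proof.
move=> r0 [v [vC fv]]; exists (fun e => a * v e); split.
  by rewrite (_ : (fun e => _) = (fun e => a * (v e * r ^+ mdeg e)));
    [exact: l1Z|apply/funext => e; rewrite mulrA].
move=> x xr; rewrite fv// -(usumZ _ (l1_mono r0 vC xr)).
by congr usum; apply/funext => e; rewrite mulrA.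
Qed.

(** The exponents [eps j] may repeat; [an1_usum] collects equal monomials. *)
Lemma an1_ofsum (J : choiceType) r C (u : J -> R) (eps : J -> {ffun T -> nat}) :
  0 < r -> l1 C (fun j => u j * r ^+ mdeg (eps j)) ->
  an1 r C (fun x => usum (fun j => u j * mono x (eps j))).
Proof.
move=> r0 uC; rewrite -(mulr1 C).
apply: an1_ext (an1_usum r0 ler01 uC (fun j => an1_mono (eps j) r0)) => x xr.
by congr usum; apply/funext => j; field; rewrite expf_neq0// gt_eqF.
Qed.

(** No Cauchy product is formed: [f] is an l^1 combination of the normalised monomials
    [mono x e / r ^+ mdeg e], and multiplication of [g] by such a monomial only shifts its
    exponents, without increasing its norm. *)
Lemma an1M r C D f g : 0 < r -> an1 r C f -> an1 r D g ->
  an1 r (C * D) (fun x => f x * g x).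
Proof.
move=> r0 [v [vC fv]] gD; have D0 := an1_ge0 gD; have [w [wD gw]] := gD.
have rn0 e : r ^+ mdeg e != 0 by rewrite expf_neq0// gt_eqF.
have h e : an1 r D (fun x => mono x e / r ^+ mdeg e * g x).
  apply: (@an1_ext _ _ (fun x => usum (fun e' =>
      (w e' / r ^+ mdeg e) * mono x (madd e e')))).
    move=> x xr; rewrite gw// -(usumZ _ (l1_mono r0 wD xr)).
    by congr usum; apply/funext => e'; rewrite monoD; field.
  apply: an1_ofsum => //; apply: l1_le wD _ => e'.
  by rewrite mdegD exprD mulrA divfK.
apply: an1_ext (an1_usum r0 D0 vC h) => x xr.
rewrite mulrC fv// -(usumZ _ (l1_mono r0 vC xr)); congr usum; apply/funext => e.
by field.
Qed.

Lemma an1X r C f n : 0 < r -> an1 r C f -> an1 r (C ^+ n) (fun x => f x ^+ n).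
Proof.
move=> r0 fC; elim: n => [|n IH].
  by have := an1_cst 1 r0; rewrite normr1; apply: an1_ext.
rewrite exprS; apply: an1_ext (an1M r0 fC IH) => x _; by rewrite exprS.
Qed.

Lemma an1_prod (S : finType) r (C : S -> R) (f : S -> (T -> R) -> R) : 0 < r ->
  (forall i, an1 r (C i) (f i)) ->
  an1 r (\prod_i C i) (fun x => \prod_i f i x).
Proof.
move=> r0 fC; elim: (index_enum S) => [|i l IH].
  by rewrite big_nil; apply: an1_ext (an1_le _ (an1_cst 1 r0)) => [x _|];
    rewrite ?big_nil ?normr1.
by rewrite big_cons; apply: an1_ext (an1M r0 (fC i) IH) => x _; rewrite big_cons.
Qed.

Lemma an1_sum (S : finType) r (C : S -> R) (f : S -> (T -> R) -> R) : 0 < r ->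
  (forall i, an1 r (C i) (f i)) ->
  an1 r (\sum_i C i) (fun x => \sum_i f i x).
Proof.
move=> r0 fC; elim: (index_enum S) => [|i l IH].
  by rewrite big_nil; apply: an1_ext (an1_le _ (an1_cst 0 r0)) => [x _|];
    rewrite ?big_nil ?normr0.
by rewrite big_cons; apply: an1_ext (an1D r0 (fC i) IH) => x _; rewrite big_cons.
Qed.

Lemma an1_var r t : 0 < r -> an1 r r (fun x => x t).
Proof.
move=> r0; pose e := [ffun t' => (t' == t : nat)] : {ffun T -> nat}.
have me x : mono x e = x t.
  rewrite /mono (bigD1 t)//= big1 => [|t' /negPf tt']; rewrite ffunE ?eqxx ?mulr1//.
  by rewrite tt'.
have de : mdeg e = 1%N.
  rewrite /mdeg (bigD1 t)//= big1 => [|t' /negPf tt']; rewrite ffunE ?eqxx//.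
  by rewrite tt'.
have := an1Z r r0 (an1_mono e r0); rewrite mulr1 gtr0_norm//.
by apply: an1_ext => x _; rewrite me de expr1 mulrC divfK// gt_eqF.
Qed.

Lemma an1_val0 r v f : 0 < r ->
  (forall x, small r x -> f x = usum (fun e => v e * mono x e)) ->
  f (fun=> 0) = v [ffun=> 0%N].
Proof.
move=> r0 fv; rewrite fv; last exact: small0.
rewrite (_ : (fun e => _) = (fun e => if e == [ffun=> 0%N] then v e else 0)).
  by rewrite usum1.
by apply/funext => e; rewrite mono0; case: ifP; rewrite ?mulr1 ?mulr0.
Qed.

(** Without constant term every monomial has degree at least one, so shrinking the radius by [s]
    gains a factor [s] in the norm. This is how small norms are produced below. *)
Lemma an1_vanish r C s f : 0 < r -> 0 < s -> s <= 1 -> an1 r C f ->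
  f (fun=> 0) = 0 -> an1 (s * r) (s * C) f.
Proof.
move=> r0 s0 s1 [v [vC fv]] f0; have v0 : v [ffun=> 0%N] = 0.
  by rewrite -f0 (an1_val0 r0 fv).
exists v; split; last first.
  move=> x xr; apply: fv => t; apply: le_trans (xr t) _.
  by rewrite ler_piMl// ltW.
have := l1Z s vC; rewrite gtr0_norm// => h; apply: l1_le h _ => e.
have [->|en0] := eqVneq e [ffun=> 0%N]; first by rewrite v0 !mul0r mulr0.
rewrite exprMn mulrCA !normrM ler_wpM2r// normrX.
rewrite !gtr0_norm//; move: en0; rewrite -mdeg0; case: mdeg => // n _.
by rewrite exprS ler_piMr// ?exprn_ile1// ltW.
Qed.

Lemma an1B0 r C f : 0 < r -> an1 r C f -> an1 r (C + C) (fun x => f x - f (fun=> 0)).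
Proof.
move=> r0 fC; apply: an1D => //; apply: an1_le (an1_cst _ r0).
by rewrite normrN; apply: (an1_bound r0 fC); exact: small0.
Qed.

Lemma an1_cont r C s f x : 0 < r -> 0 < s -> s <= 1 -> an1 r C f ->
  small (s * r) x -> `|f x - f (fun=> 0)| <= s * (C + C).
Proof.
move=> r0 s0 s1 fC xs.
apply: (an1_bound (mulr_gt0 s0 r0) (an1_vanish r0 s0 s1 (an1B0 r0 fC) _) xs).
by rewrite subrr.
Qed.

End Monomials.

(** * Composition, and expansion in one distinguished variable *)

Section Composition.
Variables (R : realType).
Implicit Types (S T : finType) (r C : R).

(** The norm of each [g s] is at most the radius [r] of [f], so the product of the [g s] with
    exponents [e] has norm at most [r ^+ mdeg e], and the normalised monomials stay in the unit
    ball. *)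
Lemma an1_comp S T r r' C (f : (S -> R) -> R) (g : S -> (T -> R) -> R) :
  0 < r -> 0 < r' -> an1 r C f -> (forall s, an1 r' r (g s)) ->
  an1 r' C (fun x => f (fun s => g s x)).
Proof.
move=> r0 r'0 [v [vC fv]] gr.
have h e : an1 r' 1 (fun x => mono (fun s => g s x) e / r ^+ mdeg e).
  have := an1_prod r'0 (fun s => an1X (e s) r'0 (gr s)).
  rewrite -expr_sum => /(an1Z (r ^+ mdeg e)^-1 r'0).
  rewrite gtr0_norm ?invr_gt0 ?exprn_gt0// mulVf ?expf_neq0 ?gt_eqF//.
  by apply: an1_ext => x _; rewrite mulrC.
rewrite -(mulr1 C); apply: an1_ext (an1_usum r'0 ler01 vC h) => x xr.
have gs : small r (fun s => g s x) by move=> s; exact: an1_bound (gr s) xr.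
rewrite fv//; congr usum; apply/funext => e.
by field; rewrite expf_neq0// gt_eqF.
Qed.

(** [None] is the distinguished last variable; the type [option T] lets variables be added one at a
    time. *)
Definition ext T (x : T -> R) (z : R) : option T -> R :=
  fun o => if o is Some t then x t else z.

Definition oexp T (e : {ffun T -> nat}) (k : nat) : {ffun option T -> nat} :=
  [ffun o => if o is Some t then e t else k].

Lemma big_option (V : Type) (idx : V) (op : Monoid.com_law idx) T (F : option T -> V) :
  \big[op/idx]_o F o = op (F None) (\big[op/idx]_t F (Some t)).
Proof.
rewrite (bigD1 None)//=; congr (op _ _).
rewrite (reindex_omap Some id)/=; last by case.
by apply: eq_bigl => t; rewrite eqxx.
Qed.

Lemma mono_ext T (x : T -> R) z e k : mono (ext x z) (oexp e k) = z ^+ k * mono x e.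
Proof.
rewrite /mono big_option ffunE /=; congr (_ * _).
by apply: eq_bigr => t _; rewrite ffunE.
Qed.

Lemma mdeg_ext T (e : {ffun T -> nat}) k : mdeg (oexp e k) = (k + mdeg e)%N.
Proof.
rewrite /mdeg big_option ffunE /=; congr (_ + _)%N.
by apply: eq_bigr => t _; rewrite ffunE.
Qed.

Lemma oexpK T (e : {ffun option T -> nat}) :
  e = oexp [ffun t => e (Some t)] (e None).
Proof. by apply/ffunP => -[t|]; rewrite !ffunE. Qed.

Lemma small_ext T r (x : T -> R) z : small r x -> `|z| <= r -> small r (ext x z).
Proof. by move=> xr zr [t|] /=. Qed.

(** Regroups the monomials by their exponent in the last variable. The bound on [r ^+ k * h k] is
    the same for all [k]; this uniformity makes the coefficients a family. *)
Lemma an1_curry T r C (f : (option T -> R) -> R) : 0 < r -> an1 r C f ->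
  exists h : nat -> (T -> R) -> R, (forall k, an1 r C (fun x => r ^+ k * h k x)) /\
   forall x z, small r x -> `|z| <= r ->
     l1 C (fun k => h k x * z ^+ k) /\ f (ext x z) = usum (fun k => h k x * z ^+ k).
Proof.
move=> r0 [v [vC fv]].
pose u k e : R := v (oexp e k).
pose w k (e : {ffun option T -> nat}) := if k == e None then v e * r ^+ mdeg e else 0.
have wC k : l1 C (w k).
  apply: l1_le vC _ => e; rewrite /w; case: ifP => // _.
  by rewrite normr0.
have hE k x : small r x -> l1 C (fun e => w k e * (mono x [ffun t => e (Some t)] /
    r ^+ mdeg [ffun t => e (Some t)])).
  move=> xr; apply: l1_le (wC k) _ => e; rewrite normrM ler_piMr//.
  rewrite normrM normfV ler_pdivrMr ?normr_gt0 ?expf_neq0 ?gt_eqF// mul1r.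
  by rewrite (le_trans (mono_small _ xr))// ler_norm.
exists (fun k x => (r ^+ k)^-1 * usum (fun e => w k e *
  (mono x [ffun t => e (Some t)] / r ^+ mdeg [ffun t => e (Some t)]))).
split=> [k|x z xr zr].
  rewrite -(mulr1 C); apply: an1_ext
    (an1_usum r0 ler01 (wC k) (fun e => an1_mono [ffun t => e (Some t)] r0)) => x xr.
  by rewrite mulVKf// expf_neq0// gt_eqF.
have xzr := small_ext xr zr.
have cr k : `|z ^+ k / r ^+ k| <= 1.
  rewrite normrM normfV !normrX ler_pdivrMr ?exprn_gt0 ?normr_gt0 ?gt_eqF// mul1r.
  by rewrite (gtr0_norm r0); apply: lerXn2r; rewrite ?nnegrE// ltW.
have W : l11 C (fun (e : {ffun option T -> nat}) k => if k == e None then v e * mono (ext x z) e else 0).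
  apply: l11_fiber; exact: l1_mono vC xzr.
have e1 : (fun k => (r ^+ k)^-1 * usum (fun e : {ffun option T -> nat} => w k e *
  (mono x [ffun t => e (Some t)] / r ^+ mdeg [ffun t => e (Some t)])) * z ^+ k) =
  (fun k => usum (fun e : {ffun option T -> nat} => if k == e None then v e * mono (ext x z) e else 0)).
  apply/funext => k; rewrite mulrAC -(usumZ _ (hE k x xr)).
  congr usum; apply/funext => e; rewrite /w; case: eqP => [->|_]; last by rewrite mul0r mulr0.
  rewrite [in RHS](oexpK e) mono_ext [in mdeg e](oexpK e) mdeg_ext exprD.
  by rewrite -oexpK; field; rewrite !expf_neq0// gt_eqF.
split; first by rewrite e1; exact: (l11_outer (l11_swap W)).
rewrite e1 fv// -(usum_swap W).
by congr usum; apply/funext => e; rewrite (@usum1 _ _ (fun=> v e * mono (ext x z) e)).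
Qed.

Lemma l1_geom (q : R) : 0 <= q -> q <= 2^-1 -> l1 2 (fun k : nat => q ^+ k).
Proof.
move=> q0 q1; rewrite /l1 /es -nneseries_esumT => [|k]; last by rewrite lee_fin.
apply: lime_le; first by apply: is_cvg_nneseries => k _ _; rewrite lee_fin.
apply: nearW => n; rewrite sumEFin lee_fin.
under eq_bigr do rewrite ger0_norm ?exprn_ge0//.
elim: n => [|n IH]; first by rewrite big_geq.
rewrite big_nat_recl// expr0.
under eq_bigr do rewrite exprS.
rewrite -mulr_sumr; have h : q * (\sum_(0 <= i < n) q ^+ i) <= 2^-1 * 2.
  by apply: ler_pM => //; apply: sumr_ge0 => i _; exact: exprn_ge0.
by lra.
Qed.

(** The factor 2 bounds the geometric series of ratio [r <= 1/2] that arises from summing the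
    coefficients. *)
Lemma an1_uncurry T r C (h : nat -> (T -> R) -> R) : 0 < r -> r <= 2^-1 ->
  (forall k, an1 r C (h k)) ->
  an1 r (2 * C) (fun y : option T -> R => usum (fun k => h k (fun t => y (Some t)) * y None ^+ k)).
Proof.
move=> r0 r1 hC; have C0 := an1_ge0 (hC 0%N).
have l := l1_geom (ltW r0) r1.
have k1 k : an1 r C (fun y : option T -> R => h k (fun t => y (Some t)) * (y None ^+ k / r ^+ k)).
  rewrite -(mulr1 C); apply: an1M => //.
    apply: (an1_comp r0 r0 (hC k)) => t; exact: an1_var.
  have := an1Z (r ^+ k)^-1 r0 (an1X k r0 (an1_var (None : option T) r0)).
  rewrite gtr0_norm ?invr_gt0 ?exprn_gt0// mulVf ?expf_neq0 ?gt_eqF//.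
  by apply: an1_ext => x _; rewrite mulrC.
apply: an1_ext (an1_usum r0 C0 l k1) => y yr; congr usum; apply/funext => k.
by field; rewrite expf_neq0// gt_eqF.
Qed.

End Composition.

Section NatSums.
Variable R : realType.
Implicit Types (f : nat -> R) (C : R).

Lemma l1_nat C f : (forall n, \sum_(0 <= i < n) `|f i| <= C) -> l1 C f.
Proof.
move=> fC; rewrite /l1 /es -nneseries_esumT => [|k]; last by rewrite lee_fin.
apply: lime_le; first by apply: is_cvg_nneseries => k _ _; rewrite lee_fin.
by apply: nearW => n; rewrite sumEFin lee_fin.
Qed.

Lemma cvg_ext (u v : nat -> R) (l : R) : (forall n, u n = v n) -> u @ \oo --> l -> v @ \oo --> l.
Proof. by move=> uv; have -> : u = v by exact/funext. Qed.

Lemma usum_nat C f : l1 C f ->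
  (fun n => \sum_(0 <= i < n) f i) @ \oo --> usum f.
Proof.
move=> fC.
have P (g : nat -> R) D : (forall i, 0 <= g i) -> (es g <= D%:E)%E ->
    (fun n => \sum_(0 <= i < n) g i) @ \oo --> fine (es g).
  move=> g0 gD; have ef := es_fin g0 gD.
  have : (fun n => \sum_(0 <= i < n) (g i)%:E)%E @ \oo --> es g.
    rewrite /es -nneseries_esumT => [|k]; last by rewrite lee_fin.
    by apply: is_cvg_nneseries => k _ _; rewrite lee_fin.
  rewrite -{1}(fineK ef) => /fine_cvgP[_].
  by apply: cvg_trans; apply: near_eq_cvg; near=> n; rewrite /= sumEFin.
apply: cvg_trans (cvgB (P _ _ (fun i => pm_ge0 (f i)) (es_pm fC)) (P _ _ (fun i => normr_ge0 (f i)) fC)).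
apply: near_eq_cvg; near=> n => /=.
rewrite -[LHS]/(\sum_(0 <= i < n) (f i + `|f i|) - \sum_(0 <= i < n) `|f i|) -sumrB.
by apply: eq_bigr => i _; rewrite addrK.
Unshelve. all: by end_near. Qed.

End NatSums.

(** * The analytic implicit function theorem *)

Section ImplicitFunction.
Variable R : realType.
Implicit Types (T : finType) (r C : R).

Lemma an1_small T r C e (f : (T -> R) -> R) : 0 < r -> 0 < e -> an1 r C f ->
  f (fun=> 0) = 0 -> exists2 s, 0 < s <= r & an1 s e f.
Proof.
move=> r0 e0 fC f0; have C0 := an1_ge0 fC.
pose t := (1 + C / e)^-1; have d1 : 1 <= 1 + C / e by rewrite lerDl divr_ge0// ltW.
have t0 : 0 < t by rewrite invr_gt0 (lt_le_trans ltr01).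
have t1 : t <= 1 by rewrite invf_le1// (lt_le_trans ltr01).
exists (t * r); first by rewrite mulr_gt0//= ler_piMl// ltW.
apply: an1_le (an1_vanish r0 t0 t1 fC f0).
rewrite /t ler_pdivrMl ?(lt_le_trans ltr01)// mulrDl mul1r divfK ?gt_eqF//.
by rewrite lerDr ltW.
Qed.

Definition gser T (h : nat -> (T -> R) -> R) : (option T -> R) -> R :=
  fun y => usum (fun k => h k (fun t => y (Some t)) * y None ^+ k).

Lemma gser_l1 T r C (h : nat -> (T -> R) -> R) x z : 0 < r ->
  (forall k, an1 r C (fun x => r ^+ k * h k x)) -> small r x -> `|z| <= r / 2 ->
  l1 (2 * C) (fun k => h k x * z ^+ k).
Proof.
move=> r0 hC xr zr.
have := l1Z C (@l1_geom R 2^-1 _ _); rewrite invr_ge0 ler0n lexx => /(_ isT isT).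
have C0 := an1_ge0 (hC 0%N).
rewrite (ger0_norm C0) mulrC => h1; apply: l1_le h1 _ => k.
rewrite !normrM !normrX (ger0_norm C0) (gtr0_norm (_ : 0 < 2^-1)) ?invr_gt0//.
apply: (@le_trans _ _ (`|h k x| * (r / 2) ^+ k)).
  by rewrite ler_wpM2l// lerXn2r// nnegrE// divr_ge0// ltW.
rewrite exprMn mulrA ler_wpM2r// ?exprn_ge0 ?invr_ge0//.
by have := an1_bound r0 (hC k) xr; rewrite normrM mulrC normrX (gtr0_norm r0).
Qed.

(** [P] is the divided difference in the last variable: [q k] is the quotient of [z ^+ k - z' ^+ k]
    by [z - z']. With [s = r / 4] its norm is at most [k * s ^+ k.-1], hence at most
    [(2 * s) ^+ k / s], and [2 * s = r / 2] leaves a geometric series of ratio 1/2 against the bound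
    [C / r ^+ k] for the coefficients. *)
Lemma divdiff T r C (h : nat -> (T -> R) -> R) : 0 < r ->
  (forall k, an1 r C (fun x => r ^+ k * h k x)) ->
  exists s D P, [/\ 0 < s <= r / 2, @an1 R (option (option T)) s D P,
    P (fun=> 0) = h 1%N (fun=> 0) &
    forall x z z', small s x -> `|z| <= s -> `|z'| <= s ->
    gser h (ext x z) - gser h (ext x z') = (z - z') * P (ext (ext x z) z')].
Proof.
move=> r0 hC; have C0 := an1_ge0 (hC 0%N).
pose s := r / 4; have s0 : 0 < s by rewrite divr_gt0.
have sr : s <= r / 2 by rewrite ler_pM2l// lef_pV2 ?posrE// ler_nat.
have srr : s <= r by apply: le_trans sr _; rewrite ler_pdivrMr// ler_pMr// ler1n.
pose q k (y : option (option T) -> R) := \sum_(i < k) y (Some None) ^+ (k.-1 - i) * y None ^+ i.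
have qA k : an1 s s^-1 (fun y => ((2 * s) ^+ k)^-1 * q k y).
  have := an1_sum s0 (fun i : 'I_k => an1M s0
    (an1X (k.-1 - i) s0 (an1_var (Some None : option (option T)) s0))
    (an1X i s0 (an1_var (None : option (option T)) s0))).
  move=> /(an1Z ((2 * s) ^+ k)^-1 s0); apply: an1_le.
  rewrite normfV ler_pdivrMl ?normr_gt0 ?expf_neq0 ?gt_eqF ?mulr_gt0//.
  rewrite gtr0_norm ?exprn_gt0 ?mulr_gt0//.
  rewrite (eq_bigr (fun=> s ^+ k.-1)) => [|i _]; last first.
    by rewrite -exprD subnK// -ltnS prednK// (leq_trans _ (ltn_ord i)).
  rewrite sumr_const card_ord; case: k => [|k]; first by rewrite mulr0n !expr0 mul1r invr_ge0 ltW.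
  rewrite (_ : (2 * s) ^+ k.+1 / s = 2 ^+ k.+1 * s ^+ k); last first.
    by rewrite exprMn [s ^+ k.+1]exprSr; field; rewrite gt_eqF.
  rewrite -(mulr_natl (s ^+ k) k.+1); apply: ler_wpM2r; first by rewrite exprn_ge0// ltW.
  rewrite -natrX ler_nat.
  exact: ltnW (ltn_expl _ _).
pose P (y : option (option T) -> R) :=
  usum (fun k => h k (fun t => y (Some (Some t))) * q k y).
have PA : an1 s (2 * (C * s^-1)) P.
  have f1 k : an1 s (C * s^-1) (fun y : option (option T) -> R =>
      (r ^+ k * h k (fun t => y (Some (Some t)))) * (((2 * s) ^+ k)^-1 * q k y)).
    apply: an1M => //; apply: (an1_comp r0 s0 (hC k)) => t.
    exact: an1_le srr (an1_var _ s0).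
  have := an1_usum s0 (mulr_ge0 C0 (ltW (_ : 0 < s^-1))) (@l1_geom R 2^-1 _ _) f1.
  rewrite invr_gt0 invr_ge0 ler0n lexx => /(_ s0 isT isT).
  apply: an1_ext => y _; congr usum; apply/funext => k.
  rewrite /s (_ : 2 * (r / 4) = r / 2); last by field.
  by rewrite expr_div_n exprVn; field; rewrite !expf_neq0// gt_eqF.
exists s, (2 * (C * s^-1)), P; split => //; first by rewrite s0.
  rewrite /P (_ : (fun k => _) = (fun k => if k == 1%N then h k (fun=> 0) else 0)).
    by rewrite (usum1 (fun k => h k (fun=> 0))).
  apply/funext => -[|[|k]]; rewrite /q /=.
  - by rewrite big_ord0 mulr0.
  - by rewrite big_ord1 !expr0 !mulr1.
  - rewrite big1 ?mulr0// => i _; case: (i : nat) => [|j]; last by rewrite exprS mul0r mulr0.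
    by rewrite subn0 exprS !mul0r.
move=> x z z' xs zs z's.
have xr : small r x by move=> t; exact: le_trans (xs t) srr.
have l := gser_l1 r0 hC xr (le_trans zs sr).
have l' := gser_l1 r0 hC xr (le_trans z's sr).
rewrite /gser /= -(usumN l').
rewrite -(usumD l (D := 2 * C)); last by apply: l1_le l' _ => k; rewrite normrN.
have lP : l1 (2 * (C * s^-1)) (fun k => h k x * q k (ext (ext x z) z')).
  have lg := @l1_geom R 2^-1; move: lg; rewrite invr_ge0 ler0n lexx => /(_ isT isT) lg.
  have := l1Z (C * s^-1) lg; rewrite ger0_norm ?mulr_ge0 ?invr_ge0 ?(ltW s0)// mulrC => h1.
  apply: l1_le h1 _ => k.
  have b1 := an1_bound r0 (hC k) xr.
  have b2 := an1_bound s0 (qA k) (small_ext (small_ext xs zs) z's).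
  have := ler_pM (normr_ge0 _) (normr_ge0 _) b1 b2.
  rewrite -normrM (_ : r ^+ k * _ * _ = 2 ^+ k * (h k x * q k (ext (ext x z) z'))); last first.
    rewrite /s (_ : 2 * (r / 4) = r / 2); last by field.
    by rewrite expr_div_n; field; rewrite !expf_neq0// gt_eqF.
  rewrite normrM -ler_pdivlMl ?normr_gt0 ?expf_neq0// => h2; apply: le_trans h2 _.
  by rewrite [X in _ <= X]normrM mulrC exprVn normfV ler_wpM2r ?invr_ge0// ler_norm.
rewrite /P -(usumZ _ lP); congr usum; apply/funext => k.
rewrite -mulrBr subrXX /q /=; rewrite mulrCA; congr (_ * (_ * _)).
Qed.

(** Picard iteration for [phi x z = z - gser h (ext x z) / c], with [c] the derivative in [z] at the
    origin. By [divdiff] a difference of two values of [phi] has a factor [Q] vanishing at the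
    origin, which becomes a contraction factor 1/2 on a smaller polydisc. The iteration is carried
    out in the norm, so its limit is again analytic. *)
Lemma ift T r C (h : nat -> (T -> R) -> R) : 0 < r ->
  (forall k, an1 r C (fun x => r ^+ k * h k x)) ->
  h 0%N (fun=> 0) = 0 -> h 1%N (fun=> 0) != 0 ->
  exists s z, [/\ 0 < s, an1 s (r / 2) z, z (fun=> 0) = 0 &
    forall x, small s x -> gser h (ext x (z x)) = 0].
Proof.
move=> r0 hC h0 h1; have [s [D [P [/andP[s0 sr] PA P0 Pd]]]] := divdiff r0 hC.
set c := h 1%N (fun=> 0) in h1 P0.
pose phi x z := z - gser h (ext x z) / c.
pose Q (y : option (option T) -> R) := 1 - P y / c.
have QA : an1 s (`|1| + `|- c^-1| * D) Q.
  apply: an1D => //; first exact: an1_cst.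
  by apply: an1_ext (an1Z (- c^-1) s0 PA) => y _; rewrite mulNr mulrC.
have Q0 : Q (fun=> 0) = 0 by rewrite /Q P0 divff// subrr.
have phid x z z' : small s x -> `|z| <= s -> `|z'| <= s ->
    phi x z - phi x z' = (z - z') * Q (ext (ext x z) z').
  move=> xs zs z's; rewrite /phi /Q mulrBr mulr1 mulrA -Pd//.
  by move: (gser h (ext x z)) (gser h (ext x z')) => a b; ring.
have h2 : 0 < 2^-1 :> R by rewrite invr_gt0.
have [s1 /andP[s10 s1s] QA1] := an1_small s0 h2 QA Q0.
have : an1 r (`|- c^-1| * C) (fun x => - c^-1 * h 0%N x).
  apply: an1Z => //; apply: an1_ext (hC 0%N) => x _; by rewrite expr0 mul1r.
have s12 : 0 < s1 / 2 by rewrite divr_gt0.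
move=> /(an1_small r0 s12); rewrite h0 mulr0.
move=> /(_ erefl)[rho0 /andP[rho00 _] hA0].
pose rho := Num.min rho0 s1.
have rho_gt0 : 0 < rho by rewrite lt_min rho00.
have rhos1 : rho <= s1 by rewrite ge_min lexx orbT.
have hA : an1 rho (s1 / 2) (fun x => - c^-1 * h 0%N x).
  by apply: an1_r hA0 => //; rewrite ge_min lexx.
pose z := fix z n x := if n is n'.+1 then phi x (z n' x) else 0.
have small_rho (x : T -> R) : small rho x -> small s x.
  by move=> xr t; rewrite (le_trans (xr t))// (le_trans rhos1).
(* The increments halve each time, and the partial sums of their bounds [s1 / 2 * 2^-1 ^+ n] are
   exactly [s1 * (1 - 2^-1 ^+ n)], so the iterates never leave the ball of norm [s1] on which [Q] is
   small. *)
have zA n : an1 rho (s1 * (1 - 2^-1 ^+ n)) (z n) /\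
            an1 rho (s1 / 2 * 2^-1 ^+ n) (fun x => z n.+1 x - z n x).
  elim: n => [|n [zn dn]].
    split; first by rewrite expr0 subrr mulr0; have := an1_cst T (0 : R) rho_gt0; rewrite normr0.
    rewrite expr0 mulr1; apply: an1_ext hA => x xr.
    rewrite /= subr0 /phi sub0r mulNr mulrC; congr (- (_ / _)).
    rewrite /gser (_ : (fun k => _) = (fun k => if k == 0%N then h k x else 0)).
      by rewrite (usum1 (fun k => h k x)).
    by apply/funext => -[|k]; rewrite /= ?expr0 ?mulr1// exprS mul0r mulr0.
  have zn1 : an1 rho (s1 * (1 - 2^-1 ^+ n.+1)) (z n.+1).
    apply: an1_ext (an1_le _ (an1D rho_gt0 zn dn)) => [x _|]; first by rewrite addrC subrK.
    by rewrite exprS; lra.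
  split=> //.
  have le1 k : s1 * (1 - 2^-1 ^+ k) <= s1.
    by rewrite ler_piMr ?(ltW s10)// lerBlDr lerDl exprn_ge0 ?invr_ge0.
  have zn' := an1_le (le1 _) zn; have zn1' := an1_le (le1 _) zn1.
  have b x k : an1 rho s1 (z k) -> small rho x -> `|z k x| <= s.
    by move=> zk xr; apply: le_trans (an1_bound rho_gt0 zk xr) s1s.
  have QC : an1 rho 2^-1 (fun x => Q (ext (ext x (z n.+1 x)) (z n x))).
    have := @an1_comp _ _ T s1 rho _ Q (fun o x => ext (ext x (z n.+1 x)) (z n x) o)
      s10 rho_gt0 QA1; apply => -[[t|]|] //=.
    by apply: an1_le rhos1 _; exact: an1_var.
  apply: an1_ext (an1_le _ (an1M rho_gt0 dn QC)) => [x xr|].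
    by rewrite -phid//; [exact: small_rho|exact: b|exact: b].
  by rewrite exprSr mulrA.
(* The rescaled increments are uniformly bounded, so the limit is a sum with geometric weights and
   [an1_usum] applies. *)
pose d n x := 2 ^+ n * (z n.+1 x - z n x).
have dA n : an1 rho (s1 / 2) (d n).
  have := an1Z (2 ^+ n) rho_gt0 (zA n).2; apply: an1_le.
  by rewrite gtr0_norm ?exprn_gt0// mulrCA -exprMn divff// expr1n mulr1.
have lg : l1 2 (fun n : nat => 2^-1 ^+ n : R).
  by apply: l1_geom; rewrite ?invr_ge0// lexx.
have zeta := an1_usum rho_gt0 (ltW (divr_gt0 s10 (ltr0n R 2))) lg dA.
set Z := (fun x => _) in zeta.
have dE x : (fun n => 2^-1 ^+ n * d n x) = (fun n => z n.+1 x - z n x).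
  by apply/funext => n; rewrite /d mulrA -exprMn mulVf// expr1n mul1r.
exists rho, Z; split => //.
- apply: an1_le zeta; apply: le_trans sr; apply: le_trans s1s.
  by rewrite mulrC divfK.
- have z0 n : z n (fun=> 0) = 0.
    elim: n => // n IH; rewrite /= IH /phi sub0r.
    rewrite (_ : gser _ _ = 0) ?mul0r ?oppr0// /gser.
    rewrite (_ : (fun k => _) = (fun k => if k == 0%N then h k (fun=> 0) else 0)).
      by rewrite (usum1 (fun k => h k (fun=> 0))).
    by apply/funext => -[|k]; rewrite /= ?expr0 ?mulr1// exprS mul0r mulr0.
  rewrite /Z dE (_ : (fun n => _) = (fun=> 0)) ?usum0//.
  by apply/funext => n; rewrite !z0 subrr.
move=> x xr.
have Zs : `|Z x| <= s.
  apply: le_trans (an1_bound rho_gt0 zeta xr) _; apply: le_trans s1s.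
  by rewrite mulrC divfK.
have lx : l1 (2 * (s1 / 2)) (fun n => 2^-1 ^+ n * d n x).
  have := l1Z (s1 / 2) lg; rewrite gtr0_norm ?divr_gt0// mulrC => h3.
  apply: l1_le h3 _ => n; rewrite !normrM mulrC ler_wpM2r//.
  rewrite -normrM; apply: le_trans (an1_bound rho_gt0 (dA n) xr) _.
  by rewrite -normrM ler_norm.
have zcvg : (fun n => z n x) @ \oo --> Z x.
  rewrite (_ : Z x = usum (fun n => z n.+1 x - z n x)); last by rewrite /Z dE.
  have := usum_nat lx; rewrite dE; apply: cvg_ext => n.
  rewrite (eq_bigr (fun i => z i.+1 x - z i x)) => [|i _].
    by rewrite telescope_sumr// subr0.
  by have := congr1 (fun f => f i) (dE x).
have phicvg : (fun n => z n.+1 x) @ \oo --> phi x (Z x).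
  apply/cvgrPdist_le => e e0.
  have := zcvg => /cvgrPdist_le/(_ e e0); apply: filterS => n zn.
  have zns : `|z n x| <= s.
    apply: le_trans (an1_bound rho_gt0 (zA n).1 xr) _; apply: le_trans s1s.
    by rewrite ler_piMr ?(ltW s10)// lerBlDr lerDl exprn_ge0 ?invr_ge0.
  rewrite [z n.+1 x]/= phid//; last exact: small_rho.
  rewrite normrM; apply: le_trans zn; rewrite ler_piMr//.
  have y1 : small s1 (ext (ext x (Z x)) (z n x)).
    move=> [[t|]|] /=.
    - by apply: le_trans (xr t) _.
    - apply: le_trans (an1_bound rho_gt0 zeta xr) _.
      by rewrite mulrC divfK.
    - apply: le_trans (an1_bound rho_gt0 (zA n).1 xr) _.
      by rewrite ler_piMr ?(ltW s10)// lerBlDr lerDl exprn_ge0 ?invr_ge0.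
  apply: le_trans (an1_bound s10 QA1 y1) _.
  by rewrite invf_le1// ler1n.
have zcvg1 : (fun n => z n.+1 x) @ \oo --> Z x by rewrite -(cvg_shiftS (fun n => z n x)) in zcvg.
have e : phi x (Z x) = Z x by exact: (cvg_unique (@norm_hausdorff _ R) phicvg zcvg1).
have gc : gser h (ext x (Z x)) / c = 0 by move: e; rewrite /phi; lra.
by rewrite -[LHS](divfK h1) gc mul0r.
Unshelve. all: by end_near. Qed.

End ImplicitFunction.

(** * Elementary functions, germs at the origin, and uniform families *)

Section Elementary.
Variable R : realType.
Implicit Types (T : finType) (r C : R).

Lemma an1_pser T r C (u : nat -> R) t : 0 < r -> l1 C (fun k => u k * r ^+ k) ->
  an1 r C (fun x : T -> R => usum (fun k => u k * x t ^+ k)).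
Proof.
move=> r0 uC; rewrite -(mulr1 C).
have h k : an1 r 1 (fun x : T -> R => (r ^+ k)^-1 * x t ^+ k).
  have := an1Z (r ^+ k)^-1 r0 (an1X k r0 (an1_var t r0)).
  by rewrite gtr0_norm ?invr_gt0 ?exprn_gt0// mulVf ?expf_neq0 ?gt_eqF.
apply: an1_ext (an1_usum r0 ler01 uC h) => x _.
by congr usum; apply/funext => k; field; rewrite expf_neq0// gt_eqF.
Qed.

Lemma pser_lim C (f : nat -> R) (l : R) : l1 C f -> series f @ \oo --> l -> usum f = l.
Proof.
move=> fC; rewrite seriesEnat => fl.
exact: (cvg_unique (@norm_hausdorff _ _) (usum_nat fC) fl).
Qed.

Lemma l1_fact : l1 (expR 1) (fun k => (k`!%:R : R)^-1).
Proof.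
apply: l1_nat => n.
under eq_bigr do rewrite ger0_norm ?invr_ge0//.
have <- : limn (series (exp_coeff (1 : R))) = expR 1 by [].
apply: le_trans (nondecreasing_cvgn_le _ (is_cvg_series_exp_coeff (1 : R)) n).
  rewrite seriesEnat le_eqVlt; apply/orP; left; apply/eqP.
  by apply: eq_bigr => i _; rewrite /exp_coeff/= expr1n mul1r.
apply: nondecreasing_series => i _ _.
by rewrite /exp_coeff/= expr1n mul1r invr_ge0.
Qed.

Lemma l1_fact_le (u : nat -> R) x : (forall k, `|u k| <= (k`!%:R)^-1) -> `|x| <= 1 ->
  l1 (expR 1) (fun k => u k * x ^+ k).
Proof.
move=> uk x1; apply: l1_le l1_fact _ => k.
rewrite normrM normrX [X in _ <= X]ger0_norm ?invr_ge0//.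
by rewrite -[leRHS]mulr1 ler_pM// exprn_ile1.
Qed.

Lemma an1_entire T (g : R -> R) (u : nat -> R) t :
  (forall k, `|u k| <= (k`!%:R)^-1) ->
  (forall x, (series (fun k => u k * x ^+ k)) @ \oo --> g x) ->
  an1 1 (expR 1) (fun x : T -> R => g (x t)).
Proof.
move=> uk ug; apply: an1_ext (an1_pser t ltr01 (l1_fact_le uk _)); last by rewrite normr1.
by move=> x xr; apply: (pser_lim (l1_fact_le uk (xr t))); exact: ug.
Qed.

Lemma an1_expR T t : an1 1 (expR 1) (fun x : T -> R => expR (x t)).
Proof.
apply: (@an1_entire _ _ (fun k => (k`!%:R)^-1)) => [k|x].
  by rewrite ger0_norm ?invr_ge0.
by rewrite -exp_coeffE; exact: is_cvg_series_exp_coeff.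
Qed.

Lemma an1_cos T t : an1 1 (expR 1) (fun x : T -> R => cos (x t)).
Proof.
apply: (@an1_entire _ _ (fun k => (~~ odd k)%:R * (-1) ^+ k./2 * (k`!%:R)^-1)) => [k|x].
  rewrite !normrM normrX normrN1 expr1n mulr1 normfV (ger0_norm (ler0n _ k`!)).
  by rewrite ler_piMl ?invr_ge0//; case: odd => /=; rewrite ?normr0 ?normr1.
by rewrite -cos_coeffE unlock; exact: is_cvg_series_cos_coeff.
Qed.

Lemma an1_sin T t : an1 1 (expR 1) (fun x : T -> R => sin (x t)).
Proof.
apply: (@an1_entire _ _ (fun k => (odd k)%:R * (-1) ^+ k.-1./2 * (k`!%:R)^-1)) => [k|x].
  rewrite !normrM normrX normrN1 expr1n mulr1 normfV (ger0_norm (ler0n _ k`!)).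
  by rewrite ler_piMl ?invr_ge0//; case: odd => /=; rewrite ?normr0 ?normr1.
by rewrite -sin_coeffE unlock; exact: is_cvg_series_sin_coeff.
Qed.

(** The logarithm is the implicit function [z] of [expR z - 1 - x = 0]; [h] lists the coefficients
    in [z] of this equation. *)
Lemma an1_ln1p : exists s C, 0 < s /\ an1 s C (fun x : unit -> R => ln (1 + x tt)) /\
  forall x : unit -> R, small s x -> 0 < 1 + x tt.
Proof.
pose h k : (unit -> R) -> R := if k is k'.+1 then (fun=> (k'.+1`!%:R)^-1) else (fun x => - x tt).
have hA k : an1 1 1 (fun x => 1 ^+ k * h k x).
  case: k => [|k] /=; rewrite expr1n.
    have := an1Z (-1) ltr01 (@an1_var R unit 1 tt ltr01); rewrite normrN1 mulr1.
    by apply: an1_ext => x _; rewrite mul1r mulN1r.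
  apply: an1_ext (an1_le _ (an1_cst unit (k.+1`!%:R)^-1 ltr01)) => [x _|]; first by rewrite mul1r.
  by rewrite ger0_norm ?invr_ge0// invf_le1 ?ltr0n ?fact_gt0// ler1n fact_gt0.
have [||s [z [s0 zA z0 zE]]] := ift ltr01 hA; rewrite /= ?oppr0 ?invr1 ?oner_neq0//.
have zexp x : small s x -> expR (z x) = 1 + x tt.
  move=> xs; have z1 : `|z x| <= 1.
    by apply: le_trans (an1_bound s0 zA xs) _; rewrite mul1r invf_le1// ler1n.
  have := zE x xs; rewrite /gser /=.
  pose e := fun k : nat => (k`!%:R)^-1 * z x ^+ k.
  have le1 : l1 (expR 1) e.
    by apply: l1_fact_le => // k; rewrite ger0_norm ?invr_ge0.
  have -> : (fun k => h k (fun t => x t) * z x ^+ k) =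
      (fun k => e k + (if k == 0%N then - (1 + x tt) else 0)).
    apply/funext => -[|k] /=; rewrite /e/= ?addr0// !expr0 !mulr1 invr1; lra.
  rewrite (usumD le1 (l1_1 (fun=> - (1 + x tt)) 0%N)) (usum1 (fun=> - (1 + x tt))).
  move=> /eqP; rewrite subr_eq0 => /eqP <-.
  rewrite /e; apply/esym/(pser_lim le1).
  rewrite (_ : e = exp_coeff (z x)); last by rewrite exp_coeffE.
  exact: is_cvg_series_exp_coeff.
exists s, (1 / 2); split => //; split.
  by apply: an1_ext zA => x xs; rewrite -zexp// expRK.
by move=> x xs; rewrite -zexp// expR_gt0.
Qed.

(** Writes [f] as its value at the origin times [1 + g] with [g] vanishing there. Positivity near
    the origin comes out at the same time, from the domain of [an1_ln1p]. *)
Lemma an1_ln T r C (f : (T -> R) -> R) : 0 < r -> an1 r C f -> 0 < f (fun=> 0) ->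
  exists s D, [/\ 0 < s <= r, an1 s D (fun x => ln (f x)) &
    forall x, small s x -> 0 < f x].
Proof.
move=> r0 fC f0; have [s1 [C1 [s10 [lnA lnp]]]] := an1_ln1p.
pose g x := (f x - f (fun=> 0)) / f (fun=> 0).
have gA : an1 r (`|(f (fun=> 0))^-1| * (C + C)) g.
  by apply: an1_ext (an1Z _ r0 (an1B0 r0 fC)) => x _; rewrite mulrC.
have [|s /andP[s0 sr] gA1] := an1_small r0 s10 gA; first by rewrite /g subrr mul0r.
have gb x : small s x -> small s1 (fun _ : unit => g x).
  by move=> xs t; exact: an1_bound gA1 xs.
have fE x : f x = f (fun=> 0) * (1 + g x) by rewrite /g; field; rewrite gt_eqF.
exists s, (`|ln (f (fun=> 0))| + C1); split; first by rewrite s0.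
  apply: an1_ext (an1D s0 (an1_cst _ (ln (f (fun=> 0))) s0)
     (an1_comp s10 s0 lnA (fun _ => gA1))) => x xs.
  by rewrite -lnM ?posrE// -?fE//; exact: (lnp _ (gb x xs)).
by move=> x xs; rewrite fE mulr_gt0//; exact: (lnp _ (gb x xs)).
Qed.

Definition ang T (f : (T -> R) -> R) := exists r C, 0 < r /\ an1 r C f.

(** One radius and one bound serve all members, whatever the index type. The uniformity survives the
    passage to the coefficients in one variable ([fam_curry]), which turns the index [A] into
    [A * nat], and the way back ([fam_uncurry]). *)
Definition fam (A : Type) T (F : A -> (T -> R) -> R) :=
  exists r C, 0 < r /\ forall a, an1 r C (F a).

Lemma ang_fam T (f : (T -> R) -> R) : ang f <-> fam (fun _ : unit => f).
Proof.
split=> [[r [C [r0 h]]]|[r [C [r0 h]]]]; first by exists r, C.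
by exists r, C; split=> //; exact: h tt.
Qed.

Lemma fam_ang A T (F : A -> (T -> R) -> R) a : fam F -> ang (F a).
Proof. by move=> [r [C [r0 h]]]; exists r, C. Qed.

Lemma fam_idx A B T (F : A -> (T -> R) -> R) (i : B -> A) : fam F -> fam (fun b => F (i b)).
Proof. by move=> [r [C [r0 h]]]; exists r, C. Qed.

Lemma fam_near A T (F G : A -> (T -> R) -> R) s : 0 < s ->
  (forall a x, small s x -> F a x = G a x) -> fam F -> fam G.
Proof.
move=> s0 FG [r [C [r0 h]]]; have m0 : 0 < Num.min r s by rewrite lt_min r0.
exists (Num.min r s), C; split=> // a.
apply: an1_ext (an1_r m0 _ (h a)) => [x xs|]; last by rewrite ge_min lexx.
by apply: FG => t; apply: le_trans (xs t) _; rewrite ge_min lexx orbT.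
Qed.

Lemma fam2 A T (F G : A -> (T -> R) -> R) : fam F -> fam G ->
  exists r C, 0 < r /\ forall a, an1 r C (F a) /\ an1 r C (G a).
Proof.
move=> [r [C [r0 h]]] [s [D [s0 g]]].
have m0 : 0 < Num.min r s by rewrite lt_min r0.
exists (Num.min r s), (Num.max C D); split=> // a; split.
  by apply: an1_le (an1_r m0 _ (h a)); rewrite ?le_max ?ge_min lexx.
by apply: an1_le (an1_r m0 _ (g a)); rewrite ?le_max ?ge_min lexx orbT.
Qed.

Lemma famD A T (F G : A -> (T -> R) -> R) : fam F -> fam G -> fam (fun a x => F a x + G a x).
Proof.
move=> hF hG; have [r [C [r0 h]]] := fam2 hF hG; exists r, (C + C); split=> // a.
by have [h1 h2] := h a; exact: an1D.
Qed.

Lemma famM A T (F G : A -> (T -> R) -> R) : fam F -> fam G -> fam (fun a x => F a x * G a x).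
Proof.
move=> hF hG; have [r [C [r0 h]]] := fam2 hF hG; exists r, (C * C); split=> // a.
by have [h1 h2] := h a; exact: an1M.
Qed.

Lemma fam_cst A T (c : A -> R) C : (forall a, `|c a| <= C) -> fam (fun a (x : T -> R) => c a).
Proof. by move=> cC; exists 1, C; split=> // a; exact: an1_le (an1_cst _ _ ltr01). Qed.

Lemma famc A T (c : R) : fam (fun (a : A) (x : T -> R) => c).
Proof. exact: (@fam_cst _ _ (fun=> c) `|c|). Qed.

Lemma fam_var A T t : fam (fun (a : A) (x : T -> R) => x t).
Proof. by exists 1, 1; split=> // a; exact: an1_var. Qed.

Lemma famX A T (F : A -> (T -> R) -> R) n : fam F -> fam (fun a x => F a x ^+ n).
Proof.
move=> hF; elim: n => [|n IH]; first exact: famc.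
by have := famM hF IH; apply: (fam_near ltr01) => a x _; rewrite exprS.
Qed.

Lemma famZ A T c (F : A -> (T -> R) -> R) : fam F -> fam (fun a x => c * F a x).
Proof. by move=> hF; apply: famM => //; exact: famc. Qed.

Lemma fam_sum A T (S : finType) (F : S -> A -> (T -> R) -> R) : (forall s, fam (F s)) ->
  fam (fun a x => \sum_s F s a x).
Proof.
move=> hF; elim: (index_enum S) => [|s l IH].
  by apply: (fam_near ltr01) (famc A T 0) => a x _; rewrite big_nil.
by apply: (fam_near ltr01) (famD (hF s) IH) => a x _; rewrite big_cons.
Qed.

Lemma all_small (S : finType) T (g : S -> (T -> R) -> R) e : 0 < e ->
  (forall s, ang (g s)) -> (forall s, g s (fun=> 0) = 0) ->
  exists2 r, 0 < r & forall s, an1 r e (g s).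
Proof.
move=> e0 gA g0.
suff [r r0 h] : exists2 r, 0 < r & forall s, s \in enum S -> an1 r e (g s).
  by exists r => // s; apply: h; rewrite mem_enum.
elim: (enum S) => [|s l [r r0 IH]]; first by exists 1.
have [r1 [C [r10 gC]]] := gA s.
have [r2 /andP[r20 _] gC2] := an1_small r10 e0 gC (g0 s).
have m0 : 0 < Num.min r r2 by rewrite lt_min r0.
exists (Num.min r r2) => // s'; rewrite in_cons => /predU1P[->|s'l].
  by apply: an1_r gC2 => //; rewrite ge_min lexx orbT.
by apply: an1_r (IH _ s'l) => //; rewrite ge_min lexx.
Qed.

Lemma fam_comp A (S : finType) T (F : A -> (S -> R) -> R) (g : S -> (T -> R) -> R) :
  fam F -> (forall s, ang (g s)) -> (forall s, g s (fun=> 0) = 0) ->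
  fam (fun a x => F a (fun s => g s x)).
Proof.
move=> [r [C [r0 h]]] gA g0; have [s s0 gs] := all_small r0 gA g0.
by exists s, C; split=> // a; exact: an1_comp (h a) gs.
Qed.

Lemma ang_near T (f g : (T -> R) -> R) s : 0 < s ->
  (forall x, small s x -> f x = g x) -> ang f -> ang g.
Proof.
move=> s0 fg /ang_fam h; apply/ang_fam.
by apply: fam_near s0 _ h => _ x; exact: fg.
Qed.

Lemma ang_cst T c : ang (fun _ : T -> R => c).
Proof. by apply/ang_fam; exact: famc. Qed.

Lemma ang_var T t : ang (fun x : T -> R => x t).
Proof. by apply/ang_fam; exact: fam_var. Qed.

Lemma angD T (f g : (T -> R) -> R) : ang f -> ang g -> ang (fun x => f x + g x).
Proof. by move=> /ang_fam hf /ang_fam hg; apply/ang_fam; exact: famD. Qed.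

Lemma angM T (f g : (T -> R) -> R) : ang f -> ang g -> ang (fun x => f x * g x).
Proof. by move=> /ang_fam hf /ang_fam hg; apply/ang_fam; exact: famM. Qed.

Lemma angX T (f : (T -> R) -> R) n : ang f -> ang (fun x => f x ^+ n).
Proof. by move=> /ang_fam hf; apply/ang_fam; exact: famX. Qed.

Lemma angZ T c (f : (T -> R) -> R) : ang f -> ang (fun x => c * f x).
Proof. by move=> hf; apply: angM => //; exact: ang_cst. Qed.

Lemma ang_comp (S : finType) T (f : (S -> R) -> R) (g : S -> (T -> R) -> R) :
  ang f -> (forall s, ang (g s)) -> (forall s, g s (fun=> 0) = 0) ->
  ang (fun x => f (fun s => g s x)).
Proof. by move=> /ang_fam hf gA g0; apply/ang_fam; exact: (fam_comp hf). Qed.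

Lemma fam_ang_cst A T (f : (T -> R) -> R) : ang f -> fam (fun _ : A => f).
Proof. by move=> [r [C [r0 h]]]; exists r, C. Qed.

Lemma ang_expR T (f : (T -> R) -> R) : ang f -> ang (fun x => expR (f x)).
Proof.
move=> hf; pose g x := f x - f (fun=> 0).
have gA : ang g by apply: angD => //; exact: ang_cst.
have e1 : ang (fun x : unit -> R => expR (x tt)) by exists 1, (expR 1); split=> //; exact: an1_expR.
have h : ang (fun x => expR (g x)).
  by apply: (ang_comp (g := fun _ => g) e1) => [_ //|_]; rewrite /g subrr.
apply: (ang_near ltr01) (angM (ang_cst T (expR (f (fun=> 0)))) h) => x _.
by rewrite -expRD /g addrCA subrr addr0.
Qed.

Lemma ang_cos0 T (f : (T -> R) -> R) : ang f -> f (fun=> 0) = 0 -> ang (fun x => cos (f x)).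
Proof.
move=> hf f0.
have e1 : ang (fun x : unit -> R => cos (x tt)) by exists 1, (expR 1); split=> //; exact: an1_cos.
exact: (ang_comp (g := fun _ => f) e1).
Qed.

Lemma ang_sin0 T (f : (T -> R) -> R) : ang f -> f (fun=> 0) = 0 -> ang (fun x => sin (f x)).
Proof.
move=> hf f0.
have e1 : ang (fun x : unit -> R => sin (x tt)) by exists 1, (expR 1); split=> //; exact: an1_sin.
exact: (ang_comp (g := fun _ => f) e1).
Qed.

Lemma ang_ln T (f : (T -> R) -> R) : ang f -> 0 < f (fun=> 0) -> ang (fun x => ln (f x)).
Proof.
move=> [r [C [r0 fC]]] f0; have [s [D [/andP[s0 _] h _]]] := an1_ln r0 fC f0.
by exists s, D.
Qed.

Lemma ang_pos T (f : (T -> R) -> R) : ang f -> 0 < f (fun=> 0) ->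
  exists2 s, 0 < s & forall x, small s x -> 0 < f x.
Proof.
move=> [r [C [r0 fC]]] f0; have [s [D [/andP[s0 _] _ h]]] := an1_ln r0 fC f0.
by exists s.
Qed.

Lemma ang_powR T (f : (T -> R) -> R) a : ang f -> 0 < f (fun=> 0) ->
  ang (fun x => f x `^ a).
Proof.
move=> hf f0; have [s s0 fp] := ang_pos hf f0.
apply: (ang_near s0) (ang_expR (angZ a (ang_ln hf f0))) => x /fp fx.
by rewrite /powR gt_eqF.
Qed.

(** The inverse is [expR (- ln f)], after a change of sign if the value at the origin is
    negative. *)
Lemma ang_inv T (f : (T -> R) -> R) : ang f -> f (fun=> 0) != 0 -> ang (fun x => (f x)^-1).
Proof.
move=> hf fn0.
have P g : ang g -> 0 < g (fun=> 0) -> ang (fun x : T -> R => (g x)^-1).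
  move=> hg g0; have [s s0 gp] := ang_pos hg g0.
  apply: (ang_near s0) (ang_expR (angZ (-1) (ang_ln hg g0))) => x /gp gx.
  by rewrite mulN1r expRN lnK// posrE.
have [f0|f0|f0] := ltgtP (f (fun=> 0)) 0; last by rewrite f0 eqxx in fn0.
  apply: (ang_near ltr01) (angZ (-1) (P _ (angZ (-1) hf) _)) => [x _|].
    by rewrite !mulN1r invrN opprK.
  by rewrite mulN1r oppr_gt0.
exact: P.
Qed.

(** The last variable is divided by [s], so that the coefficients are bounded uniformly in [k]
    without weights. *)
Lemma fam_curry A T (F : A -> (option T -> R) -> R) : fam F ->
  exists s (H : A * nat -> (T -> R) -> R), [/\ 0 < s, fam H &
   forall a x z, small s x -> `|z| <= s ->
     F a (ext x z) = gser (fun k => H (a, k)) (ext x (z / s))].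
Proof.
move=> [r [C [r0 /(_ _)/an1_curry h]]].
have /choice[h1 h1P] a := h a r0.
exists r, (fun ak x => r ^+ ak.2 * h1 ak.1 ak.2 x); split => //.
  by exists r, C; split=> // -[a k] /=; exact: (h1P a).1.
move=> a x z xr zr; rewrite ((h1P a).2 x z xr zr).2 /gser /=.
congr usum; apply/funext => k.
by rewrite exprMn exprVn; field; rewrite expf_neq0// gt_eqF.
Qed.

Lemma fam_uncurry A T (H : A * nat -> (T -> R) -> R) : fam H ->
  fam (fun a => gser (fun k => H (a, k))).
Proof.
move=> [r [C [r0 h]]]; have m0 : 0 < Num.min r 2^-1 by rewrite lt_min r0/= invr_gt0.
exists (Num.min r 2^-1), (2 * C); split=> // a; apply: an1_uncurry => //.
  by rewrite ge_min lexx orbT.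
by move=> k; apply: an1_r (h (a, k)) => //; rewrite ge_min lexx.
Qed.

Lemma gser_bounded T (h : nat -> (T -> R) -> R) C x z : (forall k, `|h k x| <= C) ->
  `|z| <= 2^-1 -> l1 (2 * C) (fun k => h k x * z ^+ k).
Proof.
move=> hC z1; have C0 : 0 <= C by exact: le_trans (hC 0%N).
have := l1Z C (l1_geom (normr_ge0 z) z1); rewrite (ger0_norm C0) mulrC => h1.
apply: l1_le h1 _ => k; rewrite [X in X <= _]normrM [X in _ <= X]normrM !normrX normr_id ler_wpM2r//.
by rewrite (ger0_norm C0).
Qed.

Lemma l1_partial C (f : nat -> R) n : l1 C f -> \sum_(0 <= i < n) `|f i| <= C.
Proof.
move=> fC; rewrite -lee_fin; apply: le_trans fC.
rewrite /es -nneseries_esumT => [|k]; last by rewrite lee_fin.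
by rewrite -sumEFin; apply: nneseries_lim_ge => k _ _; rewrite lee_fin.
Qed.

Lemma l1S C (f : nat -> R) : l1 C f -> l1 C (fun k => f k.+1).
Proof.
move=> fC; apply: l1_nat => n; apply: le_trans (l1_partial n.+1 fC).
by rewrite big_nat_recl// lerDr.
Qed.

Lemma usumS C (f : nat -> R) : l1 C f -> usum f = f 0%N + usum (fun k => f k.+1).
Proof.
move=> fC; have c1 : (fun n => \sum_(0 <= i < n.+1) f i) @ \oo --> usum f.
  by have := usum_nat fC; rewrite -(cvg_shiftS (fun n => _)).
have c2 : (fun n => f 0%N + \sum_(0 <= i < n) f i.+1) @ \oo --> f 0%N + usum (fun k => f k.+1).
  by apply: cvgD; [exact: cvg_cst|exact: usum_nat (l1S fC)].
apply: (cvg_unique (@norm_hausdorff _ R)) c1 _.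
by apply: cvg_ext c2 => n; rewrite big_nat_recl.
Qed.

Lemma usum_shift C (f : nat -> R) d : l1 C f ->
  usum f = \sum_(i < d) f i + usum (fun k => f (d + k)%N).
Proof.
elim: d f => [|d IH] f fC; first by rewrite big_ord0 add0r.
by rewrite (usumS fC) (IH _ (l1S fC)) big_ord_recl addrA.
Qed.

Lemma gser_split T (h : nat -> (T -> R) -> R) C x z d : (forall k, `|h k x| <= C) ->
  `|z| <= 2^-1 -> gser h (ext x z) =
  \sum_(i < d) h i x * z ^+ i + z ^+ d * gser (fun k => h (d + k)%N) (ext x z).
Proof.
move=> hC z1; rewrite /gser /= (usum_shift d (gser_bounded hC z1)).
rewrite -(usumZ _ (gser_bounded (C := C) (h := fun k => h (d + k)%N) _ z1))//.
by congr (_ + _); congr usum; apply/funext => k; rewrite exprD mulrCA.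
Qed.

Lemma gser0 T (h : nat -> (T -> R) -> R) x : gser h (ext x 0) = h 0%N x.
Proof.
rewrite /gser (_ : (fun k => _) = (fun k => if k == 0%N then h k x else 0)).
  by rewrite (usum1 (fun k => h k x)).
by apply/funext => -[|k]; rewrite /= ?expr0 ?mulr1// exprS mul0r mulr0.
Qed.

Lemma fam_bounded A T (F : A -> (T -> R) -> R) : fam F ->
  exists s C, 0 < s /\ forall a x, small s x -> `|F a x| <= C.
Proof. by move=> [r [C [r0 h]]]; exists r, C; split=> // a x; exact: an1_bound (h a). Qed.

End Elementary.

(** * Comparison of weighted norms with the sums over boxes in [analytic_at] *)

Section Boxes.
Variables (R : realType) (k : nat).
Local Notation N2 := {ffun 'I_k -> nat}.
Implicit Types g : N2 -> R.

Definition up N (e : {ffun 'I_k -> 'I_N}) : N2 := [ffun i => e i : nat].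
Definition box (g : N2 -> R) N := \sum_(e : {ffun 'I_k -> 'I_N}) g (up e).
Definition Box N : set N2 := [set e | forall i, (e i < N)%N].

Lemma box_sumE (u : ('I_k -> nat) -> R) N : box_sum u N = box (fun e => u e) N.
Proof.
apply: eq_bigr => e _; congr u; apply/funext => i; by rewrite ffunE.
Qed.

Lemma BoxE N : Box N = [set` map (@up N) (index_enum {ffun 'I_k -> 'I_N})].
Proof.
apply/seteqP; split=> e /=.
  move=> eN; apply/mapP; exists [ffun i => Ordinal (eN i)]; first exact: mem_index_enum.
  by apply/ffunP => i; rewrite !ffunE.
by move=> /mapP[f _ ->] i; rewrite ffunE.
Qed.

Lemma up_inj N : injective (@up N).
Proof.
move=> e f /ffunP ef; apply/ffunP => i; apply/val_inj.
by have := ef i; rewrite !ffunE.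
Qed.

Lemma box_fsum g N : (box g N)%:E = (\sum_(e \in Box N) (g e)%:E)%E.
Proof.
rewrite BoxE -fsbig_seq; last first.
  by rewrite map_inj_uniq ?index_enum_uniq//; exact: up_inj.
by rewrite big_map /box sumEFin.
Qed.

Lemma Box_finite N : finite_set (Box N).
Proof. by rewrite BoxE; exact: finite_seq. Qed.

Lemma box_le_es g N : (forall e, 0 <= g e) -> ((box g N)%:E <= es g)%E.
Proof.
move=> g0; rewrite box_fsum; apply: esum_ge; exists (Box N) => //.
by split=> //; exact: Box_finite.
Qed.

Lemma box_mono g : (forall e, 0 <= g e) -> nondecreasing_seq (box g).
Proof.
move=> g0 N N' NN'; rewrite -lee_fin !box_fsum.
apply: lee_fsum_nneg_subset; [exact: Box_finite|exact: Box_finite| |].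
  move=> e; rewrite !inE => eN i; exact: leq_trans (eN i) NN'.
by move=> e _; rewrite lee_fin.
Qed.

Lemma es_box_le g (M : R) : (forall e, 0 <= g e) -> (forall N, box g N <= M) -> (es g <= M%:E)%E.
Proof.
move=> g0 gM; apply: ub_ereal_sup => _ [A [finA _] <-].
have [r rA] := (finite_seqP A).1 finA.
pose N := (\max_(e <- r) \max_(i < k) (e : N2) i).+1.
have AN : A `<=` Box N.
  move=> e Ae i; rewrite ltnS.
  have : e \in r by move: Ae; rewrite rA.
  move=> /(leq_bigmax_seq (F := fun e : N2 => \max_(i < k) e i)) /(_ isT).
  by apply: leq_trans; exact: (leq_bigmax (F := fun i => e i)).
apply: (@le_trans _ _ (box g N)%:E); last by rewrite lee_fin.
rewrite box_fsum; apply: lee_fsum_nneg_subset => //; first exact: Box_finite.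
  move=> e; rewrite !inE; exact: AN.
by move=> e _; rewrite lee_fin.
Qed.

Lemma box_cvg0 g C : (forall e, 0 <= g e) -> (es g <= C%:E)%E -> box g @ \oo --> fine (es g).
Proof.
move=> g0 gC; have ef := es_fin g0 gC.
have bl N : box g N <= fine (es g) by rewrite -lee_fin fineK//; exact: box_le_es.
have -> : fine (es g) = sup (range (box g)).
  apply/eqP; rewrite eq_le; apply/andP; split; last first.
    apply: ge_sup => [|_ [N _ <-]//]; by exists (box g 0), 0%N.
  rewrite -lee_fin fineK//; apply: es_box_le => // N.
  by apply: ub_le_sup; [exists (fine (es g)) => _ [M _ <-]|exists N].
apply: nondecreasing_cvgn; first exact: box_mono.
by exists (fine (es g)) => _ [M _ <-].
Qed.

Lemma box_cvg g C : l1 C g -> box g @ \oo --> usum g.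
Proof.
move=> gC; have h1 := box_cvg0 (fun e => pm_ge0 (g e)) (es_pm gC).
have h2 := box_cvg0 (fun e => normr_ge0 (g e)) gC.
rewrite /usum (_ : box g = box (fun e => g e + `|g e|) \- box (fun e => `|g e|)).
  exact: cvgB.
by apply/funext => N /=; rewrite /box -sumrB; apply: eq_bigr => e _; rewrite addrK.
Qed.

Lemma analytic_at_an1 (F : 'rV[R]_k -> R) (p : 'rV[R]_k) : analytic_at F p ->
  ang (fun x : 'I_k -> R => F (p + \row_i x i)).
Proof.
move=> [c [r [r0 h]]]; have r2 : 0 < r / 2 by rewrite divr_gt0.
pose v (e : N2) := c e.
have pE (x : 'I_k -> R) i : (p + \row_i x i) 0 i - p 0 i = x i by rewrite !mxE addrC addKr.
have tE (x : 'I_k -> R) (e : N2) : monomial_term c p (p + \row_i x i) e = v e * mono x e.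
  by rewrite /monomial_term /v /mono; congr (_ * _); apply: eq_bigr => i _; rewrite pE.
(* At the point with every coordinate shifted by [r / 2], boundedness of the absolute box sums is
   finiteness of the weighted norm of radius [r / 2]. *)
have [|[M hM] _] := h (p + \row_i (r / 2)).
  by move=> i; rewrite pE gtr0_norm// ltr_pdivrMr// ltr_pMr// ltr1n.
have vM : l1 M (fun e => v e * (r / 2) ^+ mdeg e).
  apply: es_box_le => // N; apply: le_trans (hM N); rewrite box_sumE.
  rewrite le_eqVlt; apply/orP; left; apply/eqP/eq_bigr => e _; congr `| _ |; rewrite tE; congr (_ * _).
  by rewrite /mono /mdeg expr_sum.
exists (r / 2), M; split=> //; exists v; split=> // x xs.
have [|_ hx] := h (p + \row_i x i).
  move=> i; rewrite pE; apply: le_lt_trans (xs i) _.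
  by rewrite ltr_pdivrMr// ltr_pMr// ltr1n.
have := box_cvg (l1_mono r2 vM xs).
move=> h2; apply/esym.
rewrite (_ : box _ = box_sum (monomial_term c p (p + \row_i x i))) in h2; last first.
  apply/funext => N; rewrite box_sumE; apply: eq_bigr => e _; by rewrite tE.
exact: (cvg_unique (@norm_hausdorff _ R) h2 hx).
Qed.

Lemma an1_analytic_at (F : 'rV[R]_k -> R) (p : 'rV[R]_k) :
  ang (fun x : 'I_k -> R => F (p + \row_i x i)) -> analytic_at F p.
Proof.
move=> [r [C [r0 [v [vC Fv]]]]].
exists (fun e => v [ffun i => e i]), r; split=> // y yr.
pose x i := y 0 i - p 0 i.
have xr : small r x by move=> i; exact: ltW (yr i).
have yE : y = p + \row_i x i by apply/rowP => i; rewrite !mxE addrC subrK.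
have tE (e : N2) : monomial_term (fun e => v [ffun i => e i]) p y e = v e * mono x e.
  rewrite /monomial_term /mono; congr (v _ * _).
  by apply/ffunP => i; rewrite ffunE.
have l := l1_mono r0 vC xr; split.
  exists C => N; rewrite box_sumE -lee_fin; apply: le_trans l.
  rewrite (_ : (fun e : N2 => `|_|) = (fun e => `|v e * mono x e|)); last first.
    by apply/funext => e; rewrite tE.
  exact: box_le_es.
rewrite yE Fv// -yE.
rewrite (_ : box_sum _ = box (fun e => v e * mono x e)); first exact: box_cvg l.
by apply/funext => N; rewrite box_sumE; apply: eq_bigr => e _; rewrite tE.
Qed.

Lemma restricted_local (f : 'rV[R]_k -> R) (p : 'rV[R]_k) : restricted_analytic f -> unit_cube p ->
  exists F : ('I_k -> R) -> R, ang F /\ forall x, unit_cube (p + \row_i x i) -> f (p + \row_i x i) = F x.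
Proof.
move=> [U [F [_ cU FA fF _]]] cp; exists (fun x => F (p + \row_i x i)); split.
  by apply: analytic_at_an1; apply: FA; exact: cU.
by move=> x cx; rewrite fF.
Qed.

(** The rescaled germ must be analytic on a neighbourhood of the unit cube. The factor [r / 3]
    carries the cube of half-side 2, together with the polydiscs of radius 1 around its points, into
    the polydisc of radius [r]. *)
Lemma ang_restricted (W : ('I_k -> R) -> R) : ang W -> exists rho f,
  [/\ 0 < rho, restricted_analytic f &
   forall x : 'I_k -> R, small rho x -> W x = f (\row_i (x i / rho))].
Proof.
move=> [r [C [r0 WC]]]; pose rho := r / 3; have rho0 : 0 < rho by rewrite divr_gt0.
pose F (x : 'rV[R]_k) := W (fun i => rho * x 0 i).
pose f (x : 'rV[R]_k) := if `[< unit_cube x >] then F x else 0.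
exists rho, f; split=> //; last first.
  move=> x xr; rewrite /f asboolT /F.
    by congr W; apply/funext => i; rewrite mxE mulrC divfK// gt_eqF.
  move=> i; rewrite mxE; have := xr i; rewrite ler_norml => /andP[h1 h2].
  by rewrite ler_pdivlMr// ler_pdivrMr// mulN1r mul1r h1 h2.
exists [set x : 'rV[R]_k | forall i, `|x 0 i| < 2], F; split.
- rewrite openE => x xU; apply: (@filter_forall _ 'I_k (fun i (y : 'rV[R]_k) => `|y 0 i| < 2) (nbhs x)) => i.
  have o2 : open [set z : R | `|z| < 2].
    rewrite (_ : [set _ | _] = ball (0 : R) 2); first exact: ball_open.
    by apply/seteqP; split=> z; rewrite -ball_normE /= sub0r normrN.
  exact: (@coord_continuous R 1 k 0 i x _ (open_nbhs_nbhs (conj o2 (xU i)))).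
- by move=> x cx i /=; have /andP[h1 h2] := cx i; rewrite ltr_norml; apply/andP; split; lra.
- move=> a Ua; apply: an1_analytic_at; exists 1, C; split=> //; rewrite /F.
  have gA i : an1 1 r (fun x : 'I_k -> R => rho * (a 0 i + x i)).
    have := an1Z rho ltr01 (an1D ltr01 (an1_cst _ (a 0 i) ltr01) (an1_var i ltr01)).
    apply: an1_le; rewrite (gtr0_norm rho0); have := Ua i; have := rho0; rewrite /rho; nra.
  have := an1_comp r0 ltr01 WC gA; apply: an1_ext => x _.
  by congr W; apply/funext => i; rewrite !mxE.
- by move=> x cx; rewrite /f asboolT.
- by move=> x cx; rewrite /f asboolF.
Qed.

End Boxes.

(** * Hausdorff fields of germs and their extensions *)

Section AnalyticFields.
Variables (R : realType) (Om : Type) (G : set_system Om).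
Hypothesis FG : ProperFilter G.
Implicit Types (f g c y z : Om -> R) (K M E L : set (Om -> R)) (T S : finType).

Definition ev (P : Om -> Prop) := G P.
Definition to0 f := forall e : R, 0 < e -> ev (fun w => `|f w| <= e).
(** The filter [G] is not assumed to be an ultrafilter, so comparability with constants is a
    property of the germ. *)
Definition dcd f := forall t : R, ev (fun w => f w < t) \/ ev (fun w => t <= f w).

Lemma ev_mp (P Q : Om -> Prop) : ev P -> (forall w, P w -> Q w) -> ev Q.
Proof. by move=> h PQ; apply: filterS h. Qed.

Lemma ev_and (P Q : Om -> Prop) : ev P -> ev Q -> ev (fun w => P w /\ Q w).
Proof. by move=> h k; exact: filterI. Qed.

Lemma ev_mp2 (P Q S : Om -> Prop) : ev P -> ev Q -> (forall w, P w -> Q w -> S w) -> ev S.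
Proof. by move=> h k PQS; apply: (ev_mp (ev_and h k)) => w [/PQS]. Qed.

Lemma ev_true (P : Om -> Prop) : (forall w, P w) -> ev P.
Proof. by move=> h; apply: (ev_mp filterT). Qed.

Lemma ev_all (S : finType) (P : S -> Om -> Prop) :
  (forall s, ev (P s)) -> ev (fun w => forall s, P s w).
Proof. by move=> h; exact: filter_forall. Qed.

Lemma ev_false : ev (fun=> False) -> False.
Proof. by move=> h; have [] := filter_ex h. Qed.

Lemma ev_absurd (P Q : Om -> Prop) : ev P -> ev Q -> (forall w, P w -> Q w -> False) -> False.
Proof. by move=> h k n; apply: ev_false; exact: ev_mp2 h k n. Qed.

Lemma to0_eq f g : ev (fun w => f w = g w) -> to0 f -> to0 g.
Proof. by move=> fg f0 e /f0 h; apply: ev_mp2 fg h _ => w ->. Qed.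

Lemma to0_le f g C : 0 < C -> ev (fun w => `|g w| <= C * `|f w|) -> to0 f -> to0 g.
Proof.
move=> C0 gf f0 e e0; have := f0 (e / C) (divr_gt0 e0 C0) => h.
apply: ev_mp2 gf h _ => w h1; rewrite ler_pdivlMr// mulrC => h2.
exact: le_trans h1 h2.
Qed.

Lemma to0D f g : to0 f -> to0 g -> to0 (fun w => f w + g w).
Proof.
move=> f0 g0 e e0; have e2 : 0 < e / 2 by rewrite divr_gt0.
apply: ev_mp2 (f0 _ e2) (g0 _ e2) _ => w h1 h2.
by rewrite (le_trans (ler_normD _ _))// [leRHS]splitr lerD.
Qed.

Lemma to0N f : to0 f -> to0 (fun w => - f w).
Proof. by move=> f0; apply: to0_le (f0) => [|]; [exact: ltr01|apply: ev_true => w; rewrite normrN mul1r]. Qed.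

Lemma to0B f g : to0 f -> to0 g -> to0 (fun w => f w - g w).
Proof. by move=> f0 g0; apply: to0D => //; exact: to0N. Qed.

Lemma to0M f g C : ev (fun w => `|g w| <= C) -> to0 f -> to0 (fun w => g w * f w).
Proof.
move=> gC f0; have C0 : 0 < `|C| + 1 by rewrite ltr_wpDl.
apply: to0_le C0 _ f0; apply: ev_mp gC _ => w gw.
by rewrite normrM ler_wpM2r// (le_trans gw)// (le_trans (ler_norm _))// lerDl.
Qed.

Lemma to0Z f a : to0 f -> to0 (fun w => a * f w).
Proof. by apply: (@to0M _ (fun=> a) `|a|); exact: ev_true. Qed.

Lemma to0_0 : to0 (fun=> 0).
Proof. by move=> e e0; apply: ev_true => w; rewrite normr0 ltW. Qed.

Lemma to0_ge f e : 0 < e -> ev (fun w => e <= `|f w|) -> to0 f -> False.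
Proof.
move=> e0 fe f0; have e2 : 0 < e / 2 by rewrite divr_gt0.
apply: (ev_absurd fe (f0 _ e2)) => w h1 h2.
have := le_trans h1 h2; rewrite leNgt => /negP; apply.
by rewrite ltr_pdivrMr// ltr_pMr// ltr1n.
Qed.

Lemma to0_bnd f a : to0 (fun w => f w - a) -> ev (fun w => `|f w| <= `|a| + 1).
Proof.
move=> fa; apply: ev_mp (fa _ ltr01) _ => w h.
by rewrite -[f w](subrK a) addrC (le_trans (ler_normD _ _))// lerD2l.
Qed.

Lemma to0_lim_ne f a : to0 (fun w => f w - a) -> a != 0 ->
  ev (fun w => `|a| / 2 <= `|f w| /\ 0 < f w * a).
Proof.
move=> fa an0; have a0 : 0 < `|a| by rewrite normr_gt0.
have a3 : 0 < `|a| / 3 by rewrite divr_gt0.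
apply: ev_mp (fa _ a3) _ => w h; split.
  have := ler_distD (f w) 0 a; rewrite !sub0r !normrN => h2.
  by lra.
move: h a0; rewrite ler_norml => /andP[h1 h2].
have [a0|a0] := ltP 0 a; first by rewrite gtr0_norm// in h1 h2 *; nra.
rewrite ler0_norm// in h1 h2 *; have : a < 0 by rewrite lt_neqAle an0.
by nra.
Qed.

Lemma to0_uniq f a b : to0 (fun w => f w - a) -> to0 (fun w => f w - b) -> a = b.
Proof.
move=> fa fb; apply/eqP; rewrite -subr_eq0; apply/negP => /negP ab.
apply: (@to0_ge (fun w => (f w - b) - (f w - a)) `|a - b|).
- by rewrite normr_gt0.
- by apply: ev_true => w; rewrite (_ : _ - _ = a - b)//; ring.
- exact: to0B.
Qed.

Lemma small_ev T (c : T -> Om -> R) s : 0 < s -> (forall t, to0 (c t)) ->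
  ev (fun w => small s (fun t => c t w)).
Proof. by move=> s0 c0; apply: ev_all => t; exact: c0. Qed.

Lemma ang_to0 T (F : (T -> R) -> R) (c : T -> Om -> R) : ang F ->
  (forall t, to0 (c t)) -> to0 (fun w => F (fun t => c t w) - F (fun=> 0)).
Proof.
move=> [r [C [r0 FC]]] c0 e e0; have C0 := an1_ge0 FC.
pose s := Num.min 1 (e / (C + C + 1)).
have C1 : 0 < C + C + 1 by rewrite ltr_wpDl// addr_ge0.
have s0 : 0 < s by rewrite lt_min ltr01 divr_gt0.
have s1 : s <= 1 by rewrite ge_min lexx.
apply: ev_mp (small_ev (mulr_gt0 s0 r0) c0) _ => w cs.
apply: le_trans (an1_cont r0 s0 s1 FC cs) _.
have : s <= e / (C + C + 1) by rewrite ge_min lexx orbT.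
rewrite ler_pdivlMr//; apply: le_trans; rewrite ler_wpM2l ?(ltW s0)//.
by rewrite lerDl.
Qed.

Lemma ang_ev_ne T (F : (T -> R) -> R) (c : T -> Om -> R) : ang F -> F (fun=> 0) != 0 ->
  (forall t, to0 (c t)) ->
  ev (fun w => 0 < F (fun t => c t w) * F (fun=> 0)).
Proof.
by move=> FA F0 c0; apply: ev_mp (to0_lim_ne (ang_to0 FA c0) F0) _ => w [].
Qed.

(** The supremum of the constants that are eventually below [f] is its limit. Consequently the
    residue field of each field of germs below is the real field. *)
Lemma st_lim f C : dcd f -> ev (fun w => `|f w| <= C) -> exists l, to0 (fun w => f w - l).
Proof.
move=> df fC; pose S := [set t : R | ev (fun w => t <= f w)].
have hS : has_sup S.
  split.
    by exists (- C); apply: ev_mp fC _ => w; rewrite ler_norml => /andP[].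
  exists C => t tS; rewrite leNgt; apply/negP => Ct.
  apply: (ev_absurd fC tS) => w; rewrite ler_norml => /andP[_ h1] h2.
  by have := le_lt_trans (le_trans h2 h1) Ct; rewrite ltxx.
exists (sup S) => e e0.
have [t tS te] := sup_adherent e0 hS.
have h2 : ev (fun w => f w < sup S + e).
  have [//|h] := df (sup S + e).
  have : sup S + e <= sup S by apply: sup_ubound => //; exact: hS.2.
  by rewrite leNgt ltrDl e0.
apply: ev_mp2 tS h2 _ => w h1 h3; rewrite ler_norml; apply/andP; split; lra.
Qed.

Lemma dcd_bnd f : dcd f -> (exists C, ev (fun w => `|f w| <= C)) \/
  to0 (fun w => (f w)^-1).
Proof.
move=> df; have [[C hC]|nC] := pselect (exists C, ev (fun w => `|f w| <= C)).
  by left; exists C.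
right=> e e0; have h : ev (fun w => e^-1 <= `|f w|).
  have [h1|h1] := df e^-1; last by apply: ev_mp h1 _ => w h; rewrite (le_trans h)// ler_norm.
  have [h2|h2] := df (- e^-1).
    by apply: ev_mp h2 _ => w /ltW h; rewrite -normrN (le_trans _ (ler_norm _))// lerNr.
  exfalso; apply: nC; exists e^-1; apply: ev_mp2 h1 h2 _ => w /ltW h3 h4.
  by rewrite ler_norml h4.
apply: ev_mp h _ => w h; rewrite normfV -[leRHS]invrK lef_pV2// posrE ?invr_gt0//.
by rewrite (lt_le_trans _ h)// invr_gt0.
Qed.

(** After division by the single element [m] the whole family is analytic in infinitesimals [e], and
    one member is a unit at the origin. [M] is the set of admissible divisors and [E] the source of
    infinitesimals; [e] may differ from the infinitesimals in which the family was given. *)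
Definition factored M E (A : Type) (g : A -> Om -> R) :=
  ev (fun w => forall a, g a w = 0) \/
  exists (m : Om -> R) T (e : T -> Om -> R) (W : A -> (T -> R) -> R),
  [/\ M m, forall t, E (e t) /\ to0 (e t), fam W, exists a, W a (fun=> 0) != 0 &
   ev (fun w => m w != 0 /\ forall a, g a w = m w * W a (fun t => e t w))].

Definition keyprop M E := forall (A : Type) T (F : A -> (T -> R) -> R) (e : T -> Om -> R),
  fam F -> (forall t, E (e t) /\ to0 (e t)) -> factored M E (fun a w => F a (fun t => e t w)).

(* A Hausdorff field of germs along [G], closed under roots and convergent power
   series; [af_key] replaces Noetherianity of the rings of power series. *)
Record anfield K : Prop := AnField {
  af_cst : forall a, K (fun=> a);
  af_add : forall f g, K f -> K g -> K (fun w => f w + g w);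
  af_mul : forall f g, K f -> K g -> K (fun w => f w * g w);
  af_inv : forall f, K f -> K (fun w => (f w)^-1);
  af_root : forall f p, K f -> K (fun w => `|f w| `^ (p.+1%:R)^-1);
  af_dec : forall f, K f ->
    [\/ ev (fun w => f w < 0), ev (fun w => f w = 0) | ev (fun w => 0 < f w)];
  af_eqv : forall f g, K f -> ev (fun w => f w = g w) -> K g;
  af_an : forall T (F : (T -> R) -> R) (c : T -> Om -> R), ang F ->
    (forall t, K (c t) /\ to0 (c t)) -> K (fun w => F (fun t => c t w));
  af_key : keyprop K K }.

(** * The field generated by a group of leading terms and a set of infinitesimals *)

Section Extension.
Variables M E : set (Om -> R).
Hypothesis M_sgn : forall m, M m -> ev (fun w => m w < 0) \/ ev (fun w => 0 < m w).
Hypothesis M_cst : forall a, a != 0 -> M (fun=> a).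
Hypothesis M_mul : forall m n, M m -> M n -> M (fun w => m w * n w).
Hypothesis M_inv : forall m, M m -> M (fun w => (m w)^-1).
Hypothesis M_root : forall m p, M m -> M (fun w => `|m w| `^ (p.+1%:R)^-1).
Hypothesis M_lim : forall m, M m ->
  [\/ E m /\ to0 m,
      exists2 l, l != 0 & E (fun w => m w - l) /\ to0 (fun w => m w - l) |
      E (fun w => (m w)^-1) /\ to0 (fun w => (m w)^-1)].
Hypothesis ME_key : keyprop M E.

(** Every nonzero element is a leading term times a unit, so signs, inverses and roots are read off
    this form. Sums and analytic substitutions leave it, and [ME_key] brings them back. *)
Definition extn : set (Om -> R) := [set f | ev (fun w => f w = 0) \/
  exists (m : Om -> R) T (e : T -> Om -> R) (W : (T -> R) -> R),
  [/\ M m, forall t, E (e t) /\ to0 (e t), ang W, W (fun=> 0) != 0 &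
      ev (fun w => f w = m w * W (fun t => e t w))]].

Lemma M_ne0 m : M m -> ev (fun w => m w != 0).
Proof.
move=> /M_sgn[h|h]; apply: ev_mp h _ => w; first by rewrite lt_neqAle => /andP[].
by rewrite lt_neqAle eq_sym => /andP[].
Qed.

Lemma extn_eqv f g : extn f -> ev (fun w => f w = g w) -> extn g.
Proof.
move=> [h|[m [T [e [W [Mm Ee Wa W0 h]]]]]] fg.
  by left; apply: ev_mp2 h fg _ => w -> ->.
right; exists m, T, e, W; split=> //.
by apply: ev_mp2 h fg _ => w -> ->.
Qed.

(** The key property of a one-member family restores the normal form when [F] is not a unit. *)
Lemma extn_MF m T (F : (T -> R) -> R) (e : T -> Om -> R) : M m -> ang F ->
  (forall t, E (e t) /\ to0 (e t)) -> extn (fun w => m w * F (fun t => e t w)).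
Proof.
move=> Mm FA Ee.
have [h|[m' [T' [e' [W [Mm' Ee' Wf [a Wa] h]]]]]] := ME_key (fam_ang_cst unit FA) Ee.
  by left; apply: ev_mp h _ => w ->; [rewrite mulr0|exact: tt].
right; exists (fun w => m w * m' w), T', e', (W a); split=> //.
- exact: M_mul.
- exact: fam_ang Wf.
- by apply: ev_mp h _ => w [_ /(_ a) ->]; rewrite mulrA.
Qed.

Lemma extn_M m : M m -> extn m.
Proof.
move=> Mm; right; exists m, void, (fun=> fun=> 0), (fun=> 1); split=> //.
- exact: ang_cst.
- by apply: ev_true => w; rewrite mulr1.
Qed.

Lemma extn_E e : E e -> to0 e -> extn e.
Proof.
move=> Ee e0; have M1 := M_cst (oner_neq0 R).
have := @extn_MF _ unit (fun x => x tt) (fun=> e) M1 (ang_var _ tt) (fun=> conj Ee e0).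
move=> /extn_eqv; apply.
by apply: ev_true => w; rewrite mul1r.
Qed.

Lemma extn_cst a : extn (fun=> a).
Proof.
have [->|an0] := eqVneq a 0; first by left; exact: ev_true.
exact/extn_M/M_cst.
Qed.

Lemma ang_pair T1 T2 (W1 : (T1 -> R) -> R) (W2 : (T2 -> R) -> R) : ang W1 -> ang W2 ->
  ang (fun x : T1 + T2 -> R => W1 (fun t => x (inl t))) /\
  ang (fun x : T1 + T2 -> R => W2 (fun t => x (inr t))).
Proof.
move=> h1 h2; split.
  by apply: (ang_comp h1) => // t; exact: ang_var.
by apply: (ang_comp h2) => // t; exact: ang_var.
Qed.

Definition sume T1 T2 (e1 : T1 -> Om -> R) (e2 : T2 -> Om -> R) : T1 + T2 -> Om -> R :=
  fun t => match t with inl t => e1 t | inr t => e2 t end.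

Lemma extn_mul f g : extn f -> extn g -> extn (fun w => f w * g w).
Proof.
move=> [h|[m [T [e [W [Mm Ee Wa W0 h]]]]]].
  by move=> _; left; apply: ev_mp h _ => w ->; rewrite mul0r.
move=> [h'|[m' [T' [e' [W' [Mm' Ee' Wa' W0' h']]]]]].
  by left; apply: ev_mp h' _ => w ->; rewrite mulr0.
have [a1 a2] := ang_pair Wa Wa'.
right; exists (fun w => m w * m' w), (T + T')%type, (sume e e'),
  (fun x => W (fun t => x (inl t)) * W' (fun t => x (inr t))); split.
- exact: M_mul.
- by case=> t; [exact: Ee|exact: Ee'].
- exact: angM.
- exact: mulf_neq0.
- by apply: ev_mp2 h h' _ => w -> ->; rewrite mulrACA.
Qed.

Lemma extn_inv f : extn f -> extn (fun w => (f w)^-1).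
Proof.
move=> [h|[m [T [e [W [Mm Ee Wa W0 h]]]]]].
  by left; apply: ev_mp h _ => w ->; rewrite invr0.
right; exists (fun w => (m w)^-1), T, e, (fun x => (W x)^-1); split=> //.
- exact: M_inv.
- exact: ang_inv.
- by rewrite invr_eq0.
- by apply: ev_mp h _ => w ->; rewrite invfM.
Qed.

Lemma ang_norm_powR T (W : (T -> R) -> R) a : ang W -> W (fun=> 0) != 0 ->
  ang (fun x => `|W x| `^ a) /\ `|W (fun=> 0)| `^ a != 0.
Proof.
move=> Wa W0; split; last by rewrite gt_eqF// powR_gt0// normr_gt0.
have P V : ang V -> 0 < V (fun=> 0) -> ang (fun x : T -> R => `|V x| `^ a).
  move=> VA V0; have [s s0 sV] := ang_pos VA V0.
  by apply: (ang_near s0) (ang_powR a VA V0) => x /sV Vx; rewrite gtr0_norm.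
have [W0'|W0'|W0'] := ltgtP (W (fun=> 0)) 0; last by rewrite W0' eqxx in W0.
  apply: (ang_near ltr01) (P _ (angZ (-1) Wa) _) => [x _|].
    by rewrite mulN1r normrN.
  by rewrite mulN1r oppr_gt0.
exact: P.
Qed.

Lemma extn_root f p : extn f -> extn (fun w => `|f w| `^ (p.+1%:R)^-1).
Proof.
move=> [h|[m [T [e [W [Mm Ee Wa W0 h]]]]]].
  by left; apply: ev_mp h _ => w ->; rewrite normr0 powR0// invr_neq0// pnatr_eq0.
have [Wa' W0'] := ang_norm_powR (p.+1%:R)^-1 Wa W0.
right; exists (fun w => `|m w| `^ (p.+1%:R)^-1), T, e, (fun x => `|W x| `^ (p.+1%:R)^-1).
split=> //; first exact: M_root.
by apply: ev_mp h _ => w ->; rewrite normrM powRM.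
Qed.

Lemma extn_dec f : extn f ->
    [\/ ev (fun w => f w < 0), ev (fun w => f w = 0) | ev (fun w => 0 < f w)].
Proof.
move=> [h|[m [T [e [W [Mm Ee Wa W0 h]]]]]]; first by constructor 2.
have hW := ang_ev_ne Wa W0 (fun t => (Ee t).2).
have P g : M m -> ev (fun w => 0 < g w * m w) ->
    [\/ ev (fun w => g w < 0), ev (fun w => g w = 0) | ev (fun w => 0 < g w)].
  move=> /M_sgn[m0|m0] gm.
    by constructor 1; apply: ev_mp2 m0 gm _ => w m0 gm; rewrite -(nmulr_lgt0 _ m0).
  by constructor 3; apply: ev_mp2 m0 gm _ => w m0 gm; rewrite -(pmulr_lgt0 _ m0).
have [W0'|W0'] := ltP 0 (W (fun=> 0)).
  apply: P => //; apply: ev_mp2 (ev_and h hW) (M_ne0 Mm) _ => w [-> Wp] m0.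
  rewrite pmulr_lgt0// in Wp.
  by rewrite mulrAC pmulr_lgt0// -expr2 exprn_even_gt0.
have {}W0' : W (fun=> 0) < 0 by rewrite lt_neqAle W0.
have h2 : ev (fun w => 0 < - f w * m w).
  apply: ev_mp2 (ev_and h hW) (M_ne0 Mm) _ => w [-> Wp] m0.
  rewrite nmulr_lgt0// in Wp.
  by rewrite mulNr mulrAC -mulrN pmulr_lgt0 ?oppr_gt0// -expr2 exprn_even_gt0.
have [h3|h3|h3] := P _ Mm h2; [constructor 3|constructor 2|constructor 1];
  apply: ev_mp h3 _ => w; first by rewrite oppr_lt0.
  by move/eqP; rewrite oppr_eq0 => /eqP.
by rewrite oppr_gt0.
Qed.

(** By [M_lim] the quotient of the two leading terms, taken in a suitable order, is [l + d] with [l]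
    real and [d] an infinitesimal of [E]. With the denominator factored out, the sum is a leading
    term times an analytic function of infinitesimals, the case of [extn_MF]. *)
Lemma extn_add f g : extn f -> extn g -> extn (fun w => f w + g w).
Proof.
move=> [h|Lf].
  by move=> Lg; apply: extn_eqv Lg _; apply: ev_mp h _ => w ->; rewrite add0r.
move=> [h'|Lg].
  apply: (@extn_eqv f); first by right.
  by apply: ev_mp h' _ => w ->; rewrite addr0.
have [m [T [e [W [Mm Ee Wa W0 h]]]]] := Lf.
have [m' [T' [e' [W' [Mm' Ee' Wa' W0' h']]]]] := Lg.
have P m1 m2 T1 T2 (e1 : T1 -> Om -> R) (e2 : T2 -> Om -> R) W1 W2 (d : Om -> R) l :
    M m1 -> (forall t, E (e1 t) /\ to0 (e1 t)) -> (forall t, E (e2 t) /\ to0 (e2 t)) ->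
    ang W1 -> ang W2 -> E d -> to0 d -> ev (fun w => m2 w / m1 w = l + d w) ->
    extn (fun w => m1 w * W1 (fun t => e1 t w) + m2 w * W2 (fun t => e2 t w)).
  move=> Mm1 Ee1 Ee2 Wa1 Wa2 Ed d0 dE; have [a1 a2] := ang_pair Wa1 Wa2.
  pose e3 : option (T1 + T2) -> Om -> R := fun o => if o is Some t then sume e1 e2 t else d.
  pose F (x : option (T1 + T2) -> R) := W1 (fun t => x (Some (inl t))) +
     (l + x None) * W2 (fun t => x (Some (inr t))).
  have FA : ang F.
    apply: angD.
      by apply: (ang_comp Wa1) => // t; exact: ang_var.
    apply: angM; first by apply: angD; [exact: ang_cst|exact: ang_var].
    by apply: (ang_comp Wa2) => // t; exact: ang_var.
  have Ee3 o : E (e3 o) /\ to0 (e3 o) by case: o => [[t|t]|] //=.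
  apply: extn_eqv (extn_MF Mm1 FA Ee3) _.
  apply: ev_mp2 dE (M_ne0 Mm1) _ => w dE m0.
  by rewrite /F /= -dE; field.
have fgE : ev (fun w => m w * W (fun t => e t w) + m' w * W' (fun t => e' t w) = f w + g w).
  by apply: ev_mp2 h h' _ => w -> ->.
have [[Ed d0]|[l ln0 [Ed d0]]|[Ed d0]] := M_lim (M_mul Mm' (M_inv Mm)).
- apply: extn_eqv (P m m' _ _ e e' W W' _ 0 Mm Ee Ee' Wa Wa' Ed d0 _) fgE.
  by apply: ev_true => w; rewrite add0r.
- apply: extn_eqv (P m m' _ _ e e' W W' _ l Mm Ee Ee' Wa Wa' Ed d0 _) fgE.
  by apply: ev_true => w; rewrite addrC subrK.
- apply: extn_eqv (P m' m _ _ e' e W' W _ 0 Mm' Ee' Ee Wa' Wa Ed d0 _) _.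
    by apply: ev_true => w; rewrite add0r invfM invrK mulrC.
  by apply: ev_mp fgE _ => w <-; rewrite addrC.
Qed.

(** The unit factor has a nonzero limit, so the leading term is itself infinitesimal and [M_lim]
    places it in [E]. *)
Lemma extn_inf f : extn f -> to0 f -> exists T (e : T -> Om -> R) (W : (T -> R) -> R),
  [/\ forall t, E (e t) /\ to0 (e t), ang W, W (fun=> 0) = 0 &
      ev (fun w => f w = W (fun t => e t w))].
Proof.
move=> [h|[m [T [e [W [Mm Ee Wa W0 h]]]]]] f0.
  by exists void, (fun=> fun=> 0), (fun=> 0); split=> //; exact: ang_cst.
have m0 : to0 m.
  have := to0_lim_ne (ang_to0 Wa (fun t => (Ee t).2)) W0 => hW.
  apply: (@to0_le f _ (`|W (fun=> 0)| / 2)^-1) f0; first by rewrite invr_gt0 divr_gt0// normr_gt0.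
  apply: ev_mp2 h hW _ => w -> [hw _]; rewrite normrM mulrC -ler_pdivrMr; last first.
    by rewrite invr_gt0 divr_gt0// normr_gt0.
  by rewrite invrK ler_wpM2l.
have [[Em _]|[l ln0 [_ h1]]|[_ h1]] := M_lim Mm.
- exists (option T), (fun o => if o is Some t then e t else m),
    (fun x => x None * W (fun t => x (Some t))); split=> //.
  + by case.
  + apply: angM; first exact: ang_var.
    by apply: (ang_comp Wa) => // t; exact: ang_var.
  + by rewrite mul0r.
- exfalso; move: ln0; rewrite (@to0_uniq m l 0) ?eqxx//.
  by apply: to0_eq m0; apply: ev_true => w; rewrite subr0.
- exfalso; apply: (@to0_ge (fun w => m w * (m w)^-1) 1) => //.
    by apply: ev_mp (M_ne0 Mm) _ => w mw; rewrite divff// normr1.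
  by apply: to0M h1; exact: (m0 _ ltr01).
Qed.

Lemma extn_subst (A : Type) T (F : A -> (T -> R) -> R) (c : T -> Om -> R) : fam F ->
  (forall t, extn (c t) /\ to0 (c t)) ->
  exists S (e : S -> Om -> R) (F' : A -> (S -> R) -> R), [/\ fam F', forall s, E (e s) /\ to0 (e s) &
    ev (fun w => forall a, F a (fun t => c t w) = F' a (fun s => e s w))].
Proof.
move=> hF hc.
have /choice[S hS] t := extn_inf (hc t).1 (hc t).2.
pose e t := projT1 (cid (hS t)); have he t := projT2 (cid (hS t)).
pose W t := projT1 (cid (he t)); have hW t := projT2 (cid (he t)).
exists {t : T & S t}, (fun ts => e (tag ts) (tagged ts)),
  (fun a x => F a (fun t => W t (fun s => x (Tagged S s)))); split.
- apply: (fam_comp hF) => t; last by have [] := hW t.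
  by have [_ Wa _ _] := hW t; apply: (ang_comp Wa) => // s; exact: ang_var.
- by case=> t s; have [h _ _ _] := hW t; exact: h s.
- have : ev (fun w => forall t, c t w = W t (fun s => e t s w)).
    by apply: ev_all => t; have [] := hW t.
  move=> h; apply: ev_mp h _ => w cw a; congr (F a _).
  by apply/funext => t.
Qed.

Lemma extn_anfield : anfield extn.
Proof.
split.
- exact: extn_cst.
- exact: extn_add.
- exact: extn_mul.
- exact: extn_inv.
- exact: extn_root.
- exact: extn_dec.
- exact: extn_eqv.
- move=> T F c FA hc.
  have [S [e [F' [F'A Ee h]]]] := extn_subst (fam_ang_cst unit FA) hc.
  apply: extn_eqv (extn_MF (M_cst (oner_neq0 R)) (fam_ang tt F'A) Ee) _.
  by apply: ev_mp h _ => w /(_ tt) ->; rewrite mul1r.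
- move=> A T F c hF hc.
  have [S [e [F' [F'A Ee h]]]] := extn_subst hF hc.
  have [h0|[m [T' [e' [W [Mm Ee' Wf Wa h1]]]]]] := ME_key F'A Ee.
    by left; apply: ev_mp2 h h0 _ => w cw F'0 a; rewrite cw F'0.
  right; exists m, T', e', W; split=> //; first exact: extn_M.
    by move=> t; have [Et t0] := Ee' t; split=> //; exact: extn_E.
  by apply: ev_mp2 h h1 _ => w cw [m0 F'E]; split=> // a; rewrite cw F'E.
Qed.

End Extension.

End AnalyticFields.

(** * Recentring a power series so as to kill one coefficient *)

Section Recentering.
Variable R : realType.
Implicit Types (T : finType) (r C : R).

Lemma l1_fin (f : nat -> R) k : (forall i, (k <= i)%N -> f i = 0) ->
  l1 (\sum_(0 <= i < k) `|f i|) f /\ usum f = \sum_(i < k) f i.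
Proof.
move=> f0; have h : l1 (\sum_(0 <= i < k) `|f i|) f.
  apply: l1_nat => n.
  apply: (@le_trans _ _ (\sum_(0 <= i < maxn n k) `|f i|)).
    by rewrite (big_cat_nat (leq0n n) (leq_maxl n k))//= lerDl sumr_ge0.
  rewrite (big_cat_nat (leq0n k) (leq_maxr n k))//= gerDl big_nat_cond big1 ?lexx// => i.
  by rewrite andbT => /andP[ki _]; rewrite f0// normr0.
split=> //; rewrite (usum_shift k h) [X in _ + X](_ : _ = 0) ?addr0//.
rewrite (_ : (fun i => _) = (fun=> 0)) ?usum0//.
by apply/funext => i; rewrite f0// leq_addr.
Qed.

Lemma bin_le2 n k : ('C(n, k) <= 2 ^ n)%N.
Proof.
have [kn|nk] := leqP k n; last by rewrite bin_small.
rewrite -[2%N]/(1 + 1)%N expnDn (bigD1 (Ordinal (kn : (k < n.+1)%N)))//=.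
by rewrite !exp1n !muln1 leq_addr.
Qed.

Lemma bin_le4 n k : ('C(n, k)%:R <= 4 ^+ n :> R).
Proof.
rewrite -natrX ler_nat (leq_trans (bin_le2 _ _))//.
by case: n => // n; rewrite leq_exp2r.
Qed.

Lemma ext00 T : ext (fun _ : T => 0 : R) 0 = (fun=> 0).
Proof. by apply/funext => -[]. Qed.

(** Binomial expansion of [(a + z) ^+ k] with the sums exchanged. The binomial coefficients are at
    most [4 ^+ (i + k)]; powers of [4^-1] absorb them, at the price of scaling both variables by 4,
    which brings the radius 1/8 up to the radius 1/2 of convergence. *)
Lemma gser_recenter T (h : nat -> (T -> R) -> R) C x (a z : R) :
  (forall k, `|h k x| <= C) -> `|a| <= 8^-1 -> `|z| <= 8^-1 ->
  gser h (ext x (a + z)) =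
  gser (fun i x => usum (fun k =>
     4^-1 ^+ (i + k) * 'C(i + k, i)%:R * h (i + k)%N x * (4 * a) ^+ k)) (ext x (4 * z)).
Proof.
move=> hC a8 z8; have C0 : 0 <= C by exact: le_trans (hC 0%N).
pose f k i := if (i <= k)%N then h k x * 'C(k, i)%:R * a ^+ (k - i) * z ^+ i else 0.
have fk k : l1 (`|h k x| * (`|a| + `|z|) ^+ k) (f k) /\ usum (f k) = h k x * (a + z) ^+ k.
  have [|l u] := @l1_fin (f k) k.+1; first by move=> i; rewrite /f ltnNge => /negPf ->.
  have fE (i : 'I_k.+1) : f k i = h k x * 'C(k, i)%:R * a ^+ (k - i) * z ^+ i.
    by rewrite /f -ltnS ltn_ord.
  split.
    apply: l1_leC l; rewrite big_mkord exprDn mulr_sumr; apply: ler_sum => i _.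
    rewrite fE !normrM !normrX normr_nat -mulr_natl le_eqVlt; apply/orP; left.
    by apply/eqP; ring.
  rewrite u exprDn mulr_sumr; apply: eq_bigr => i _.
  by rewrite fE -mulr_natl; ring.
have az : `|a| + `|z| <= 2^-1 by lra.
have fl : l11 (2 * C) f.
  apply: l11_nest (fun k => (fk k).1).
  have := @gser_bounded R T (fun k _ => `|h k x|) C x (`|a| + `|z|).
  apply; first by move=> k; rewrite normr_id.
  by rewrite ger0_norm// addr_ge0.
rewrite /gser /= (_ : (fun k => _) = (fun k => usum (f k))); last first.
  by apply/funext => k; rewrite (fk k).2.
rewrite (usum_swap fl); congr usum; apply/funext => i.
rewrite (usum_shift i (l11_inner i (l11_swap fl))) big1 ?add0r => [|k _]; last first.
  by rewrite /f leqNgt ltn_ord.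
have hb k : `|4^-1 ^+ (i + k) * 'C(i + k, i)%:R * h (i + k)%N x| <= C.
  rewrite normrM (le_trans _ (hC (i + k)%N))// ler_piMl// normrM normrX normfV !normr_nat exprVn.
  rewrite ler_pdivrMl ?exprn_gt0// mulr1.
  exact: bin_le4.
have a4 : `|4 * a| <= 2^-1 by rewrite normrM normr_nat; lra.
rewrite mulrC -(usumZ _ (@gser_bounded R T
  (fun k x => 4^-1 ^+ (i + k) * 'C(i + k, i)%:R * h (i + k)%N x) C x _ hb a4)).
congr usum; apply/funext => k; rewrite /f leq_addr addKn !exprMn exprD !exprVn.
by field; rewrite !expf_neq0.
Qed.

(** Tschirnhausen transformation: [zeta] is a zero of the derivative of order [d] in [z] of the
    member [a0]. It is found by [ift], since the derivative of order [d.+1] does not vanish at the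
    origin. The expansion around [zeta] then has no term of degree [d] for this member. *)
Lemma tschirnhaus (A : Type) T (H : A * nat -> (T -> R) -> R) a0 d : fam H ->
  H (a0, d) (fun=> 0) = 0 -> H (a0, d.+1) (fun=> 0) != 0 ->
  exists s (zeta : (T -> R) -> R) (H' : A * nat -> (T -> R) -> R),
  [/\ 0 < s, ang zeta, zeta (fun=> 0) = 0, fam H' &
   [/\ forall a i, H' (a, i) (fun=> 0) = 4^-1 ^+ i * H (a, i) (fun=> 0),
    forall x, small s x -> H' (a0, d) x = 0 &
    forall a x z, small s x -> `|z| <= s -> gser (fun k => H (a, k)) (ext x z) =
      gser (fun k => H' (a, k)) (ext x (4 * (z - zeta x)))]].
Proof.
move=> [r0 [C [r00 HC]]] Hd Hd1; have C0 := an1_ge0 (HC (a0, d)).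
pose r := Num.min r0 2^-1; have r_gt0 : 0 < r by rewrite lt_min r00/= invr_gt0.
have HCr b : an1 r C (H b) by apply: an1_r (HC b) => //; rewrite ge_min lexx.
(* The coefficients in [z] of the derivative of order [d], divided by the factorial of [d]. *)
pose h k (x : T -> R) := 'C(d + k, d)%:R * H (a0, (d + k)%N) x.
have hA k : an1 r (2 ^+ d * C) (fun x => r ^+ k * h k x).
  apply: an1_ext (an1_le _ (an1Z (r ^+ k * 'C(d + k, d)%:R) r_gt0 (HCr (a0, (d + k)%N)))) => [x _|].
    by rewrite mulrA.
  rewrite ler_wpM2r// normrM normr_nat normrX gtr0_norm//.
  apply: (@le_trans _ _ (2^-1 ^+ k * 2 ^+ (d + k))).
    rewrite ler_pM ?exprn_ge0 ?(ltW r_gt0)//.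
      by rewrite lerXn2r ?nnegrE ?invr_ge0 ?(ltW r_gt0)// ge_min lexx orbT.
    by rewrite -natrX ler_nat bin_le2.
  by rewrite exprD mulrCA -exprMn mulVf// expr1n mulr1.
have [||s [z [s0 zA z0 zE]]] := ift r_gt0 hA.
- by rewrite /h addn0 Hd mulr0.
- by rewrite /h addn1 mulf_neq0// pnatr_eq0 -lt0n bin_gt0.
pose hh (b : A * nat * nat) (x : T -> R) := 4^-1 ^+ (b.1.2 + b.2) * 'C(b.1.2 + b.2, b.1.2)%:R *
  H (b.1.1, (b.1.2 + b.2)%N) x.
have hhA : fam hh.
  exists r, C; split=> // b; apply: an1_le (an1Z _ r_gt0 (HCr _)).
  rewrite ler_piMl// normrM normrX normfV !normr_nat exprVn.
  rewrite ler_pdivrMl ?exprn_gt0// mulr1.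
  exact: bin_le4.
have zang : ang z by exists s, (r / 2).
have h16 : 0 < 16^-1 :> R by rewrite invr_gt0.
have [t /andP[t0 ts] zt] := an1_small s0 h16 zA z0.
pose H' (b : A * nat) (x : T -> R) := gser (fun k => hh (b, k)) (ext x (4 * z x)).
have H'A : fam H'.
  have := @fam_comp R (A * nat) (option T) T _ (fun o x => ext x (4 * z x) o)
    (fam_uncurry hhA); apply.
    by case=> [u|] /=; [exact: ang_var|exact: angZ].
  by case=> [u|] //=; rewrite z0 mulr0.
pose u := Num.min (Num.min t r) 16^-1.
have u0 : 0 < u by rewrite 2!lt_min t0 r_gt0.
have ut : u <= t by rewrite 2!ge_min lexx.
have ur : u <= r by rewrite 2!ge_min lexx orbT.
have u16 : u <= 16^-1 by rewrite ge_min lexx orbT.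
exists u, z, H'; split=> //; split.
- move=> a i; rewrite /H' z0 mulr0 gser0 /hh /= addn0 binn mulr1//.
- move=> x xu.
  have xs : small s x by move=> v; apply: le_trans (xu v) (le_trans ut ts).
  have xr : small r x by move=> v; apply: le_trans (xu v) ur.
  have zr : `|z x| <= r / 2 by exact: an1_bound zA xs.
  have l := gser_l1 r_gt0 hA xr zr.
  have := zE x xs; rewrite /gser /= => zE'.
  rewrite /H' /gser /= -[RHS](mulr0 (4^-1 ^+ d)) -zE' -(usumZ _ l).
  congr usum; apply/funext => k; rewrite /hh /h /= exprD exprMn exprVn exprVn.
  by field; rewrite !expf_neq0.
- move=> a x y xu yu.
  have xr : small r x by move=> v; apply: le_trans (xu v) ur.
  have xt : small t x by move=> v; apply: le_trans (xu v) ut.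
  have z16 : `|z x| <= 16^-1 by exact: an1_bound zt xt.
  have := @gser_recenter T (fun k => H (a, k)) C x (z x) (y - z x).
  rewrite (_ : z x + (y - z x) = y); last by ring.
  move=> -> //.
  + by move=> k; exact: an1_bound (HCr _) xr.
  + lra.
  + by have := ler_normB y (z x); lra.
Qed.

Lemma poly_small (p : {poly R}) d (C e : R) : 0 < e ->
  (forall t, t != 0 -> `|t| <= e -> `|p.[t]| <= C * `|t| ^+ d) ->
  forall k, (k < d)%N -> p`_k = 0.
Proof.
move=> e0; elim: d p => // d IH p.
have [q [c ->]] : exists q c, p = q * 'X + c%:P.
  elim/poly_ind: p => [|q c _]; last by exists q, c.
  by exists 0, 0; rewrite mul0r addr0.
move=> pC; have pE t : (q * 'X + c%:P).[t] = q.[t] * t + c by rewrite !hornerE.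
have c0 : c = 0.
  apply/eqP/negP => /negP cn0; have c0 : 0 < `|c| by rewrite normr_gt0.
  have [B hB] := poly_itv_bound q 0 1.
  have B0 : 0 <= B by apply: le_trans (hB 0 _); rewrite ?lexx ?ler01.
  (* For [t <= |c| / D] the hypothesis would give [|c| <= (|C| + B) * t], which is less than
     [|c| / 2]. *)
  pose D := 2 * (`|C| + B + 1); have D0 : 0 < D by rewrite mulr_gt0// ltr_wpDl// addr_ge0.
  pose t := Num.min (Num.min e 1) (`|c| / D).
  have t0 : 0 < t by rewrite !lt_min e0 ltr01 divr_gt0.
  have te : t <= e by rewrite /t !ge_min lexx.
  have t1 : t <= 1 by rewrite /t !ge_min lexx orbT.
  have tc : t * D <= `|c| by rewrite -ler_pdivlMr// /t ge_min lexx orbT.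
  have := pC t (lt0r_neq0 t0); rewrite (gtr0_norm t0) => /(_ te); rewrite pE => h.
  have hq : `|q.[t]| <= B by apply: hB; rewrite (ltW t0) t1.
  have h1 : C * t ^+ d.+1 <= `|C| * t.
    apply: (@le_trans _ _ (`|C| * t ^+ d.+1)).
      by rewrite ler_wpM2r ?exprn_ge0 ?(ltW t0)// ler_norm.
    by rewrite ler_wpM2l// exprS ler_piMr ?(ltW t0)// exprn_ile1// ltW.
  have h2 : `|c| <= `|q.[t] * t + c| + `|q.[t] * t|.
    by have := ler_normB (q.[t] * t + c) (q.[t] * t); rewrite addrAC subrr add0r.
  have h3 : `|q.[t] * t| <= B * t by rewrite normrM (gtr0_norm t0) ler_wpM2r// ltW.
  move: tc; rewrite /D => tc; nra.
move=> [|k] kd; first by rewrite coefD coefMX coefC/= add0r.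
rewrite coefD coefMX coefC/= addr0; apply: IH => // t tn0 te.
have := pC t tn0 te; rewrite pE c0 addr0 normrM exprS mulrCA mulrC.
by rewrite ler_pM2l// normr_gt0.
Qed.

End Recentering.

Section FieldTools.
Variables (R : realType) (Om : Type) (G : set_system Om).
Hypothesis FG : ProperFilter G.
Variable K : set (Om -> R).
Hypothesis KA : anfield G K.
Local Notation ev := (ev G).
Local Notation to0 := (to0 G).
Implicit Types (f g c y z : Om -> R) (T S : finType).

Lemma fam_rename (A : Type) T S (F : A -> (T -> R) -> R) (i : T -> S) :
  fam F -> fam (fun a (x : S -> R) => F a (fun t => x (i t))).
Proof. by move=> hF; apply: (fam_comp hF) => // t; exact: ang_var. Qed.

Lemma factored_eq M E (A : Type) (g h : A -> Om -> R) :
  ev (fun w => forall a, g a w = h a w) -> factored G M E g -> factored G M E h.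
Proof.
move=> gh [g0|[m [T [e [W [Mm Ee Wf W0 gE]]]]]].
  by left; apply: ev_mp2 gh g0 _ => w gh g0 a; rewrite -gh g0.
right; exists m, T, e, W; split=> //.
by apply: ev_mp2 gh gE _ => w gh [m0 gE]; split=> // a; rewrite -gh gE.
Qed.

Lemma Kcst a : K (fun=> a). Proof. exact: (af_cst KA). Qed.
Lemma KD f g : K f -> K g -> K (fun w => f w + g w). Proof. exact: (af_add KA). Qed.
Lemma KM f g : K f -> K g -> K (fun w => f w * g w). Proof. exact: (af_mul KA). Qed.
Lemma KV f : K f -> K (fun w => (f w)^-1). Proof. exact: (af_inv KA). Qed.
Lemma Keqv f g : K f -> (forall w, f w = g w) -> K g.
Proof. by move=> Kf fg; rewrite (_ : g = f)//; apply/funext. Qed.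
Lemma KZ f a : K f -> K (fun w => a * f w).
Proof. by move=> Kf; exact: (KM (Kcst a) Kf). Qed.
Lemma KB f g : K f -> K g -> K (fun w => f w - g w).
Proof. by move=> Kf Kg; apply: Keqv (KD Kf (KZ (-1) Kg)) _ => w; rewrite mulN1r. Qed.
Lemma KX f n : K f -> K (fun w => f w ^+ n).
Proof.
move=> Kf; elim: n => [|n IH]; first exact: (Kcst 1).
by apply: Keqv (KM Kf IH) _ => w; rewrite exprS.
Qed.
Lemma Knorm f : K f -> K (fun w => `|f w|).
Proof. by move=> Kf; apply: Keqv (af_root KA 0 Kf) _ => w; rewrite invr1 powRr1. Qed.

Lemma Kdcd f : K f -> dcd G f.
Proof.
move=> Kf t; have [h|h|h] := af_dec KA (KB Kf (Kcst t)); [left|right|right];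
  apply: ev_mp h _ => w; rewrite ?subr_lt0//.
  by move/eqP; rewrite subr_eq0 => /eqP ->.
by rewrite subr_gt0 => /ltW.
Qed.

Lemma Kle f g : K f -> K g -> ev (fun w => f w <= g w) \/ ev (fun w => g w < f w).
Proof.
move=> Kf Kg; have [h|h] := Kdcd (KB Kg Kf) 0; [right|left]; apply: ev_mp h _ => w.
  by rewrite subr_lt0.
by rewrite subr_ge0.
Qed.

Lemma Keq0 f : K f -> ev (fun w => f w = 0) \/ ev (fun w => f w != 0).
Proof.
move=> Kf; have [h|h|h] := af_dec KA Kf; [right|left|right]; apply: ev_mp h _ => w //.
  by rewrite lt_neqAle => /andP[].
by rewrite lt_neqAle eq_sym => /andP[].
Qed.

Lemma Kst f : K f -> (exists l, to0 (fun w => f w - l)) \/ to0 (fun w => (f w)^-1).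
Proof.
move=> Kf; have [[C fC]|h] := dcd_bnd FG (Kdcd Kf); last by right.
left; have := st_lim FG (Kdcd Kf) fC; exact.
Qed.

Lemma kmax S (s0 : S) (b : S -> Om -> R) : (forall s, K (b s)) ->
  exists s1, forall s, ev (fun w => b s w <= b s1 w).
Proof.
move=> Kb.
suff [s1 h] : exists s1, forall s, s \in s0 :: enum S -> ev (fun w => b s w <= b s1 w).
  by exists s1 => s; apply: h; rewrite in_cons mem_enum orbT.
elim: (enum S) => [|s l [s1 IH]].
  by exists s0 => s; rewrite inE => /eqP ->; exact: ev_true.
have [h|h] := Kle (Kb s) (Kb s1).
  exists s1 => s'; rewrite !in_cons => /or3P[/eqP ->|/eqP ->|s'l] //; apply: IH.
    by rewrite in_cons eqxx.
  by rewrite in_cons s'l orbT.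
have h' : ev (fun w => b s1 w <= b s w) by apply: ev_mp h _ => w /ltW.
exists s => s'; rewrite !in_cons => /or3P[/eqP ->|/eqP ->|s'l].
- by apply: ev_mp2 (IH s0 (mem_head _ _)) h' _ => w; exact: le_trans.
- exact: ev_true.
- by apply: ev_mp2 (IH s' _) h' _ => [|w]; [rewrite in_cons s'l orbT|exact: le_trans].
Qed.

Lemma rootK (a : R) n : (`|a| `^ (n.+1%:R)^-1) ^+ n.+1 = `|a|.
Proof. by rewrite -powR_mulrn ?powR_ge0// -powRrM mulVf ?powRr1// pnatr_eq0. Qed.

Lemma to0_root f n : to0 f -> to0 (fun w => `|f w| `^ (n.+1%:R)^-1).
Proof.
move=> f0 e e0; apply: ev_mp (f0 _ (exprn_gt0 n.+1 e0)) _ => w h.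
rewrite ger0_norm ?powR_ge0// -(ler_pXn2r (ltn0Sn n)) ?nnegrE ?powR_ge0 ?(ltW e0)//.
by rewrite rootK.
Qed.

(** The vanishing case of the key property is included with the factor 0, and the data are packed
    into one sigma type, so that [choice] can treat the coefficients of all indices uniformly. *)
Lemma Kfactor (A : Type) T (F : A -> (T -> R) -> R) (c : T -> Om -> R) : fam F ->
  (forall t, K (c t) /\ to0 (c t)) ->
  exists p : {S : finType & ((Om -> R) * (S -> Om -> R) * (A -> (S -> R) -> R))%type},
  [/\ K (tagged p).1.1, forall s, K ((tagged p).1.2 s) /\ to0 ((tagged p).1.2 s),
    fam (tagged p).2,
    ev (fun w => forall a, F a (fun t => c t w) =
        (tagged p).1.1 w * (tagged p).2 a (fun s => (tagged p).1.2 s w)) &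
    ev (fun w => (tagged p).1.1 w = 0) \/
    ev (fun w => (tagged p).1.1 w != 0) /\ exists a, (tagged p).2 a (fun=> 0) != 0].
Proof.
move=> hF hc; have [h|[m [S [e [W [Km Ke Wf W0 h]]]]]] := af_key KA hF hc.
  exists (existT _ (void : finType) (fun=> 0, fun=> fun=> 0, fun=> fun=> 0)); split => //=.
  - exact: Kcst.
  - exact: famc.
  - by apply: ev_mp h _ => w h a; rewrite h mul0r.
  - by left; exact: ev_true.
exists (existT _ S (m, e, W)); split => //=; first by apply: ev_mp h _ => w [].
by right; split=> //; apply: ev_mp h _ => w [].
Qed.

End FieldTools.

(** * Immediate extensions: lowering the order of a family in the new variable *)

Section Immediate.
Variables (R : realType) (Om : Type) (G : set_system Om).
Hypothesis FG : ProperFilter G.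
Variable K : set (Om -> R).
Hypothesis KA : anfield G K.
Local Notation ev := (ev G).
Local Notation to0 := (to0 G).
Implicit Types (f g c z : Om -> R) (T S : finType).
Variable y : Om -> R.
Hypothesis imm : forall th, K th -> exists b, [/\ K b, ev (fun w => b w != 0) &
  exists2 l, l != 0 & to0 (fun w => (y w - th w) / b w - l)].

(** Affine forms in [y] over [K]; this set is stable under recentring by elements of [K] and under
    rescaling. *)
Definition Zset z := exists th b, [/\ K th, K b, ev (fun w => b w != 0) &
  ev (fun w => z w = (y w - th w) / b w)].
Definition Kne m := K m /\ ev (fun w => m w != 0).
Definition KZset e := K e \/ Zset e.

Lemma coefXDn (c : R) n k : (('X + c%:P) ^+ n)`_k = 'C(n, k)%:R * c ^+ (n - k).
Proof.
rewrite exprDn coef_sum.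
have [kn|nk] := leqP k n.
  have kn' : (n - k < n.+1)%N by rewrite ltnS leq_subr.
  rewrite (bigD1 (Ordinal kn'))//= big1 ?addr0 => [|i ik].
    by rewrite coefMn -rmorphXn/= coefMC coefXn subKn// eqxx mul1r bin_sub// mulr_natl.
  rewrite coefMn -rmorphXn/= coefMC coefXn; case: eqP => [kE|_]; last by rewrite mul0r mul0rn.
  by move: ik; rewrite -val_eqE /= kE subKn ?eqxx// -ltnS.
rewrite bin_small// mul0r big1// => i _.
rewrite coefMn -rmorphXn/= coefMC coefXn; case: eqP => [kE|_]; last by rewrite mul0r mul0rn.
by move: nk; rewrite kE ltnNge leq_subr.
Qed.

Section Step.
Variables (d : nat) (A : Type) (T : finType) (H : A * nat -> (T -> R) -> R)
  (c : T -> Om -> R) (z : Om -> R) (a0 : A) (s0 : R).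
Hypothesis IH : forall k, (k < d.+1)%N -> forall (A : Type) T (H : A * nat -> (T -> R) -> R)
  (c : T -> Om -> R) z, fam H -> (forall t, K (c t) /\ to0 (c t)) -> Zset z -> to0 z ->
  (exists a, H (a, k) (fun=> 0) != 0) ->
  (forall a i, (i < k)%N -> H (a, i) (fun=> 0) = 0) ->
  factored G Kne KZset (fun a w => gser (fun k => H (a, k)) (ext (fun t => c t w) (z w))).
Hypotheses (Hf : fam H) (Kc : forall t, K (c t) /\ to0 (c t)) (Zz : Zset z) (z0 : to0 z).
Hypotheses (Hd : H (a0, d.+1) (fun=> 0) != 0)
  (Hlt : forall a i, (i < d.+1)%N -> H (a, i) (fun=> 0) = 0).
Hypotheses (s0_gt0 : 0 < s0) (Hkill : forall x, small s0 x -> H (a0, d) x = 0).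

(** A step in the manner of the Newton polygon. The coefficients of degree at most [d] are
    infinitesimal; [al i] is the common factor of those of degree [i], and [s] is the largest of the
    roots of [|al i|] of order [d + 1 - i]. If [z] is much larger than [s], the term of degree
    [d.+1] dominates and gives a unit after division. Otherwise [z = s * (nu + z2)] with [z2]
    infinitesimal, and division by [s ^+ d.+1] leaves a family of smaller order in [z2], to which
    [IH] applies. *)
Lemma key_step :
  factored G Kne KZset (fun a w => gser (fun k => H (a, k)) (ext (fun t => c t w) (z w))).
Proof.
have /choice[p hp] := fun i : 'I_d.+1 => Kfactor FG KA (fam_idx (fun a => (a, i : nat)) Hf) Kc.
pose al i := (tagged (p i)).1.1; pose ci i := (tagged (p i)).1.2.
pose W i := (tagged (p i)).2.
have Kal i : K (al i) by have [] := hp i.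
have Kci i t : K (ci i t) /\ to0 (ci i t) by have [_ h _ _ _] := hp i; exact: h.
have Wf i : fam (W i) by have [] := hp i.
have HE (i : 'I_d.+1) : ev (fun w => forall a, H (a, i : nat) (fun t => c t w) =
    al i w * W i a (fun t => ci i t w)) by have [] := hp i.
have al_or (i : 'I_d.+1) : ev (fun w => al i w = 0) \/
    ev (fun w => al i w != 0) /\ exists a, W i a (fun=> 0) != 0 by have [] := hp i.
have al0 i : to0 (al i).
  have [h|[h [a Wa]]] := al_or i; first by apply: to0_eq (to0_0 FG); apply: ev_mp h _ => w ->.
  have := ang_to0 FG (fam_ang (a, i : nat) Hf) (fun t => (Kc t).2).
  rewrite Hlt// => H0.
  have hW := to0_lim_ne FG (ang_to0 FG (fam_ang a (Wf i)) (fun t => (Kci i t).2)) Wa.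
  apply: (to0_le FG (C := (`|W i a (fun=> 0)| / 2)^-1)) H0.
    by rewrite invr_gt0 divr_gt0// normr_gt0.
  apply: ev_mp2 (HE i) hW _ => w h1 [h2 _]; rewrite subr0 h1 normrM mulrC -ler_pdivrMr.
    by rewrite invrK ler_wpM2l.
  by rewrite invr_gt0 divr_gt0// normr_gt0.
(* [(n i).+1] is [d + 1 - i], the amount by which [i] falls short of [d.+1]: with these weights all
   terms have the same degree in [s] and [z] together. *)
pose n (i : 'I_d.+1) := (d - i)%N.
pose be i w := `|al i w| `^ ((n i).+1%:R)^-1.
have Kbe i : K (be i) by exact: (af_root KA).
have [i0 hi0] := kmax FG KA ord0 Kbe.
pose s := be i0.
have s_ge0 w : 0 <= s w by exact: powR_ge0.
have s0' : to0 s by exact: to0_root.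
pose q i w := al i w / s w ^+ (n i).+1.
have Kq i : K (q i) by exact: (KM KA (Kal i) (KV KA (KX KA _ (Kbe i0)))).
have alE i : ev (fun w => al i w = q i w * s w ^+ (n i).+1 /\ `|q i w| <= 1).
  apply: ev_mp (hi0 i) _ => w h.
  have h2 : `|al i w| <= s w ^+ (n i).+1.
    by rewrite -(rootK (al i w) (n i)) lerXn2r// nnegrE ?powR_ge0.
  have [sw|sw] := eqVneq (s w) 0.
    move: h2; rewrite /q sw exprS mul0r normr_le0 => /eqP ->.
    by rewrite !mul0r normr0 ler01.
  rewrite /q divfK ?expf_neq0//; split=> //.
  by rewrite normrM normfV ler_pdivrMr ?normr_gt0 ?expf_neq0// mul1r (ger0_norm (exprn_ge0 _ (s_ge0 w))).
have /choice[la hla] i : exists l, to0 (fun w => q i w - l).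
  by apply: (st_lim FG (Kdcd FG KA (Kq i)) (C := 1)); apply: ev_mp (alE i) _ => w [].
pose ep i w := q i w - la i.
have Kep i : K (ep i) /\ to0 (ep i) by split; [apply: (KB KA) => //; exact: (Kcst KA)|exact: hla].
(* By [imm], [z] is an element [tau] of [K] times a factor [u] with nonzero limit [l], so the size
   of [z] can be compared with that of [s] inside [K]. *)
have [th [b [Kth Kb b0 zE]]] := Zz.
have [b' [Kb' b'0 [l ln0 hl]]] := imm Kth.
pose u w := (y w - th w) / b' w; pose z' w := u w - l; pose tau w := b' w / b w.
have Ktau : K tau by apply: (KM KA) => //; exact: (KV KA).
have tau_ne0 : ev (fun w => tau w != 0).
  by apply: ev_mp2 b0 b'0 _ => w h1 h2; rewrite mulf_neq0// invr_eq0.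
have ztau : ev (fun w => z w = tau w * u w).
  apply: ev_mp2 zE (ev_and FG b0 b'0) _ => w -> [h1 h2].
  by rewrite /tau /u; field; rewrite ?h1 ?h2.
have z'0 : to0 z' by exact: hl.
have Zz' : Zset z'.
  exists (fun w => th w + l * b' w), b'; split=> //.
    by apply: (KD KA) => //; exact: (KZ KA).
  by apply: ev_mp b'0 _ => w h; rewrite /z' /u; field.
have tau0 : to0 tau.
  apply: (to0_le FG (C := (`|l| / 2)^-1)) z0; first by rewrite invr_gt0 divr_gt0// normr_gt0.
  apply: ev_mp2 ztau (to0_lim_ne FG hl ln0) _ => w -> [h2 _].
  by rewrite [X in _ <= X]mulrC ler_pdivlMr ?divr_gt0 ?normr_gt0// [X in _ <= X]normrM ler_wpM2l.
pose U (a : A) := gser (fun k => H (a, (d.+1 + k)%N)).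
have Uf : fam U by exact: (fam_uncurry (fam_idx (fun ak => (ak.1, (d.+1 + ak.2)%N)) Hf)).
have [sb [C [sb0 HC]]] := fam_bounded Hf.
have split_ev : ev (fun w => forall a, gser (fun k => H (a, k)) (ext (fun t => c t w) (z w)) =
   \sum_(i < d.+1) al i w * W i a (fun t => ci i t w) * z w ^+ i +
   z w ^+ d.+1 * U a (ext (fun t => c t w) (z w))).
  have h2 : 0 < 2^-1 :> R by rewrite invr_gt0.
  have hs := ev_and FG (small_ev FG sb0 (fun t => (Kc t).2)) (z0 h2).
  apply: ev_mp2 (ev_all FG HE) hs _ => w hE [cs zs] a.
  rewrite (gser_split (C := C) d.+1)//; last by move=> k; exact: HC.
  by congr (_ + _); apply: eq_bigr => i _; rewrite hE.
have U0 : U a0 (fun=> 0) != 0 by rewrite -ext00 /U gser0 addn0.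
pose TT := (T + {i : 'I_d.+1 & tag (p i)} + 'I_d.+1)%type.
pose cc : TT -> Om -> R := fun t => match t with
  | inl (inl t) => c t | inl (inr t) => ci (tag t) (tagged t) | inr i => ep i end.
have Kcc t : K (cc t) /\ to0 (cc t).
  by case: t => [[t|[i t]]|i] /=; [exact: Kc|exact: Kci|exact: Kep].
have sumf (S : finType) (i1 : TT -> S) (s1 : S -> R -> R) (X Y : (S -> R) -> R) : ang X -> ang Y ->
  fam (fun a (x : S -> R) => \sum_(i < d.+1) (la i + x (i1 (inr i))) * X x ^+ (n i).+1 *
     Y x ^+ i * W i a (fun t => x (i1 (inl (inr (Tagged (fun i => tag (p i)) t)))))).
  move=> Xa Ya; apply: fam_sum => i; apply: famM; last exact: fam_rename.
  apply: famM; last exact/famX/fam_ang_cst.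
  apply: famM; last exact/famX/fam_ang_cst.
  by apply: famD; [exact: famc|exact: fam_var].
(* the leading term of order [d.+1] dominates *)
have caseA : to0 (fun w => s w / tau w) ->
  factored G Kne KZset (fun a w => gser (fun k => H (a, k)) (ext (fun t => c t w) (z w))).
  move=> sig0; pose sig w := s w / tau w.
  pose S := option (option (option TT)).
  pose e : S -> Om -> R := fun o => match o with
    | Some (Some (Some t)) => cc t | Some (Some None) => sig | Some None => z' | None => z end.
  pose i1 (t : TT) : S := Some (Some (Some t)).
  pose F a (x : S -> R) := \sum_(i < d.+1) (la i + x (i1 (inr i))) * x (Some (Some None)) ^+ (n i).+1 *
     (l + x (Some None)) ^+ i * W i a (fun t => x (i1 (inl (inr (Tagged (fun i => tag (p i)) t))))) +
     (l + x (Some None)) ^+ d.+1 * U a (ext (fun t => x (i1 (inl (inl t)))) (x None)).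
  right; exists (fun w => tau w ^+ d.+1), S, e, F; split.
  - split; first exact: (KX KA).
    by apply: ev_mp tau_ne0 _ => w h; rewrite expf_neq0.
  - case=> [[[t|]|]|] /=.
    + by have [h1 h2] := Kcc t; split=> //; left.
    + by split=> //; left; apply: (KM KA); [exact: Kbe|exact: (KV KA)].
    + by split=> //; right.
    + by split=> //; right.
  - apply: famD.
      apply: (sumf S i1 (fun _ => id) (fun x => x (Some (Some None))) (fun x => l + x (Some None))).
        exact: ang_var.
      by apply: angD; [exact: ang_cst|exact: ang_var].
    apply: famM; first by apply: famX; apply: famD; [exact: famc|exact: fam_var].
    have := @fam_comp _ _ _ S _ (fun o x => ext (fun t => x (i1 (inl (inl t)))) (x None) o) Uf.
    by apply; [case=> [t|] /=; exact: ang_var|case].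
  - exists a0; rewrite /F big1 ?add0r => [|i _]; last by rewrite exprS mul0r mulr0 !mul0r.
    by rewrite addr0 ext00 mulf_neq0// expf_neq0.
  - apply: ev_mp2 split_ev (ev_and FG (ev_and FG tau_ne0 ztau) (ev_all FG alE)) _.
    move=> w sE [[tn0 zw] aE]; split=> [|a]; first by rewrite expf_neq0.
    rewrite sE /F (mulrDr (tau w ^+ d.+1)) mulr_sumr; congr (_ + _).
      apply: eq_bigr => i _; rewrite (aE i).1 zw /e /= /ep /z' /sig.
      rewrite (_ : tau w ^+ d.+1 = tau w ^+ (n i).+1 * tau w ^+ i); last first.
        by rewrite -exprD addSn subnK// -ltnS.
      rewrite addrC subrK (addrC l) subrK (expr_div_n (s w)) exprMn.
      by field; rewrite expf_neq0.
    rewrite /e /= /z' (addrC l) subrK {1}zw exprMn mulrA; congr (_ * _).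
have [s_eq0|s_ne0] := Keq0 FG KA (Kbe i0).
  apply: caseA; apply: to0_eq (to0_0 FG); apply: ev_mp s_eq0 _ => w h.
  by rewrite /s h mul0r.
pose rho w := tau w / s w.
have Krho : K rho by apply: (KM KA) => //; exact: (KV KA (Kbe i0)).
(* Either [s / tau] is infinitesimal, the case settled by [caseA], or [z / s] has the finite limit
   [nu = ka * l]. *)
have [[ka hka]|h] := Kst FG KA Krho; last first.
  by apply: caseA; apply: to0_eq h; apply: ev_true => w; rewrite invf_div.
pose nu := ka * l; pose z2 w := z w / s w - nu.
have z20 : to0 z2.
  apply: (@to0_eq _ _ _ FG (fun w => rho w * (u w - l) + l * (rho w - ka))).
    by apply: ev_mp ztau _ => w zw; rewrite /z2 zw /nu /rho; ring.
  apply: (to0D FG); last exact: to0Z.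
  exact: (to0M FG (to0_bnd FG hka)).
have Zz2 : Zset z2.
  exists (fun w => th w + nu * (b w * s w)), (fun w => b w * s w); split.
  - by apply: (KD KA) => //; apply: (KZ KA); exact: (KM KA Kb (Kbe i0)).
  - exact: (KM KA Kb (Kbe i0)).
  - by apply: ev_mp2 b0 s_ne0 _ => w h1 h2; rewrite mulf_neq0.
  - apply: ev_mp2 zE (ev_and FG b0 s_ne0) _ => w h [h1 h2].
    by rewrite /z2 h; field; rewrite ?h1 ?h2.
pose TS := option TT; pose cs : TS -> Om -> R := fun o => if o is Some t then cc t else s.
have Kcs t : K (cs t) /\ to0 (cs t) by case: t => [t|] /=; [exact: Kcc|exact: (conj (Kbe i0) s0')].
pose i2 (t : TT) : option TS := Some (Some t).
pose F a (x : option TS -> R) := \sum_(i < d.+1) (la i + x (i2 (inr i))) * 1 ^+ (n i).+1 *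
     (nu + x None) ^+ i * W i a (fun t => x (i2 (inl (inr (Tagged (fun i => tag (p i)) t))))) +
     (nu + x None) ^+ d.+1 * U a (ext (fun t => x (i2 (inl (inl t)))) (x (Some None) * (nu + x None))).
have Ff : fam F.
  apply: famD.
    apply: (sumf _ i2 (fun _ => id) (fun=> 1) (fun x => nu + x None)); first exact: ang_cst.
    by apply: angD; [exact: ang_cst|exact: ang_var].
  apply: famM; first by apply: famX; apply: famD; [exact: famc|exact: fam_var].
  have := @fam_comp _ _ _ (option TS) _ (fun o x => ext (fun t => x (i2 (inl (inl t))))
    (x (Some None) * (nu + x None)) o) Uf.
  apply; last by case=> //=; rewrite mul0r.
  case=> [t|] /=; first exact: ang_var.
  by apply: angM; [exact: ang_var|apply: angD; [exact: ang_cst|exact: ang_var]].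
have FE : ev (fun w => forall a, gser (fun k => H (a, k)) (ext (fun t => c t w) (z w)) =
    s w ^+ d.+1 * F a (ext (fun t => cs t w) (z2 w))).
  apply: ev_mp2 split_ev (ev_and FG s_ne0 (ev_all FG alE)) _ => w sE [sn0 aE] a.
  have zw : z w = s w * (nu + z2 w) by rewrite /z2 addrC subrK mulrC divfK.
  rewrite sE /F (mulrDr (s w ^+ d.+1)) mulr_sumr; congr (_ + _).
    apply: eq_bigr => i _; rewrite (aE i).1 {1}zw /= /ep.
    rewrite (_ : s w ^+ d.+1 = s w ^+ (n i).+1 * s w ^+ i); last first.
      by rewrite -exprD addSn subnK// -ltnS.
    by rewrite addrC subrK expr1n exprMn; ring.
  by rewrite /= -zw {1}zw exprMn mulrA.
have [r0 [H2 [r00 H2f H2E]]] := fam_curry Ff.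
have z2r0 : to0 (fun w => z2 w / r0).
  by apply: to0_eq (to0Z FG r0^-1 z20); apply: ev_true => w; rewrite mulrC.
have Zz2r : Zset (fun w => z2 w / r0).
  have [t2 [b2 [Kt2 Kb2 b20 z2E]]] := Zz2; exists t2, (fun w => b2 w * r0); split=> //.
  - by apply: (KM KA) => //; exact: (Kcst KA).
  - by apply: ev_mp b20 _ => w h; rewrite mulf_neq0// gt_eqF.
  - by apply: ev_mp z2E _ => w ->; rewrite invfM mulrA.
(* the order in [z] drops, since a full [d.+1]-st power would have a nonzero
   coefficient of index [d] unless centred at [0] *)
have [k0 [kd [a1 Ha1]]] : exists k, (k < d.+1)%N /\ exists a, H2 (a, k) (fun=> 0) != 0.
  apply/not_existsP => nH.
  have H20 a k : (k < d.+1)%N -> H2 (a, k) (fun=> 0) = 0.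
    move=> kd; apply/eqP/negP => /negP h; apply: (nH k); split=> //; by exists a.
  have [sb2 [C2 [sb20 H2C]]] := fam_bounded H2f.
  (* The reduction of [F a] modulo the infinitesimals of [K]. Under the hypothesis to be refuted,
     its coefficients of index below [d.+1] vanish, so it is a multiple of the monomial of degree
     [d.+1]. *)
  pose P a : {poly R} := \sum_(i < d.+1) (la i * W i a (fun=> 0)) *: ('X + nu%:P) ^+ i +
     U a (fun=> 0) *: ('X + nu%:P) ^+ d.+1.
  have PE a t : (P a).[t] = F a (ext (fun=> 0) t).
    rewrite /P /F hornerD horner_sum hornerZ; congr (_ + _).
      apply: eq_bigr => i _; by rewrite !(hornerE, horner_exp) /= expr1n [t + nu]addrC; ring.
    by rewrite !(hornerE, horner_exp) /= ?mul0r ext00 [t + nu]addrC mulrC.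
  have P0 a k : (k < d.+1)%N -> (P a)`_k = 0.
    apply: (@poly_small _ _ _ (2 * C2 / r0 ^+ d.+1) (r0 / 2)) => [|t _ tr]; first by rewrite divr_gt0.
    have tr0 : `|t| <= r0 by apply: le_trans tr _; rewrite ler_pdivrMr// ler_pMr// ler1n.
    have tr1 : `|t / r0| <= 2^-1.
      by rewrite normrM normfV (gtr0_norm r00) ler_pdivrMr// mulrC.
    rewrite PE H2E//; last exact: small0.
    have H2C' i : `|H2 (a, i) (fun=> 0)| <= C2 by apply: H2C; exact: small0.
    rewrite (gser_split (C := C2) d.+1)// big1 ?add0r => [|i _]; last by rewrite H20 ?mul0r.
    rewrite normrM normrX [`|t / r0|]normrM normfV (gtr0_norm r00) exprMn exprVn.
    have hb := usum_norm (gser_bounded (h := fun k => H2 (a, (d.+1 + k)%N)) (fun k => H2C' _) tr1).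
    rewrite [X in _ <= X](_ : _ = `|t| ^+ d.+1 / r0 ^+ d.+1 * (2 * C2)); last by ring.
    by apply: ler_wpM2l => //; rewrite mulr_ge0 ?invr_ge0 ?exprn_ge0// ltW.
  have coefP a k : (P a)`_k = \sum_(i < d.+1) la i * W i a (fun=> 0) * ('C(i, k)%:R * nu ^+ (i - k)) +
      U a (fun=> 0) * ('C(d.+1, k)%:R * nu ^+ (d.+1 - k)).
    rewrite coefD coef_sum coefZ coefXDn; congr (_ + _).
    by apply: eq_bigr => i _; rewrite coefZ coefXDn.
  (* For the member [a0] the coefficient of degree [d] was killed by the recentring, so nothing of
     it is left in the limit. *)
  have od : la ord_max * W ord_max a0 (fun=> 0) = 0.
    have Hk : ev (fun w => H (a0, d) (fun t => c t w) = 0).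
      by apply: ev_mp (small_ev FG s0_gt0 (fun t => (Kc t).2)) _ => w; exact: Hkill.
    have [h|[h _]] := al_or ord_max.
      rewrite (_ : la ord_max = 0) ?mul0r//.
      apply: (to0_uniq FG (hla ord_max)); apply: to0_eq (to0_0 FG).
      by apply: ev_mp h _ => w hw; rewrite /q hw mul0r subr0.
    rewrite [X in _ * X](_ : _ = 0) ?mulr0//.
    apply: (to0_uniq FG (f := fun w => W ord_max a0 (fun t => ci ord_max t w))).
      exact: (ang_to0 FG (fam_ang a0 (Wf ord_max)) (fun t => (Kci ord_max t).2)).
    apply: to0_eq (to0_0 FG).
    apply: ev_mp2 (HE ord_max) (ev_and FG h Hk) _ => w /(_ a0) -> [h1 /eqP].
    by rewrite mulf_eq0 (negPf h1) => /eqP ->; rewrite subr0.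
  have nu0 : nu = 0.
    have := P0 a0 d (ltnSn d); rewrite coefP big1 ?add0r => [|i _]; last first.
      have [id|di] := ltnP i d; first by rewrite bin_small// mul0r mulr0.
      rewrite (_ : i = ord_max) ?od ?mul0r//; apply/val_inj/eqP.
      by rewrite eqn_leq di -ltnS ltn_ord.
    move=> /eqP; rewrite subSn// subnn expr1 binSn !mulf_eq0 (negPf U0) pnatr_eq0 /=.
    by move=> /orP[/eqP h|/eqP h]; rewrite /nu h ?mul0r ?mulr0.
  have la0 i a : la i * W i a (fun=> 0) = 0.
    have := P0 a i (ltn_ord i); rewrite coefP (bigD1 i)//= binn subnn expr0 !mulr1.
    rewrite big1 ?addr0 => [|j ji].
      by rewrite nu0 subSn ?(ltnW (ltn_ord i))// ?exprS ?mul0r ?mulr0 ?addr0// -ltnS.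
    have [ji'|ij] := ltnP j i; first by rewrite bin_small// mul0r mulr0.
    have {}ij : (i < j)%N.
      by rewrite ltn_neqAle ij andbT; apply: contraNneq ji => /val_inj ->.
    by rewrite nu0 -[(j - i)%N]prednK ?subn_gt0// exprS mul0r !mulr0.
  (* At the index [i0] attaining the maximum, [|q i0| = 1], so its limit [la i0] cannot vanish. *)
  have [h|[h [a Wa]]] := al_or i0.
    apply: (ev_absurd FG h s_ne0) => w hw /negP; apply.
    by rewrite /be hw normr0 powR0// invr_neq0// pnatr_eq0.
  have lai0 : la i0 = 0.
    by apply/eqP; have /eqP := la0 i0 a; rewrite mulf_eq0 (negPf Wa) orbF.
  apply: (to0_ge FG ltr01 (f := q i0)); last first.
    by apply: to0_eq (hla i0); apply: ev_true => w; rewrite lai0 subr0.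
  apply: ev_mp s_ne0 _ => w sn0.
  rewrite /q normrM normfV normrX (ger0_norm (s_ge0 w)) /s /be rootK divff//.
  by apply: contra sn0 => /eqP h0; rewrite /be h0 powR0// invr_neq0// pnatr_eq0.
pose Q k := `[< exists a, H2 (a, k) (fun=> 0) != 0 >].
have exQ : exists k, Q k by exists k0; apply/asboolP; exists a1.
have [k /asboolP Qk kmin] := ex_minnP exQ.
have kd' : (k < d.+1)%N by apply: leq_ltn_trans kd; apply: kmin; apply/asboolP; exists a1.
have Qlt a i : (i < k)%N -> H2 (a, i) (fun=> 0) = 0.
  move=> ik; apply/eqP/negP => /negP h; move: ik; rewrite ltnNge => /negP; apply.
  by apply: kmin; apply/asboolP; exists a.
have ext_ev : ev (fun w => forall a, gser (fun k => H2 (a, k)) (ext (fun t => cs t w) (z2 w / r0)) =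
    F a (ext (fun t => cs t w) (z2 w))).
  apply: ev_mp2 (small_ev FG r00 (fun t => (Kcs t).2)) (z20 _ r00) _ => w h1 h2 a.
  by rewrite H2E.
have [h0|[m [T' [e [W' [[Km m0] Ee W'f W'0 h]]]]]] := IH kd' H2f Kcs Zz2r z2r0 Qk Qlt.
  left; apply: ev_mp2 FE (ev_and FG h0 ext_ev) _ => w h1 [h2 h3] a.
  by rewrite h1 -h3 h2 mulr0.
right; exists (fun w => s w ^+ d.+1 * m w), T', e, W'; split=> //.
  split; first by apply: (KM KA) => //; exact: (KX KA _ (Kbe i0)).
  by apply: ev_mp2 m0 s_ne0 _ => w h1 h2; rewrite mulf_neq0// expf_neq0.
apply: ev_mp2 FE (ev_and FG (ev_and FG h s_ne0) ext_ev) _ => w h1 [[[h2 h2'] h3] h4].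
by split=> [|a]; [rewrite mulf_neq0// expf_neq0|rewrite h1 -h4 h2' mulrA].
Qed.

End Step.

End Immediate.

Section ImmediateExtension.
Variables (R : realType) (Om : Type) (G : set_system Om).
Hypothesis FG : ProperFilter G.
Variable K : set (Om -> R).
Hypothesis KA : anfield G K.
Local Notation ev := (ev G).
Local Notation to0 := (to0 G).
Implicit Types (f g c z : Om -> R) (T S : finType).
Variable y : Om -> R.
Hypothesis imm : forall th, K th -> exists b, [/\ K b, ev (fun w => b w != 0) &
  exists2 l, l != 0 & to0 (fun w => (y w - th w) / b w - l)].
Local Notation Zset := (Zset G K y).
Local Notation Kne := (Kne G K).
Local Notation KZset := (KZset G K y).

(** Strong induction on [d], the least degree in [z] with a coefficient that does not vanish at the
    origin. Order 0 already gives a unit; otherwise [tschirnhaus] puts the family into the shape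
    required by [key_step]. *)
Lemma key_imm d (A : Type) T (H : A * nat -> (T -> R) -> R) (c : T -> Om -> R) z :
  fam H -> (forall t, K (c t) /\ to0 (c t)) -> Zset z -> to0 z ->
  (exists a, H (a, d) (fun=> 0) != 0) ->
  (forall a i, (i < d)%N -> H (a, i) (fun=> 0) = 0) ->
  factored G Kne KZset (fun a w => gser (fun k => H (a, k)) (ext (fun t => c t w) (z w))).
Proof.
elim/ltn_ind: d A T H c z => -[|d] IH A T H c z Hf Kc Zz z0 [a0 Ha0] Hlt.
  right; exists (fun=> 1), (option T), (fun o => if o is Some t then c t else z),
    (fun a => gser (fun k => H (a, k))); split.
  - by split; [exact: (Kcst KA)|apply: ev_true => w; exact: oner_neq0].
  - case=> [t|]; last by split=> //; right.
    by have [h1 h2] := Kc t; split=> //; left.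
  - exact: fam_uncurry.
  - by exists a0; rewrite -ext00 gser0.
  - apply: ev_true => w; split=> [|a]; first exact: oner_neq0.
    by rewrite mul1r; congr gser; apply/funext => -[].
have [s [zeta [H' [s0 za z00 H'f [H'0 kill HE]]]]] :=
  tschirnhaus Hf (Hlt a0 d (ltnSn d)) Ha0.
pose zc w := zeta (fun t => c t w).
have Kzc : K zc := af_an KA za Kc.
have zc0 : to0 zc.
  by have := ang_to0 FG za (fun t => (Kc t).2); apply: to0_eq; apply: ev_true => w; rewrite z00 subr0.
pose z1 w := 4 * (z w - zc w).
have z10 : to0 z1 by apply: to0Z; exact: to0B.
have Zz1 : Zset z1.
  have [th [b [Kth Kb b0 zE]]] := Zz.
  exists (fun w => th w + b w * zc w), (fun w => 4^-1 * b w); split.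
  - by apply: (KD KA) => //; exact: (KM KA).
  - exact: (KZ KA).
  - by apply: ev_mp b0 _ => w h; rewrite mulf_neq0// invr_eq0.
  - by apply: ev_mp2 zE b0 _ => w h1 h2; rewrite /z1 h1; field.
have hlt a i : (i < d.+1)%N -> H' (a, i) (fun=> 0) = 0.
  by move=> id; rewrite H'0 Hlt// mulr0.
have hne : H' (a0, d.+1) (fun=> 0) != 0 by rewrite H'0 mulf_neq0// expf_neq0.
apply: factored_eq (key_step FG KA imm IH H'f Kc Zz1 z10 hne hlt s0 kill).
by apply: ev_mp2 (small_ev FG s0 (fun t => (Kc t).2)) (z0 _ s0) _ => w cs zs a; rewrite HE.
Qed.

(** All forms [(y - th) / b] are expressed by the one with the smallest [|b|]: each is that one
    times the bounded quotient [bo / b], which has a limit, plus an element of [K]. The extra index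
    [None] guarantees that at least one form involving [y] is present. *)
Lemma merge_imm T (e : T -> Om -> R) : (forall t, KZset (e t) /\ to0 (e t)) ->
  exists z (la : T -> R) (ep de : T -> Om -> R), [/\ Zset z, to0 z,
   forall t, K (ep t) /\ to0 (ep t), forall t, K (de t) /\ to0 (de t) &
   forall t, ev (fun w => e t w = (la t + ep t w) * z w + de t w)].
Proof.
move=> he; have [b0 [Kb0 b00 [l ln0 hl]]] := imm (Kcst KA 0).
pose e1 o : Om -> R := if o is Some t then e t else fun w => (y w - 0) / b0 w - l.
have he1 o : KZset (e1 o) /\ to0 (e1 o).
  case: o => [t|] //=; split=> //; right; exists (fun w => l * b0 w), b0; split=> //.
    exact: (KZ KA).
  by apply: ev_mp b00 _ => w h; rewrite subr0; field.
have /choice[p hp] o : exists p : bool * (Om -> R) * (Om -> R),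
    if p.1.1 then [/\ K p.1.2, K p.2, ev (fun w => p.2 w != 0) &
       ev (fun w => e1 o w = (y w - p.1.2 w) / p.2 w)] else K (e1 o) /\ o != None.
  have [Ko|nKo] := pselect (K (e1 o) /\ o != None).
    by exists (false, fun=> 0, fun=> 0).
  have [[Ke|[th [b [? ? ? ?]]]] _] := he1 o; last by exists (true, th, b).
  case: o nKo Ke => [t|] nKo Ke; first by exfalso; apply: nKo.
  exists (true, fun w => l * b0 w, b0); split=> //; first exact: (KZ KA).
  by apply: ev_mp b00 _ => w h /=; rewrite subr0; field.
have pN : (p None).1.1 by have := hp None; case: (p None).1.1 => // -[].
pose bb o w := if (p o).1.1 then `|(p o).2 w|^-1 else 0.
have Kbb o : K (bb o).
  rewrite /bb; case: ifP (hp o) => _ h; last exact: (Kcst KA).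
  by have [_ Kp _ _] := h; apply: (KV KA); exact: (Knorm KA).
have [om hom] := kmax FG KA None Kbb.
have pom : (p om).1.1.
  apply/negPn/negP => np; have := hp None; rewrite pN => -[_ _ h _].
  apply: (ev_absurd FG h (hom None)) => w hw; rewrite /bb pN (negPf np).
  by rewrite invr_le0 normr_le0 (negPf hw).
have := hp om; rewrite pom => -[Kth0 Kbo bo0 zE].
set th0 := (p om).1.2 in Kth0 zE; set bo := (p om).2 in Kbo bo0 zE.
pose z := e1 om.
pose rho t w := if (p (Some t)).1.1 then bo w / (p (Some t)).2 w else 0.
pose de t w := if (p (Some t)).1.1 then (th0 w - (p (Some t)).1.2 w) / (p (Some t)).2 w else e t w.
have Krho t : K (rho t).
  rewrite /rho; case: ifP (hp (Some t)) => _ h; last exact: (Kcst KA).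
  by have [_ Kp _ _] := h; apply: (KM KA) => //; exact: (KV KA).
have Kde t : K (de t).
  rewrite /de; case: ifP (hp (Some t)) => _ h; last by have [] := h.
  by have [Kt Kp _ _] := h; apply: (KM KA); [exact: (KB KA)|exact: (KV KA)].
have rho1 t : ev (fun w => `|rho t w| <= 1).
  have h := hom (Some t); rewrite /bb pom in h; rewrite /rho.
  case: ifP (hp (Some t)) h => [_ [_ _ pn0 _] h|_ _ _]; last first.
    by apply: ev_true => w; rewrite normr0 ler01.
  apply: ev_mp2 h (ev_and FG bo0 pn0) _ => w h1 [h2 h3].
  rewrite normrM normfV -(divff (_ : `|bo w| != 0)) ?normr_eq0//.
  by rewrite ler_wpM2l.
have /choice[la hla] t : exists l, to0 (fun w => rho t w - l).
  by have := st_lim FG (Kdcd FG KA (Krho t)) (rho1 t).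
have z0 : to0 z by have [] := he1 om.
have eE t : ev (fun w => e t w = rho t w * z w + de t w).
  rewrite /rho /de; case: ifP (hp (Some t)) => [_ [_ _ pn0 h]|_ _]; last first.
    by apply: ev_true => w; rewrite mul0r add0r.
  apply: ev_mp2 (ev_and FG h zE) (ev_and FG pn0 bo0) _ => w [h1 h2] [h3 h4].
  by rewrite /z h2 -[e t w]/(e1 (Some t) w) h1; field; rewrite ?h3 ?h4.
exists z, la, (fun t w => rho t w - la t), de; split=> //.
- by exists th0, bo.
- by move=> t; split; [apply: (KB KA) => //; exact: (Kcst KA)|exact: hla].
- move=> t; split=> //; have [_ et0] := he t.
  apply: (@to0_eq _ _ _ FG (fun w => e t w - rho t w * z w)).
    by apply: ev_mp (eE t) _ => w ->; rewrite addrC addKr.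
  by apply: to0B => //; exact: (to0M FG (rho1 t)).
- by move=> t; apply: ev_mp (eE t) _ => w ->; rewrite (addrC (la t)) subrK.
Qed.

Lemma Zset_scale z r : r != 0 -> Zset z -> Zset (fun w => z w / r).
Proof.
move=> r0 [th [b [Kth Kb b0 zE]]]; exists th, (fun w => b w * r); split=> //.
- by apply: (KM KA) => //; exact: (Kcst KA).
- by apply: ev_mp b0 _ => w h; rewrite mulf_neq0.
- by apply: ev_mp zE _ => w ->; rewrite invfM mulrA.
Qed.

Lemma factored_scale M E (A : Type) (g : A -> Om -> R) m :
  (forall n, M n -> M (fun w => m w * n w)) -> ev (fun w => m w != 0) ->
  factored G M E g -> factored G M E (fun a w => m w * g a w).
Proof.
move=> Mm m0 [h|[n [T [e [W [Mn Ee Wf W0 h]]]]]].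
  by left; apply: ev_mp h _ => w h a; rewrite h mulr0.
right; exists (fun w => m w * n w), T, e, W; split=> //; first exact: Mm.
apply: ev_mp2 h m0 _ => w [n0 h] m0'; split=> [|a]; first by rewrite mulf_neq0.
by rewrite h mulrA.
Qed.

Lemma KneM m n : Kne m -> Kne n -> Kne (fun w => m w * n w).
Proof.
move=> [Km m0] [Kn n0]; split; first exact: (KM KA).
by apply: ev_mp2 m0 n0 _ => w h1 h2; rewrite mulf_neq0.
Qed.

(** The coefficients in [z] of all members form one infinite family over [K], indexed by [A * nat].
    Its key property over [K] supplies a common divisor after which some coefficient is a unit; the
    least degree where this happens starts the induction of [key_imm]. *)
Lemma keyprop_imm : keyprop G Kne KZset.
Proof.
move=> A T F e Ff he; have [z [la [ep [de [Zz z0 Kep Kde eE]]]]] := merge_imm he.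
pose c (t : T + T) : Om -> R := match t with inl t => ep t | inr t => de t end.
have Kc t : K (c t) /\ to0 (c t) by case: t => t /=; [exact: Kep|exact: Kde].
pose F' a (x : option (T + T) -> R) :=
  F a (fun t => (la t + x (Some (inl t))) * x None + x (Some (inr t))).
have F'f : fam F'.
  apply: (fam_comp Ff) => t; last by rewrite mulr0 addr0.
  apply: angD; last exact: ang_var.
  by apply: angM; [apply: angD; [exact: ang_cst|]|]; exact: ang_var.
have [r [H [r0 Hf HE]]] := fam_curry F'f.
have Zzr := Zset_scale (lt0r_neq0 r0) Zz.
have zr0 : to0 (fun w => z w / r).
  by apply: to0_eq (to0Z FG r^-1 z0); apply: ev_true => w; rewrite mulrC.
have FE : ev (fun w => forall a, gser (fun k => H (a, k)) (ext (fun t => c t w) (z w / r)) =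
    F a (fun t => e t w)).
  apply: ev_mp2 (ev_and FG (small_ev FG r0 (fun t => (Kc t).2)) (z0 _ r0)) (ev_all FG eE) _.
  move=> w [h1 h2] h3 a; rewrite -HE//; congr (F a _).
  by apply/funext => t; rewrite /= h3.
apply: factored_eq FE _.
have [h|[m [T' [c' [W [Km Kc' Wf [[a0 k0] W0] h]]]]]] := af_key KA Hf Kc.
  left; apply: ev_mp h _ => w h a.
  rewrite /gser (_ : (fun k => _) = (fun=> 0)) ?usum0//.
  by apply/funext => k; rewrite h mul0r.
have [sb [C [sb0 WC]]] := fam_bounded Wf.
have h2 : 0 < 2^-1 :> R by rewrite invr_gt0.
have gE : ev (fun w => forall a, m w * gser (fun k => W (a, k)) (ext (fun t => c' t w) (z w / r)) =
   gser (fun k => H (a, k)) (ext (fun t => c t w) (z w / r))).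
  apply: ev_mp2 h (ev_and FG (small_ev FG sb0 (fun t => (Kc' t).2)) (zr0 _ h2)) _.
  move=> w [_ hw] [h3 h4] a; rewrite /gser /=.
  have hC k : `|W (a, k) (fun t => c' t w)| <= C by exact: WC.
  rewrite -(usumZ _ (gser_bounded (h := fun k => W (a, k)) hC h4)).
  by congr usum; apply/funext => k; rewrite hw mulrA.
apply: factored_eq gE _.
have m0 : ev (fun w => m w != 0) by apply: ev_mp h _ => w [].
apply: factored_scale => //; first by move=> n; apply: KneM.
pose Q k := `[< exists a, W (a, k) (fun=> 0) != 0 >].
have exQ : exists k, Q k by exists k0; apply/asboolP; exists a0.
have [k /asboolP Qk kmin] := ex_minnP exQ.
apply: (key_imm Wf Kc' Zzr zr0 Qk) => a i ik.
apply/eqP/negP => /negP hn; move: ik; rewrite ltnNge => /negP; apply.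
by apply: kmin; apply/asboolP; exists a.
Qed.

Definition imm_ext := extn G Kne KZset.

Lemma Kne_sgn m : Kne m -> ev (fun w => m w < 0) \/ ev (fun w => 0 < m w).
Proof.
move=> [Km m0]; have [h|h|h] := af_dec KA Km; [by left| |by right].
by exfalso; apply: (ev_absurd FG m0 h) => w /eqP.
Qed.

Lemma imm_ext_anfield : anfield G imm_ext /\ K `<=` imm_ext /\ imm_ext y.
Proof.
have M_cst a : a != 0 -> Kne (fun=> a).
  by move=> a0; split; [exact: (Kcst KA)|exact: ev_true].
have M_inv m : Kne m -> Kne (fun w => (m w)^-1).
  move=> [Km m0]; split; first exact: (KV KA).
  by apply: ev_mp m0 _ => w; rewrite invr_eq0.
have M_root m p : Kne m -> Kne (fun w => `|m w| `^ (p.+1%:R)^-1).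
  move=> [Km m0]; split; first exact: (af_root KA).
  by apply: ev_mp m0 _ => w h; rewrite gt_eqF// powR_gt0// normr_gt0.
have M_lim m : Kne m ->
  [\/ KZset m /\ to0 m,
      exists2 l, l != 0 & KZset (fun w => m w - l) /\ to0 (fun w => m w - l) |
      KZset (fun w => (m w)^-1) /\ to0 (fun w => (m w)^-1)].
  move=> [Km m0]; have [[l hl]|h] := Kst FG KA Km; last first.
    by constructor 3; split=> //; left; exact: (KV KA).
  have [l0|l0] := eqVneq l 0.
    constructor 1; split; first by left.
    by apply: to0_eq hl; apply: ev_true => w; rewrite l0 subr0.
  constructor 2; exists l => //; split=> //; left.
  by apply: (KB KA) => //; exact: (Kcst KA).
split; first exact: (extn_anfield FG Kne_sgn M_cst KneM M_inv M_root M_lim keyprop_imm).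
split=> [f Kf|].
  have [h|h] := Keq0 FG KA Kf; first by left.
  exact: extn_M.
have [b [Kb b0 [l ln0 hl]]] := imm (Kcst KA 0).
pose z w := (y w - 0) / b w - l.
have Zz : KZset z.
  right; exists (fun w => l * b w), b; split=> //; first exact: (KZ KA).
  by apply: ev_mp b0 _ => w h; rewrite /z subr0; field.
have lA : ang (fun x : unit -> R => l + x tt) by apply: angD; [exact: ang_cst|exact: ang_var].
have := extn_MF FG KneM keyprop_imm (conj Kb b0) lA (e := fun=> z) (fun=> conj Zz hl).
move=> /(extn_eqv FG); apply; apply: ev_mp b0 _ => w h.
by rewrite /z addrC subrK subr0 mulrC divfK.
Qed.

End ImmediateExtension.

Section DoubleSplit.
Variable R : realType.

(** The terms [v ^+ i * w ^+ j] are sorted by [j <= i] or [i < j], and the powers of [v * w] are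
    taken out. In the applications [v * w] belongs to the smaller field, so each half is a series in
    one new infinitesimal only. The factor [w] and the shift [l.+1] keep the diagonal out of the
    second half. *)
Lemma double_split (h : nat -> nat -> R) (C v w : R) :
  (forall i j, `|h i j| <= C) -> `|v| <= 2^-1 -> `|w| <= 2^-1 ->
  usum (fun j => usum (fun i => h j i * v ^+ i) * w ^+ j) =
  usum (fun l => usum (fun j => h j (j + l)%N * (v * w) ^+ j) * v ^+ l) +
  w * usum (fun l => usum (fun i => h (i + l.+1)%N i * (v * w) ^+ i) * w ^+ l).
Proof.
move=> hC v1 w1; have C0 : 0 <= C by exact: le_trans (hC 0%N 0%N).
have gb (u : nat -> R) (z D : R) : (forall k, `|u k| <= D) -> `|z| <= 2^-1 ->
    l1 (2 * D) (fun k => u k * z ^+ k).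
  by move=> uD z1; exact: (@gser_bounded R void (fun k _ => u k) D (fun=> 0) z uD z1).
pose f j i := h j i * v ^+ i * w ^+ j.
have fl : l11 (2 * (2 * C)) f.
  apply: (@l11_nest _ _ _ _ (fun j => 2 * C * `|w| ^+ j)).
    apply: gb => [k|]; first by rewrite ger0_norm// mulr_ge0.
    by rewrite normr_id.
  move=> j; have := l1Z (w ^+ j) (gb (h j) v C (hC j) v1); rewrite normrX mulrC.
  by move=> h1; apply: l1_le h1 _ => i; rewrite /f mulrC.
have fE j : usum (f j) = usum (fun i => h j i * v ^+ i) * w ^+ j.
  rewrite mulrC -(usumZ _ (gb (h j) v C (hC j) v1)).
  by congr usum; apply/funext => i; rewrite /f mulrC.
pose g j i := if (i < j)%N then f j i else 0.
pose k j l := f j (j + l)%N.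
pose m i l := f (i.+1 + l)%N i.
have nl (u : nat -> nat -> R) (x y : R) : (forall i l, `|u i l| <= C * `|x| ^+ i * `|y| ^+ l) ->
    `|x| <= 2^-1 -> `|y| <= 2^-1 -> l11 (2 * (2 * C)) u.
  move=> uC x1 y1; apply: (@l11_nest _ _ _ _ (fun j => 2 * (C * `|x| ^+ j))).
    have := gb (fun=> 2 * C) `|x| (2 * C) _ _; rewrite normr_id => h1.
    apply: l1_le (h1 _ x1) _ => [i|i]; first by rewrite ger0_norm// mulr_ge0.
    by rewrite -mulrA.
  move=> i; have := gb (fun=> C * `|x| ^+ i) `|y| (C * `|x| ^+ i) _ _; rewrite normr_id => h1.
  apply: l1_le (h1 _ y1) _ => [l|l]; first by rewrite ger0_norm// mulr_ge0// exprn_ge0.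
  by rewrite [X in _ <= X]ger0_norm// !mulr_ge0// ?exprn_ge0.
have p1 (x : R) n : `|x| <= 2^-1 -> `|x : R| ^+ n <= 1.
  by move=> x1; rewrite exprn_ile1//; lra.
have kl : l11 (2 * (2 * C)) k.
  apply: (nl k w v) => // j l; rewrite /k /f !normrM !normrX exprD.
  rewrite [leLHS](_ : _ = `|h j (j + l)%N| * `|w| ^+ j * `|v| ^+ l * `|v| ^+ j); last by ring.
  apply: le_trans (ler_piMr _ (p1 v j v1)) _; rewrite ?mulr_ge0 ?exprn_ge0//.
  by rewrite ler_wpM2r ?exprn_ge0// ler_wpM2r ?exprn_ge0.
have ml : l11 (2 * (2 * C)) m.
  apply: (nl m v w) => // i l; rewrite /m /f !normrM !normrX exprD.
  rewrite -!mulrA; apply: ler_pM => //; rewrite ?mulr_ge0 ?exprn_ge0//.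
  apply: ler_pM => //; rewrite ?mulr_ge0 ?exprn_ge0//.
  by rewrite ler_piMl ?exprn_ge0// p1.
have gl : l11 (2 * (2 * C)) g.
  by apply: l11_le fl _ => j i; rewrite /g; case: ifP => // _; rewrite normr0.
have fgk j : usum (f j) = usum (g j) + usum (k j).
  rewrite (usum_shift j (l11_inner j fl)); congr (_ + _).
  have [|_ ->] := @l1_fin R (g j) j; first by move=> i; rewrite /g ltnNge => ->.
  by apply: eq_bigr => i _; rewrite /g ltn_ord.
rewrite (_ : (fun j => _) = (fun j => usum (g j) + usum (k j))); last first.
  by apply/funext => j; rewrite -fgk fE.
rewrite (usumD (l11_outer gl) (l11_outer kl)) addrC; congr (_ + _).
  rewrite (usum_swap kl); congr usum; apply/funext => l.
  have vw : `|v * w| <= 2^-1.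
    by rewrite normrM; have := normr_ge0 v; have := normr_ge0 w; nra.
  rewrite mulrC -(usumZ _ (gb (fun j => h j (j + l)%N) _ C (fun j => hC _ _) vw)).
  by congr usum; apply/funext => j; rewrite /k /f exprMn exprD; ring.
rewrite (usum_swap gl).
rewrite (_ : (fun i => _) = (fun i => usum (m i))); last first.
  apply/funext => i; rewrite (usum_shift i.+1 (l11_inner i (l11_swap gl))).
  rewrite big1 ?add0r => [|j _]; last by rewrite /g ltnNge -ltnS ltn_ord.
  by congr usum; apply/funext => l; rewrite /g /m addSn ltnS leq_addr.
have vw : `|v * w| <= 2^-1.
  by rewrite normrM; have := normr_ge0 v; have := normr_ge0 w; nra.
rewrite (usum_swap ml) -(usumZ w (C := 2 * (2 * C))).
  congr usum; apply/funext => l; rewrite mulrCA mulrC.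
  rewrite -(usumZ _ (gb (fun i => h (i + l.+1)%N i) _ C (fun j => hC _ _) vw)).
  congr usum; apply/funext => i; rewrite /m /f addSn -addnS exprMn exprD exprS; ring.
apply: (gb _ _ _ _ w1) => l; apply: usum_norm; apply: (gb _ _ _ _ vw) => i; exact: hC.
Qed.

End DoubleSplit.

Section Dominance.
Variables (R : realType) (Om : Type) (G : set_system Om).
Hypothesis FG : ProperFilter G.
Local Notation ev := (ev G).
Local Notation to0 := (to0 G).
Implicit Types (T S : finType).

Lemma ev_max S (s0 : S) (b : S -> Om -> R) :
  (forall s t, ev (fun w => b s w <= b t w) \/ ev (fun w => b t w <= b s w)) ->
  exists s1, forall s, ev (fun w => b s w <= b s1 w).
Proof.
move=> tot.
suff [s1 h] : exists s1, forall s, s \in s0 :: enum S -> ev (fun w => b s w <= b s1 w).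
  by exists s1 => s; apply: h; rewrite in_cons mem_enum orbT.
elim: (enum S) => [|s l [s1 IH]].
  by exists s0 => s; rewrite inE => /eqP ->; exact: ev_true.
have [h|h] := tot s s1.
  exists s1 => s'; rewrite !in_cons => /or3P[/eqP ->|/eqP ->|s'l] //; apply: IH.
    by rewrite in_cons eqxx.
  by rewrite in_cons s'l orbT.
exists s => s'; rewrite !in_cons => /or3P[/eqP ->|/eqP ->|s'l].
- by apply: ev_mp2 (IH s0 (mem_head _ _)) h _ => w; exact: le_trans.
- exact: ev_true.
- by apply: ev_mp2 (IH s' _) h _ => [|w]; [rewrite in_cons s'l orbT|exact: le_trans].
Qed.

Lemma to0_div_le (f g : Om -> R) : to0 (fun w => f w / g w) -> ev (fun w => g w != 0) ->
  ev (fun w => `|f w| <= `|g w|).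
Proof.
move=> h g0; apply: ev_mp2 (h _ ltr01) g0 _ => w; rewrite normrM normfV => h1 h2.
by rewrite ler_pdivrMr ?normr_gt0// mul1r in h1.
Qed.

(** Any two leading terms are infinitely far apart in size, so they cannot cancel: the largest one
    is divided out and the remaining quotients become new infinitesimals. *)
Lemma dominant (M E : set (Om -> R)) A S T (mu : S -> Om -> R) (e : T -> Om -> R)
  (U : S -> A -> (T -> R) -> R) : E (fun=> 0) -> (forall m, M m -> ev (fun w => m w != 0)) ->
  (forall t, E (e t) /\ to0 (e t)) -> (forall s, fam (U s)) ->
  (forall s, ev (fun w => mu s w = 0) \/ M (mu s) /\ exists a, U s a (fun=> 0) != 0) ->
  (forall s t, s != t -> M (mu s) -> M (mu t) -> E (fun w => mu s w / mu t w) /\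
     (to0 (fun w => mu s w / mu t w) \/ to0 (fun w => mu t w / mu s w))) ->
  factored G M E (fun a w => \sum_s mu s w * U s a (fun t => e t w)).
Proof.
move=> E0 M0 Ee Uf muP cmp.
have tot s t : ev (fun w => `|mu s w| <= `|mu t w|) \/ ev (fun w => `|mu t w| <= `|mu s w|).
  have [->|st] := eqVneq s t; first by left; exact: ev_true.
  have [h|[Ms _]] := muP s; first by left; apply: ev_mp h _ => w ->; rewrite normr0.
  have [h|[Mt _]] := muP t; first by right; apply: ev_mp h _ => w ->; rewrite normr0.
  have [_ [h|h]] := cmp s t st Ms Mt; [left|right]; apply: to0_div_le h _; exact: M0.
have [[s0 _]|noS] := pselect (exists s : S, True); last first.
  left; apply: ev_true => w a; rewrite big1// => s _; exfalso; apply: noS; by exists s.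
have [s1 hs1] := ev_max s0 tot.
have [h|[M1 [a1 Ua1]]] := muP s1.
  left; have : ev (fun w => forall s, mu s w = 0).
    apply: ev_all => s; apply: ev_mp2 (hs1 s) h _ => w h1 h2.
    by apply/eqP; rewrite -normr_le0 (le_trans h1)// h2 normr0.
  by move=> h0; apply: ev_mp h0 _ => w h0 a; rewrite big1// => s _; rewrite h0 mul0r.
pose rho s w := mu s w / mu s1 w.
have /choice[b hb] s : exists b : bool, if b then s != s1 /\ E (rho s) /\ to0 (rho s) else
    s = s1 \/ ev (fun w => mu s w = 0).
  have [->|ss1] := eqVneq s s1; first by exists false; left.
  have [h|[Ms _]] := muP s; first by exists false; right.
  have [Er [h|h]] := cmp s s1 ss1 Ms M1; first by exists true.
  exfalso; have h2 := to0M FG (f := fun w => mu s1 w / mu s w) (g := rho s) (C := 1).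
  apply: (to0_ge FG ltr01 _ (h2 _ h)); apply: ev_mp2 (hs1 s) (ev_and FG (M0 _ Ms) (M0 _ M1)) _ => w h1 [h3 h4].
    by rewrite /rho (_ : _ * _ = 1) ?normr1//; field; rewrite h3 h4.
  by rewrite /rho normrM normfV ler_pdivrMr ?normr_gt0// mul1r.
pose e' (t : T + S) : Om -> R := match t with inl t => e t | inr s => if b s then rho s else fun=> 0 end.
pose F a (x : T + S -> R) := \sum_s (if s == s1 then 1 else x (inr s)) * U s a (fun t => x (inl t)).
right; exists (mu s1), (T + S)%type, e', F; split=> //.
- case=> [t|s] /=; first exact: Ee.
  by case: (b s) (hb s) => [[_]//|_]; split=> //; exact: to0_0.
- apply: fam_sum => s; apply: famM; last exact: fam_rename.
  by case: (s == s1); [exact: famc|exact: fam_var].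
- exists a1; rewrite /F (bigD1 s1)//= eqxx mul1r big1 ?addr0// => s /negPf ->.
  by rewrite mul0r.
- have : ev (fun w => forall s, mu s w = mu s1 w * (if s == s1 then 1 else e' (inr s) w)).
    apply: ev_all => s; have [->|ss1] := eqVneq s s1; first by apply: ev_true => w; rewrite mulr1.
    rewrite /=; case: (b s) (hb s) => [_|[/eqP|h]].
    + by apply: ev_mp (M0 _ M1) _ => w h; rewrite /rho mulrC divfK.
    + by rewrite (negPf ss1).
    + by apply: ev_mp h _ => w ->; rewrite mulr0.
  move=> h; apply: ev_mp2 h (M0 _ M1) _ => w h m0; split=> // a.
  by rewrite /F mulr_sumr; apply: eq_bigr => s _; rewrite h mulrA.
Qed.

Lemma to0_powR (f : Om -> R) s : 0 < s -> to0 f -> to0 (fun w => `|f w| `^ s).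
Proof.
move=> s0 f0 e e0; apply: ev_mp (f0 _ (powR_gt0 s^-1 e0)) _ => w h.
rewrite ger0_norm ?powR_ge0//.
have -> : e = (e `^ s^-1) `^ s by rewrite -powRrM mulVf ?lt0r_neq0// powRr1// ltW.
by apply: ge0_ler_powR; rewrite ?nnegrE ?powR_ge0 ?(ltW s0).
Qed.

Lemma ratr_closed (P : set (Om -> R)) f (q : rat) : (forall a, P (fun=> a)) ->
  (forall f g, P f -> P g -> P (fun w => f w * g w)) ->
  (forall f, P f -> P (fun w => (f w)^-1)) ->
  (forall f p, P f -> P (fun w => `|f w| `^ (p.+1%:R)^-1)) ->
  P f -> P (fun w => `|f w| `^ ratr q).
Proof.
move=> Pc PM PV Pr Pf.
have Pn p n : P (fun w => (`|f w| `^ (p.+1%:R)^-1) ^+ n).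
  elim: n => [|n IH]; first by rewrite (_ : (fun w => _) = fun=> 1)//; apply/funext => w.
  by rewrite (_ : (fun w => _) = fun w => `|f w| `^ p.+1%:R^-1 * (`|f w| `^ p.+1%:R^-1) ^+ n);
    [apply: PM => //; exact: Pr|apply/funext => w; rewrite exprS].
have [p pE] : exists p, `|denq q|%N = p.+1.
  by exists `|denq q|.-1; rewrite prednK// absz_gt0 denq_eq0.
have dE : (denq q)%:~R = p.+1%:R :> R by rewrite -[denq q]gez0_abs// pE.
rewrite /ratr dE; case: (numq q) => n.
  rewrite (_ : (fun w => _) = fun w => (`|f w| `^ (p.+1%:R)^-1) ^+ n)//.
  by apply/funext => w; rewrite -powR_mulrn ?powR_ge0// -powRrM mulrC.
rewrite (_ : (fun w => _) = fun w => ((`|f w| `^ (p.+1%:R)^-1) ^+ n.+1)^-1); first exact/PV.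
apply/funext => w; rewrite -powR_mulrn ?powR_ge0// -powRrM -powRN; congr (_ `^ _).
by rewrite NegzE rmorphN/= mulNr mulrC.
Qed.

End Dominance.

(** * Extensions by an element of a new order of magnitude *)

Section MonomialExtension.
Variables (R : realType) (Om : Type) (G : set_system Om).
Hypothesis FG : ProperFilter G.
Variable K : set (Om -> R).
Hypothesis KA : anfield G K.
Local Notation ev := (ev G).
Local Notation to0 := (to0 G).
Implicit Types (f g c : Om -> R) (T S : finType).
Variable z : Om -> R.
Hypothesis z_gt0 : ev (fun w => 0 < z w).
Hypothesis sep : forall a, K a -> ev (fun w => 0 < a w) ->
  to0 (fun w => z w / a w) \/ to0 (fun w => a w / z w).

Definition zmon (a : Om -> R) (q : rat) w := a w * z w `^ ratr q.
Definition Mmon m := exists a q, [/\ K a, ev (fun w => a w != 0) & ev (fun w => m w = zmon a q w)].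
Definition Emon e := exists a q, K a /\ ev (fun w => e w = zmon a q w).

Lemma Kratr f (q : rat) : K f -> K (fun w => `|f w| `^ ratr q).
Proof. apply: ratr_closed; [exact: (Kcst KA)|exact: (KM KA)|exact: (KV KA)|exact: (af_root KA)]. Qed.

Lemma zmonM a b p q : ev (fun w => zmon a p w * zmon b q w = zmon (fun w => a w * b w) (p + q) w).
Proof.
apply: ev_mp z_gt0 _ => w z0; rewrite /zmon raddfD/= powRD; first by ring.
by apply/implyP => _; rewrite gt_eqF.
Qed.

Lemma zmonV a q w : (zmon a q w)^-1 = zmon (fun w => (a w)^-1) (- q) w.
Proof. by rewrite /zmon invfM raddfN/= powRN. Qed.

Lemma zmon0 a w : zmon a 0 w = a w.
Proof. by rewrite /zmon raddf0 powRr0 mulr1. Qed.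

Lemma powR_invr (x s : R) : 0 <= x -> x^-1 `^ s = (x `^ s)^-1.
Proof. by move=> x0; rewrite -powR_inv1// -powRrM mulrC powRrM powR_inv1 ?powR_ge0. Qed.

(** Taking the root of order [q] reduces [a * z ^ q] to the comparison of [z] with the power of
    [|a|] of exponent [- q^-1], which lies in [K] because [K] is closed under rational powers. *)
Lemma sepq a q : K a -> ev (fun w => a w != 0) -> q != 0 ->
  to0 (zmon a q) \/ to0 (fun w => (zmon a q w)^-1).
Proof.
suff P a' q' : K a' -> ev (fun w => a' w != 0) -> 0 < q' ->
    to0 (zmon a' q') \/ to0 (fun w => (zmon a' q' w)^-1).
  move=> Ka a0 q0; have [q1|q1|q1] := ltgtP q 0; [|exact: P|by rewrite q1 eqxx in q0].
  have [||h|h] := P (fun w => (a w)^-1) (- q) (KV KA Ka); rewrite ?oppr_gt0//.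
  - by apply: ev_mp a0 _ => w; rewrite invr_eq0.
  - by right; apply: to0_eq h; apply: ev_true => w; rewrite zmonV.
  - by left; apply: to0_eq h; apply: ev_true => w; rewrite zmonV /zmon invrK opprK.
move=> Ka a0 q0; have r0 : 0 < ratr q' :> R by rewrite ltr0q.
pose b w := `|a' w| `^ ratr (- q'^-1).
have Kb : K b by exact: Kratr.
have b0 : ev (fun w => 0 < b w) by apply: ev_mp a0 _ => w h; rewrite powR_gt0 ?normr_gt0.
have bE w : a' w != 0 -> b w `^ ratr q' = `|a' w|^-1.
  move=> h; rewrite -powRrM -rmorphM/= mulNr mulVf ?gt_eqF// rmorphN rmorph1.
  by rewrite powR_inv1.
have [h|h] := sep Kb b0; [left|right]; move/(to0_powR FG r0): h; apply: (to0_le FG ltr01);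
  apply: ev_mp2 a0 (ev_and FG z_gt0 b0) _ => w h [h1 h2]; rewrite mul1r.
- rewrite (ger0_norm (powR_ge0 _ _)) (gtr0_norm (divr_gt0 h1 h2)).
  rewrite (@powRM _ (z w) (b w)^-1) ?invr_ge0 ?(ltW h1) ?(ltW h2)// powR_invr ?(ltW h2)// bE//.
  by rewrite invrK /zmon normrM (ger0_norm (powR_ge0 _ _)) mulrC.
- rewrite (ger0_norm (powR_ge0 _ _)) (gtr0_norm (divr_gt0 h2 h1)).
  rewrite (@powRM _ (b w) (z w)^-1) ?invr_ge0 ?(ltW h1) ?(ltW h2)// powR_invr ?(ltW h1)// bE//.
  by rewrite /zmon normfV normrM invfM (ger0_norm (powR_ge0 _ _)).
Qed.

Lemma Mmon_ne0 m : Mmon m -> ev (fun w => m w != 0).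
Proof.
move=> [a [q [_ a0 mE]]]; apply: ev_mp2 mE (ev_and FG a0 z_gt0) _ => w -> [h1 h2].
by rewrite /zmon mulf_neq0// gt_eqF// powR_gt0.
Qed.

Lemma Mmon_mul m n : Mmon m -> Mmon n -> Mmon (fun w => m w * n w).
Proof.
move=> [a [q [Ka a0 mE]]] [b [r [Kb b0 nE]]]; exists (fun w => a w * b w), (q + r); split.
- exact: (KM KA).
- by apply: ev_mp2 a0 b0 _ => w h1 h2; rewrite mulf_neq0.
- by apply: ev_mp2 (zmonM a b q r) (ev_and FG mE nE) _ => w h [-> ->].
Qed.

Lemma Mmon_inv m : Mmon m -> Mmon (fun w => (m w)^-1).
Proof.
move=> [a [q [Ka a0 mE]]]; exists (fun w => (a w)^-1), (- q); split.
- exact: (KV KA).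
- by apply: ev_mp a0 _ => w; rewrite invr_eq0.
- by apply: ev_mp mE _ => w ->; rewrite zmonV.
Qed.

Lemma KMmon a : K a -> ev (fun w => a w != 0) -> Mmon a.
Proof. by move=> Ka a0; exists a, 0; split=> //; apply: ev_true => w; rewrite zmon0. Qed.

Lemma KEmon a : K a -> Emon a.
Proof. by move=> Ka; exists a, 0; split=> //; apply: ev_true => w; rewrite zmon0. Qed.

Lemma MEmon m : Mmon m -> Emon m.
Proof. by move=> [a [q [? ? ?]]]; exists a, q. Qed.

(** [A] is the largest of the roots of [|a t|] of order [n t]. The quotients [a t / A ^+ n t] are
    then bounded and have limits, so all the monomials are powers of the single infinitesimal
    [A * x] up to factors in [K]. *)
Lemma half T (a : T -> Om -> R) (n : T -> nat) (x : Om -> R) :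
  (forall t, K (a t)) -> ev (fun w => 0 < x w) ->
  (forall t, (0 < n t)%N -> to0 (fun w => a t w * x w ^+ n t)) ->
  exists A (la : T -> R) (ep : T -> Om -> R), [/\ K A, to0 (fun w => A w * x w),
   forall t, K (ep t) /\ to0 (ep t) &
   forall t, (0 < n t)%N ->
     ev (fun w => a t w * x w ^+ n t = (la t + ep t w) * (A w * x w) ^+ n t)].
Proof.
move=> Ka x0 ax0.
(* For positive [n t] the number [(n t).-1.+1] is [n t], written in the shape of [af_root]; the
   other indices get the value 0. *)
pose b o w := if o is Some t then (if (0 < n t)%N then `|a t w| `^ ((n t).-1.+1%:R)^-1 else 0) else 0 : R.
have Kb o : K (b o).
  case: o => [t|]; last exact: (Kcst KA).
  by rewrite /b; case: (0 < n t)%N; [exact: (af_root KA)|exact: (Kcst KA)].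
have [om hom] := kmax FG KA None Kb.
pose A := b om.
have A_ge0 w : 0 <= A w.
  by rewrite /A /b; case: (om) => // t; case: ifP => // _; exact: powR_ge0.
pose q t w := a t w / A w ^+ n t.
have qE t : (0 < n t)%N -> ev (fun w => a t w = q t w * A w ^+ n t /\ `|q t w| <= 1).
  move=> nt; apply: ev_mp (hom (Some t)) _ => w h0.
  have h : `|a t w| `^ (n t).-1.+1%:R^-1 <= A w by move: h0; rewrite /A {1}/b nt.
  have h2 : `|a t w| <= A w ^+ n t.
    by rewrite -(rootK (a t w) (n t).-1) -[X in A w ^+ X]prednK// lerXn2r// nnegrE ?powR_ge0//.
  have [sw|sw] := eqVneq (A w) 0.
    move: h2; rewrite /q sw expr0n (gtn_eqF nt) normr_le0 => /eqP ->.
    by rewrite !mul0r normr0 ler01.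
  rewrite /q divfK ?expf_neq0//; split=> //.
  by rewrite normrM normfV ler_pdivrMr ?normr_gt0 ?expf_neq0// mul1r (ger0_norm (exprn_ge0 _ (A_ge0 w))).
have Kq t : K (q t) by apply: (KM KA) => //; apply: (KV KA); apply: (KX KA); exact: Kb.
have /choice[la hla] t : exists l, (0 < n t)%N -> to0 (fun w => q t w - l).
  have [nt|nt] := ltnP 0 (n t); last by exists 0.
  have [||l hl] := st_lim FG (f := q t) (C := 1); first exact: (Kdcd FG KA).
    by apply: ev_mp (qE t nt) _ => w [].
  by exists l.
exists A, la, (fun t w => if (0 < n t)%N then q t w - la t else 0); split=> //.
- exact: Kb.
- rewrite /A; case: om {hom hla Kq qE q A_ge0 A} => [t|]; last first.
    by apply: to0_eq (to0_0 FG); apply: ev_true => w /=; rewrite mul0r.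
  rewrite /b; case nt: (0 < n t)%N; last first.
    by apply: to0_eq (to0_0 FG); apply: ev_true => w /=; rewrite mul0r.
  apply: to0_eq (to0_root FG (n t).-1 (ax0 t nt)); apply: ev_mp x0 _ => w xw.
  rewrite normrM powRM// prednK// normrX (gtr0_norm xw); congr (_ * _).
  by rewrite -powR_mulrn ?ltW// -powRrM divff ?powRr1 ?ltW// pnatr_eq0 -lt0n.
- move=> t; case nt: (0 < n t)%N; last by split; [exact: (Kcst KA)|exact: to0_0].
  by split; [apply: (KB KA) => //; exact: (Kcst KA)|exact: hla].
- move=> t nt; apply: ev_mp (qE t nt) _ => w [h _].
  by rewrite nt (addrC (la t)) subrK {1}h exprMn mulrA.
Qed.

Definition zeta p w := z w `^ ((p : R)^-1).

(** With a common denominator [p] for the exponents, the monomials of positive exponent are merged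
    into [A * zeta], those of negative exponent into [B / zeta], and those of exponent 0 are
    infinitesimals of [K]. *)
Lemma merge_mono T (e : T -> Om -> R) : (forall t, Emon (e t) /\ to0 (e t)) ->
  exists (p : nat) A B S (c : S -> Om -> R) (g : T -> (option (option S) -> R) -> R),
  [/\ (0 < p)%N, K A /\ K B,
   to0 (fun w => A w * zeta p%:R w) /\ to0 (fun w => B w * (zeta p%:R w)^-1),
   (forall s, K (c s) /\ to0 (c s)) /\ (forall t, ang (g t) /\ g t (fun=> 0) = 0) &
   forall t, ev (fun w => e t w =
     g t (ext (ext (fun s => c s w) (A w * zeta p%:R w)) (B w * (zeta p%:R w)^-1)))].
Proof.
move=> he.
have /choice[a ha] t : exists a, exists q, K a /\ ev (fun w => e t w = zmon a q w) by exact: (he t).1.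
have {ha}/choice[q ha] := ha.
have Ka t : K (a t) by have [] := ha t.
have [p p0 /choice[n hn]] : exists2 p : nat, (0 < p)%N &
    forall t, exists n : bool * nat, q t = (-1) ^+ n.1 * n.2%:R / p%:R.
  pose D (t : T) := `|denq (q t)|%N.
  have D0 t : (0 < D t)%N by rewrite absz_gt0 denq_eq0.
  exists (\prod_t D t)%N; first exact: prodn_gt0.
  move=> t; exists (numq (q t) < 0, (`|numq (q t)| * \prod_(s | s != t) D s)%N).
  rewrite /= [(\prod_s D s)%N](bigD1 t)//= !natrM mulrA -mulf_div divff ?mulr1; last first.
    by rewrite pnatr_eq0 -lt0n prodn_gt0.
  rewrite /D -{1}(divq_num_den (q t)); congr (_ / _); last first.
    by rewrite -{1}[denq (q t)]gez0_abs.
  by rewrite {1}[numq (q t)]intEsign rmorphM rmorph_sign.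
pose zt w := zeta p%:R w.
have zt0 : ev (fun w => 0 < zt w) by apply: ev_mp z_gt0 _ => w h; rewrite /zt /zeta powR_gt0.
have zi0 : ev (fun w => 0 < (zt w)^-1) by apply: ev_mp zt0 _ => w; rewrite invr_gt0.
pose n1 t := if (n t).1 then 0%N else (n t).2.
pose n2 t := if (n t).1 then (n t).2 else 0%N.
have eE t : ev (fun w => e t w = a t w * zt w ^+ n1 t * (zt w)^-1 ^+ n2 t).
  apply: ev_mp2 (ha t).2 z_gt0 _ => w -> zw; rewrite /zmon hn -[RHS]mulrA; congr (_ * _).
  have E k : zt w ^+ k = z w `^ (k%:R / p%:R).
    by rewrite /zt /zeta -powR_mulrn ?powR_ge0// -powRrM mulrC.
  rewrite /n1 /n2 exprVn !E; case: (n t).1.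
    by rewrite mul0r powRr0 mul1r mulN1r mulNr raddfN/= powRN fmorph_div/= !ratr_nat.
  by rewrite !mul1r mul0r powRr0 invr1 mulr1 fmorph_div/= !ratr_nat.
have [|A [la [ep [KA' A0 Kep hA]]]] := half (n := n1) Ka zt0.
  move=> t nt; apply: to0_eq (he t).2; apply: ev_mp (eE t) _ => w ->.
  by move: nt; rewrite /n1 /n2; case: (n t).1 => // _; rewrite expr0 mulr1.
have [|B [lb [eq [KB' B0 Keq hB]]]] := half (n := n2) Ka zi0.
  move=> t nt; apply: to0_eq (he t).2; apply: ev_mp (eE t) _ => w ->.
  by move: nt; rewrite /n1 /n2; case: (n t).1 => // _; rewrite expr0 mulr1.
pose c (s : T + T + T) : Om -> R := match s with inl (inl t) => ep t | inl (inr t) => eq t |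
   inr t => if (n t).2 == 0%N then a t else fun=> 0 end.
pose g t (x : option (option (T + T + T)) -> R) :=
  if (0 < n1 t)%N then (la t + x (Some (Some (inl (inl t))))) * x (Some None) ^+ n1 t else
  if (0 < n2 t)%N then (lb t + x (Some (Some (inl (inr t))))) * x None ^+ n2 t else
  x (Some (Some (inr t))).
exists p, A, B, (T + T + T)%type, c, g; split=> //.
  split.
    move=> [[t|t]|t] /=; [exact: Kep|exact: Keq|].
    case: eqP => nt; last by split; [exact: (Kcst KA)|exact: to0_0].
    split=> //; apply: to0_eq (he t).2; apply: ev_mp (eE t) _ => w ->.
    by rewrite /n1 /n2 nt !if_same !expr0 !mulr1.
  move=> t; rewrite /g; split.
    case: (0 < n1 t)%N; [|case: (0 < n2 t)%N; last exact: ang_var];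
    by apply: angM; [apply: angD; [exact: ang_cst|exact: ang_var]|apply: angX; exact: ang_var].
  by case: ifP => [h|_]; [|case: ifP => [h|_]]; rewrite ?expr0n ?gtn_eqF// mulr0.
move=> t; move: (eE t) (hA t) (hB t); rewrite /g /c /n1 /n2.
case nE: (n t) => [[] [|k]] /= e1 e2 e3; rewrite ?nE /=.
- by apply: ev_mp e1 _ => w ->; rewrite !expr0 !mulr1.
- by apply: ev_mp2 e1 (e3 isT) _ => w -> <-; rewrite expr0 mulr1.
- by apply: ev_mp e1 _ => w ->; rewrite !expr0 !mulr1.
- by apply: ev_mp2 e1 (e2 isT) _ => w -> <-; rewrite expr0 mulr1.
Qed.

(* Expansion in an infinitesimal [u], cut off at the first exponent with a
   coefficient of nonzero constant term. *)
Lemma expand1 A T (H : A * nat -> (T -> R) -> R) (c : T -> Om -> R) (u : Om -> R) :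
  fam H -> (forall t, K (c t) /\ to0 (c t)) -> to0 u ->
  exists S (x : S -> nat) (b : S -> Om -> R) T' (e : T' -> Om -> R)
    (U : S -> A -> (option T' -> R) -> R),
  [/\ injective x, forall s, K (b s) /\ (ev (fun w => b s w = 0) \/
       ev (fun w => b s w != 0) /\ exists a, U s a (fun=> 0) != 0),
    forall t, K (e t) /\ to0 (e t), forall s, fam (U s) &
    ev (fun w => forall a, gser (fun l => H (a, l)) (ext (fun t => c t w) (u w)) =
      \sum_s b s w * u w ^+ x s * U s a (ext (fun t => e t w) (u w)))].
Proof.
move=> Hf Kc u0.
have [h|[m [T1 [e1 [W [Km Ke1 Wf [[a0 k0] Wa0] h]]]]]] := af_key KA Hf Kc.
  exists void, (fun=> 0%N), (fun=> fun=> 0), void, (fun=> fun=> 0), (fun _ _ _ => 0).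
  split; [by case|by case|by case|by case|].
  apply: ev_mp h _ => w h a.
  rewrite big1// /gser (_ : (fun k => _) = (fun=> 0)) ?usum0//.
  by apply/funext => k; rewrite h mul0r.
have /choice[p hp] := fun i : 'I_k0 => Kfactor FG KA (fam_idx (fun a => (a, i : nat)) Wf) Ke1.
pose al i := (tagged (p i)).1.1; pose ci i := (tagged (p i)).1.2.
pose V i := (tagged (p i)).2.
have Kal i : K (al i) by have [] := hp i.
have Kci i t : K (ci i t) /\ to0 (ci i t) by have [_ hh _ _ _] := hp i; exact: hh.
have Vf i : fam (V i) by have [] := hp i.
have VE (i : 'I_k0) : ev (fun w => forall a, W (a, i : nat) (fun t => e1 t w) =
    al i w * V i a (fun t => ci i t w)) by have [] := hp i.
have al_or (i : 'I_k0) : ev (fun w => al i w = 0) \/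
    ev (fun w => al i w != 0) /\ exists a, V i a (fun=> 0) != 0 by have [] := hp i.
have m0 : ev (fun w => m w != 0) by apply: ev_mp h _ => w [].
pose T' := (T1 + {i : 'I_k0 & tag (p i)})%type.
pose e (t : T') : Om -> R := match t with inl t => e1 t | inr t => ci (tag t) (tagged t) end.
pose U (s : option 'I_k0) a (y : option T' -> R) := match s with
  | Some i => V i a (fun t => y (Some (inr (Tagged (fun i => tag (p i)) t))))
  | None => gser (fun k => W (a, (k0 + k)%N)) (ext (fun t => y (Some (inl t))) (y None)) end.
have tailf : fam (fun a => gser (fun k => W (a, (k0 + k)%N))).
  exact: (fam_uncurry (fam_idx (fun ak => (ak.1, (k0 + ak.2)%N)) Wf)).
exists (option 'I_k0), (fun s : option 'I_k0 => if s is Some i then i : nat else k0),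
  (fun (s : option 'I_k0) w => if s is Some i then m w * al i w else m w), T', e, U; split.
- move=> [i|] [j|] //; first by move=> /val_inj ->.
    by move=> ij; have := ltn_ord i; rewrite ij ltnn.
  by move=> ij; have := ltn_ord j; rewrite -ij ltnn.
- case=> [i|]; split=> //.
  + exact: (KM KA).
  + have [h0|[h0 hV]] := al_or i; [left|right]; first by apply: ev_mp h0 _ => w ->; rewrite mulr0.
    by split=> //; apply: ev_mp2 h0 m0 _ => w h1 h2; rewrite mulf_neq0.
  + by right; split=> //; exists a0; rewrite /U gser0 addn0.
- by case=> [t|[i t]] /=; [exact: Ke1|exact: Kci].
- case=> [i|] /=; first by apply: fam_rename (Vf i).
  have := @fam_comp _ _ _ (option T') _ (fun o y => ext (fun t => y (Some (inl t))) (y None) o) tailf.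
  by apply; [case=> [t|] /=; exact: ang_var|case].
have [sb [C [sb0 WC]]] := fam_bounded Wf.
have h2 : 0 < 2^-1 :> R by rewrite invr_gt0.
apply: ev_mp2 h (ev_and FG (ev_and FG (small_ev FG sb0 (fun t => (Ke1 t).2)) (u0 _ h2)) (ev_all FG VE)) _.
move=> w [_ hw] [[h3 h4] hV] a.
have hC k : `|W (a, k) (fun t => e1 t w)| <= C by exact: WC.
rewrite [LHS](_ : _ = m w * gser (fun k => W (a, k)) (ext (fun t => e1 t w) (u w))); last first.
  rewrite /gser /= -(usumZ _ (gser_bounded (h := fun k => W (a, k)) hC h4)).
  by congr usum; apply/funext => k; rewrite hw mulrA.
rewrite (gser_split (C := C) k0)// big_option /= addrC mulrDr mulrA; congr (_ + _).
by rewrite mulr_sumr; apply: eq_bigr => i _; rewrite hV /=; ring.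
Qed.

Lemma Emon_div s t : Mmon s -> Mmon t -> Emon (fun w => s w / t w).
Proof. by move=> hs ht; apply: MEmon; apply: Mmon_mul => //; exact: Mmon_inv. Qed.

(** The product of [A * zeta] and [B / zeta] lies in [K], so [double_split] removes the mixed
    powers. [expand1] then cuts each half down to finitely many monomials. Their exponents in [z]
    are pairwise distinct, hence by [sepq] their sizes are infinitely far apart and [dominant]
    applies. *)
Lemma keyprop_mono : keyprop G Mmon Emon.
Proof.
move=> A T F e Ff he.
have [p [A1 [B1 [T1 [c [g [p0 [KA1 KB1] [v0 w0] [Kc ga] eE]]]]]]] := merge_mono he.
pose zt w := zeta p%:R w.
pose v w := A1 w * zt w; pose u w := B1 w * (zt w)^-1.
have zt0 : ev (fun w => 0 < zt w) by apply: ev_mp z_gt0 _ => w h; rewrite /zt /zeta powR_gt0.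
have F'f : fam (fun a x => F a (fun t => g t x)).
  by apply: (fam_comp Ff) => t; have [_ /(_ t)[]] := (Kc, ga).
have [r1 [H1 [r10 H1f H1E]]] := fam_curry F'f.
have [r2 [H2 [r20 H2f H2E]]] := fam_curry H1f.
pose de w := A1 w * B1 w / (r1 * r2).
have Kde : K de by apply: (KM KA); [exact: (KM KA)|exact: (Kcst KA)].
have vu : ev (fun w => v w / r2 * (u w / r1) = de w).
  apply: ev_mp zt0 _ => w h; rewrite /v /u /de; field.
  by rewrite !gt_eqF.
have v'0 : to0 (fun w => v w / r2).
  by apply: to0_eq (to0Z FG r2^-1 v0); apply: ev_true => w; rewrite mulrC.
have u'0 : to0 (fun w => u w / r1).
  by apply: to0_eq (to0Z FG r1^-1 w0); apply: ev_true => w; rewrite mulrC.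
have de0 : to0 de by apply: to0_eq vu _; apply: to0M u'0; exact: (v'0 _ ltr01).
pose c' o : Om -> R := if o is Some t then c t else de.
have Kc' o : K (c' o) /\ to0 (c' o) by case: o => [t|] //=; exact: Kc.
pose P (al : A * nat) := gser (fun j => H2 ((al.1, j), (j + al.2)%N)).
pose Q (al : A * nat) := gser (fun j => H2 ((al.1, (j + al.2.+1)%N), j)).
have Pf : fam P := fam_uncurry (fam_idx (fun aj : A * nat * nat => ((aj.1.1, aj.2), (aj.2 + aj.1.2)%N)) H2f).
have Qf : fam Q := fam_uncurry (fam_idx (fun aj : A * nat * nat => ((aj.1.1, (aj.2 + aj.1.2.+1)%N), aj.2)) H2f).
have [S1 [x1 [b1 [T1' [e1 [U1 [x1i b1P Ke1 U1f hP]]]]]]] := expand1 Pf Kc' v'0.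
have [S2 [x2 [b2 [T2' [e2 [U2 [x2i b2P Ke2 U2f hQ]]]]]]] := expand1 Qf Kc' u'0.
pose mu (s : S1 + S2) w := match s with
  | inl s => b1 s w * (v w / r2) ^+ x1 s | inr s => b2 s w * (u w / r1) ^+ (x2 s).+1 end.
pose TT := (option T1' + option T2')%type.
pose ee (t : TT) w := match t with
  | inl o => ext (fun t => e1 t w) (v w / r2) o | inr o => ext (fun t => e2 t w) (u w / r1) o end.
pose U (s : S1 + S2) a (y : TT -> R) := match s with
  | inl s => U1 s a (fun o => y (inl o)) | inr s => U2 s a (fun o => y (inr o)) end.
(* The second half of [double_split] carries a factor [u] in front, hence [(x2 s).+1]: its exponents
   are strictly negative and never meet those of the first half. *)
pose xq (s : S1 + S2) : rat := match s with inl s => (x1 s)%:R / p%:R | inr s => - ((x2 s).+1%:R / p%:R) end.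
have pn0 : p%:R != 0 :> rat by rewrite pnatr_eq0 -lt0n.
have ztE k w : zt w ^+ k = z w `^ ratr (k%:R / p%:R).
  rewrite /zt /zeta -powR_mulrn ?powR_ge0// -powRrM mulrC.
  by rewrite fmorph_div/= !ratr_nat.
(* each term is a monomial with coefficient in [K] and exponent [xq s] *)
have muE s : exists a, [/\ K a, ev (fun w => mu s w = zmon a (xq s) w) &
    ev (fun w => mu s w = 0) \/ ev (fun w => a w != 0) /\ exists a, U s a (fun=> 0) != 0].
  case: s => s.
    have [Kb bP] := b1P s; exists (fun w => b1 s w * (A1 w / r2) ^+ x1 s); split.
    + apply: (KM KA) => //; apply: (KX KA); apply: (KM KA) => //; exact: (Kcst KA).
    + by apply: ev_true => w; rewrite /mu /v /zmon /= -ztE !exprMn; ring.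
    + have [bz|[bn0 Ua]] := bP; first by left; apply: ev_mp bz _ => w /= ->; rewrite mul0r.
      have [x0|x0] := posnP (x1 s).
        by right; split=> //; apply: ev_mp bn0 _ => w; rewrite x0 expr0 mulr1.
      have [Az|An] := Keq0 FG KA KA1.
        left; apply: ev_mp Az _ => w /=; rewrite /v => ->.
        by rewrite !mul0r expr0n (gtn_eqF x0) mulr0.
      right; split=> //; apply: ev_mp2 bn0 An _ => w h1 h2.
      by rewrite mulf_neq0// expf_neq0// mulf_neq0// invr_eq0 gt_eqF.
  have [Kb bP] := b2P s; exists (fun w => b2 s w * (B1 w / r1) ^+ (x2 s).+1); split.
  + apply: (KM KA) => //; apply: (KX KA); apply: (KM KA) => //; exact: (Kcst KA).
  + apply: ev_true => w; rewrite /mu /u /zmon /= raddfN/= powRN -ztE mulrAC exprMn.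
    by rewrite exprVn mulrA.
  + have [bz|[bn0 Ua]] := bP; first by left; apply: ev_mp bz _ => w /= ->; rewrite mul0r.
    have [Az|An] := Keq0 FG KA KB1.
      by left; apply: ev_mp Az _ => w /=; rewrite /u => ->; rewrite !mul0r exprS mul0r mulr0.
    right; split=> //; apply: ev_mp2 bn0 An _ => w h1 h2.
    by rewrite mulf_neq0// expf_neq0// mulf_neq0// invr_eq0 gt_eqF.
have xqi s t : s != t -> xq s != xq t.
  apply: contra => /eqP; case: s t => s [] t /=.
  - by move=> /(mulIf _); rewrite invr_eq0 => /(_ pn0)/eqP; rewrite eqr_nat => /eqP/x1i ->.
  - move=> h; exfalso; have : (x1 s)%:R / p%:R + (x2 t).+1%:R / p%:R = 0 :> rat by rewrite h addNr.
    by move/eqP; rewrite -mulrDl mulf_eq0 invr_eq0 (negPf pn0) orbF -natrD pnatr_eq0 addnS.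
  - move=> h; exfalso; have : (x1 t)%:R / p%:R + (x2 s).+1%:R / p%:R = 0 :> rat by rewrite -h addNr.
    by move/eqP; rewrite -mulrDl mulf_eq0 invr_eq0 (negPf pn0) orbF -natrD pnatr_eq0 addnS.
  - move=> /oppr_inj /(mulIf _); rewrite invr_eq0 => /(_ pn0)/eqP.
    by rewrite eqr_nat => /eqP[/x2i ->].
have Evv : Emon (fun w => v w / r2).
  exists (fun w => A1 w / r2), (1%:R / p%:R); split; first by apply: (KM KA) => //; exact: (Kcst KA).
  by apply: ev_true => w; rewrite /zmon -ztE /v expr1 mulrAC.
have Euu : Emon (fun w => u w / r1).
  exists (fun w => B1 w / r1), (- (1%:R / p%:R)); split; first by apply: (KM KA) => //; exact: (Kcst KA).
  by apply: ev_true => w; rewrite /zmon raddfN/= powRN -ztE /u expr1 mulrAC.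
have D : factored G Mmon Emon (fun a w => \sum_s mu s w * U s a (fun t => ee t w)).
  apply: (dominant FG (M := Mmon) (E := Emon)).
  - exact: KEmon (Kcst KA 0).
  - exact: Mmon_ne0.
  - case=> [[t|]|[t|]] //=; [have [h ?] := Ke1 t|have [h ?] := Ke2 t];
      by split=> //; exact: KEmon.
  - case=> s /=.
      by apply: (fam_rename (fun o => inl o : TT) (U1f s)).
    by apply: (fam_rename (fun o => inr o : TT) (U2f s)).
  - move=> s; have [a [Ka aE [h|[an0 Ua]]]] := muE s; first by left.
    by right; split=> //; exists a, (xq s).
  - move=> s t st Ms Mt; split; first exact: Emon_div.
    have [a [Ka aE aP]] := muE s; have [b [Kb bE bP]] := muE t.
    have nz r (d : Om -> R) : Mmon (mu r) -> ev (fun w => mu r w = zmon d (xq r) w) ->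
        ev (fun w => d w != 0).
      move=> Mr dE; apply: ev_mp2 (Mmon_ne0 Mr) dE _ => w h1 h2.
      by move: h1; rewrite h2 /zmon mulf_eq0 negb_or => /andP[].
    have Kab : K (fun w => a w * (b w)^-1) by apply: (KM KA) => //; exact: (KV KA).
    have ab0 : ev (fun w => a w * (b w)^-1 != 0).
      by apply: ev_mp2 (nz _ _ Ms aE) (nz _ _ Mt bE) _ => w h1 h2; rewrite mulf_neq0// invr_eq0.
    have xst : xq s + - xq t != 0 by rewrite subr_eq0 xqi.
    have E : ev (fun w => zmon (fun w => a w * (b w)^-1) (xq s + - xq t) w = mu s w / mu t w).
      apply: ev_mp2 (zmonM a (fun w => (b w)^-1) (xq s) (- xq t)) (ev_and FG aE bE) _.
      by move=> w <- [-> ->]; rewrite zmonV.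
    have [h|h] := sepq Kab ab0 xst; [left|right]; apply: to0_eq h; apply: ev_mp E _ => w -> //.
    by rewrite invfM invrK mulrC.
apply: factored_eq D.
have [sb [C [sb0 HC]]] := fam_bounded H2f.
have h2 : 0 < 2^-1 :> R by rewrite invr_gt0.
have c0 t : to0 (c t) by have [] := Kc t.
apply: ev_mp2 (ev_and FG (ev_and FG hP hQ) (ev_all FG eE))
  (ev_and FG (ev_and FG (small_ev FG sb0 c0) (small_ev FG r20 c0))
   (ev_and FG (ev_and FG (ev_and FG (v0 _ r20) (v0 _ r10)) (w0 _ r10))
   (ev_and FG (ev_and FG (v'0 _ h2) (u'0 _ h2)) (ev_and FG vu (small_ev FG r10 c0))))) _.
move=> w [[hP' hQ'] eE'] [[hs hs2] [[[v2 v1] u1] [[v2' u2'] [vuE cr1]]]] a.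
rewrite (_ : (fun t => e t w) = (fun t => g t (ext (ext (fun s => c s w) (v w)) (u w)))); last first.
  by apply/funext => t; rewrite eE'.
rewrite H1E//; last by case=> [t|] /=; [exact: cr1|exact: v1].
have cE : ext (fun t => c t w) (de w) = fun o => c' o w by apply/funext => -[].
transitivity (gser (fun l => P (a, l)) (ext (fun o => c' o w) (v w / r2)) +
   (u w / r1) * gser (fun l => Q (a, l)) (ext (fun o => c' o w) (u w / r1))).
  rewrite hP' hQ' big_sumType /= mulr_sumr; congr (_ + _); apply: eq_bigr => s _ /=.
  by rewrite exprS; ring.
rewrite -cE [RHS]/gser /=.
have := @double_split R (fun j i => H2 ((a, j), i) (fun t => c t w)) C (v w / r2) (u w / r1)
  (fun i j => HC ((a, i), j) _ hs) v2' u2'.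
rewrite vuE /P /Q /gser /= => <-.
congr usum; apply/funext => j; congr (_ * _).
by rewrite H2E.
Qed.

Definition mono_extn := extn G Mmon Emon.

Lemma mono_ext_anfield : anfield G mono_extn /\ K `<=` mono_extn /\ mono_extn z.
Proof.
have M_sgn m : Mmon m -> ev (fun w => m w < 0) \/ ev (fun w => 0 < m w).
  move=> [a [q [Ka a0 mE]]]; have zq : ev (fun w => 0 < z w `^ ratr q).
    by apply: ev_mp z_gt0 _ => w h; rewrite powR_gt0.
  have [h|h|h] := af_dec KA Ka; [left| |right].
  - apply: ev_mp2 h (ev_and FG mE zq) _ => w h1 [-> h2].
    by rewrite /zmon pmulr_llt0.
  - by exfalso; apply: (ev_absurd FG a0 h) => w /eqP.
  - apply: ev_mp2 h (ev_and FG mE zq) _ => w h1 [-> h2].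
    by rewrite /zmon mulr_gt0.
have M_cst a : a != 0 -> Mmon (fun=> a).
  by move=> a0; apply: KMmon; [exact: (Kcst KA)|exact: ev_true].
have M_root m p : Mmon m -> Mmon (fun w => `|m w| `^ (p.+1%:R)^-1).
  move=> [a [q [Ka a0 mE]]]; exists (fun w => `|a w| `^ (p.+1%:R)^-1), (q / p.+1%:R); split.
  - exact: (af_root KA).
  - by apply: ev_mp a0 _ => w h; rewrite gt_eqF// powR_gt0// normr_gt0.
  - apply: ev_mp2 mE z_gt0 _ => w -> h; rewrite /zmon normrM powRM// (ger0_norm (powR_ge0 _ _)).
    by rewrite -powRrM rmorphM/= fmorphV/= ratr_nat.
have M_lim m : Mmon m ->
  [\/ Emon m /\ to0 m,
      exists2 l, l != 0 & Emon (fun w => m w - l) /\ to0 (fun w => m w - l) |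
      Emon (fun w => (m w)^-1) /\ to0 (fun w => (m w)^-1)].
  move=> Mm; have [a [q [Ka a0 mE]]] := Mm.
  have [q0|q0] := eqVneq q 0.
    have mE' : ev (fun w => a w = m w) by apply: ev_mp mE _ => w ->; rewrite q0 zmon0.
    have [[l hl]|h] := Kst FG KA Ka; last first.
      constructor 3; split; first exact: MEmon (Mmon_inv Mm).
      by apply: to0_eq h; apply: ev_mp mE' _ => w ->.
    have hl' : to0 (fun w => m w - l) by apply: to0_eq hl; apply: ev_mp mE' _ => w ->.
    have [l0|l0] := eqVneq l 0.
      constructor 1; split; first exact: MEmon.
      by apply: to0_eq hl'; apply: ev_true => w; rewrite l0 subr0.
    constructor 2; exists l => //; split=> //.
    exists (fun w => a w - l), 0; split; first by apply: (KB KA) => //; exact: (Kcst KA).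
    by apply: ev_mp mE' _ => w <-; rewrite zmon0.
  have [h|h] := sepq Ka a0 q0.
    by constructor 1; split; [exact: MEmon|apply: to0_eq h; apply: ev_mp mE _ => w ->].
  constructor 3; split; first exact: MEmon (Mmon_inv Mm).
  by apply: to0_eq h; apply: ev_mp mE _ => w ->.
split; first exact: (extn_anfield FG M_sgn M_cst Mmon_mul Mmon_inv M_root M_lim keyprop_mono).
split=> [f Kf|].
  have [h|h] := Keq0 FG KA Kf; first by left.
  by apply: (extn_M FG); exact: KMmon.
apply: (extn_M FG); exists (fun=> 1), 1; split; first exact: (Kcst KA).
  by apply: ev_true => w; exact: oner_neq0.
by apply: ev_mp z_gt0 _ => w h; rewrite /zmon mul1r rmorph1 powRr1// ltW.
Qed.

End MonomialExtension.

(** * Adjoining one element to a field of germs, and the prepared form *)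

Section FieldExtension.
Variables (R : realType) (Om : Type) (G : set_system Om).
Hypothesis FG : ProperFilter G.
Local Notation ev := (ev G).
Local Notation to0 := (to0 G).
Implicit Types (f g c : Om -> R) (T S I : finType) (P : set (Om -> R)).

(** Closure properties without any decision of signs; they express that an extension is contained in
    every closed set containing [K] and [y]. *)
Record anclosed P : Prop := AnClosed {
  ac_cst : forall a, P (fun=> a);
  ac_add : forall f g, P f -> P g -> P (fun w => f w + g w);
  ac_mul : forall f g, P f -> P g -> P (fun w => f w * g w);
  ac_inv : forall f, P f -> P (fun w => (f w)^-1);
  ac_root : forall f p, P f -> P (fun w => `|f w| `^ (p.+1%:R)^-1);
  ac_eqv : forall f g, P f -> ev (fun w => f w = g w) -> P g;
  ac_an : forall T (F : (T -> R) -> R) (c : T -> Om -> R), ang F ->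
    (forall t, P (c t) /\ to0 (c t)) -> P (fun w => F (fun t => c t w)) }.

Lemma extn_sub P M E : anclosed P -> M `<=` P -> E `<=` P -> extn G M E `<=` P.
Proof.
move=> PA MP EP f [h|[m [T [e [W [Mm Ee Wa W0 h]]]]]].
  by apply: (ac_eqv PA (ac_cst PA 0)); apply: ev_mp h _ => w ->.
apply: (ac_eqv PA (f := fun w => m w * W (fun t => e t w))).
  apply: (ac_mul PA); first exact: MP.
  by apply: (ac_an PA) => // t; have [Et ?] := Ee t; split=> //; exact: EP.
by apply: ev_mp h _ => w ->.
Qed.

Variable K : set (Om -> R).
Hypothesis KA : anfield G K.
Variable y : Om -> R.
Hypothesis ydec : forall th, K th ->
  [\/ ev (fun w => y w < th w), ev (fun w => y w = th w) | ev (fun w => th w < y w)].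

(* All the [f i] have the form [a z^r W(c, A z^(1/p), B z^(-1/p))] where
   [z = |y - th|], with [th], [a], [c], [A], [B] in [K]. *)
Definition prepared I (f : I -> Om -> R) :=
  exists th (s : R) p A B S (c : S -> Om -> R) (a : I -> Om -> R) (r : I -> rat)
    (W : I -> (option (option S) -> R) -> R),
  let z w := s * (y w - th w) in
  let v w := A w * zeta z p%:R w in let u w := B w * (zeta z p%:R w)^-1 in
  [/\ K th /\ (s = 1 \/ s = -1), (0 < p)%N /\ ev (fun w => 0 < z w),
   (K A /\ to0 v) /\ (K B /\ to0 u), (forall t, K (c t) /\ to0 (c t)) &
   forall i, [/\ K (a i), ang (W i), W i (fun=> 0) != 0 &
     ev (fun w => f i w = a i w * z w `^ ratr (r i) * W i (ext (ext (fun t => c t w) (v w)) (u w)))]].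

Lemma y_shift s (th : Om -> R) (t : R) : s = 1 \/ s = -1 -> K th ->
  forall a, K a -> ev (fun w => 0 < a w) ->
  ev (fun w => s * (y w - th w) / a w < t) \/ ev (fun w => t <= s * (y w - th w) / a w).
Proof.
move=> sE Kth a Ka a0.
have Kt : K (fun w => th w + s * (t * a w)).
  by apply: (KD KA) => //; apply: (KZ KA); exact: (KZ KA).
have E w : 0 < a w -> s * (y w - th w) / a w - t = s * (y w - (th w + s * (t * a w))) / a w.
  by move=> aw; case: sE => ->; field; rewrite gt_eqF.
have := ydec Kt; case: sE E => -> E [] h.
- by left; apply: ev_mp2 h a0 _ => w h1 h2; rewrite -subr_lt0 E// pmulr_llt0 ?invr_gt0//; lra.
- by right; apply: ev_mp2 h a0 _ => w h1 h2; rewrite -subr_ge0 E// h1 subrr mulr0 mul0r.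
- by right; apply: ev_mp2 h a0 _ => w h1 h2; rewrite -subr_ge0 E// pmulr_lge0 ?invr_gt0//; lra.
- by right; apply: ev_mp2 h a0 _ => w h1 h2; rewrite -subr_ge0 E// pmulr_lge0 ?invr_gt0//; lra.
- by right; apply: ev_mp2 h a0 _ => w h1 h2; rewrite -subr_ge0 E// h1 subrr mulr0 mul0r.
- by left; apply: ev_mp2 h a0 _ => w h1 h2; rewrite -subr_lt0 E// pmulr_llt0 ?invr_gt0//; lra.
Qed.

Lemma y_cases : (exists2 th, K th & ev (fun w => y w = th w)) \/
  (forall th, K th -> exists2 s : R, s = 1 \/ s = -1 & ev (fun w => 0 < s * (y w - th w))).
Proof.
have [h|h] := pselect (exists2 th, K th & ev (fun w => y w = th w)); first by left.
right=> th Kth; have [h1|h1|h1] := ydec Kth.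
- by exists (-1); [right|apply: ev_mp h1 _ => w ?; lra].
- by exfalso; apply: h; exists th.
- by exists 1; [left|apply: ev_mp h1 _ => w ?; lra].
Qed.

(** If no [y - th] is infinitely far in size from all of [K], then for each [th] some positive [a]
    is such that neither [s * (y - th) / a] nor its inverse is infinitesimal. This quotient is
    decided against constants, so it has a finite nonzero limit. *)
Lemma y_imm : (forall th, K th -> exists2 s : R, s = 1 \/ s = -1 & ev (fun w => 0 < s * (y w - th w))) ->
  (exists th (s : R), [/\ K th, s = 1 \/ s = -1, ev (fun w => 0 < s * (y w - th w)) &
     forall a, K a -> ev (fun w => 0 < a w) ->
      to0 (fun w => s * (y w - th w) / a w) \/ to0 (fun w => a w / (s * (y w - th w)))]) \/
  (forall th, K th -> exists b, [/\ K b, ev (fun w => b w != 0) &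
     exists2 l, l != 0 & to0 (fun w => (y w - th w) / b w - l)]).
Proof.
move=> hs; match goal with |- ?A \/ _ => have [h|h] := pselect A; first by left end.
right=> th Kth; have [s sE sp] := hs _ Kth.
have [a [Ka a0 n1 n2]] : exists a, [/\ K a, ev (fun w => 0 < a w),
    ~ to0 (fun w => s * (y w - th w) / a w) & ~ to0 (fun w => a w / (s * (y w - th w)))].
  apply: contrapT => nh; apply: h; exists th, s; split=> // a Ka a0.
  apply: contrapT => /not_orP[n1 n2]; apply: nh; by exists a.
exists a; split=> //; first by apply: ev_mp a0 _ => w; rewrite lt0r => /andP[].
have da : dcd G (fun w => s * (y w - th w) / a w) by move=> t; exact: y_shift.
have [[C hC]|hi] := dcd_bnd FG da; last first.
  exfalso; apply: n2; apply: to0_eq hi; apply: ev_true => w.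
  by rewrite invfM invrK mulrC.
have [l hl] := st_lim FG da hC; exists (s * l).
  have [l0|] := eqVneq l 0; last by case: sE => -> ln; rewrite mulf_neq0// ?oppr_eq0 oner_neq0.
  by exfalso; apply: n1; apply: to0_eq hl; apply: ev_true => w; rewrite l0 subr0.
apply: to0_eq (to0Z FG s hl); apply: ev_true => w; case: sE => ->; ring.
Qed.

(** Three cases: [y] is already in [K], it brings a new order of magnitude, or the extension is
    immediate. The minimality clause serves to identify [L] with the germs of D-functions. *)
Lemma ext_thm : exists L, [/\ anfield G L, K `<=` L /\ L y,
   forall P, anclosed P -> K `<=` P -> P y -> L `<=` P &
   (exists2 th, K th & ev (fun w => y w = th w)) \/
   forall I (f : I -> Om -> R), (forall i, L (f i)) -> prepared f].
Proof.
have [[th Kth yE]|hs] := y_cases.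
  exists K; split=> //; last by left; exists th.
  by split=> //; apply: (af_eqv KA Kth); apply: ev_mp yE _ => w ->.
have [[th [s [Kth sE z0 sep]]]|imm] := y_imm hs.
  pose z w := s * (y w - th w).
  have [LA [KL Lz]] := mono_ext_anfield FG KA z0 sep.
  exists (mono_extn G K z); split=> //.
  - split=> //; have h := KD LA (KL _ Kth) (KZ LA s Lz).
    by apply: Keqv h _ => w; rewrite /z; case: sE => ->; ring.
  - move=> P PA KP Py.
    have Pz : P z.
      apply: (ac_mul PA); first exact: (ac_cst PA).
      have := ac_add PA Py (ac_mul PA (ac_cst PA (-1)) (KP _ Kth)).
      by rewrite (_ : (fun w => _) = (fun w => y w - th w))//; apply/funext => w; rewrite mulN1r.
    have Pzq q : P (fun w => z w `^ ratr q).
      have := ratr_closed q (ac_cst PA) (ac_mul PA) (ac_inv PA) (ac_root PA) Pz.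
      move=> h; apply: (ac_eqv PA h); apply: ev_mp z0 _ => w zw.
      by rewrite gtr0_norm.
    have Pm a q m : K a -> ev (fun w => m w = zmon z a q w) -> P m.
      move=> Ka mE; apply: (ac_eqv PA (f := zmon z a q)).
        by apply: (ac_mul PA) => //; exact: KP.
      by apply: ev_mp mE _ => w ->.
    apply: (extn_sub PA).
      by move=> m [a [q [Ka _ mE]]]; exact: (Pm a q).
    by move=> m [a [q [Ka mE]]]; exact: (Pm a q).
  - right=> I f Lf.
    have /choice[d hd] i : exists d : {T : finType & (T -> Om -> R) * ((T -> R) -> R) * (Om -> R) * rat}%type,
        [/\ K (tagged d).1.2, forall t, Emon G K z ((tagged d).1.1.1 t) /\ to0 ((tagged d).1.1.1 t),
          ang (tagged d).1.1.2, (tagged d).1.1.2 (fun=> 0) != 0 &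
          ev (fun w => f i w = (tagged d).1.2 w * z w `^ ratr (tagged d).2 *
             (tagged d).1.1.2 (fun t => (tagged d).1.1.1 t w))].
      have [h|[m [T [e [W [[a [q [Ka _ mE]]] Ee Wa W0 h]]]]]] := Lf i.
        exists (existT _ (void : finType) (fun _ _ => 0, fun=> 1, fun=> 0, 0)); split=> //=.
        + exact: (Kcst KA).
        + exact: ang_cst.
        + by apply: ev_mp h _ => w ->; rewrite !mul0r.
      exists (existT _ T (e, W, a, q)); split=> //=.
      by apply: ev_mp2 h mE _ => w -> ->.
    pose e (t : {i : I & tag (d i)}) := (tagged (d (tag t))).1.1.1 (tagged t).
    have Ee t : Emon G K z (e t) /\ to0 (e t) by have [_ h _ _ _] := hd (tag t); exact: h.
    have [p [A [B [S [c [g [p0 [KA1 KB1] [v0 u0] [Kc ga] eE]]]]]]] := merge_mono FG KA z0 Ee.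
    exists th, s, p, A, B, S, c, (fun i => (tagged (d i)).1.2), (fun i => (tagged (d i)).2),
      (fun i x => (tagged (d i)).1.1.2 (fun t => g (Tagged (fun i => tag (d i)) t) x)).
    split=> // i; have [Ka Ei Wa W0 h] := hd i; split=> //.
    + by apply: (ang_comp Wa) => t; have [] := ga (Tagged (fun i => tag (d i)) t).
    + rewrite (_ : (fun t => _) = fun=> 0)//; apply/funext => t.
      by have [] := ga (Tagged (fun i => tag (d i)) t).
    + have hE := ev_all FG eE; apply: ev_mp2 h hE _ => w -> hE'.
      congr (_ * _); apply: (congr1 (tagged (d i)).1.1.2); apply/funext => t.
      exact: (hE' (Tagged (fun i => tag (d i)) t)).
have [LA [KL Ly]] := imm_ext_anfield FG KA imm.
exists (imm_ext G K y); split=> //.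
- move=> P PA KP Py; apply: (extn_sub PA).
    by move=> m [Km _]; exact: KP.
  move=> e [Ke|[th [b [Kth Kb b0 zE]]]]; first exact: KP.
  apply: (ac_eqv PA (f := fun w => (y w + -1 * th w) * (b w)^-1)).
    apply: (ac_mul PA); last by apply: (ac_inv PA); exact: KP.
    apply: (ac_add PA) => //; apply: (ac_mul PA); [exact: (ac_cst PA)|exact: KP].
  by apply: ev_mp zE _ => w ->; rewrite mulN1r.
- right=> I f Lf.
  have /choice[d hd] i : exists d : {T : finType & (T -> Om -> R) * ((T -> R) -> R) * (Om -> R)}%type,
      [/\ K (tagged d).2, forall t, KZset G K y ((tagged d).1.1 t) /\ to0 ((tagged d).1.1 t),
        ang (tagged d).1.2, (tagged d).1.2 (fun=> 0) != 0 &
        ev (fun w => f i w = (tagged d).2 w * (tagged d).1.2 (fun t => (tagged d).1.1 t w))].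
    have [h|[m [T [e [W [[Km _] Ee Wa W0 h]]]]]] := Lf i.
      exists (existT _ (void : finType) (fun _ _ => 0, fun=> 1, fun=> 0)); split=> //=.
      + exact: (Kcst KA).
      + exact: ang_cst.
      + by apply: ev_mp h _ => w ->; rewrite !mul0r.
    by exists (existT _ T (e, W, m)).
  pose e (t : {i : I & tag (d i)}) := (tagged (d (tag t))).1.1 (tagged t).
  have Ee t : KZset G K y (e t) /\ to0 (e t) by have [_ h _ _ _] := hd (tag t); exact: h.
  have [z [la [ep [de [[th [b [Kth Kb b0 zE]]] z0 Kep Kde eE]]]]] := merge_imm FG KA imm Ee.
  have [s sE sp] := hs _ Kth.
  pose TT := {i : I & tag (d i)}.
  pose c (t : TT + TT) := match t with inl t => ep t | inr t => de t end.
  have vE : ev (fun w => s * (b w)^-1 * zeta (fun w => s * (y w - th w)) 1%:R w = z w).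
    apply: ev_mp2 zE sp _ => w -> h; rewrite /zeta invr1 powRr1 ?ltW//.
    by case: sE => ->; rewrite ?mul1r ?mulN1r ?mulNr ?mulrN ?opprK mulrC.
  (* In the immediate case neither roots nor inverse powers of [z] occur: [p = 1], the exponents
     [r i] are 0, and [B = 0]. *)
  exists th, s, 1%N, (fun w => s * (b w)^-1), (fun=> 0), (TT + TT)%type, c,
    (fun i => (tagged (d i)).2), (fun=> 0),
    (fun i x => (tagged (d i)).1.2 (fun t => (fun t => (la t + x (Some (Some (inl t)))) * x (Some None) + x (Some (Some (inr t))))
         (Tagged (fun i => tag (d i)) t))).
  split=> //.
  + split; split.
    * by apply: (KZ KA); exact: (KV KA).
    * by apply: to0_eq z0; apply: ev_mp vE _ => w ->.
    * exact: (Kcst KA).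
    * by apply: to0_eq (to0_0 FG); apply: ev_true => w; rewrite mul0r.
  + by case=> t /=; [exact: Kep|exact: Kde].
  + move=> i; have [Ka Ei Wa W0 h] := hd i; split=> //.
    * apply: (ang_comp (g := fun t x => (fun t => (la t + x (Some (Some (inl t)))) * x (Some None) +
        x (Some (Some (inr t)))) (Tagged (fun i => tag (d i)) t)) Wa) => t; last by rewrite mulr0 addr0.
      apply: angD; last exact: ang_var.
      by apply: angM; [apply: angD; [exact: ang_cst|exact: ang_var]|exact: ang_var].
    * rewrite (_ : (fun t => _) = fun=> 0)//; apply/funext => t /=.
      by rewrite mulr0 addr0.
    * have hE := ev_all FG eE; apply: ev_mp2 (ev_and FG h vE) hE _ => w [-> h1] hE'.
      rewrite raddf0 powRr0 mulr1; congr (_ * _); apply: (congr1 (tagged (d i)).1.2); apply/funext => t /=.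
      by rewrite h1 -(hE' (Tagged (fun i => tag (d i)) t)).
Qed.

End FieldExtension.

(** * Cell decomposition and quantifier elimination *)

Section DFunctions.
Variable R : realType.

(* In the roots the absolute value makes every constructor total; [x^-1] is [0]
   at [0]. *)
Inductive Dfun n : ('rV[R]_n -> R) -> Prop :=
| D_coord i : Dfun (fun x => x 0 i)
| D_cst a : Dfun (fun=> a)
| D_add f g : Dfun f -> Dfun g -> Dfun (fun x => f x + g x)
| D_mul f g : Dfun f -> Dfun g -> Dfun (fun x => f x * g x)
| D_inv f : Dfun f -> Dfun (fun x => (f x)^-1)
| D_root f p : Dfun f -> Dfun (fun x => `|f x| `^ (p.+1%:R)^-1)
| D_ran k (f : 'rV[R]_k -> R) (g : 'I_k -> 'rV[R]_n -> R) : restricted_analytic f ->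
    (forall i, Dfun (g i)) -> Dfun (fun x => f (\row_i g i x)).

Definition Dset n (B : set 'rV[R]_n) := Dfun (fun x => (`[< B x >])%:R).

Lemma Deq n (f g : 'rV[R]_n -> R) : Dfun f -> (forall x, f x = g x) -> Dfun g.
Proof. by move=> Df fg; rewrite (_ : g = f)//; apply/funext. Qed.

Lemma DZ n a (f : 'rV[R]_n -> R) : Dfun f -> Dfun (fun x => a * f x).
Proof. by move=> Df; exact: D_mul (D_cst _ a) Df. Qed.

Lemma DB n (f g : 'rV[R]_n -> R) : Dfun f -> Dfun g -> Dfun (fun x => f x - g x).
Proof. by move=> Df Dg; apply: Deq (D_add Df (DZ (-1) Dg)) _ => x; rewrite mulN1r. Qed.

Lemma Dnorm n (f : 'rV[R]_n -> R) : Dfun f -> Dfun (fun x => `|f x|).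
Proof. by move=> Df; apply: Deq (D_root 0 Df) _ => x; rewrite invr1 powRr1. Qed.

Lemma Dmax n (f g : 'rV[R]_n -> R) : Dfun f -> Dfun g -> Dfun (fun x => Num.max (f x) (g x)).
Proof.
move=> Df Dg; apply: Deq (DZ 2^-1 (D_add (D_add Df Dg) (Dnorm (DB Df Dg)))) _ => x.
have [h|h] := leP (f x) (g x).
  by rewrite ler0_norm ?subr_le0//; field.
by rewrite gtr0_norm ?subr_gt0//; field.
Qed.

Lemma Dmin n (f g : 'rV[R]_n -> R) : Dfun f -> Dfun g -> Dfun (fun x => Num.min (f x) (g x)).
Proof.
move=> Df Dg; apply: Deq (DB (D_add Df Dg) (Dmax Df Dg)) _ => x.
by have [h|h] := leP (f x) (g x); rewrite ?addrK// addrC addKr.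
Qed.

Lemma Dset_eq n (B C : set 'rV[R]_n) : Dset B -> (forall x, B x <-> C x) -> Dset C.
Proof. by move=> DB BC; rewrite (_ : C = B)//; apply/seteqP; split=> x /BC. Qed.

(** Because [0^-1 = 0], the quotient of [Num.max (f x) 0] by itself is the indicator of the set. *)
Lemma Dset_gt0 n (f : 'rV[R]_n -> R) : Dfun f -> Dset [set x | 0 < f x].
Proof.
move=> Df; have Dm := Dmax Df (D_cst _ 0).
apply: Deq (D_mul Dm (D_inv Dm)) _ => x; case: asboolP => /= h.
  by rewrite max_l ?(ltW h)// divff// gt_eqF.
by rewrite max_r ?mul0r// leNgt; exact/negP.
Qed.

Lemma Dset_not n (B : set 'rV[R]_n) : Dset B -> Dset (~` B).
Proof.
move=> DB'; apply: Deq (DB (D_cst _ 1) DB') _ => x.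
by rewrite asbool_neg; case: asboolP; rewrite ?subrr ?subr0.
Qed.

Lemma Dset_and n (B C : set 'rV[R]_n) : Dset B -> Dset C -> Dset (B `&` C).
Proof.
move=> DB' DC; apply: Deq (D_mul DB' DC) _ => x.
by rewrite asbool_and; do 2 case: asboolP => _; rewrite ?mulr0 ?mul0r ?mulr1.
Qed.

Lemma Dset_or n (B C : set 'rV[R]_n) : Dset B -> Dset C -> Dset (B `|` C).
Proof.
move=> DB' DC; have := Dset_not (Dset_and (Dset_not DB') (Dset_not DC)).
by rewrite setCI !setCK.
Qed.

Lemma Dset_lt n (f g : 'rV[R]_n -> R) : Dfun f -> Dfun g -> Dset [set x | f x < g x].
Proof. by move=> Df Dg; apply: Dset_eq (Dset_gt0 (DB Dg Df)) _ => x /=; rewrite subr_gt0. Qed.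

Lemma Dset_le n (f g : 'rV[R]_n -> R) : Dfun f -> Dfun g -> Dset [set x | f x <= g x].
Proof.
move=> Df Dg; apply: Dset_eq (Dset_not (Dset_lt Dg Df)) _ => x /=.
by rewrite leNgt; split=> /negP.
Qed.

Lemma Dset_eqf n (f g : 'rV[R]_n -> R) : Dfun f -> Dfun g -> Dset [set x | f x = g x].
Proof.
move=> Df Dg; apply: Dset_eq (Dset_and (Dset_le Df Dg) (Dset_le Dg Df)) _ => x /=.
by split=> [[h1 h2]|->//]; apply/eqP; rewrite eq_le h1 h2.
Qed.

Lemma DsetT n : Dset [set: 'rV[R]_n].
Proof. by apply: Deq (D_cst _ 1) _ => x; rewrite asboolT. Qed.

Lemma Dset0 n : Dset (set0 : set 'rV[R]_n).
Proof. by rewrite -setCT; exact/Dset_not/DsetT. Qed.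

Lemma Dset_bigor n N (B : 'I_N -> set 'rV[R]_n) : (forall i, Dset (B i)) ->
  Dset [set x | exists i, B i x].
Proof.
elim: N B => [|N IH] B DB'; first by apply: Dset_eq (@Dset0 n) _ => x; split=> // -[[]].
apply: Dset_eq (Dset_or (DB' ord0) (IH (fun i => B (lift ord0 i)) (fun i => DB' _))) _ => x.
split; first by case=> [h|[i h]]; [exists ord0|exists (lift ord0 i)].
by case=> i; case: (unliftP ord0 i) => [j ->|->] h; [right; exists j|left].
Qed.

Lemma Dif n (B : set 'rV[R]_n) f g : Dset B -> Dfun f -> Dfun g ->
  Dfun (fun x => if `[< B x >] then f x else g x).
Proof.
move=> DB' Df Dg; apply: Deq (D_add (D_mul DB' Df) (D_mul (Dset_not DB') Dg)) _ => x.
by rewrite asbool_neg; case: asboolP; rewrite ?mul1r ?mul0r ?addr0 ?add0r.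
Qed.

Lemma Dcomp n k (f : 'rV[R]_k -> R) (g : 'I_k -> 'rV[R]_n -> R) : Dfun f ->
  (forall i, Dfun (g i)) -> Dfun (fun x => f (\row_i g i x)).
Proof.
move=> Df Dg; elim: Df => {f} [i|a|f h _ IHf _ IHh|f h _ IHf _ IHh|f _ IHf|f p _ IHf|l f h rf _ IH].
- by apply: Deq (Dg i) _ => x; rewrite mxE.
- exact: D_cst.
- exact: D_add.
- exact: D_mul.
- exact: D_inv.
- exact: D_root.
- exact: (D_ran rf IH).
Qed.

Definition lst n (z : 'rV[R]_(n + 1)) : R := z 0 (rshift n ord0).

Lemma lst_row n (x : 'rV[R]_n) (t : R) : lst (row_mx x t%:M) = t.
Proof. by rewrite /lst row_mxEr mxE eqxx mulr1n. Qed.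

Lemma row_lst n (z : 'rV[R]_(n + 1)) : row_mx (lsubmx z) (lst z)%:M = z.
Proof.
rewrite -[RHS]hsubmxK; congr row_mx; apply/rowP => i; rewrite (ord1 i) !mxE eqxx mulr1n.
by rewrite /lst; congr (z _ _).
Qed.

Lemma Dlsub n (f : 'rV[R]_n -> R) : Dfun f -> Dfun (fun z : 'rV[R]_(n + 1) => f (lsubmx z)).
Proof.
move=> Df; apply: Deq (Dcomp Df (fun i => D_coord (lshift 1 i))) _ => z.
by congr f; apply/rowP => i; rewrite !mxE.
Qed.

Section Pull.
Variables (Om : Type) (G : set_system Om).
Hypothesis FG : ProperFilter G.
Local Notation ev := (ev G).
Local Notation to0 := (to0 G).

Definition pull n (pi : Om -> 'rV[R]_n) : set (Om -> R) :=
  [set f | exists g, Dfun g /\ ev (fun w => f w = g (pi w))].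

Definition decides n (pi : Om -> 'rV[R]_n) := forall f, Dfun f ->
  [\/ ev (fun w => f (pi w) < 0), ev (fun w => f (pi w) = 0) | ev (fun w => 0 < f (pi w))].

(** Only the analytic clause has content: eventually the arguments are below the radius, and there
    the germ is a restricted analytic function of rescaled arguments. *)
Lemma pull_anclosed n (pi : Om -> 'rV[R]_n) : anclosed G (pull pi).
Proof.
split.
- by move=> a; exists (fun=> a); split; [exact: D_cst|exact: ev_true].
- move=> f g [f' [Df fE]] [g' [Dg gE]]; exists (fun x => f' x + g' x).
  by split; [exact: D_add|apply: ev_mp2 fE gE _ => w -> ->].
- move=> f g [f' [Df fE]] [g' [Dg gE]]; exists (fun x => f' x * g' x).
  by split; [exact: D_mul|apply: ev_mp2 fE gE _ => w -> ->].
- move=> f [f' [Df fE]]; exists (fun x => (f' x)^-1).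
  by split; [exact: D_inv|apply: ev_mp fE _ => w ->].
- move=> f p [f' [Df fE]]; exists (fun x => `|f' x| `^ (p.+1%:R)^-1).
  by split; [exact: D_root|apply: ev_mp fE _ => w ->].
- by move=> f g [f' [Df fE]] fg; exists f'; split=> //; apply: ev_mp2 fE fg _ => w -> ->.
move=> T F c FA cP.
have /choice[g hg] t : exists g, Dfun g /\ ev (fun w => c t w = g (pi w)) by exact: (cP t).1.
pose F' (x : 'I_#|T| -> R) := F (fun t => x (enum_rank t)).
have F'A : ang F' by apply: (ang_comp FA) => // t; exact: ang_var.
have [rho [f [rho0 fr fE]]] := ang_restricted F'A.
exists (fun x => f (\row_i (g (enum_val i) x / rho))); split.
  apply: (D_ran fr (g := fun i x => g (enum_val i) x / rho)) => i.
  by apply: D_mul; [have [] := hg (enum_val i)|exact: D_cst].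
have cg : ev (fun w => forall t, c t w = g t (pi w)) by apply: ev_all => t; have [] := hg t.
apply: ev_mp2 cg (small_ev FG rho0 (fun t => (cP t).2)) _ => w cE cs.
rewrite (_ : F _ = F' (fun i => c (enum_val i) w)); last first.
  by congr F; apply/funext => t; rewrite enum_rankK.
rewrite fE; last by move=> i; exact: cs.
by congr f; apply/rowP => i; rewrite !mxE cE.
Qed.

(** For a restricted analytic function, either some argument eventually leaves the cube, where the
    value is 0, or all arguments have limits in the cube and the function is analytic in the
    infinitesimal deviations from the limit point. *)
Lemma Dfun_in n (pi : Om -> 'rV[R]_n) L f : anfield G L -> (forall i, L (fun w => pi w 0 i)) ->
  Dfun f -> L (fun w => f (pi w)).
Proof.
move=> LA Lc; elim=> {f} [i|a|f h _ IHf _ IHh|f h _ IHf _ IHh|f _ IHf|f p _ IHf|k f h rf _ IH].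
- exact: Lc.
- exact: (af_cst LA).
- exact: (af_add LA).
- exact: (af_mul LA).
- exact: (af_inv LA).
- exact: (af_root LA).
have [[i hi]|nb] := pselect (exists i, ev (fun w => 1 < `|h i (pi w)|)).
  apply: (af_eqv LA (af_cst LA 0)); apply: ev_mp hi _ => w hi.
  have [U [F [_ _ _ _ ->//]]] := rf.
  move=> /(_ i); rewrite mxE -ler_norml => /le_lt_trans/(_ hi).
  by rewrite ltxx.
have bd i : ev (fun w => `|h i (pi w)| <= 1).
  have [//|h1] := Kle FG LA (Knorm LA (IH i)) (af_cst LA 1).
  by exfalso; apply: nb; exists i.
have /choice[l hl] i : exists l, to0 (fun w => h i (pi w) - l).
  by apply: (st_lim FG (Kdcd FG LA (IH i)) (C := 1)); exact: bd.
have l1 i : `|l i| <= 1.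
  rewrite leNgt; apply/negP => l1; have e0 : 0 < (`|l i| - 1) / 2 by rewrite divr_gt0// subr_gt0.
  apply: (ev_absurd FG (bd i) (hl i _ e0)) => w h1 h2.
  have := ler_distD (h i (pi w)) (l i) 0; rewrite !subr0 => h3.
  by move: h2; rewrite distrC => h2; lra.
have cl : unit_cube (\row_i l i) by move=> i; rewrite mxE -ler_norml.
have [F [FA fF]] := restricted_local rf cl.
have Le i : L (fun w => h i (pi w) - l i) /\ to0 (fun w => h i (pi w) - l i).
  by split; [apply: (KB LA) => //; exact: (Kcst LA)|exact: hl].
apply: (af_eqv LA (af_an LA FA Le)).
apply: ev_mp (ev_all FG bd) _ => w hw.
have E : \row_i h i (pi w) = \row_i l i + \row_i (h i (pi w) - l i).
  by apply/rowP => i; rewrite !mxE addrC subrK.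
by rewrite E fF// -E => i; rewrite mxE -ler_norml.
Qed.

(** The extension [L] is closed under the constructors of [Dfun], and the germs of D-functions are
    closed in the sense required by the minimality of [L]; so the two coincide. *)
Lemma Dfield_step n (pi : Om -> 'rV[R]_(n + 1)) :
  anfield G (pull (fun w => lsubmx (pi w))) ->
  (forall th, pull (fun w => lsubmx (pi w)) th -> [\/ ev (fun w => lst (pi w) < th w),
    ev (fun w => lst (pi w) = th w) | ev (fun w => th w < lst (pi w))]) ->
  anfield G (pull pi) /\
  ((exists2 th, pull (fun w => lsubmx (pi w)) th & ev (fun w => lst (pi w) = th w)) \/
   forall (I : finType) (f : I -> Om -> R), (forall i, pull pi (f i)) ->
     prepared G (pull (fun w => lsubmx (pi w))) (fun w => lst (pi w)) f).
Proof.
move=> KA ydec; have [L [LA [KL Ly] Lmin alt]] := ext_thm FG KA ydec.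
have Kpull : pull (fun w => lsubmx (pi w)) `<=` pull pi.
  by move=> f [g [Dg fE]]; exists (fun z => g (lsubmx z)); split=> //; exact: Dlsub.
have LE : pull pi = L.
  apply/seteqP; split; last first.
    apply: Lmin => //; first exact: pull_anclosed.
    by exists (@lst n); split; [exact: D_coord|exact: ev_true].
  move=> f [g [Dg fE]]; apply: (af_eqv LA (f := fun w => g (pi w))); last first.
    by apply: ev_mp fE _ => w ->.
  apply: (Dfun_in LA _ Dg) => i; rewrite -(splitK i); case: (fintype.split i) => j /=.
    apply: KL; exists (fun x => x 0 j); split; first exact: D_coord.
    by apply: ev_true => w; rewrite mxE.
  by rewrite (ord1 j).
by rewrite LE.
Qed.

(** Germs of functions on a one-point space are constants, so every infinitesimal is eventually 0
    and a family is simply evaluated at the origin. *)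
Lemma Dfield0 (pi : Om -> 'rV[R]_0) : anfield G (pull pi).
Proof.
have [c0 cD cM cV cR cE cA] := pull_anclosed pi.
have cst f : pull pi f -> exists a, ev (fun w => f w = a).
  move=> [g [_ fE]]; exists (g 0); apply: ev_mp fE _ => w ->.
  by congr g; exact: thinmx0.
split=> //.
- move=> f /cst[a fE]; have [a0|a0|a0] := ltgtP a 0; [constructor 1|constructor 3|constructor 2];
    by apply: ev_mp fE _ => w ->.
- move=> A T F e Ff he; have e0 : ev (fun w => forall t, e t w = 0).
    apply: ev_all => t; have [/cst[a eE] t0] := he t; apply: ev_mp (eE) _ => w ->.
    apply/esym; apply: (to0_uniq FG (f := fun=> 0)).
      by rewrite subrr; exact: to0_0.
    by apply: to0_eq (to0N FG t0); apply: ev_mp eE _ => w' ->; rewrite sub0r.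
  have [[a Fa]|nF] := pselect (exists a, F a (fun=> 0) != 0).
    right; exists (fun=> 1), T, (fun=> fun=> 0), F; split=> //.
    + by move=> t; split; [exact: c0|exact: to0_0].
    + by exists a.
    + apply: ev_mp e0 _ => w e0; split=> [|b]; first exact: oner_neq0.
      by rewrite mul1r; congr (F b _); apply/funext => t; rewrite e0.
  left; apply: ev_mp e0 _ => w e0 a.
  rewrite (_ : (fun t => e t w) = fun=> 0); last by apply/funext => t; rewrite e0.
  by apply/eqP/negPn/negP => h; apply: nF; exists a.
Qed.

End Pull.

Lemma Dfield n (Om : Type) (G : set_system Om) (FG : ProperFilter G) (pi : Om -> 'rV[R]_n) :
  decides G pi -> anfield G (pull G pi).
Proof.
elim: n pi => [|n IH] pi; first by move=> _; exact: Dfield0.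
suff H (pi' : Om -> 'rV[R]_(n + 1)) : decides G pi' -> anfield G (pull G pi').
  by move: pi; rewrite -[n.+1]/(1 + n)%N; move: H; rewrite addnC.
move=> dec.
have dec' : decides G (fun w => lsubmx (pi' w)) by move=> f Df; exact: dec (Dlsub Df).
have [|//] := Dfield_step FG (IH _ dec').
move=> th [g [Dg gE]]; have [h|h|h] := dec _ (DB (D_coord (rshift n ord0)) (Dlsub Dg));
  [constructor 1|constructor 2|constructor 3]; apply: ev_mp2 h gE _ => w h ->.
- by rewrite -subr_lt0.
- by apply/eqP; rewrite -subr_eq0; apply/eqP.
- by rewrite -subr_gt0.
Qed.

End DFunctions.

Section UltraCover.
Variable T : Type.

(** Compactness: if no finite subfamily covered, the complements of the members would generate a
    proper filter, and an ultrafilter above it would contain both a member of [CC] and its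
    complement. *)
Lemma ultra_cover (CC : set (set T)) :
  (forall q : set_system T, UltraFilter q -> exists2 C, CC C & q C) ->
  exists N (C : 'I_N -> set T), (forall i, CC (C i)) /\ forall x, exists i, C i x.
Proof.
move=> h; apply: contrapT => ncov.
pose F : set_system T := [set P | exists N (C : 'I_N -> set T),
  (forall i, CC (C i)) /\ forall x, (forall i, ~ C i x) -> P x].
have FF : ProperFilter F.
  split.
    move=> [N [C [CCi hC]]]; apply: ncov; exists N, C; split=> // x.
    by apply: contrapT => nx; apply: (hC x) => i Cx; apply: nx; exists i.
  split.
  - by exists 0%N, (fun=> set0); split=> [[]|].
  - move=> P Q [N [C [Ci hC]]] [M [C' [Ci' hC']]].
    exists (N + M)%N, (fun i => match fintype.split i with inl j => C j | inr j => C' j end); split.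
      by move=> i; case: (fintype.split i).
    move=> x nx; split.
      by apply: hC => j Cj; apply: (nx (lshift M j)); rewrite (unsplitK (inl j)).
    by apply: hC' => j Cj; apply: (nx (rshift N j)); rewrite (unsplitK (inr j)).
  - by move=> P Q PQ [N [C [Ci hC]]]; exists N, C; split=> // x /hC /PQ.
have [q [qU Fq]] := ultraFilterLemma FF.
have [C CCC qC] := h q qU.
have : F (~` C) by exists 1%N, (fun=> C); split=> // x /(_ ord0).
move=> /Fq qnC; by have [x []] := filter_ex (filterI qC qnC).
Qed.

Lemma ultra_or (q : set_system T) (P Q S : set T) : UltraFilter q -> (forall x, [\/ P x, Q x | S x]) ->
  [\/ q P, q Q | q S].
Proof.
move=> qU h; have [qP|nP] := in_ultra_setVsetC P qU; first by constructor 1.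
have [qQ|nQ] := in_ultra_setVsetC Q qU; first by constructor 2.
by constructor 3; apply: filterS2 nP nQ => x nP nQ; have [] := h x.
Qed.

End UltraCover.

(** * Cells over definable bases, and the filters generated by them *)

Section Cells.
Variables (R : realType) (n : nat).
Local Notation X := 'rV[R]_n.
Local Notation Z := 'rV[R]_(n + 1).

Definition bound := option (X -> R).
Definition Dbound (b : bound) := if b is Some l then Dfun l else True.
Definition above (b : bound) x t := if b is Some l then l x < t else true.
Definition below (b : bound) x t := if b is Some l then t < l x else true.

(** A bound [None] is an infinite end; fibres may be empty. *)
Definition ocell (B : set X) (lo hi : bound) : set Z :=
  [set z | [/\ B (lsubmx z), above lo (lsubmx z) (lst z) & below hi (lsubmx z) (lst z)]].
Definition gcell (B : set X) (th : X -> R) : set Z :=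
  [set z | B (lsubmx z) /\ lst z = th (lsubmx z)].

Definition is_ocell C := exists B lo hi, [/\ Dset B, Dbound lo, Dbound hi & C = ocell B lo hi].
Definition is_gcell C := exists B th, [/\ Dset B, Dfun th & C = gcell B th].
Definition is_cell C := is_ocell C \/ is_gcell C.

Lemma ocellI C C' : is_ocell C -> is_ocell C' -> is_ocell (C `&` C').
Proof.
move=> [B [lo [hi [DB' Dlo Dhi ->]]]] [B1 [lo1 [hi1 [DB1 Dlo1 Dhi1 ->]]]].
exists (B `&` B1).
exists (match lo, lo1 with Some l, Some l1 => Some (fun x => Num.max (l x) (l1 x))
  | Some l, None => Some l | None, o => o end).
exists (match hi, hi1 with Some l, Some l1 => Some (fun x => Num.min (l x) (l1 x))
  | Some l, None => Some l | None, o => o end).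
split; first exact: Dset_and.
- by case: lo lo1 Dlo Dlo1 => [l|] [l1|] //=; exact: Dmax.
- by case: hi hi1 Dhi Dhi1 => [l|] [l1|] //=; exact: Dmin.
apply/seteqP; split=> z.
  move=> [[h1 h2 h3] [h4 h5 h6]]; split=> //.
  - by case: lo lo1 h2 h5 {Dlo Dlo1} => [l|] [l1|] //= h2 h5; rewrite gt_max h2.
  - by case: hi hi1 h3 h6 {Dhi Dhi1} => [l|] [l1|] //= h3 h6; rewrite lt_min h3.
move=> [[h1 h4] h2 h3].
have [{}h2 h5] : above lo (lsubmx z) (lst z) /\ above lo1 (lsubmx z) (lst z).
  by move: h2; case: lo lo1 {Dlo Dlo1} => [l|] [l1|] //=; rewrite gt_max => /andP.
have [{}h3 h6] : below hi (lsubmx z) (lst z) /\ below hi1 (lsubmx z) (lst z).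
  by move: h3; case: hi hi1 {Dhi Dhi1} => [l|] [l1|] //=; rewrite lt_min => /andP.
by [].
Qed.

Lemma DsetTb : Dset [set x : X | true].
Proof. exact: (Dset_eq (@DsetT R n)). Qed.

Lemma Dabove lo (th : X -> R) : Dbound lo -> Dfun th -> Dset [set x | above lo x (th x)].
Proof. by case: lo => [l|] /= Dl Dth; [exact: Dset_lt|exact: DsetTb]. Qed.

Lemma Dbelow hi (th : X -> R) : Dbound hi -> Dfun th -> Dset [set x | below hi x (th x)].
Proof. by case: hi => [l|] /= Dl Dth; [exact: Dset_lt|exact: DsetTb]. Qed.

(** Stability under intersection makes the cells of an ultrafilter a filter base, and later permits
    inclusion and exclusion over a cover. *)
Lemma cellI C C' : is_cell C -> is_cell C' -> is_cell (C `&` C').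
Proof.
have og (D D' : set Z) : is_ocell D -> is_gcell D' -> is_gcell (D `&` D').
  move=> [B [lo [hi [DB' Dlo Dhi ->]]]] [B1 [th [DB1 Dth ->]]].
  exists (B `&` [set x | above lo x (th x)] `&` [set x | below hi x (th x)] `&` B1), th; split=> //.
    by apply: Dset_and => //; apply: Dset_and; [apply: Dset_and => //; exact: Dabove|exact: Dbelow].
  apply/seteqP; split=> z /=.
    by move=> [[h1 h2 h3] [h4 h5]]; rewrite /gcell /= -!h5.
  by move=> [[[[h1 h2] h3] h4] h5]; rewrite /ocell /gcell /= h5.
move=> [h|h] [h'|h'].
- by left; exact: ocellI.
- by right; exact: og.
- by right; rewrite setIC; exact: og.
right; move: h h' => [B [th [DB' Dth ->]]] [B1 [th1 [DB1 Dth1 ->]]].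
exists (B `&` B1 `&` [set x | th x = th1 x]), th; split=> //.
  by apply: Dset_and; [exact: Dset_and|exact: Dset_eqf].
apply/seteqP; split=> z /=.
  by move=> [[h1 h2] [h3 h4]]; rewrite /gcell /= -h2 -h4.
by move=> [[[h1 h2] h3] h4]; rewrite /gcell /= h4 h3.
Qed.

Lemma ocell_lsub (B : set X) : Dset B -> is_cell [set z : Z | B (lsubmx z)].
Proof.
move=> DB'; left; exists B, None, None; split=> //.
by apply/seteqP; split=> z // -[].
Qed.

(** Coarser than [q]: an eventual statement holds on a whole cell of [q]. Along [q] itself all
    comparisons would be decided for free, but identities would hold only on sets without
    structure. *)
Definition cfilter (q : set_system Z) : set_system Z :=
  [set P | exists C, [/\ is_cell C, q C & C `<=` P]].

Section CellFilter.
Variable q : set_system Z.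
Hypothesis qU : UltraFilter q.
Local Notation G := (cfilter q).

Lemma cfilter_proper : ProperFilter G.
Proof.
split.
  by move=> [C [_ qC C0]]; have [z /C0] := filter_ex qC.
split.
- exists setT; split=> //; last exact: filterT.
  by have := ocell_lsub (@DsetT R n).
- move=> P Q [C [cC qC CP]] [C' [cC' qC' CQ]]; exists (C `&` C'); split.
  + exact: cellI.
  + exact: filterI.
  + by move=> z [/CP ? /CQ].
- by move=> P Q PQ [C [cC qC CP]]; exists C; split=> // z /CP /PQ.
Qed.

Lemma cfilter_cell C : is_cell C -> q C -> G C.
Proof. by move=> cC qC; exists C; split. Qed.

#[local] Instance FG : ProperFilter G := cfilter_proper.

Lemma cfilter_sign (g : X -> R) : Dfun g ->
  [\/ G [set z | lst z < g (lsubmx z)], G [set z | lst z = g (lsubmx z)] |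
      G [set z | g (lsubmx z) < lst z]].
Proof.
move=> Dg.
have [|h|h|h] := ultra_or (P := [set z | lst z < g (lsubmx z)]) (Q := [set z | lst z = g (lsubmx z)])
  (S := [set z | g (lsubmx z) < lst z]) qU.
- move=> z; have [h|h|h] := ltgtP (lst z) (g (lsubmx z)); [constructor 1|constructor 3|constructor 2]; exact: h.
- constructor 1; apply: cfilter_cell => //; left; exists setT, None, (Some g); split=> //; first exact: DsetT.
  by apply/seteqP; split=> z // -[].
- constructor 2; apply: cfilter_cell => //; right; exists setT, g; split=> //; first exact: DsetT.
  by apply/seteqP; split=> z // -[].
- constructor 3; apply: cfilter_cell => //; left; exists setT, (Some g), None; split=> //; first exact: DsetT.
  by apply/seteqP; split=> z // -[].
Qed.

Lemma cfilter_dec : decides G (fun z => lsubmx z).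
Proof.
move=> f Df.
have cl (B : set X) : Dset B -> q [set z | B (lsubmx z)] -> G [set z | B (lsubmx z)].
  by move=> DB' qB; apply: cfilter_cell => //; exact: ocell_lsub.
have [|h|h|h] := ultra_or (P := [set z : Z | f (lsubmx z) < 0]) (Q := [set z | f (lsubmx z) = 0])
  (S := [set z | 0 < f (lsubmx z)]) qU.
- move=> z; have [h|h|h] := ltgtP (f (lsubmx z)) 0; [constructor 1|constructor 3|constructor 2]; exact: h.
- by constructor 1; exact: (cl _ (Dset_lt Df (D_cst _ 0))).
- by constructor 2; exact: (cl _ (Dset_eqf Df (D_cst _ 0))).
- by constructor 3; exact: (cl _ (Dset_lt (D_cst _ 0) Df)).
Qed.

Lemma cfilter_field : anfield G (pull G id) /\
  ((exists2 th, pull G (fun z => lsubmx z) th & ev G (fun z => lst z = th z)) \/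
   forall (I : finType) (f : I -> Z -> R), (forall i, pull G id (f i)) ->
     prepared G (pull G (fun z => lsubmx z)) (@lst R n) f).
Proof.
have [] := @Dfield_step R Z G FG n id (Dfield FG cfilter_dec) => //.
move=> th [g [Dg gE]]; have [h|h|h] := cfilter_sign Dg; [constructor 1|constructor 2|constructor 3];
  by apply: ev_mp2 h gE _ => w h ->.
Qed.

(** The indicator of [S] is a D-function, and germs of D-functions along the filter have a sign. *)
Lemma cfilter_set (S : set Z) : Dset S -> G S \/ G (~` S).
Proof.
move=> DS; have [FA _] := cfilter_field.
have : pull G id (fun z => (`[< S z >])%:R : R) by exists (fun z => (`[< S z >])%:R); split=> //; exact: ev_true.
move=> /(af_dec FA)[h|h|h]; [exfalso|right|left].
- have := filter_ex h => -[z]; case: asboolP => _; rewrite ?ltxx//.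
  by rewrite ltNge ler01.
- apply: ev_mp h _ => z; case: asboolP => // _ /eqP; by rewrite oner_eq0.
- by apply: ev_mp h _ => z; case: asboolP => // _; rewrite ltxx.
Qed.

End CellFilter.

Lemma cell_cover (S : set Z) : Dset S -> exists N (C : 'I_N -> set Z),
  (forall i, is_cell (C i) /\ (C i `<=` S \/ C i `<=` ~` S)) /\ forall z, exists i, C i z.
Proof.
move=> DS; apply: (@ultra_cover _ [set C | is_cell C /\ (C `<=` S \/ C `<=` ~` S)]) => q qU.
have [[C [cC qC CS]]|[C [cC qC CS]]] := cfilter_set qU DS; exists C => //; split=> //.
  by left.
by right.
Qed.

Definition dproj (S : set Z) : set X := [set x | exists t, S (row_mx x t%:M)].

Lemma proj_cell C : is_cell C -> Dset (dproj C).
Proof.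
move=> [[B [lo [hi [DB' Dlo Dhi ->]]]]|[B [th [DB' Dth ->]]]].
  have DL : Dset [set x | if lo is Some l then if hi is Some h then l x < h x else true else true].
    case: lo hi Dlo Dhi => [l|] [h|] /= Dl Dh; try exact: DsetTb.
    exact: Dset_lt.
  apply: Dset_eq (Dset_and DB' DL) _ => x; rewrite /dproj /ocell /=; split=> [[Bx h]|[t]].
    have [t [t1 t2]] : exists t, above lo x t /\ below hi x t.
      case: lo hi h {Dlo Dhi DL} => [l|] [h|] /= h1.
      - by exists ((l x + h x) / 2); split; lra.
      - by exists (l x + 1); split=> //; lra.
      - by exists (h x - 1); split=> //; lra.
      - by exists 0.
    by exists t; rewrite row_mxKl lst_row.
  rewrite row_mxKl lst_row => -[Bx h1 h2]; split=> //.
  by case: lo hi h1 h2 {Dlo Dhi DL} => [l|] [h|] //=; exact: lt_trans.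
apply: Dset_eq DB' _ => x; rewrite /dproj /gcell /=; split=> [Bx|[t]].
  by exists (th x); rewrite row_mxKl lst_row.
by rewrite row_mxKl => -[].
Qed.

(** This eliminates an existential quantifier: the cells of a finite cover that lie in [S] are
    projected one by one. *)
Lemma Dset_proj (S : set Z) : Dset S -> Dset (dproj S).
Proof.
move=> DS; have [N [C [CP cov]]] := cell_cover DS.
pose B i := if `[< C i `<=` S >] then dproj (C i) else set0.
apply: (@Dset_eq _ _ [set x | exists i, B i x]).
  apply: Dset_bigor => i; rewrite /B; case: asboolP => _; last exact: Dset0.
  by apply: proj_cell; have [] := CP i.
move=> x; split=> [[i h]|[t St]].
  by move: h; rewrite /B; case: asboolP => // CS [t /CS]; exists t.
have [i Ci] := cov (row_mx x t%:M); exists i; rewrite /B.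
have [_ [CS|CS]] := CP i; last by have := CS _ Ci.
by rewrite asboolT//; exists t.
Qed.

(** A nonempty fibre of an open cell has two points, so only graphs can lie in [S] with nonempty
    fibres; their functions are glued along the projections of these cells. *)
Lemma gsel (S : set Z) : Dset S ->
  (forall x t u, S (row_mx x t%:M) -> S (row_mx x u%:M) -> t = u) ->
  exists2 g : X -> R, Dfun g & forall x t, S (row_mx x t%:M) -> g x = t.
Proof.
move=> DS uS; have [N [C [CP cov]]] := cell_cover DS.
have hg i : exists g : X -> R, Dfun g /\ (C i `<=` S -> forall x t, C i (row_mx x t%:M) -> t = g x).
  have [[[B [lo [hi [DB' Dlo Dhi CE]]]]|[B [th [DB' Dth CE]]]] _] := CP i; last first.
    by exists th; split=> // _ x t; rewrite CE /gcell /= row_mxKl lst_row => -[].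
  exists (fun=> 0); split; first exact: D_cst.
  move=> CS x t Cx; exfalso.
  have [t' tt' Cx'] : exists2 t', t != t' & C i (row_mx x t'%:M).
    move: Cx; rewrite CE /ocell /=; case: hi {CE Dhi} => [h|] /=.
      rewrite !row_mxKl !lst_row => -[Bx h1 h2]; exists ((t + h x) / 2).
        by rewrite lt_eqF//; lra.
      rewrite row_mxKl lst_row; split=> //; last by lra.
      by case: lo h1 {Dlo} => //= l h1; lra.
    rewrite !row_mxKl !lst_row => -[Bx h1 _]; exists (t + 1); first by rewrite lt_eqF//; lra.
    rewrite row_mxKl lst_row; split=> //.
    by case: lo h1 {Dlo} => //= l h1; lra.
  by move/eqP: tt'; apply; apply: uS (CS _ Cx) (CS _ Cx').
have {hg}/choice[g hg] := hg.
pose good i := C i `<=` S.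
suff [f Df hf] : exists2 f : X -> R, Dfun f & forall x i t, good i -> C i (row_mx x t%:M) -> f x = t.
  exists f => // x t St; have [i Ci] := cov (row_mx x t%:M); apply: (hf x i) => //.
  by have [_ [//|CS]] := CP i; have := CS _ Ci.
suff [f Df hf] : exists2 f : X -> R, Dfun f &
    forall x i t, i \in enum 'I_N -> good i -> C i (row_mx x t%:M) -> f x = t.
  by exists f => // x i t; apply: hf; rewrite mem_enum.
elim: (enum 'I_N) => [|j l [f Df hf]]; first by exists (fun=> 0) => //; exact: D_cst.
have [gj|ngj] := pselect (good j); last first.
  by exists f => // x i t; rewrite in_cons => /orP[/eqP ->|]; [|exact: hf].
exists (fun x => if `[< dproj (C j) x >] then g j x else f x).
  by apply: Dif => //; [apply: proj_cell; have [] := CP j|have [] := hg j].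
move=> x i t il gi Ci; case: asboolP => [[u Cu]|nC].
  have [_ /(_ gj x u Cu) <-] := hg j; exact: uS (gj _ Cu) (gi _ Ci).
move: il; rewrite in_cons => /orP[/eqP ij|il]; last exact: hf gi Ci.
by exfalso; apply: nC; exists t; rewrite -ij.
Qed.

(** The prepared form of germs is realised on an actual cell. The cell is chosen after [rho], while
    the data of the form do not depend on [rho]; so the infinitesimals can later be made as small as
    required. *)
Lemma prep_cell (q : set_system Z) (I : finType) (f : I -> Z -> R) : UltraFilter q ->
  (forall i, Dfun (f i)) ->
  (exists2 C, is_gcell C & q C) \/
  exists (th : X -> R) (s : R) p (A B : X -> R) (S : finType) (c : S -> X -> R) (a : I -> X -> R)
    (r : I -> rat) (W : I -> (option (option S) -> R) -> R),
  let zt (z : Z) := s * (lst z - th (lsubmx z)) in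
  let v (z : Z) := A (lsubmx z) * zeta zt p%:R z in
  let u (z : Z) := B (lsubmx z) * (zeta zt p%:R z)^-1 in
  [/\ [/\ Dfun th, Dfun A, Dfun B, forall t, Dfun (c t) & forall i, Dfun (a i)],
      s = 1 \/ s = -1, (0 < p)%N, forall i, ang (W i) /\ W i (fun=> 0) != 0 &
    forall rho, 0 < rho -> exists C, [/\ is_ocell C, q C & forall z, C z ->
      [/\ 0 < zt z, small rho (fun t => c t (lsubmx z)), `|v z| <= rho /\ `|u z| <= rho &
       forall i, f i z = a i (lsubmx z) * zt z `^ ratr (r i) *
         W i (ext (ext (fun t => c t (lsubmx z)) (v z)) (u z))]]].
Proof.
move=> qU Df; have FG := cfilter_proper qU.
have [[C gC qC]|ng] := pselect (exists2 C, is_gcell C & q C); first by left; exists C.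
right; have oc C : is_cell C -> q C -> is_ocell C.
  by move=> [//|gC] qC; exfalso; apply: ng; exists C.
have [FA [[th [g [Dg gE]] yE]|prep]] := cfilter_field qU.
  exfalso; apply: ng; exists (gcell setT g); first by exists setT, g; split=> //; exact: DsetT.
  have [C [cC qC hC]] := ev_and FG gE yE.
  by apply: filterS qC => z /hC[/= h1 h2]; split=> //; rewrite h2 h1.
have [|th [s [p [A [B [S [c [a [r [W [[Kth sE] [p0 z0] [[KA' A0] [KB' B0]] Kc Wh]]]]]]]]]]] := prep I f.
  by move=> i; exists (f i); split=> //; exact: ev_true.
have [gth [Dth thE]] := Kth; have [gA [DA AE]] := KA'; have [gB [DB' BE]] := KB'.
have /choice[gc hc] t : exists g, Dfun g /\ ev (cfilter q) (fun z => c t z = g (lsubmx z)) by exact: (Kc t).1.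
have /choice[ga ha] i : exists g, Dfun g /\ ev (cfilter q) (fun z => a i z = g (lsubmx z)).
  by have [] := Wh i.
exists gth, s, p, gA, gB, S, gc, ga, r, W; split=> //.
- by split=> //; [move=> t; have [] := hc t|move=> i; have [] := ha i].
- by move=> i; have [_ Wa W0 _] := Wh i.
move=> rho rho0.
have cE : ev (cfilter q) (fun z => forall t, c t z = gc t (lsubmx z)) by apply: ev_all => t; have [] := hc t.
have aE : ev (cfilter q) (fun z => forall i, a i z = ga i (lsubmx z)) by apply: ev_all => i; have [] := ha i.
have fE : ev (cfilter q) (fun z => forall i, f i z = a i z * (s * (lst z - th z)) `^ ratr (r i) *
   W i (ext (ext (fun t => c t z) (A z * zeta (fun z => s * (lst z - th z)) p%:R z))
     (B z * (zeta (fun z => s * (lst z - th z)) p%:R z)^-1))).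
  by apply: ev_all => i; have [] := Wh i.
have [C [cC qC hC]] := ev_and FG (ev_and FG (ev_and FG thE (ev_and FG AE BE)) (ev_and FG cE aE))
  (ev_and FG (ev_and FG z0 fE) (ev_and FG (small_ev FG rho0 (fun t => (Kc t).2)) (ev_and FG (A0 _ rho0) (B0 _ rho0)))).
exists C; split=> // [|z /hC]; first exact: oc.
rewrite /zeta => -[[[h1 [h2 h3]] [h4 h5]] [[h6 h7] [h8 [h9 h10]]]].
rewrite -h1 -h2 -h3; split=> //.
  by move=> t; rewrite -h4; exact: h8.
move=> i; rewrite (h7 i) h5; congr (_ * W i (ext (ext _ _) _)).
by apply/funext => t; rewrite h4.
Qed.

End Cells.

(** * Passage between first-order formulas and D-functions *)

Section Formulas.
Variable R : realType.

Lemma Dterm n (t : an_term R n) : Dfun (fun x => an_eval x t).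
Proof.
elim: t => [i|a|t IHt u IHu|t IHt u IHu|k f rf ts IH] /=.
- exact: D_coord.
- exact: D_cst.
- exact: D_add.
- exact: D_mul.
- exact: (D_ran rf IH).
Qed.

Lemma Dformula n (phi : an_formula R n) : Dset [set x | an_holds phi x].
Proof.
elim: phi => {n} [n t u|n t u|n phi IH|n phi IHp psi IHq|n phi IH] /=.
- by apply: Dset_eqf; exact: Dterm.
- by apply: Dset_lt; exact: Dterm.
- exact: Dset_not.
- exact: Dset_and.
- exact: Dset_proj.
Qed.

Lemma subanalytic_Dset n (A : set 'rV[R]_n) : subanalytic A -> Dset A.
Proof. by move=> [phi ->]; exact: Dformula. Qed.

(** The graph is a D-set by quantifier elimination, and [gsel] reads a D-function off it. *)
Lemma subanalytic_Dfun n (X : set 'rV[R]_n) f : subanalytic_fun X f ->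
  exists2 g, Dfun g & forall x, X x -> f x = g x.
Proof.
move=> /subanalytic_Dset /gsel[|g Dg hg].
  move=> x t u [x1 _ /eq_row_mx[e1 h1]] [x2 _ /eq_row_mx[e2 h2]].
  move: h1 h2; rewrite e1 e2 => /matrixP /(_ 0 0) + /matrixP /(_ 0 0).
  by rewrite !mxE eqxx !mulr1n => -> ->.
by exists g => // x Xx; apply/esym/hg; exists x.
Qed.

Fixpoint tren n n' (s : 'I_n -> 'I_n') (t : an_term R n) : an_term R n' :=
  match t with
  | an_var i => an_var _ (s i)
  | an_const c => an_const _ c
  | an_add t u => an_add (tren s t) (tren s u)
  | an_mul t u => an_mul (tren s t) (tren s u)
  | an_fun k f rf ts => an_fun rf (fun i => tren s (ts i))
  end.

Lemma trenE n n' (s : 'I_n -> 'I_n') t x : an_eval x (tren s t) = an_eval (\row_i x 0 (s i)) t.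
Proof.
elim: t => [i|a|t IHt u IHu|t IHt u IHu|k f rf ts IH] //=; rewrite ?mxE ?IHt ?IHu//.
by congr f; apply/rowP => i; rewrite !mxE.
Qed.

Lemma subanalytic_eq n (A B : set 'rV[R]_n) : subanalytic A -> (forall x, A x <-> B x) -> subanalytic B.
Proof. by move=> sA AB; rewrite (_ : B = A)//; apply/seteqP; split=> x /AB. Qed.

Lemma subanalytic_ren n n' (s : 'I_n -> 'I_n') (A : set 'rV[R]_n) : subanalytic A ->
  subanalytic [set x : 'rV[R]_n' | A (\row_i x 0 (s i))].
Proof.
move=> [phi ->] {A}; suff [psi h] : exists psi : an_formula R n', forall x,
    an_holds psi x <-> an_holds phi (\row_i x 0 (s i)).
  by exists psi; apply/seteqP; split=> x /h.
elim: phi n' s => {n} [n t u|n t u|n phi IH|n phi IHp psi IHq|n phi IH] n' s.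
- by exists (an_eq (tren s t) (tren s u)) => x /=; rewrite !trenE.
- by exists (an_lt (tren s t) (tren s u)) => x /=; rewrite !trenE.
- by have [psi h] := IH n' s; exists (an_not psi) => x /=; rewrite h.
- have [p hp] := IHp n' s; have [q hq] := IHq n' s; exists (an_and p q) => x /=.
  by rewrite hp hq.
have [psi h] := IH (n' + 1)%N (fun i => match fintype.split i with
   inl j => lshift 1 (s j) | inr j => rshift n' j end).
exists (an_exists psi) => x /=.
have E y : \row_i (row_mx x (y%:M : 'M[R]_1)) 0 (match fintype.split i with
   inl j => lshift 1 (s j) | inr j => rshift n' j end) = row_mx (\row_i x 0 (s i)) y%:M.
  apply/rowP => i; rewrite mxE [RHS]mxE; case: (fintype.split i) => j.
    by rewrite row_mxEl mxE.
  by rewrite row_mxEr.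
by split=> -[y hy]; exists y; move: hy; rewrite h E.
Qed.

Lemma subanalytic_and n (A B : set 'rV[R]_n) : subanalytic A -> subanalytic B -> subanalytic (A `&` B).
Proof. by move=> [p ->] [q ->]; exists (an_and p q). Qed.

Lemma subanalytic_not n (A : set 'rV[R]_n) : subanalytic A -> subanalytic (~` A).
Proof. by move=> [p ->]; exists (an_not p). Qed.

Lemma subanalytic_or n (A B : set 'rV[R]_n) : subanalytic A -> subanalytic B -> subanalytic (A `|` B).
Proof.
move=> sA sB; rewrite -[A]setCK -[B]setCK -setCI.
by apply: subanalytic_not; apply: subanalytic_and; exact: subanalytic_not.
Qed.

Lemma subanalytic_eqt n (t u : an_term R n) : subanalytic [set x | an_eval x t = an_eval x u].
Proof. by exists (an_eq t u). Qed.

Lemma subanalytic_ltt n (t u : an_term R n) : subanalytic [set x | an_eval x t < an_eval x u].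
Proof. by exists (an_lt t u). Qed.

Lemma subanalytic_all n k (A : 'I_k -> set 'rV[R]_n) : (forall i, subanalytic (A i)) ->
  subanalytic [set x | forall i, A i x].
Proof.
elim: k A => [|k IH] A sA.
  apply: subanalytic_eq (subanalytic_eqt (an_const _ 0) (an_const _ 0)) _ => x /=.
  by split=> // _ [].
apply: subanalytic_eq (subanalytic_and (sA ord0) (IH (fun i => A (lift ord0 i)) (fun i => sA _))) _ => x.
split=> [[h1 h2] i|h]; last by split=> [|i]; exact: h.
by case: (unliftP ord0 i) => [j ->|->]; [exact: h2|].
Qed.

Lemma subanalytic_proj n k (A : set 'rV[R]_(n + k)) : subanalytic A ->
  subanalytic [set x : 'rV[R]_n | exists y : 'rV[R]_k, A (row_mx x y)].
Proof.
elim: k A => [|k IH] A sA.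
  have := subanalytic_ren (cast_ord (addn0 n)) sA; move=> /subanalytic_eq; apply => x.
  have E (y : 'rV[R]_0) : \row_i x 0 (cast_ord (addn0 n) i) = row_mx x y.
    apply/rowP => i; rewrite mxE; rewrite -(splitK i); case: (fintype.split i) => [j|[]//].
    by rewrite /= row_mxEl; congr (x _ _); apply/val_inj.
  rewrite /=; split=> [h|[y h]]; first by exists 0; rewrite -E.
  by rewrite (E y).
have e : (n + k.+1 = n + k + 1)%N by rewrite addnS addn1.
pose B := [set z : 'rV[R]_(n + k + 1) | A (\row_i z 0 (cast_ord e i))].
have [p pE] : subanalytic [set z : 'rV[R]_(n + k) | exists t : R, B (row_mx z t%:M)].
  by have [p pE] := subanalytic_ren (cast_ord e) sA; exists (an_exists p); rewrite /B pE.
have sB : subanalytic [set z : 'rV[R]_(n + k) | exists t : R, B (row_mx z t%:M)] by exists p.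
apply: subanalytic_eq (IH _ sB) _ => x /=.
have E (y : 'rV[R]_k) (t : R) : \row_i (row_mx (row_mx x y) (t%:M : 'M[R]_1)) 0 (cast_ord e i) =
    row_mx x (\row_(i < k.+1) if unlift ord_max i is Some j then y 0 j else t).
  apply/rowP => i; rewrite mxE -(splitK i); case: (fintype.split i) => j /=.
    rewrite row_mxEl (_ : cast_ord e _ = lshift 1 (lshift k j)); last exact/val_inj.
    by rewrite !row_mxEl.
  rewrite row_mxEr mxE; case: unliftP => [l ->|->].
    rewrite (_ : cast_ord e _ = lshift 1 (rshift n l)); last first.
      by apply/val_inj => /=; rewrite /bump leqNgt ltn_ord.
    by rewrite row_mxEl row_mxEr.
  rewrite (_ : cast_ord e _ = rshift (n + k) ord0); last by apply/val_inj => /=; rewrite addn0.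
  by rewrite row_mxEr mxE eqxx mulr1n.
split=> [[y [t]]|[y Ay]].
  by rewrite /B /= E => h; exists (\row_(i < k.+1) if unlift ord_max i is Some j then y 0 j else t).
exists (\row_j y 0 (lift ord_max j)), (y 0 ord_max); rewrite /B /= E.
rewrite (_ : \row_i _ = y)//; apply/rowP => i; rewrite mxE.
by case: unliftP => [j ->|->]; rewrite ?mxE.
Qed.

Definition SAf n (f : 'rV[R]_n -> R) := subanalytic [set z : 'rV[R]_(n + 1) | lst z = f (lsubmx z)].

(** The intermediate values [y] are quantified out. Among the coordinates of [x], of the value [t]
    and of [y], the map [s1 i] selects those of the graph of the [i]-th inner function and [s2]
    those of the graph of [F]. *)
Lemma SAf_comp n k (F : 'rV[R]_k -> R) (f : 'I_k -> 'rV[R]_n -> R) : SAf F ->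
  (forall i, SAf (f i)) -> SAf (fun x => F (\row_i f i x)).
Proof.
move=> sF sf.
pose s1 i (j : 'I_(n + 1)) : 'I_(n + 1 + k) := match fintype.split j with
  inl j => lshift k (lshift 1 j) | inr _ => rshift (n + 1) i end.
pose s2 (j : 'I_(k + 1)) : 'I_(n + 1 + k) := match fintype.split j with
  inl j => rshift (n + 1) j | inr _ => lshift k (rshift n ord0) end.
have := subanalytic_proj (subanalytic_and (subanalytic_all (fun i => subanalytic_ren (s1 i) (sf i)))
  (subanalytic_ren s2 sF)).
move=> /subanalytic_eq; apply => z /=.
have E1 (y : 'rV[R]_k) i : lst (\row_j (row_mx z y) 0 (s1 i j)) = y 0 i.
  by rewrite /lst mxE /s1 (unsplitK (inr ord0)) row_mxEr.
have E2 (y : 'rV[R]_k) i : lsubmx (\row_j (row_mx z y) 0 (s1 i j)) = lsubmx z.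
  by apply/rowP => j; rewrite mxE mxE /s1 (unsplitK (inl j)) row_mxEl [RHS]mxE.
have E3 (y : 'rV[R]_k) : lst (\row_j (row_mx z y) 0 (s2 j)) = lst z.
  by rewrite /lst mxE /s2 (unsplitK (inr ord0)) row_mxEl.
have E4 (y : 'rV[R]_k) : lsubmx (\row_j (row_mx z y) 0 (s2 j)) = y.
  by apply/rowP => j; rewrite mxE mxE /s2 (unsplitK (inl j)) row_mxEr.
split=> [[y [h1]]|h].
  rewrite E3 E4 => ->; congr F; apply/rowP => i; rewrite mxE.
  by have := h1 i; rewrite E1 E2.
exists (\row_i f i (lsubmx z)); rewrite E3 E4; split=> // i.
by rewrite E1 E2 mxE.
Qed.

Lemma SAf_eq n (f g : 'rV[R]_n -> R) : SAf f -> (forall x, f x = g x) -> SAf g.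
Proof. by move=> sf fg; rewrite (_ : g = f)//; apply/funext. Qed.

Lemma SAf1 n (f : 'rV[R]_n -> R) (F : R -> R) (A : set 'rV[R]_2) : SAf f -> subanalytic A ->
  (forall z, A z <-> z 0 ord_max = F (z 0 ord0)) -> SAf (fun x => F (f x)).
Proof.
move=> sf sA AF.
have sF : SAf (fun x : 'rV[R]_1 => F (x 0 ord0)).
  apply: subanalytic_eq sA _ => z; rewrite AF /lst /= mxE.
  by rewrite (_ : rshift 1 ord0 = ord_max) 1?(_ : lshift 1 0 = ord0)//; exact/val_inj.
by apply: SAf_eq (SAf_comp sF (fun _ => sf)) _ => x; rewrite mxE.
Qed.

Lemma SAf2 n (f g : 'rV[R]_n -> R) (F : R -> R -> R) (t : an_term R 2) : SAf f -> SAf g ->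
  (forall z, an_eval z t = F (z 0 ord0) (z 0 ord_max)) -> SAf (fun x => F (f x) (g x)).
Proof.
move=> sf sg tF.
have sF : SAf (fun x : 'rV[R]_2 => F (x 0 ord0) (x 0 ord_max)).
  have := subanalytic_eqt (an_var _ (rshift 2 ord0)) (tren (lshift 1) t).
  move=> /subanalytic_eq; apply => z /=; rewrite trenE tF !mxE /lst.
  by [].
have sh i : SAf (fun x => if i == ord0 :> 'I_2 then f x else g x) by case: (i == ord0).
by apply: SAf_eq (SAf_comp sF sh) _ => x; rewrite !mxE.
Qed.

(** Inverses and roots are defined by polynomial conditions on argument and value; the default value
    of [0^-1] is a separate disjunct, and for roots the sign of the argument is left open. *)
Lemma Dfun_SAf n (f : 'rV[R]_n -> R) : Dfun f -> SAf f.
Proof.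
elim=> {f} [i|a|f h _ IHf _ IHh|f h _ IHf _ IHh|f _ IHf|f p _ IHf|k f h rf _ IH].
- apply: subanalytic_eq (subanalytic_eqt (an_var _ (rshift n ord0)) (an_var _ (lshift 1 i))) _ => z /=.
  by rewrite mxE.
- by apply: subanalytic_eq (subanalytic_eqt (an_var _ (rshift n ord0)) (an_const _ a)) _.
- by apply: (SAf2 (F := fun a b => a + b) (t := an_add (an_var _ ord0) (an_var _ ord_max))).
- by apply: (SAf2 (F := fun a b => a * b) (t := an_mul (an_var _ ord0) (an_var _ ord_max))).
- pose v i := an_var R (i : 'I_2).
  have sA := subanalytic_or (subanalytic_eqt (an_mul (v ord0) (v ord_max)) (an_const _ 1))
    (subanalytic_and (subanalytic_eqt (v ord0) (an_const _ 0)) (subanalytic_eqt (v ord_max) (an_const _ 0))).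
  apply: (SAf1 IHf sA) => z /=; split=> [[h|[-> ->]]|->].
  + have z0 : z 0 ord0 != 0.
      by apply/eqP => z0; move/eqP: h; rewrite z0 mul0r eq_sym oner_eq0.
    by apply: (mulfI z0); rewrite h divff.
  + by rewrite invr0.
  + by have [->|z0] := eqVneq (z 0 ord0) 0; [right; rewrite invr0|left; rewrite divff].
- pose v i := an_var R (i : 'I_2).
  pose pw := fix pw k := if k is k'.+1 then an_mul (v ord_max) (pw k') else an_const 2 1.
  have pwE k (z : 'rV[R]_2) : an_eval z (pw k) = z 0 ord_max ^+ k.
    by elim: k => //= k ->; rewrite exprS.
  have sA := subanalytic_and (subanalytic_not (subanalytic_ltt (v ord_max) (an_const _ 0)))
    (subanalytic_or (subanalytic_eqt (pw p.+1) (v ord0))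
       (subanalytic_eqt (pw p.+1) (an_mul (an_const _ (-1)) (v ord0)))).
  apply: (SAf1 (F := fun a => `|a| `^ (p.+1%:R)^-1) IHf sA) => z; rewrite /setI /setU /setC /mkset !pwE /=.
  split=> [[/negP h1 h2]|zE].
    rewrite -leNgt in h1.
    have -> : `|z 0 ord0| = z 0 ord_max ^+ p.+1.
      rewrite -(ger0_norm h1) -normrX; case: h2 => ->//.
      by rewrite mulN1r normrN.
    by rewrite -powR_mulrn// -powRrM divff ?pnatr_eq0// powRr1.
  have z1 : 0 <= z 0 ord_max by rewrite zE powR_ge0.
  split; first by apply/negP; rewrite -leNgt.
  rewrite {1 2}zE rootK mulN1r; have [h|h] := leP 0 (z 0 ord0).
    by left; rewrite ger0_norm.
  by right; rewrite ltr0_norm.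
- apply: SAf_comp IH.
  apply: subanalytic_eq (subanalytic_eqt (an_var _ (rshift k ord0))
    (an_fun rf (fun i => an_var _ (lshift 1 i)))) _ => z /=.
  by rewrite (_ : \row_i _ = lsubmx z)//; apply/rowP => i; rewrite !mxE.
Qed.

Lemma Dfun_pos_subanalytic n (X : set 'rV[R]_n) f : subanalytic X -> Dfun f ->
  (forall x, X x -> 0 < f x) -> pos_subanalytic_fun X f.
Proof.
move=> sX Df f0; split=> //; rewrite /subanalytic_fun.
apply: subanalytic_eq (subanalytic_and (subanalytic_ren (lshift 1) sX) (Dfun_SAf Df)) _ => z /=.
have E : \row_i z 0 (lshift 1 i) = lsubmx z by apply/rowP => i; rewrite !mxE.
rewrite E; split=> [[Xz zE]|[x Xx <-]].
  by exists (lsubmx z) => //; rewrite -zE row_lst.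
by rewrite row_mxKl lst_row.
Qed.

End Formulas.

Local Open Scope complex_scope.

(** * Power-constructible functions *)

Section ComplexPower.
Variable R : realType.
Implicit Types (a b : R) (z w : R[i]).

Lemma complex_eq (z w : R[i]) : complex.Re z = complex.Re w -> complex.Im z = complex.Im w -> z = w.
Proof. by case: z w => [a b] [c d] /= -> ->. Qed.

Lemma cpowD a z w : cpow a (z + w) = cpow a z * cpow a w.
Proof.
case: z w => [z1 z2] [w1 w2]; rewrite /cpow /=.
by apply: complex_eq; rewrite /= !mulrDl expRD ?cosD ?sinD; ring.
Qed.

Lemma cpow0 a : cpow a 0 = 1.
Proof. by apply: complex_eq; rewrite /= !mul0r expR0 ?cos0 ?sin0 ?mulr1 ?mulr0. Qed.

Lemma cpow1r a : 0 < a -> cpow a 1 = a%:C.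
Proof.
by move=> a0; apply: complex_eq; rewrite /= mul0r ?cos0 ?sin0 ?mulr0// mul1r lnK ?mulr1// posrE.
Qed.

Lemma cpowM a b z : 0 < a -> 0 < b -> cpow (a * b) z = cpow a z * cpow b z.
Proof.
case: z => [z1 z2] a0 b0; rewrite /cpow /= lnM ?posrE//.
by apply: complex_eq; rewrite /= !mulrDr expRD ?cosD ?sinD; ring.
Qed.

Lemma cpow_powR a (r : R) z : 0 < a -> cpow (a `^ r) z = cpow a (r%:C * z).
Proof.
case: z => [z1 z2] a0; rewrite /cpow /= ln_powR.
by apply: complex_eq; rewrite /= ?mul0r ?subr0 ?addr0 !mulrA (mulrC z1 r) (mulrC z2 r).
Qed.

Lemma ratC_in (K : divringClosed R[i]) (q : rat) : (ratr q)%:C \in K.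
Proof.
have -> : (ratr q : R)%:C = ratr q :> R[i].
  exact: (fmorph_rat (real_complex R)).
by rewrite /ratr; apply: rpred_div; exact: rpred_int.
Qed.

End ComplexPower.

Section Span.
Variables (R : realType) (T X : Type) (ev : T -> X -> R[i]) (mul : T -> T -> T).
Hypothesis mulE : forall s t x, ev (mul s t) x = ev s x * ev t x.

Definition fspan (h : X -> R[i]) := exists s : seq T, forall x, h x = \sum_(t <- s) ev t x.

Lemma spanD f g : fspan f -> fspan g -> fspan (fun x => f x + g x).
Proof. by move=> [s fE] [t gE]; exists (s ++ t) => x; rewrite big_cat fE gE. Qed.

Lemma spanM f g : fspan f -> fspan g -> fspan (fun x => f x * g x).
Proof.
move=> [s fE] [t gE]; exists [seq mul a b | a <- s, b <- t] => x.
rewrite big_allpairs_dep fE gE mulr_suml; apply: eq_bigr => a _.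
by rewrite mulr_sumr; apply: eq_bigr => b _; rewrite mulE.
Qed.

Lemma span1 t h : (forall x, h x = ev t x) -> fspan h.
Proof. by move=> hE; exists [:: t] => x; rewrite big_seq1. Qed.

End Span.

Section Constructible.
Variables (R : realType) (K : divringClosed R[i]).

(* Global variant of [power_constructible], with complex coefficients even for
   real [K]. *)
Inductive PC n : ('rV[R]_n -> R[i]) -> Prop :=
| PC_cst c : PC (fun=> c)
| PC_pow f a : Dfun f -> (forall x, 0 < f x) -> a \in K -> PC (fun x => cpow (f x) a)
| PC_log f : Dfun f -> (forall x, 0 < f x) -> PC (fun x => (ln (f x))%:C)
| PC_add f g : PC f -> PC g -> PC (fun x => f x + g x)
| PC_mul f g : PC f -> PC g -> PC (fun x => f x * g x).

Lemma PC_eq n (f g : 'rV[R]_n -> R[i]) : PC f -> (forall x, f x = g x) -> PC g.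
Proof. by move=> Pf fg; rewrite (_ : g = f)//; apply/funext. Qed.

(** A D-function is the difference of the positive D-functions [Num.max f 0 + 1] and
    [Num.max (- f) 0 + 1], each of which is its own first power. *)
Lemma PC_D n (f : 'rV[R]_n -> R) : Dfun f -> PC (fun x => (f x)%:C).
Proof.
move=> Df.
have P g : Dfun g -> PC (fun x : 'rV[R]_n => (Num.max (g x) 0 + 1)%:C).
  move=> Dg; have g0 x : 0 < Num.max (g x) 0 + 1 by rewrite ltr_wpDl// le_max lexx orbT.
  have Dg' : Dfun (fun x => Num.max (g x) 0 + 1).
    by apply: D_add; [apply: Dmax => //|]; exact: D_cst.
  by apply: PC_eq (PC_pow Dg' g0 (rpred1 K)) _ => x; rewrite cpow1r.
apply: PC_eq (PC_add (P _ Df) (PC_mul (PC_cst _ (-1)) (P _ (DZ (-1) Df)))) _ => x.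
rewrite mulN1r -rmorphB/=; congr (_%:C).
rewrite mulN1r; have [h|h] := leP (f x) 0.
  by rewrite max_l ?oppr_ge0//; ring.
by rewrite max_r ?oppr_le0 ?ltW//; ring.
Qed.

Lemma PC_if n (B : set 'rV[R]_n) (f g : 'rV[R]_n -> R[i]) : Dset B -> PC f -> PC g ->
  PC (fun x => if `[< B x >] then f x else g x).
Proof.
move=> DB' Pf Pg.
apply: PC_eq (PC_add (PC_mul (PC_D DB') Pf) (PC_mul (PC_D (Dset_not DB')) Pg)) _ => x.
by rewrite asbool_neg; case: asboolP; rewrite ?mul1r ?mul0r ?addr0 ?add0r.
Qed.

Lemma PC_X n (f : 'rV[R]_n -> R[i]) k : PC f -> PC (fun x => f x ^+ k).
Proof.
move=> Pf; elim: k => [|k IH]; first exact: (PC_cst _ 1).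
by apply: PC_eq (PC_mul Pf IH) _ => x; rewrite exprS.
Qed.

Lemma PC_comp n k (h : 'rV[R]_k -> R[i]) (g : 'I_k -> 'rV[R]_n -> R) : PC h ->
  (forall i, Dfun (g i)) -> PC (fun x => h (\row_i g i x)).
Proof.
move=> Ph Dg; elim: Ph => {h} [c|f a Df f0 aK|f Df f0|f h _ IHf _ IHh|f h _ IHf _ IHh].
- exact: PC_cst.
- by apply: (PC_pow (f := fun x => f (\row_i g i x))) => //; exact: Dcomp.
- by apply: (PC_log (f := fun x => f (\row_i g i x))) => //; exact: Dcomp.
- exact: PC_add.
- exact: PC_mul.
Qed.

(** Each factor carries both a power and a logarithm, as in [power_constructible]; a missing power
    gets the exponent 0 and a missing logarithm is [ln (expR 1)]. *)
Record fact n := Fact { fc_f : 'rV[R]_n -> R; fc_a : R[i]; fc_g : 'rV[R]_n -> R;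
  fc_D : Dfun fc_f /\ (forall x, 0 < fc_f x);
  fc_K : fc_a \in K;
  fc_L : Dfun fc_g /\ (forall x, 0 < fc_g x) }.

Definition fact_ev n (t : fact n) x := cpow (fc_f t x) (fc_a t) * (ln (fc_g t x))%:C.

Lemma Dpos_cst n (a : R) : 0 < a -> Dfun (fun _ : 'rV[R]_n => a) /\ forall x : 'rV[R]_n, 0 < a.
Proof. by move=> a0; split=> //; exact: D_cst. Qed.

Definition fact1 n : fact n := Fact (Dpos_cst n ltr01) (rpred0 K) (Dpos_cst n (expR_gt0 1)).

Lemma fact1E n x : fact_ev (fact1 n) x = 1.
Proof. by rewrite /fact_ev /= cpow0 expRK mulr1. Qed.

Definition mon_ev n (t : R[i] * seq (fact n)) x := t.1 * \prod_(q <- t.2) fact_ev q x.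

Lemma PC_span n (h : 'rV[R]_n -> R[i]) : PC h -> fspan (@mon_ev n) h.
Proof.
have mE (s t : R[i] * seq (fact n)) x :
    mon_ev (s.1 * t.1, s.2 ++ t.2) x = mon_ev s x * mon_ev t x.
  by rewrite /mon_ev /= big_cat mulrACA.
elim=> {h} [c|f a Df f0 aK|f Df f0|f h _ IHf _ IHh|f h _ IHf _ IHh].
- by apply: (span1 (t := (c, [::]))) => x; rewrite /mon_ev big_nil mulr1.
- apply: (span1 (t := (1, [:: Fact (conj Df f0) aK (Dpos_cst n (expR_gt0 1))]))) => x.
  by rewrite /mon_ev big_seq1 /fact_ev /= expRK mulr1 mul1r.
- apply: (span1 (t := (1, [:: Fact (Dpos_cst n ltr01) (rpred0 K) (conj Df f0)]))) => x.
  by rewrite /mon_ev big_seq1 /fact_ev /= cpow0 !mul1r.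
- exact: spanD.
- exact: (spanM mE).
Qed.

Lemma real_cpow (f : R) (a : R[i]) : complex.Im a = 0 -> complex.Im (cpow f a) = 0.
Proof. by rewrite /cpow /= => ->; rewrite mul0r sin0 mulr0. Qed.

Lemma Im_mul (z w : R[i]) : complex.Im z = 0 -> complex.Im w = 0 -> complex.Im (z * w) = 0.
Proof. by case: z w => [a b] [c d] /= -> ->; rewrite mulr0 mul0r addr0. Qed.

Lemma Re_mul (z w : R[i]) : complex.Im w = 0 ->
  (complex.Re (z * w))%:C = (complex.Re z)%:C * w.
Proof. by case: z w => [a b] [c d] /= ->; apply: complex_eq; rewrite /= ?mulr0 ?mul0r ?subr0 ?addr0. Qed.

(* [(1, fact1)] pads sums of products of different lengths. *)
Lemma PC_constructible n (X : set 'rV[R]_n) (h : 'rV[R]_n -> R[i]) : subanalytic X -> PC h ->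
  exists2 H, power_constructible K X H & forall x, complex.Im (h x) = 0 \/ coef_field K = [set: R[i]] -> H x = h x.
Proof.
move=> sX /PC_span[s hE].
(* For real [K] the coefficients have to be real. Taking real parts is harmless wherever [h] is
   real, because all factors are real in that case. *)
pose cre (c : R[i]) := if `[< coef_field K = [set: R[i]] >] then c else (complex.Re c)%:C.
have creK c : coef_field K (cre c).
  rewrite /cre; case: asboolP => [->//|nT].
  by move: nT; rewrite /coef_field; case: asboolP.
pose t0 : R[i] * seq (fact n) := (0, [::]).
pose M := (\max_(i < size s) size (nth t0 s i).2).+1.
pose ff (i : 'I_(size s).+1) (j : 'I_M) := nth (fact1 n) (nth t0 s i).2 j.
pose c (i : 'I_(size s).+1) := cre (nth t0 s i).1.
have pE (t : seq (fact n)) x : (size t <= M)%N -> \prod_(j < M) fact_ev (nth (fact1 n) t j) x =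
    \prod_(q <- t) fact_ev q x.
  move=> tM; rewrite (big_nth (fact1 n)) -(big_mkord xpredT (fun j => fact_ev (nth (fact1 n) t j) x)).
  rewrite (big_cat_nat (n := size t))//= [X in _ * X]big1_seq ?mulr1// => j.
  by rewrite mem_index_iota => /andP[_ /andP[tj _]]; rewrite nth_default// fact1E.
have HE x : \sum_(i < (size s).+1) c i *
    \prod_(j < M) (cpow (fc_f (ff i j) x) (fc_a (ff i j)) * (ln (fc_g (ff i j) x))%:C) =
    \sum_(t <- s) cre t.1 * \prod_(q <- t.2) fact_ev q x.
  rewrite big_ord_recr /= [X in _ + X](_ : _ = 0) ?addr0; last first.
    rewrite /c /= nth_default//= (_ : cre 0 = 0) ?mul0r// /cre.
    by case: asboolP.
  rewrite (big_nth t0) big_mkord; apply: eq_bigr => i _; congr (_ * _).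
  rewrite -pE; first by [].
  by rewrite /M ltnW// ltnS (leq_bigmax (F := fun i : 'I_(size s) => size (nth t0 s i).2)).
exists (fun x => \sum_(i < (size s).+1) c i *
  \prod_(j < M) (cpow (fc_f (ff i j) x) (fc_a (ff i j)) * (ln (fc_g (ff i j) x))%:C)).
  exists (size s).+1, M, c, (fun i j => fc_a (ff i j)), (fun i j => fc_f (ff i j)), (fun i j => fc_g (ff i j)).
  split=> //; first by move=> i; exact: creK.
    by move=> i j; exact: fc_K.
  move=> i j; have [D1 p1] := fc_D (ff i j); have [D2 p2] := fc_L (ff i j).
  by split; apply: Dfun_pos_subanalytic.
move=> x cf; rewrite HE hE.
have [cT|cN] := pselect (coef_field K = [set: R[i]]).
  by apply: eq_bigr => t _; rewrite /cre asboolT.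
have Kr z : z \in K -> complex.Im z = 0.
  move: cN; rewrite /coef_field; case: asboolP => // h0 _; exact: h0.
have hx : complex.Im (h x) = 0 by case: cf.
rewrite -hE; have -> : h x = (complex.Re (h x))%:C by apply: complex_eq.
rewrite hE raddf_sum /= rmorph_sum /=; apply: eq_bigr => t _.
rewrite /cre asboolF// /mon_ev Re_mul//.
elim/big_rec: _ => [//|q y _ y0]; apply: Im_mul => //; apply: Im_mul => //.
by apply: real_cpow; apply: Kr; exact: fc_K.
Qed.

(** The D-functions representing the data on [X] are replaced by 1 outside [X] and wherever they are
    not positive, which makes them positive on the whole space. *)
Lemma constructible_PC n (X : set 'rV[R]_n) (h : 'rV[R]_n -> R[i]) : subanalytic X ->
  power_constructible K X h -> exists2 g, PC g & forall x, X x -> h x = g x.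
Proof.
move=> sX [N [M [c [al [f [g [_ cK aK fgP hE]]]]]]].
have DX := subanalytic_Dset sX.
have rep (u : 'rV[R]_n -> R) : pos_subanalytic_fun X u ->
    exists v, [/\ Dfun v, forall x, 0 < v x & forall x, X x -> u x = v x].
  move=> [/subanalytic_Dfun[v Dv uv] u0].
  exists (fun x => if `[< X x /\ 0 < v x >] then v x else 1); split.
  - by apply: Dif => //; [apply: Dset_and => //; exact: Dset_gt0|exact: D_cst].
  - by move=> x; case: asboolP => [[]//|_]; exact: ltr01.
  - by move=> x Xx; rewrite asboolT ?uv//; split=> //; rewrite -uv//; exact: u0.
have /choice[v hv] (p : 'I_N * 'I_M) : exists v, [/\ Dfun v, forall x, 0 < v x & forall x, X x -> f p.1 p.2 x = v x].
  by have [h1 _] := fgP p.1 p.2; exact: rep.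
have /choice[w hw] (p : 'I_N * 'I_M) : exists w, [/\ Dfun w, forall x, 0 < w x & forall x, X x -> g p.1 p.2 x = w x].
  by have [_ h1] := fgP p.1 p.2; exact: rep.
exists (fun x => \sum_(i < N) c i * \prod_(j < M) (cpow (v (i, j) x) (al i j) * (ln (w (i, j) x))%:C)); last first.
  move=> x Xx; rewrite hE//; apply: eq_bigr => i _; congr (_ * _); apply: eq_bigr => j _.
  by have [_ _ ->//] := hv (i, j); have [_ _ ->//] := hw (i, j).
have Psum L (F : 'I_L -> 'rV[R]_n -> R[i]) : (forall i, PC (F i)) -> PC (fun x => \sum_(i < L) F i x).
  elim: L F => [|L IH] F PF; first by apply: PC_eq (PC_cst _ 0) _ => x; rewrite big_ord0.
  apply: PC_eq (PC_add (PF ord0) (IH (fun i => F (lift ord0 i)) (fun i => PF _))) _ => x.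
  by rewrite big_ord_recl.
have Pprod L (F : 'I_L -> 'rV[R]_n -> R[i]) : (forall i, PC (F i)) -> PC (fun x => \prod_(i < L) F i x).
  elim: L F => [|L IH] F PF; first by apply: PC_eq (PC_cst _ 1) _ => x; rewrite big_ord0.
  apply: PC_eq (PC_mul (PF ord0) (IH (fun i => F (lift ord0 i)) (fun i => PF _))) _ => x.
  by rewrite big_ord_recl.
apply: Psum => i; apply: PC_mul; first exact: PC_cst.
apply: Pprod => j; have [D1 p1 _] := hv (i, j); have [D2 p2 _] := hw (i, j).
by apply: PC_mul; [exact: (PC_pow D1 p1 (aK i j))|exact: (PC_log D2 p2)].
Qed.

End Constructible.

(** * Limits of exponential sums *)

Section Sequences.
Variable R : realType.
Local Notation C := R[i].
Implicit Types (u v : nat -> C) (c z w : C).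

Lemma normC_real (x : R) : `|x%:C| = `|x|%:C.
Proof. by rewrite normc_def /= expr0n addr0 sqrtr_sqr. Qed.

Lemma normC_le (z : C) : `|z| <= (`|complex.Re z| + `|complex.Im z|)%:C.
Proof.
have h := addr_ge0 (normr_ge0 (complex.Re z)) (normr_ge0 (complex.Im z)).
rewrite normc_def lecR -[leRHS]ger0_norm// -[leRHS]sqrtr_sqr ler_wsqrtr//.
rewrite sqrrD !real_normK ?num_real// addrAC lerDl mulrn_wge0// mulr_ge0//.
Qed.

Lemma Re_le_normC (z : C) : `|complex.Re z|%:C <= `|z|.
Proof. by rewrite normc_def lecR -sqrtr_sqr ler_wsqrtr// lerDl sqr_ge0. Qed.

Lemma Im_le_normC (z : C) : `|complex.Im z|%:C <= `|z|.
Proof. by rewrite normc_def lecR -sqrtr_sqr ler_wsqrtr// lerDr sqr_ge0. Qed.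

Lemma norm_cpow (a : R) z : `|cpow a z| = (expR (complex.Re z * ln a))%:C.
Proof.
rewrite normc_def /= !exprMn -mulrDr cos2Dsin2 mulr1 sqrtr_sqr ger0_norm//; exact: expR_ge0.
Qed.

Definition cv0 u := forall e : R, 0 < e -> exists N : nat, forall n, (N <= n)%N -> `|u n| <= e%:C.

Lemma cv0_eq u v : (forall n, u n = v n) -> cv0 u -> cv0 v.
Proof. by move=> uv u0 e /u0[N h]; exists N => n /h; rewrite uv. Qed.

Lemma cv0D u v : cv0 u -> cv0 v -> cv0 (fun n => u n + v n).
Proof.
move=> u0 v0 e e0; have e2 : 0 < e / 2 by rewrite divr_gt0.
have [N hN] := u0 _ e2; have [M hM] := v0 _ e2; exists (maxn N M) => n.
rewrite geq_max => /andP[/hN h1 /hM h2].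
by rewrite (le_trans (ler_normD _ _))// [e]splitr rmorphD lerD.
Qed.

Lemma cv0M u v (M : R) : (forall n, `|v n| <= M%:C) -> cv0 u -> cv0 (fun n => v n * u n).
Proof.
move=> vM u0 e e0; have M0 : 0 <= M by rewrite -lecR; exact: le_trans (normr_ge0 _) (vM 0%N).
have M1 : 0 < M + 1 by rewrite ltr_wpDl.
have [N hN] := u0 _ (divr_gt0 e0 M1); exists N => n /hN h.
rewrite normrM (le_trans (ler_pM _ _ (vM n) h))// -rmorphM/= lecR.
rewrite mulrCA -[leRHS]mulr1 ler_pM2l// ler_pdivrMr// mul1r; lra.
Qed.

Lemma cv0Z u c : cv0 u -> cv0 (fun n => c * u n).
Proof.
apply: (@cv0M _ _ (`|complex.Re c| + `|complex.Im c|)) => n; exact: normC_le.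
Qed.

Lemma cv0_0 : cv0 (fun=> 0).
Proof. by move=> e e0; exists 0%N => n _; rewrite normr0 lecR ltW. Qed.

Lemma cv0_sum (J : Type) (s : seq J) (F : J -> nat -> C) : (forall j, cv0 (F j)) ->
  cv0 (fun n => \sum_(j <- s) F j n).
Proof.
move=> F0; elim: s => [|j s IH]; first by apply: cv0_eq cv0_0 => n; rewrite big_nil.
by apply: cv0_eq (cv0D (F0 j) IH) => n; rewrite big_cons.
Qed.

Lemma cv0S u : cv0 u -> cv0 (fun n => u n.+1).
Proof. by move=> u0 e /u0[N h]; exists N => n Nn; apply: h; rewrite (leq_trans Nn). Qed.

Lemma poly_periodic (p : {poly C}) : (forall n, p.[n.+1%:R] = p.[n%:R]) -> p = p.[0]%:P.
Proof.
move=> hp; apply/eqP; rewrite -subr_eq0; apply/eqP.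
apply: (@roots_geq_poly_eq0 _ _ [seq i%:R | i <- iota 0 (size p).+1]).
- apply/allP => _ /mapP[i _ ->]; rewrite rootE !hornerE subr_eq0; apply/eqP.
  by elim: i => [|i <-]; [|rewrite hp].
- by rewrite map_inj_uniq ?iota_uniq// => i j /eqP; rewrite eqr_nat => /eqP.
- rewrite size_map size_iota (leq_trans (size_polyD _ _))// size_polyN geq_max leqnSn/=.
  by rewrite (leq_trans (size_polyC_leq1 _)).
Qed.

(* Linear independence at infinity of the sequences [z^n n^k], [|z| >= 1],
   by induction, applying the operator [u(n+1) - z u(n)]. *)
Lemma exp_poly_indep (Z : seq C) (P : C -> {poly C}) : uniq Z ->
  (forall z, z \in Z -> 1 <= `|z|) -> cv0 (fun n => \sum_(z <- Z) z ^+ n * (P z).[n%:R]) ->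
  forall z, z \in Z -> P z = 0.
Proof.
move=> uZ Z1; have [N] := ubnP (\sum_(z <- Z) size (P z))%N.
elim: N P => // N IH P hN u0.
have [nz z0Z|[z0 z0Z Pz0]] : (forall z, z \in Z -> P z = 0) \/ exists2 z0 : R[i], z0 \in Z & P z0 != 0.
    have [h|h] := pselect (exists2 z0 : R[i], z0 \in Z & P z0 != 0); [by right|left=> z zZ].
    by apply/eqP/negPn/negP => Pz; apply: h; exists z.
  exact: nz.
have s2 : size ('X + 1%:P : {poly C}) = 2%N by rewrite size_XaddC.
have lcX : lead_coef ('X + 1%:P : {poly C}) = 1 by rewrite lead_coefXaddC.
pose sh (p : {poly C}) := p \Po ('X + 1%:P).
have shs p : size (sh p) = size p by rewrite size_comp_poly2.
have shl p : lead_coef (sh p) = lead_coef p by rewrite lead_coef_comp ?s2// lcX expr1n mulr1.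
pose Q z := z *: sh (P z) - z0 *: P z.
have Qs z : (size (Q z) <= size (P z))%N.
  rewrite (leq_trans (size_polyD _ _))// size_polyN geq_max.
  by rewrite !(leq_trans (size_scale_leq _ _))// shs.
(* At [z0] the leading coefficients cancel, so the total size of the polynomials drops. *)
have Qs0 : (size (Q z0) < size (P z0))%N.
  have Ps : (0 < size (P z0))%N by rewrite lt0n size_poly_eq0.
  rewrite -[X in (_ < X)%N](prednK Ps) ltnS; apply/leq_sizeP => j jP.
  rewrite /Q coefB !coefZ -mulrBr.
  have [ej|nj] := eqVneq j (size (P z0)).-1.
    rewrite ej -{1}(shs (P z0)) -[(sh _)`_ _]/(lead_coef _) shl lead_coefE subrr mulr0 //.
  have {}jP : (size (P z0) <= j)%N by rewrite -(prednK Ps) ltn_neqAle eq_sym nj.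
  by rewrite !nth_default ?shs// subrr mulr0.
have Q0 : forall z, z \in Z -> Q z = 0.
  apply: IH.
    apply: (@leq_trans (\sum_(z <- Z) size (P z))%N); last by rewrite -ltnS.
    rewrite (bigD1_seq z0)//= [X in (_ < X)%N](bigD1_seq z0)//=.
    rewrite -addSn leq_add// leq_sum// => z _; exact: Qs.
  apply: cv0_eq (cv0D (cv0S u0) (cv0Z (- z0) u0)) => n.
  rewrite mulr_sumr -big_split/=; apply: eq_bigr => z _.
  rewrite /Q /sh !hornerE horner_comp !hornerE exprS -natr1 /=.
  ring.
(* Since all [Q z] vanish, comparison of leading coefficients kills [P z] for [z != z0], while
   [P z0] is invariant under the unit shift and hence a constant [c]; then [|c| <= |z0 ^+ n * c|],
   which tends to 0. *)
have P0 z : z \in Z -> z != z0 -> P z = 0.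
  move=> zZ zz0; apply/eqP; rewrite -lead_coef_eq0; apply/eqP.
  have /eqP := Q0 z zZ; rewrite subr_eq0 => /eqP /(congr1 lead_coef).
  rewrite !lead_coefZ shl => /eqP; rewrite -subr_eq0 -mulrBl mulf_eq0 subr_eq0 (negPf zz0) /=.
  by move=> /eqP.
have z0n : z0 != 0 by apply: contraTneq (Z1 _ z0Z) => ->; rewrite normr0 ler10.
exfalso; move: Pz0; rewrite (poly_periodic (p := P z0)); last first.
  move=> n; have /eqP := Q0 _ z0Z; rewrite subr_eq0 => /eqP /(scalerI z0n) /(congr1 (horner^~ n%:R)).
  by rewrite horner_comp !hornerE natr1.
rewrite polyC_eq0 => /negP; apply; set c := (P z0).[0].
rewrite -normr_eq0 eq_le normr_ge0 andbT.
have cE : `|c| = (Num.sqrt (complex.Re c ^+ 2 + complex.Im c ^+ 2))%:C by rewrite normc_def.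
rewrite cE lecR; apply/ler_addgt0Pr => e e0; rewrite add0r -lecR -cE.
have [M hM] := u0 _ e0; apply: le_trans (hM M (leqnn _)).
rewrite (bigD1_seq z0)//= big1_seq ?addr0; last first.
  by move=> z /andP[zz0 zZ]; rewrite P0// horner0 mulr0.
have -> : (P z0).[M%:R] = c.
  elim: M {hM} => // M <-; have /eqP := Q0 _ z0Z; rewrite subr_eq0 => /eqP /(scalerI z0n).
  by move=> /(congr1 (horner^~ M%:R)); rewrite horner_comp !hornerE natr1.
by rewrite normrM ler_peMl// normrX exprn_ege1// Z1.
Qed.

Definition bounded (a : nat -> C) (M : R) := forall l : nat, `|complex.Re (a l)| <= M /\ `|complex.Im (a l)| <= M.
Definition csum (a : nat -> C) (w : R) : C :=
  (usum (fun l => complex.Re (a l) * w ^+ l)) +i* (usum (fun l => complex.Im (a l) * w ^+ l)).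

Lemma bounded_l1 a M (w : R) : bounded a M -> `|w| <= 2^-1 ->
  l1 (2 * M) (fun l => complex.Re (a l) * w ^+ l) /\ l1 (2 * M) (fun l => complex.Im (a l) * w ^+ l).
Proof.
move=> aM w1; split.
  apply: (@gser_bounded R void (fun l _ => complex.Re (a l)) M (fun=> 0) w) => // l.
  by have [] := aM l.
apply: (@gser_bounded R void (fun l _ => complex.Im (a l)) M (fun=> 0) w) => // l.
by have [] := aM l.
Qed.

Lemma csum_bound a M (w : R) : bounded a M -> `|w| <= 2^-1 -> `|csum a w| <= (4 * M)%:C.
Proof.
move=> aM w1; have [h1 h2] := bounded_l1 aM w1.
apply: le_trans (normC_le _) _; rewrite lecR /=.
have := usum_norm h1; have := usum_norm h2; lra.
Qed.

Lemma complex_sum n (F G : 'I_n -> R) : (\sum_i F i) +i* (\sum_i G i) = \sum_i (F i +i* G i) :> C.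
Proof.
elim: n F G => [|n IH] F G; first by rewrite !big_ord0.
by rewrite !big_ord_recl -IH.
Qed.

Lemma csum_split a M (w : R) d : bounded a M -> `|w| <= 2^-1 ->
  csum a w = \sum_(l < d) a l * (w ^+ l)%:C + (w ^+ d)%:C * csum (fun l => a (d + l)%N) w.
Proof.
move=> aM w1; have [h1 h2] := bounded_l1 aM w1.
have aM' : bounded (fun l => a (d + l)%N) M by move=> l; exact: aM.
have [h3 h4] := bounded_l1 aM' w1.
rewrite /csum (usum_shift d h1) (usum_shift d h2).
rewrite (_ : \sum_(l < d) a l * _ = (\sum_(i < d) complex.Re (a i) * w ^+ i) +i*
    (\sum_(i < d) complex.Im (a i) * w ^+ i)); last first.
  rewrite complex_sum; apply: eq_bigr => i _; case: (a i) => p q.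
  by apply/(@complex_eq R); rewrite /= ?mulr0 ?subr0 ?addr0 ?add0r.
have E (f : nat -> R) : l1 (2 * M) (fun l => f (d + l)%N * w ^+ l) ->
    usum (fun l => f (d + l)%N * w ^+ (d + l)) = w ^+ d * usum (fun l => f (d + l)%N * w ^+ l).
  move=> hf; rewrite -(usumZ _ hf); congr usum; apply/funext => l; rewrite exprD; ring.
rewrite (E (fun l => complex.Re (a l)))// (E (fun l => complex.Im (a l)))//.
by apply: complex_eq; rewrite /= ?mul0r ?subr0 ?addr0.
Qed.

Lemma exp_beats_pow (s e : R) k : 0 < s -> 0 < e ->
  exists T, forall t, T <= t -> expR (- s * t) * `|t| ^+ k <= e.
Proof.
move=> s0 e0; pose m : R := k.+1%:R / s; have m0 : 0 < m by rewrite divr_gt0.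
(* With this [m], [expR (s * t)] is the power [k.+1] of [expR (t / m)] and so at least
   [(t / m) ^+ k.+1], one power more than the numerator. *)
exists (Num.max 1 (m ^+ k.+1 / e)) => t; rewrite ge_max => /andP[t1 t2].
have t0 : 0 < t by exact: lt_le_trans ltr01 t1.
rewrite gtr0_norm// mulNr expRN mulrC ler_pdivrMr ?expR_gt0//.
have h : (t / m) ^+ k.+1 <= expR (s * t).
  have -> : s * t = k.+1%:R * (t / m) by rewrite /m; field; rewrite gt_eqF//= pnatr_eq0.
  rewrite expRM_natl; apply: lerXn2r; rewrite ?nnegrE ?expR_ge0//; first by rewrite divr_ge0// ltW.
  by apply: le_trans (expR_ge1Dx _); rewrite lerDr.
apply: le_trans (ler_wpM2l (ltW e0) h); rewrite expr_div_n exprS mulrA.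
rewrite ler_pdivlMr ?exprn_gt0// mulrC mulrA ler_wpM2r ?(exprn_ge0 _ (ltW t0))//.
by rewrite ler_pdivrMr// mulrC in t2.
Qed.

Section Limit.
Variables (J : finType) (la E : J -> C) (k : J -> nat) (kap D : J -> R) (a : J -> nat -> C) (M : R).
Hypotheses (kap0 : forall j, 0 < kap j) (aM : forall j, bounded (a j) M).

Definition expval j (t : R) := E j * cpow (expR t) (la j) * (t ^+ k j)%:C * csum (a j) (D j * expR (- kap j * t)).

(** Sampled along an arithmetic progression of step [eta], the sum is a null sequence plus finitely
    many terms [z ^+ n] times polynomials in [n], with [|z| >= 1]. By [exp_poly_indep] the
    polynomial belonging to [z = 1] vanishes. The hypothesis says that no term is a nonzero constant
    in [t], so this polynomial determines [L]. *)
Lemma expsum_limit :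
  (forall j (l : nat), la j = (kap j * l%:R)%:C -> k j = 0%N -> E j * a j l * (D j ^+ l)%:C = 0) ->
  exists2 eta : R, 0 < eta & forall (t0 : R) (L : C),
   (forall j n, `|D j * expR (- kap j * (t0 + n%:R * eta))| <= 2^-1) ->
   cv0 (fun n => \sum_j expval j (t0 + n%:R * eta) - L) -> L = 0.
Proof.
move=> adm.
(* From the index [d] on all exponents have negative real part, so the tails of the series are null
   sequences. *)
have [d hd] : exists d, forall j, complex.Re (la j) - kap j * d%:R < 0.
  pose b j := Num.truncn (`|complex.Re (la j)| / kap j).
  exists (\max_j (b j).+1)%N => j; rewrite subr_lt0.
  have h1 : `|complex.Re (la j)| / kap j < (b j).+1%:R by exact: truncnS_gt.
  have h2 : (b j).+1%:R <= (\max_j (b j).+1)%N%:R :> R by rewrite ler_nat (leq_bigmax j).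
  apply: le_lt_trans (ler_norm _) _; rewrite mulrC -ltr_pdivrMr//.
  exact: lt_le_trans h1 h2.
pose mu (p : J * 'I_d) : C := la p.1 - (kap p.1 * p.2%:R)%:C.
(* With step [B^-1] every phase [complex.Im (mu p) * eta] is at most 1 in absolute value, hence
   below [pi]: the base [ze p] equals 1 only if [mu p = 0], and no frequency is aliased. *)
pose B := \sum_p `|complex.Im (mu p)| + 1.
have B0 : 0 < B by rewrite ltr_wpDl// sumr_ge0.
have hB p : `|complex.Im (mu p)| * B^-1 <= 1.
  rewrite ler_pdivrMr// mul1r /B (bigD1 p)//= -addrA lerDl addr_ge0// sumr_ge0//.
exists B^-1 => [|t0 L wn u0]; first by rewrite invr_gt0.
pose eta := B^-1; have eta0 : 0 < eta by rewrite invr_gt0.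
pose tn n : R := t0 + n%:R * eta.
have ten n : tn n = t0 + n%:R * eta by [].
pose ze p := cpow (expR eta) (mu p).
have tnM n z : cpow (expR (tn n)) z = cpow (expR t0) z * cpow (expR eta) z ^+ n.
  rewrite /tn; elim: n => [|n IH]; first by rewrite mul0r addr0 expr0 mulr1.
  rewrite -natr1 mulrDl mul1r addrA expRD cpowM ?expR_gt0// IH exprS; ring.
have decay z q : complex.Re z < 0 -> cv0 (fun n => cpow (expR (tn n)) z * (tn n ^+ q)%:C).
  move=> z0 e e0; have [|T' hT'] := @exp_beats_pow (- complex.Re z) e q _ e0; first by rewrite oppr_gt0.
  exists (Num.truncn (`|T' - t0| / eta)).+1 => n nN.
  rewrite normrM norm_cpow expRK normC_real -rmorphM/= lecR normrX.
  have := hT' (tn n); rewrite opprK; apply.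
  have : `|T' - t0| / eta <= n%:R.
    by apply: le_trans (ltW (truncnS_gt _)) _; rewrite ler_nat.
  rewrite ler_pdivrMr// => h; rewrite /tn -lerBlDl; apply: le_trans h; exact: ler_norm.
pose c (p : J * 'I_d) : C := E p.1 * a p.1 p.2 * (D p.1 ^+ p.2)%:C * cpow (expR t0) (mu p).
pose lin : {poly C} := t0%:C%:P + eta%:C *: 'X.
have linE n : lin.[n%:R] = (tn n)%:C.
  by rewrite /lin !hornerE /tn rmorphD rmorphM/= rmorph_nat mulrC.
pose big p := 0 <= complex.Re (mu p).
pose Pp (o : option (J * 'I_d)) : {poly C} := match o with
  | Some p => if big p then c p *: lin ^+ k p.1 else 0 | None => - L%:P end.
pose zz o := if o is Some p then ze p else 1.
have w_split j n : D j * expR (- kap j * tn n) = D j * expR (- kap j * tn n) by [].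
have expE (j : J) (l : nat) n : ((D j * expR (- kap j * tn n)) ^+ l)%:C * cpow (expR (tn n)) (la j) =
   (D j ^+ l)%:C * cpow (expR (tn n)) (la j - (kap j * l%:R)%:C).
  rewrite exprMn rmorphM/= -mulrA; congr (_ * _).
  rewrite -[X in _ = cpow _ X]addrC cpowD; congr (_ * _).
  rewrite -rmorphN/= /cpow /= expRK mul0r cos0 sin0 mulr1 mulr0; apply: complex_eq => //=.
  by rewrite -expRM_natl; congr expR; ring.
have main : cv0 (fun n => \sum_o zz o ^+ n * (Pp o).[n%:R]).
  pose small p := fun n => (if big p then 0 else c p * ze p ^+ n * (tn n ^+ k p.1)%:C).
  pose tail j n := E j * (D j ^+ d)%:C * csum (fun l => a j (d + l)%N) (D j * expR (- kap j * tn n)) *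
     (cpow (expR (tn n)) (la j - (kap j * d%:R)%:C) * (tn n ^+ k j)%:C).
  have small0 p : cv0 (small p).
    rewrite /small /big; case: (leP 0 (complex.Re (mu p))) => h; first exact: cv0_0.
    apply: cv0_eq (cv0Z (E p.1 * a p.1 p.2 * (D p.1 ^+ p.2)%:C) (decay _ (k p.1) h)) => n.
    by rewrite tnM /c /ze; ring.
  have tail0 j : cv0 (tail j).
    have h : complex.Re (la j - (kap j * d%:R)%:C) < 0 by rewrite raddfB /=; exact: hd.
    have cb n : `|csum (fun l => a j (d + l)%N) (D j * expR (- kap j * tn n))| <= (4 * M)%:C.
      by apply: csum_bound => [l|]; [exact: aM|exact: wn].
    apply: cv0_eq (cv0Z (E j * (D j ^+ d)%:C) (cv0M cb (decay _ (k j) h))) => n.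
    by rewrite /tail; ring.
  have := cv0D u0 (cv0D (cv0Z (-1) (cv0_sum (index_enum J) tail0)) (cv0Z (-1) (cv0_sum (index_enum _) small0))).
  apply: cv0_eq => n; rewrite big_option /= expr1n mul1r hornerN hornerC.
  have E1 : \sum_p ze p ^+ n * (if big p then c p *: lin ^+ k p.1 else 0).[n%:R] =
      \sum_p (c p * ze p ^+ n * (tn n ^+ k p.1)%:C) - \sum_p small p n.
    rewrite -sumrB; apply: eq_bigr => p _; rewrite /small; case: ifP => _.
      by rewrite hornerZ horner_exp linE subr0 -rmorphXn/=; ring.
    by rewrite horner0 mulr0 subrr.
  suff E2 : \sum_j expval j (tn n) - \sum_j tail j n = \sum_p (c p * ze p ^+ n * (tn n ^+ k p.1)%:C).
    rewrite E1 -E2 -ten !mulN1r.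
    move: (\sum_j expval j (tn n)) (\sum_j tail j n) (\sum_p small p n) => u1 u2 u3.
    by rewrite -!addrA addrCA; congr (_ + _).
  rewrite (_ : \sum_p c p * _ * _ = \sum_j \sum_(l < d) c (j, l) * ze (j, l) ^+ n * (tn n ^+ k j)%:C); last first.
    by rewrite pair_bigA; apply: eq_bigr => -[].
  rewrite -sumrB; apply: eq_bigr => j _.
  rewrite /expval -/(tn n) (csum_split d (aM j)) //; last exact: wn.
  rewrite mulrDr (_ : tail j n = E j * cpow (expR (tn n)) (la j) * (tn n ^+ k j)%:C *
     (((D j * expR (- kap j * tn n)) ^+ d)%:C * csum (fun l => a j (d + l)%N) (D j * expR (- kap j * tn n)))).
    rewrite addrK mulr_sumr; apply: eq_bigr => l _.
    rewrite /c /ze /=.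
    rewrite (_ : E j * cpow (expR (tn n)) (la j) * (tn n ^+ k j)%:C * (a j l * ((D j * expR (- kap j * tn n)) ^+ l)%:C) =
      E j * a j l * (tn n ^+ k j)%:C * (((D j * expR (- kap j * tn n)) ^+ l)%:C * cpow (expR (tn n)) (la j))); last by ring.
    by rewrite expE (tnM n (mu (j, l))); ring.
  rewrite /tail.
  rewrite [RHS](_ : _ = E j * (tn n ^+ k j)%:C * csum (fun l => a j (d + l)%N) (D j * expR (- kap j * tn n)) *
     (((D j * expR (- kap j * tn n)) ^+ d)%:C * cpow (expR (tn n)) (la j))); last by ring.
  by rewrite expE; ring.
pose good (o : option (J * 'I_d)) := if o is Some p then big p else true.
pose Z := undup [seq zz o | o <- enum {: option (J * 'I_d)} & good o].
pose P z := \sum_(o | good o && (zz o == z)) Pp o.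
have zzZ o : good o -> zz o \in Z.
  by move=> go; rewrite mem_undup map_f// mem_filter go mem_enum.
have := @exp_poly_indep Z P (undup_uniq _) _ _ 1 (zzZ None isT).
have ne : forall z, z \in Z -> 1 <= `|z|.
  move=> z; rewrite mem_undup => /mapP[[p|]]; rewrite mem_filter => /andP[gp _] ->; last by rewrite normr1.
  rewrite /zz /ze norm_cpow expRK (_ : 1 = 1%:C)// lecR -expR0 ler_expR mulr_ge0 ?(ltW eta0)//.
(* The argument [- t0 / eta] corresponds to [t = 0], where all terms with a positive power of [t]
   vanish. *)
move=> /(_ ne) h; have {h} /(congr1 (horner^~ ((- t0 / eta)%:C))) : P 1 = 0.
  apply: h; apply: cv0_eq main => n.
  rewrite (bigID good) /= [X in _ + X]big1 ?addr0; last first.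
    by move=> [p|] //= /negPf bp; rewrite bp horner0 mulr0.
  rewrite (eq_bigr (fun o => \sum_(z <- Z) if zz o == z then z ^+ n * (Pp o).[n%:R] else 0)); last first.
    move=> o go; rewrite (bigD1_seq (zz o)) ?undup_uniq ?zzZ//= eqxx big1 ?addr0// => z.
    by rewrite eq_sym => /negPf ->.
  rewrite exchange_big /=; apply: eq_bigr => z _.
  rewrite /P horner_sum mulr_sumr big_mkcondr; apply: eq_bigr => o _.
  by case: eqP.
rewrite horner0 /P big_mkcond big_option /= eqxx hornerD horner_sum big1 ?addr0.
  by rewrite hornerN hornerC => /eqP; rewrite oppr_eq0 => /eqP.
move=> p _; case: ifP => [|_]; last by rewrite horner0.
move=> /andP[bp /eqP zp]; rewrite bp hornerZ horner_exp.
have -> : lin.[(- t0 / eta)%:C] = 0.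
  by rewrite /lin !hornerE -rmorphM -rmorphD/= mulrCA divff ?gt_eqF// mulr1 subrr.
have [k0|k0] := eqVneq (k p.1) 0%N; last by rewrite expr0n (negPf k0) mulr0.
have mu0 : mu p = 0.
  have hr : complex.Re (mu p) = 0.
    have := congr1 (fun z => `|z|) zp; rewrite /ze norm_cpow expRK normr1 => /eqP.
    rewrite -[1 : C]/(1%:C) (inj_eq (@complexI R)) -expR0 => /eqP/expR_inj/eqP.
    by rewrite mulf_eq0 (gt_eqF eta0) orbF => /eqP.
  have := hB p; rewrite -/eta => hb.
  have := congr1 (@complex.Im R) zp; rewrite /ze /cpow /= expRK hr mul0r expR0 mul1r => hs.
  apply: complex_eq => //=; apply/eqP; rewrite -(mulIr_eq0 _ (mulIf (lt0r_neq0 eta0))).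
  apply/negPn/negP => hn; have hp := pi_gt0 R; have p1 : 1 < pi :> R by have := pi_ge2 R; lra.
  have hb' : `|complex.Im (mu p) * eta| <= 1 by rewrite normrM (gtr0_norm eta0).
  have [h|h] := ltP 0 (complex.Im (mu p) * eta).
    rewrite gtr0_norm// in hb'; have := sin_gt0_pi (_ : 0 < complex.Im (mu p) * eta < pi).
    by rewrite hs ltxx h (le_lt_trans hb' p1) => /(_ isT).
  have h' : complex.Im (mu p) * eta < 0 by rewrite lt_neqAle hn.
  rewrite ltr0_norm// in hb'; have := sin_gt0_pi (_ : 0 < - (complex.Im (mu p) * eta) < pi).
  by rewrite sinN hs oppr0 ltxx oppr_gt0 h' (le_lt_trans hb' p1) => /(_ isT).
rewrite k0 expr0 mulr1 /c.
have := adm p.1 p.2; move: mu0; rewrite /mu => /eqP; rewrite subr_eq0 => /eqP -> /(_ erefl k0) ->.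
by rewrite mul0r.
Qed.

End Limit.

End Sequences.

(** * Termwise primitives *)

Section Primitives.
Variable R : realType.
Local Notation C := R[i].

Lemma usum_pseries (b : nat -> R) (w M : R) : l1 M (fun l => b l * w ^+ l) ->
  pseries b w @ \oo --> usum (fun l => b l * w ^+ l).
Proof.
by move=> bl; have := usum_nat bl; rewrite /pseries /series.
Qed.

Lemma l1_geomM (b : nat -> R) (w M q : R) : 0 <= q -> (forall l, `|b l| * q ^+ l <= M) -> `|w| <= q / 2 ->
  0 < q -> l1 (2 * M) (fun l => b l * w ^+ l).
Proof.
move=> q0 bM wq qp; have M0 : 0 <= M by apply: le_trans (bM 0%N); rewrite mulr_ge0// exprn_ge0.
have h : `|w / q| <= 2^-1.
  by rewrite normrM normfV (gtr0_norm qp) ler_pdivrMr// mulrC.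
have := @gser_bounded R void (fun l _ => `|b l| * q ^+ l) M (fun=> 0) (w / q) _ h.
move=> /(_ (fun l => _)) /l1_le; apply => l.
  by rewrite ger0_norm// mulr_ge0// exprn_ge0.
rewrite (_ : _ * (w / q) ^+ l = `|b l| * w ^+ l); first by rewrite !normrM normr_id.
by rewrite expr_div_n; field; rewrite expf_neq0// gt_eqF.
Qed.

Lemma succ_le2 l : (l.+1%:R : R) <= 2 ^+ l.
Proof. by rewrite -natrX ler_nat ltn_expl. Qed.

(** The derivative [d] is described through [w * d], which keeps the powers of the original series;
    this is the form suited to the operator [z d/dz]. Two formal derivatives must converge at 1/8,
    and the factors [l.+1] are absorbed by [l.+1 <= 2 ^ l]. *)
Lemma der_pser (b : nat -> R) (w M : R) : (forall l, `|b l| <= M) -> `|w| < 8^-1 ->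
  exists d, [/\ is_derive w (1 : R) (fun w => usum (fun l => b l * w ^+ l)) d,
    w * d = usum (fun l => l%:R * b l * w ^+ l) &
    l1 (2 * M) (fun l => l%:R * b l * w ^+ l)].
Proof.
move=> bM w8; have M0 : 0 <= M by exact: le_trans (bM 0%N).
have K0 : 0 < 8^-1 :> R by rewrite invr_gt0.
have h1 l : `|b l| * 4^-1 ^+ l <= M.
  by rewrite -[leRHS]mulr1 ler_pM ?exprn_ge0 ?invr_ge0// exprn_ile1 ?invr_ge0// invf_le1// ler1n.
have lb u : `|u| <= 8^-1 -> l1 (2 * M) (fun l => b l * u ^+ l).
  by move=> u8; apply: (l1_geomM (q := 4^-1)) => //; lra.
pose b1 := pseries_diffs b; pose b2 := pseries_diffs b1.
have s0 l : 0 <= 2 ^+ l :> R by rewrite exprn_ge0.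
have e4 l : 4^-1 ^+ l = (2 ^+ l * 2 ^+ l)^-1 :> R.
  by rewrite -exprMn -exprVn; congr (_ ^+ _); lra.
have p2 l : 0 < 2 ^+ l :> R by rewrite exprn_gt0.
have h2 l : `|b1 l| * 4^-1 ^+ l <= M.
  rewrite /b1 /pseries_diffs normrM ger0_norm// e4 ler_pdivrMr ?mulr_gt0//.
  have := succ_le2 l; have := bM l.+1; have := p2 l; have : 1 <= 2 ^+ l :> R by rewrite exprn_ege1// ler1n.
  move=> q1 q2 q3 q4; apply: (@le_trans _ _ (2 ^+ l * M)); first by apply: ler_pM.
  by rewrite mulrC ler_wpM2l// ler_peMr.
have h3 l : `|b2 l| * 4^-1 ^+ l <= 2 * M.
  rewrite /b2 /b1 /pseries_diffs !normrM ger0_norm// ger0_norm// e4 ler_pdivrMr ?mulr_gt0//.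
  have := succ_le2 l; have := succ_le2 l.+1; rewrite exprS; have := bM l.+2.
  move=> q1 q2 q3; rewrite mulrA.
  apply: (@le_trans _ _ ((2 ^+ l * (2 * 2 ^+ l)) * M)); first by rewrite ler_pM ?mulr_ge0// ler_pM.
  by rewrite le_eqVlt; apply/orP; left; apply/eqP; ring.
have c0 := usum_pseries (lb _ (_ : `|8^-1 : R| <= 8^-1)).
have K8 : `|8^-1 : R| <= 8^-1 by rewrite gtr0_norm.
have l2 u : `|u| <= 8^-1 -> l1 (2 * M) (fun l => b1 l * u ^+ l).
  by move=> u8; apply: (l1_geomM (q := 4^-1)) => //; lra.
have l3 u : `|u| <= 8^-1 -> l1 (2 * (2 * M)) (fun l => b2 l * u ^+ l).
  by move=> u8; apply: (l1_geomM (q := 4^-1)) => //; lra.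
have l0w : l1 (2 * M) (fun l => l%:R * b l * w ^+ l).
  apply: (l1_geomM (q := 4^-1)) => //; last by lra.
  move=> l; rewrite normrM ger0_norm// e4 ler_pdivrMr ?mulr_gt0//.
  have := succ_le2 l; have := bM l; have := p2 l; have : 1 <= 2 ^+ l :> R by rewrite exprn_ege1// ler1n.
  move=> q1 q2 q3 q4; apply: (@le_trans _ _ (2 ^+ l * M)).
    by apply: ler_pM => //; apply: le_trans q4; rewrite ler_nat.
  by rewrite mulrC ler_wpM2l// ler_peMr.
have cv (g : nat -> R) (u D : R) : l1 D (fun l => g l * u ^+ l) -> cvgn (pseries g u) /\
    limn (pseries g u) = usum (fun l => g l * u ^+ l).
  move=> /usum_pseries h; split; first by apply/cvg_ex; exists (usum (fun l => g l * u ^+ l)).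
  by apply/cvg_lim => //; exact: norm_hausdorff.
have w8' := ltW w8.
exists (usum (fun l => b1 l * w ^+ l)); split.
- have := @pseries_snd_diffs R b 8^-1 w (cv _ _ _ (lb _ K8)).1 (cv _ _ _ (l2 _ K8)).1 (cv _ _ _ (l3 _ K8)).1.
  rewrite (gtr0_norm K0) => /(_ w8); rewrite (cv _ _ _ (l2 _ w8')).2.
  apply: near_eq_is_derive.
  have : \forall u \near w, `|u| < 8^-1.
    apply: (@open_nbhs_nbhs _ w [set u : R | `|u| < 8^-1]); split=> //.
    rewrite (_ : [set _ | _] = ball (0 : R) 8^-1); first exact: ball_open.
    by apply/seteqP; split=> z; rewrite -ball_normE /= sub0r normrN.
  by apply: filterS => u u8; rewrite (cv _ _ _ (lb _ (ltW u8))).2.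
- rewrite [RHS](usumS l0w) !mul0r add0r -(usumZ _ (l2 _ w8')); congr usum; apply/funext => l.
  by rewrite /b1 /pseries_diffs exprS; ring.
- exact: l0w.
Qed.

Definition cder (f : R -> C) (z : R) (d : C) :=
  is_derive z (1 : R) (fun z => complex.Re (f z)) (complex.Re d) /\
  is_derive z (1 : R) (fun z => complex.Im (f z)) (complex.Im d).

Lemma cder_eq f z d d' : cder f z d -> d = d' -> cder f z d'.
Proof. by move=> h <-. Qed.

Lemma cder_ext f g z d : (forall z, f z = g z) -> cder f z d -> cder g z d.
Proof. by move=> fg; rewrite (_ : g = f)//; apply/funext. Qed.

Lemma cder_cst c z : cder (fun=> c) z 0.
Proof. by split; exact: is_derive_cst. Qed.

Lemma cderD f g z d e : cder f z d -> cder g z e -> cder (fun z => f z + g z) z (d + e).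
Proof.
move=> [f1 f2] [g1 g2]; split.
  apply: is_derive_eq; last by rewrite raddfD.
  rewrite (_ : (fun z => _) = (fun z => complex.Re (f z)) + (fun z => complex.Re (g z))).
    exact: is_deriveD.
  by apply/funext => w; rewrite raddfD.
apply: is_derive_eq; last by rewrite raddfD.
rewrite (_ : (fun z => _) = (fun z => complex.Im (f z)) + (fun z => complex.Im (g z))).
  exact: is_deriveD.
by apply/funext => w; rewrite raddfD.
Qed.

Lemma cReD (z w : C) : complex.Re (z + w) = complex.Re z + complex.Re w.
Proof. by case: z w => [a b] [c d]. Qed.

Lemma cImD (z w : C) : complex.Im (z + w) = complex.Im z + complex.Im w.
Proof. by case: z w => [a b] [c d]. Qed.

Lemma cReM (z w : C) : complex.Re (z * w) = complex.Re z * complex.Re w - complex.Im z * complex.Im w.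
Proof. by case: z w => [a b] [c d]. Qed.

Lemma cImM (z w : C) : complex.Im (z * w) = complex.Re z * complex.Im w + complex.Im z * complex.Re w.
Proof. by case: z w => [a b] [c d]. Qed.

Lemma cderM f g z d e : cder f z d -> cder g z e -> cder (fun z => f z * g z) z (d * g z + f z * e).
Proof.
move=> [f1 f2] [g1 g2]; split.
  rewrite (_ : (fun z => _) = (fun z => complex.Re (f z)) * (fun z => complex.Re (g z)) -
     (fun z => complex.Im (f z)) * (fun z => complex.Im (g z))).
    have := is_deriveB (is_deriveM f1 g1) (is_deriveM f2 g2); move/is_derive_eq; apply.
    by rewrite cReD !cReM /GRing.scale /=; ring.
  by apply/funext => w; rewrite cReM.
rewrite (_ : (fun z => _) = (fun z => complex.Re (f z)) * (fun z => complex.Im (g z)) +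
   (fun z => complex.Im (f z)) * (fun z => complex.Re (g z))).
  have := is_deriveD (is_deriveM f1 g2) (is_deriveM f2 g1); move/is_derive_eq; apply.
  by rewrite cImD !cImM /GRing.scale /=; ring.
by apply/funext => w; rewrite cImM.
Qed.

Lemma cderZ c f z d : cder f z d -> cder (fun z => c * f z) z (c * d).
Proof. by move=> h; apply: cder_eq (cderM (cder_cst c z) h) _; rewrite mul0r add0r. Qed.

Lemma cder_sum (T : Type) (s : seq T) (F : T -> R -> C) z (d : T -> C) : (forall t, cder (F t) z (d t)) ->
  cder (fun z => \sum_(t <- s) F t z) z (\sum_(t <- s) d t).
Proof.
move=> h; elim: s => [|t s IH].
  by rewrite big_nil; apply: cder_ext (cder_cst 0 z) => w; rewrite big_nil.
by rewrite big_cons; apply: cder_ext (cderD (h t) IH) => w; rewrite big_cons.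
Qed.

Lemma cder_ln z : 0 < z -> cder (fun z => (ln z)%:C) z (z^-1)%:C.
Proof. by move=> z0; split => /=; [exact: is_derive1_ln|exact: is_derive_cst]. Qed.

Lemma cder_X f z d k : cder f z d -> cder (fun z => f z ^+ k) z (k%:R * f z ^+ k.-1 * d).
Proof.
move=> h; elim: k => [|k IH].
  by rewrite !mul0r; apply: cder_ext (cder_cst 1 z) => w.
apply: cder_ext (fun w => esym (exprS _ _)) _; apply: cder_eq (cderM h IH) _.
case: k IH => [|k] _; first by rewrite /= !mul0r mulr0 addr0 !expr0 mulr1 !mul1r.
by rewrite /= -[k.+2%:R]natr1 exprS; ring.
Qed.

Lemma cder_cpow (z : R) (la : C) : 0 < z -> cder (fun w : R => cpow w la) z (la * cpow z la * (z^-1)%:C).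
Proof.
move=> z0; case: la => a b.
have dl (e : R) : is_derive z (1 : R) (fun z => e * ln z) (e * z^-1).
  exact: (is_deriveZ e (is_derive1_ln z0)).
have de : is_derive z (1 : R) (fun z => expR (a * ln z)) (expR (a * ln z) * (a * z^-1)).
  apply: (@is_derive1_comp R expR (fun z => a * ln z)).
have dc : is_derive z (1 : R) (fun z => cos (b * ln z)) (- sin (b * ln z) * (b * z^-1)).
  apply: (@is_derive1_comp R cos (fun z => b * ln z)).
have ds : is_derive z (1 : R) (fun z => sin (b * ln z)) (cos (b * ln z) * (b * z^-1)).
  apply: (@is_derive1_comp R sin (fun z => b * ln z)).
split; rewrite /cpow /=.
  by have := is_deriveM de dc; move/is_derive_eq; apply; rewrite /GRing.scale /=; ring.
by have := is_deriveM de ds; move/is_derive_eq; apply; rewrite /GRing.scale /=; ring.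
Qed.

Definition cl1 (a : nat -> C) (w : R) := exists M,
  l1 M (fun l => complex.Re (a l) * w ^+ l) /\ l1 M (fun l => complex.Im (a l) * w ^+ l).

Lemma eq_csum a b (w : R) : a =1 b -> csum a w = csum b w.
Proof. by move=> ab; rewrite (_ : a = b)//; apply/funext. Qed.

Lemma csumD a b w : cl1 a w -> cl1 b w -> csum (fun l => a l + b l) w = csum a w + csum b w.
Proof.
move=> [M [a1 a2]] [M' [b1 b2]]; apply: complex_eq; rewrite /csum /=.
  by rewrite -(usumD a1 b1); congr usum; apply/funext => l; rewrite raddfD mulrDl.
by rewrite -(usumD a2 b2); congr usum; apply/funext => l; rewrite raddfD mulrDl.
Qed.

Lemma csumZ a w c : cl1 a w -> csum (fun l => c * a l) w = c * csum a w.
Proof.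
move=> [M [a1 a2]]; case: c => c d; apply: complex_eq; rewrite /csum /=.
  rewrite -(usumZ c a1) -mulNr -(usumZ (- d) a2) -(usumD (l1Z c a1) (l1Z (- d) a2)).
  by congr usum; apply/funext => l; rewrite cReM /=; ring.
rewrite -(usumZ c a2) -(usumZ d a1) -(usumD (l1Z c a2) (l1Z d a1)).
by congr usum; apply/funext => l; rewrite cImM /=; ring.
Qed.

Lemma cl1D a b w : cl1 a w -> cl1 b w -> cl1 (fun l => a l + b l) w.
Proof.
move=> [M [a1 a2]] [M' [b1 b2]]; exists (M + M'); split.
  by apply: l1_le (l1D a1 b1) _ => l; rewrite raddfD mulrDl.
by apply: l1_le (l1D a2 b2) _ => l; rewrite raddfD mulrDl.
Qed.

Lemma cl1Z a w c : cl1 a w -> cl1 (fun l => c * a l) w.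
Proof.
move=> [M [a1 a2]]; case: c => c d; exists (`|c| * M + `|d| * M); split.
  have := l1D (l1Z c a1) (l1Z (- d) a2); rewrite normrN => h.
  apply: l1_le h _ => l; rewrite cReM /=.
  by rewrite mulrBl mulNr -!mulrA.
by apply: l1_le (l1D (l1Z c a2) (l1Z d a1)) _ => l; rewrite cImM /= mulrDl !mulrA.
Qed.

Lemma bounded_cl1 a M w : bounded a M -> `|w| <= 2^-1 -> cl1 a w.
Proof. by move=> aM w1; exists (2 * M); exact: bounded_l1. Qed.

Lemma cder_csum a M (om : R -> R) z (d : R) : bounded a M -> `|om z| < 8^-1 -> is_derive z (1 : R) om d ->
  exists e : C, [/\ cder (fun z => csum a (om z)) z (d%:C * e),
    (om z)%:C * e = csum (fun l => l%:R * a l) (om z) & cl1 (fun l => l%:R * a l) (om z)].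
Proof.
move=> aM w8 dom.
have [d1 [D1 E1 L1]] := der_pser (fun l => (aM l).1) w8.
have [d2 [D2 E2 L2]] := der_pser (fun l => (aM l).2) w8.
have lRe l : complex.Re (l%:R * a l) = l%:R * complex.Re (a l).
  by rewrite mulr_natl raddfMn mulr_natl.
have lIm l : complex.Im (l%:R * a l) = l%:R * complex.Im (a l).
  by rewrite mulr_natl raddfMn mulr_natl.
exists (d1 +i* d2); split.
- split => /=.
    apply: is_derive_eq; first exact: (is_derive1_comp D1 dom).
    by rewrite mul0r subr0 mulrC.
  apply: is_derive_eq; first exact: (is_derive1_comp D2 dom).
  by rewrite mul0r addr0 mulrC.
- apply: complex_eq; rewrite /= mul0r ?subr0 ?addr0 ?E1 ?E2; congr usum; apply/funext => l.
    by rewrite lRe.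
  by rewrite lIm.
- exists (2 * M); split; [apply: l1_le L1 _|apply: l1_le L2 _] => l.
    by rewrite lRe.
  by rewrite lIm.
Qed.

Section HalfTerm.
Variables (D ep : R) (la : C).
Hypothesis ep0 : ep != 0.

Definition omega (z : R) := D * z `^ ep.
Definition hval (k : nat) (a : nat -> C) (z : R) := cpow z la * (ln z)%:C ^+ k * csum a (omega z).
Definition nu (l : nat) : C := la + (ep * l%:R)%:C.

Lemma cder_hval k a M z : bounded a M -> 0 < z -> `|omega z| < 8^-1 ->
  cl1 (fun l => nu l * a l) (omega z) /\
  cder (hval k a) z ((z^-1)%:C * (hval k (fun l => nu l * a l) z + k%:R * hval k.-1 a z)).
Proof.
move=> aM z0 w8.
have dom : is_derive z (1 : R) omega (z^-1 * (ep * omega z)).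
  have := is_deriveZ D (is_derive1_powR ep z0); move/is_derive_eq; apply.
  rewrite /omega /GRing.scale /= powRB ?powRr1 ?(ltW z0)//; last by rewrite (gt_eqF z0) implybT.
  by field; rewrite gt_eqF.
have [e [De Ee Le]] := cder_csum aM w8 dom.
have ca : cl1 a (omega z) by apply: bounded_cl1 aM _; lra.
have L2 : cl1 (fun l => nu l * a l) (omega z).
  have := cl1D (cl1Z la ca) (cl1Z ep%:C Le).
  rewrite (_ : (fun l => _) = (fun l => nu l * a l))//; apply/funext => l.
  by rewrite /nu rmorphM/= rmorph_nat; ring.
split=> //; apply: cder_eq (cderM (cderM (cder_cpow la z0) (cder_X k (cder_ln z0))) De) _.
have nE : csum (fun l => nu l * a l) (omega z) = la * csum a (omega z) + ep%:C * ((omega z)%:C * e).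
  rewrite Ee; apply: etrans (congr2 +%R (csumZ la ca) (csumZ ep%:C Le)).
  rewrite -(csumD (cl1Z la ca) (cl1Z ep%:C Le)); apply: eq_csum => l.
  by rewrite /nu rmorphM/= rmorph_nat; ring.
by rewrite /hval nE !rmorphM/=; ring.
Qed.

(* Terms of a primitive of [z^la (ln z)^k \sum_l q_l a_l omega^l dz / z], by
   repeated integration by parts; the resonant index [nu l = 0] raises the power
   of [ln z]. *)
Fixpoint prim (k : nat) (q : nat -> C) : seq (nat * (nat -> C)) :=
  let b l := if nu l == 0 then 0 else q l / nu l in
  (k, b) :: (k.+1, fun l => if nu l == 0 then q l / k.+1%:R else 0) ::
  if k is k'.+1 then prim k' (fun l => - k%:R * b l) else [::].

Definition nbd (q : nat -> C) := exists B : R, forall l, `|q l| <= B%:C.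

(** Beyond the index [L] the real part of [nu l] is at least 1 in absolute value, and only finitely
    many indices remain. So there are no small divisors, and termwise integration keeps coefficients
    bounded. *)
Lemma nu_inv_bound : nbd (fun l => if nu l == 0 then 0 else (nu l)^-1).
Proof.
pose e := `|ep|; have e0 : 0 < e by rewrite normr_gt0.
pose L := Num.truncn ((`|complex.Re la| + 1) / e).
pose f l := if nu l == 0 then 0 else (nu l)^-1.
exists (\sum_(l < L.+1) (`|complex.Re (f l)| + `|complex.Im (f l)|) + 1) => l; rewrite -/(f l).
have S0 (P : pred 'I_L.+1) : 0 <= \sum_(l < L.+1 | P l) (`|complex.Re (f l)| + `|complex.Im (f l)|).
  by apply: sumr_ge0 => i _; rewrite addr_ge0.
have [lL|Ll] := ltnP l L.+1.
  apply: le_trans (normC_le _) _; rewrite lecR (bigD1 (Ordinal lL))//= -addrA lerDl.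
  by rewrite addr_ge0.
rewrite /f; case: eqP => [_|/eqP nu0]; first by rewrite normr0 lecR addr_ge0.
apply: (@le_trans _ _ 1); last by rewrite lecR lerDr; exact: (S0 xpredT).
rewrite normfV invf_le1 ?normr_gt0//; apply: le_trans (Re_le_normC _); rewrite lecR /nu raddfD /=.
have h1 : (`|complex.Re la| + 1) / e < l%:R.
  by apply: lt_le_trans (truncnS_gt _) _; rewrite ler_nat.
rewrite ltr_pdivrMr// in h1.
have := lerB_normD (ep * l%:R) (complex.Re la); rewrite normrM (ger0_norm (ler0n _ l)) -/e.
rewrite (addrC (complex.Re la)); lra.
Qed.

Lemma prim_nbd k q : nbd q -> forall i, (i < size (prim k q))%N -> nbd (nth (0%N, fun=> 0) (prim k q) i).2.
Proof.
have [B hB] := nu_inv_bound; have B0 : 0 <= B by rewrite -lecR; exact: le_trans (normr_ge0 _) (hB 0%N).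
have nb q' : nbd q' -> nbd (fun l => if nu l == 0 then 0 else q' l / nu l).
  move=> [A qA]; exists (A * B) => l; have := hB l; case: ifP => _ h; last first.
    by rewrite normrM rmorphM/=; apply: ler_pM.
  have A0 : 0 <= A by rewrite -lecR; exact: le_trans (normr_ge0 _) (qA 0%N).
  by rewrite normr0 lecR mulr_ge0.
elim: k q => [|k IH] q [A qA] [|[|i]] hi //=.
- by apply: nb; exists A.
- have A0 : 0 <= A by rewrite -lecR; exact: le_trans (normr_ge0 _) (qA 0%N).
  by exists A => l; case: ifP => _; rewrite ?invr1 ?mulr1// normr0 lecR.
- by apply: nb; exists A.
- have A0 : 0 <= A by rewrite -lecR; exact: le_trans (normr_ge0 _) (qA 0%N).
  exists A => l; case: ifP => _; last by rewrite normr0 lecR.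
  rewrite normrM normfV normr_nat ler_pdivrMr ?ltr0n// (le_trans (qA l))//.
  by rewrite ler_peMr ?lecR// ler1n.
- apply: IH => //; have [A' hA'] := nb q (ex_intro _ A qA).
  exists (k.+1%:R * A') => l; rewrite normrM normrN normr_nat rmorphM/= rmorph_nat ler_wpM2l//.
Qed.

(** A constant term would have exponent [nu l = 0] and no logarithm; at such indices the primitive
    gets a logarithm instead. This is the condition under which [expsum_limit] forces a limit to be
    0. *)
Lemma prim_adm k q i l : (i < size (prim k q))%N -> nu l = 0 ->
  (nth (0%N, fun=> 0) (prim k q) i).1 = 0%N -> (nth (0%N, fun=> 0) (prim k q) i).2 l = 0.
Proof.
move=> hi nl; elim: k q i hi => [|k IH] q [|[|i]] hi //=; rewrite ?nl ?eqxx//.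
exact: IH.
Qed.

Lemma nbd_bounded q a A : nbd q -> (forall l, `|a l| <= A%:C) -> exists M, bounded (fun l => q l * a l) M.
Proof.
move=> [B qB] aA; exists (B * A) => l.
have h : `|q l * a l| <= (B * A)%:C by rewrite normrM rmorphM/=; apply: ler_pM.
by split; rewrite -lecR; [exact: le_trans (Re_le_normC _) h|exact: le_trans (Im_le_normC _) h].
Qed.

(** Induction on [k]: the first two terms of [prim] reproduce the integrand up to an error with one
    logarithm less, which the remaining terms cancel. *)
Lemma cder_prim k q (a : nat -> C) (A z : R) : nbd q -> (forall l, `|a l| <= A%:C) -> 0 < z ->
  `|omega z| < 8^-1 ->
  cder (fun z => \sum_(t <- prim k q) hval t.1 (fun l => t.2 l * a l) z) z
    ((z^-1)%:C * hval k (fun l => q l * a l) z).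
Proof.
move=> qb aA z0 w8.
pose b (q : nat -> C) (l : nat) : C := if nu l == 0 then 0 else q l / nu l.
pose rr (k : nat) (q : nat -> C) (l : nat) : C := if nu l == 0 then q l / k.+1%:R else 0.
have bq q' : nbd q' -> nbd (b q') by move=> qb'; have := @prim_nbd 0%N q' qb' 0%N isT.
have rq k' q' : nbd q' -> nbd (rr k' q').
  by move=> qb'; case: k' => [|k']; [have := @prim_nbd 0%N q' qb' 1%N isT|have := @prim_nbd k'.+1 q' qb' 1%N isT].
have w2 : `|omega z| <= 2^-1 by lra.
have step k' q' : nbd q' -> cder (fun z => hval k' (fun l => b q' l * a l) z + hval k'.+1 (fun l => rr k' q' l * a l) z) z
    ((z^-1)%:C * (hval k' (fun l => q' l * a l) z + k'%:R * hval k'.-1 (fun l => b q' l * a l) z)).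
  move=> qb'; have [M1 h1] := nbd_bounded (bq _ qb') aA; have [M2 h2] := nbd_bounded (rq k' _ qb') aA.
  have [L1 D1] := cder_hval k' h1 z0 w8; have [L2 D2] := cder_hval k'.+1 h2 z0 w8.
  apply: cder_eq (cderD D1 D2) _.
  have cr : cl1 (fun l => rr k' q' l * a l) (omega z) by apply: bounded_cl1 h2 _.
  have E : csum (fun l => q' l * a l) (omega z) =
     csum (fun l => nu l * (b q' l * a l)) (omega z) + k'.+1%:R * csum (fun l => rr k' q' l * a l) (omega z).
    apply: etrans (congr1 (+%R _) (csumZ k'.+1%:R cr)).
    rewrite -(csumD L1 (cl1Z k'.+1%:R cr)); apply: eq_csum => l.
    rewrite /b /rr; case: eqP => [->|/eqP nu0]; last by rewrite mul0r mulr0 addr0 mulrA (mulrCA (nu l)) mulfV// mulr1.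
    by rewrite mul0r add0r mulrA (mulrCA k'.+1%:R) mulfV ?pnatr_eq0// mulr1.
  have Z0 : csum (fun l => nu l * (rr k' q' l * a l)) (omega z) = 0.
    rewrite (_ : (fun l => _) = fun=> 0).
      by apply: complex_eq; rewrite /csum /= (_ : (fun l => _) = fun=> 0) ?usum0//; apply/funext => l; rewrite mul0r.
    by apply/funext => l; rewrite /rr; case: eqP => [->|_]; rewrite ?mul0r ?mulr0.
  by rewrite /hval E Z0 /=; ring.
elim: k q qb => [|k IH] q qb.
  have := step 0%N q qb; rewrite mul0r addr0; apply: cder_ext => w.
  by rewrite /= !big_cons big_nil addr0.
have qb' : nbd (fun l => - k.+1%:R * b q l).
  have [B hB] := bq _ qb; exists (k.+1%:R * B) => l.
  by rewrite normrM normrN normr_nat rmorphM/= rmorph_nat ler_wpM2l.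
have h := cderD (step k.+1 q qb) (IH _ qb').
apply: cder_eq (cder_ext _ h) _ => [w|].
  by rewrite /= !big_cons addrA.
have [M1 h1] := nbd_bounded (bq _ qb) aA.
have cb : cl1 (fun l => b q l * a l) (omega z) by apply: bounded_cl1 h1 _.
have -> : hval k (fun l => - k.+1%:R * b q l * a l) z = - k.+1%:R * hval k (fun l => b q l * a l) z.
  have E : csum (fun l => - k.+1%:R * b q l * a l) (omega z) = - k.+1%:R * csum (fun l => b q l * a l) (omega z).
    by rewrite -(csumZ _ cb); apply: eq_csum => l; rewrite mulrA.
  by rewrite /hval E; ring.
by rewrite /=; ring.
Qed.

End HalfTerm.

End Primitives.

(** * Integrals as limits of increments of a primitive *)

Section IntervalIntegral.
Variable R : realType.
Local Notation C := R[i].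
Local Notation mu := (@lebesgue_measure R).

(** The fundamental theorem on the compact intervals of an exhaustion, passed to the limit by
    dominated convergence with [|f|] as dominating function. Nothing is assumed about [F] at the
    ends of [J]. *)
Lemma FTC_seq (J : set R) (F f : R -> R) (a b : nat -> R) : measurable J ->
  (forall t, J t -> is_derive t (1 : R) F (f t)) -> (forall t, J t -> {for t, continuous f}) ->
  mu.-integrable J (EFin \o f) -> (forall n, a n < b n) -> (forall n t, a n <= t <= b n -> J t) ->
  (forall t, J t -> exists N, forall n, (N <= n)%N -> a n <= t <= b n) ->
  (fun n => F (b n) - F (a n)) @ \oo --> Rintegral mu J f.
Proof.
move=> mJ dF cf If ab abJ exh.
have JI n : J `&` `[a n, b n] = `[a n, b n]%classic.
  by apply/seteqP; split=> t [] // tab; split=> //; apply: (abJ n); move: tab; rewrite /= in_itv.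
have E n : (F (b n) - F (a n))%:E = (\int[mu]_(t in J) (EFin \o (f \_ `[a n, b n])) t)%E.
  have -> : (\int[mu]_(t in J) (EFin \o (f \_ `[a n, b n])) t)%E = (\int[mu]_(t in J `&` `[a n, b n]) (f t)%:E)%E.
    by rewrite integral_mkcondr; apply: eq_integral => t _; rewrite restrict_EFin.
  rewrite JI EFinB -(continuous_FTC2 (f := f) (ab n)) //.
  - apply: continuous_in_subspaceT => t; rewrite inE /= in_itv /= => tab; exact/cf/(abJ n).
  - split.
    + move=> t; rewrite in_itv /= => /andP[t1 t2].
      have Jt : J t by apply: (abJ n); rewrite !ltW.
      by have [] := dF _ Jt.
    + apply: cvg_at_right_filter; apply: differentiable_continuous; apply/derivable1_diffP.
      by have [] : is_derive (a n) (1 : R) F (f (a n)) by apply/dF/(abJ n); rewrite lexx ltW.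
    + apply: cvg_at_left_filter; apply: differentiable_continuous; apply/derivable1_diffP.
      by have [] : is_derive (b n) (1 : R) F (f (b n)) by apply/dF/(abJ n); rewrite lexx ltW.
  - move=> t; rewrite in_itv /= => /andP[t1 t2].
    have Jt : J t by apply: (abJ n); rewrite !ltW.
    by rewrite derive1E; have [] := dF _ Jt.
have mf := measurable_int mu If.
have [] := @dominated_convergence _ _ R mu J mJ (fun n => EFin \o (f \_ `[a n, b n])) (EFin \o f)
  (fun t => `|f t|%:E) _ mf _ _ _.
- move=> n; apply/measurable_EFinP/measurable_restrict => //.
  by rewrite setIC; apply: measurable_funS mJ _ _ => [//|]; move/measurable_EFinP: mf.
- apply: aeW => t Jt; have [N hN] := exh t Jt.
  apply: cvg_near_cst; exists N => // n /= /hN tab.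
  by rewrite /= patchE mem_set//= in_itv.
- exact: (integrable_norm If).
- apply: aeW => t n Jt; rewrite /= patchE; case: ifP => _ //.
  by rewrite lee_fin (_ : point = 0 :> R) ?normr0.
move=> _ _ h; have fJ : (\int[mu]_(t in J) (EFin \o f) t)%E \is a fin_num by exact: integrable_fin_num.
move: h; rewrite -(fineK fJ) (_ : [sequence _]_n = (fun n => (F (b n) - F (a n))%:E)); last first.
  by apply/funext => n; rewrite E.
by move/fine_cvgP => -[_].
Qed.

Lemma cv0_cvg (u v : nat -> R) (L M : R) : u @ \oo --> L -> v @ \oo --> M ->
  cv0 (fun n => u n +i* v n - (L +i* M)).
Proof.
move=> /cvgrPdist_le hu /cvgrPdist_le hv e e0; have e2 : 0 < e / 2 by rewrite divr_gt0.
have [N1 _ h1] := hu _ e2; have [N2 _ h2] := hv _ e2.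
exists (maxn N1 N2) => n; rewrite geq_max => /andP[n1 n2].
apply: le_trans (normC_le _) _; rewrite lecR /=.
have := h1 n n1; have := h2 n n2; rewrite /= distrC => h3; rewrite distrC => h4; lra.
Qed.

Lemma cv0_uniq (u : nat -> C) L M : cv0 (fun n => u n - L) -> cv0 (fun n => u n - M) -> L = M.
Proof.
move=> hL hM; apply/eqP; rewrite -subr_eq0 -normr_eq0; apply/eqP.
have E : `|L - M| = (complex.Re `|L - M|)%:C by rewrite normc_def.
have h e : 0 < e -> complex.Re `|L - M| <= e.
  move=> e0; have e2 : 0 < e / 2 by rewrite divr_gt0.
  have [N1 h1] := hL _ e2; have [N2 h2] := hM _ e2.
  have {}h1 := h1 _ (leq_maxl N1 N2); have {}h2 := h2 _ (leq_maxr N1 N2).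
  rewrite -lecR -E (_ : L - M = - (u (maxn N1 N2) - L) + (u (maxn N1 N2) - M)); last by ring.
  by rewrite (le_trans (ler_normD _ _))// normrN [e]splitr rmorphD lerD.
have n0 : 0 <= complex.Re `|L - M| by rewrite -lecR -E; exact: normr_ge0.
rewrite E; congr (_%:C); apply/eqP; rewrite eq_le n0 andbT leNgt; apply/negP => h0.
by have := h _ (divr_gt0 h0 (ltr0n R 2)); lra.
Qed.

Definition cinteg (J : set R) (f : R -> C) :=
  mu.-integrable J (EFin \o (fun t => complex.Re (f t))) /\
  mu.-integrable J (EFin \o (fun t => complex.Im (f t))).
Definition cint (J : set R) (f : R -> C) : C :=
  (Rintegral mu J (fun t => complex.Re (f t))) +i* (Rintegral mu J (fun t => complex.Im (f t))).

Lemma cintegS (I J : set R) f : measurable I -> measurable J -> J `<=` I -> cinteg I f -> cinteg J f.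
Proof. by move=> mI mJ JI [I1 I2]; split; [exact: integrableS I1|exact: integrableS I2]. Qed.

Lemma cinteg_eq (I : set R) (f g : R -> C) : measurable I -> (forall t, I t -> f t = g t) -> cinteg I f -> cinteg I g.
Proof.
move=> mI fg [I1 I2]; split.
  by apply: (@eq_integrable _ _ R mu I mI (EFin \o (fun t => complex.Re (f t))) _ _ I1) => t; rewrite inE /= => /fg ->.
by apply: (@eq_integrable _ _ R mu I mI (EFin \o (fun t => complex.Im (f t))) _ _ I2) => t; rewrite inE /= => /fg ->.
Qed.

Lemma cder_cont (f : R -> C) (z : R) (d : C) : cder f z d ->
  {for z, continuous (fun z => complex.Re (f z))} /\ {for z, continuous (fun z => complex.Im (f z))}.
Proof.
by move=> [[h1 _] [h2 _]]; split; apply: differentiable_continuous; exact/derivable1_diffP.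
Qed.

Lemma cFTC_seq (J : set R) (F f : R -> C) (a b : nat -> R) : measurable J ->
  (forall t, J t -> cder F t (f t)) -> (forall t, J t -> exists d, cder f t d) ->
  cinteg J f -> (forall n, a n < b n) -> (forall n t, a n <= t <= b n -> J t) ->
  (forall t, J t -> exists N, forall n, (N <= n)%N -> a n <= t <= b n) ->
  cv0 (fun n => F (b n) - F (a n) - cint J f).
Proof.
move=> mJ dF cf [I1 I2] ab abJ exh.
have h1 := FTC_seq mJ (fun t Jt => (dF t Jt).1) _ I1 ab abJ exh.
have h2 := FTC_seq mJ (fun t Jt => (dF t Jt).2) _ I2 ab abJ exh.
apply: cv0_eq (cv0_cvg (h1 _) (h2 _)) => [n|t /cf[d /cder_cont[]]//|t /cf[d /cder_cont[]]//].
by congr (_ - _); apply: complex_eq; rewrite raddfB.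
Qed.

Lemma cder_aff (f : R -> C) (s th t : R) (d : C) : cder f (s * (t - th)) d ->
  cder (fun t => f (s * (t - th))) t (s%:C * d).
Proof.
move=> [h1 h2].
have ha : is_derive t (1 : R) (fun t => s * (t - th)) s.
  have := is_deriveZ s (is_deriveB (is_derive_id t (1 : R)) (is_derive_cst th t 1)).
  by move/is_derive_eq; apply; rewrite subr0 /GRing.scale /= mulr1.
split.
  have := @is_derive1_comp R (fun z => complex.Re (f z)) (fun t => s * (t - th)) _ _ _ h1 ha; move/is_derive_eq; apply.
  by rewrite cReM /= mul0r subr0 mulrC.
have := @is_derive1_comp R (fun z => complex.Im (f z)) (fun t => s * (t - th)) _ _ _ h2 ha; move/is_derive_eq; apply.
by rewrite cImM /= mul0r addr0 mulrC.
Qed.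

Lemma cder_seq (f : R -> C) (x : R) (d : C) (e : nat -> R) : cder f x d -> e @ \oo --> x ->
  cv0 (fun n => f (e n) - f x).
Proof.
move=> /cder_cont[h1 h2] ex.
have := cv0_cvg (cvg_comp _ _ ex h1) (cvg_comp _ _ ex h2); apply: cv0_eq => n.
by rewrite /=; case: (f (e n)) => a b; case: (f x).
Qed.

Lemma inv_cvg0 (c : R) : (fun n : nat => c / n.+2%:R) @ \oo --> (0 : R).
Proof.
rewrite -(mulr0 c); apply: cvgM; first exact: cvg_cst.
by have := @cvg_harmonic R; rewrite -(cvg_shiftS (@harmonic R)).
Qed.

(** Continuity of [omega] at a positive value of [z], used along [l - (l - m) / (n + 2)]; the shift
    by 2 keeps the parameter strictly between 0 and 1. *)
Lemma om_endpoint (D ep r s th l m : R) : 0 < s * (l - th) ->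
  (forall u, 0 < u < 1 -> `|omega D ep (s * (l - u * (l - m) - th))| <= r) -> `|omega D ep (s * (l - th))| <= r.
Proof.
move=> zl h; pose e n := l - (l - m) / n.+2%:R.
have ecvg : e @ \oo --> l.
  rewrite -[X in _ --> X]subr0; apply: cvgB; [exact: cvg_cst|exact: inv_cvg0].
have zecvg : (fun n => s * (e n - th)) @ \oo --> s * (l - th).
  by apply: cvgM; [exact: cvg_cst|apply: cvgB => //; exact: cvg_cst].
have dom : is_derive (s * (l - th)) (1 : R) (omega D ep) (D * (ep * (s * (l - th)) `^ (ep - 1))).
  exact: (is_deriveZ D (is_derive1_powR ep zl)).
have cj : {for (s * (l - th)), continuous (omega D ep)}.
  by case: dom => ? _; apply: differentiable_continuous; exact/derivable1_diffP.
have nc : (fun n => `|omega D ep (s * (e n - th))|) @ \oo --> `|omega D ep (s * (l - th))|.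
  by apply: cvg_norm; exact: (cvg_comp _ _ zecvg cj).
apply: (cvgr_to_le nc); near=> n; rewrite /e (mulrC (l - m)); apply: h.
by rewrite invr_gt0 ltr0n invf_lt1 ?ltr0n// ltr1n.
Unshelve. all: by end_near.
Qed.

End IntervalIntegral.

(** * The integral over one interval of a finite sum of terms *)

Section FiberIntegral.
Variable R : realType.
Local Notation C := R[i].
Variables (J : finType) (P : J -> C) (D ep : J -> R) (la : J -> C) (k : J -> nat) (a : J -> nat -> C) (A : R).
Hypotheses (ep0 : forall j, ep j != 0) (aA : forall j l, `|a j l| <= A%:C).

Definition tcoef (j : J) := prim (ep j) (la j) (k j) (fun=> 1).
Definition Phi (z : R) : C := \sum_j P j * \sum_(t <- tcoef j) hval (D j) (ep j) (la j) t.1 (fun l => t.2 l * a j l) z.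
(** The factor [z^-1] is split off so that the terms [hval] are integrated against [dz / z], as in
    [prim]. *)
Definition phi (z : R) : C := (z^-1)%:C * \sum_j P j * hval (D j) (ep j) (la j) (k j) (a j) z.
Definition om_small (r z : R) := forall j, `|omega (D j) (ep j) z| <= r.

Lemma nbd1 : nbd (fun=> 1 : C).
Proof. by exists 1 => l; rewrite normr1. Qed.

Lemma cder_Phi z : 0 < z -> om_small 16^-1 z -> cder Phi z (phi z).
Proof.
move=> z0 w; have w8 j : `|omega (D j) (ep j) z| < 8^-1 by apply: le_lt_trans (w j) _; lra.
apply: cder_eq (cder_sum (F := fun j z => P j * \sum_(t <- tcoef j) hval (D j) (ep j) (la j) t.1 (fun l => t.2 l * a j l) z) _ _) _.
  move=> j; apply: cderZ; exact: (@cder_prim _ (D j) (ep j) (la j) (ep0 j) (k j) (fun=> 1) (a j) A z nbd1 (aA j) z0 (w8 j)).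
rewrite /phi mulr_sumr; apply: eq_bigr => j _.
rewrite (_ : (fun l => 1 * a j l) = a j); last by apply/funext => l; rewrite mul1r.
by rewrite mulrCA.
Qed.

Lemma cder_phi z : 0 < z -> om_small 16^-1 z -> exists d, cder phi z d.
Proof.
move=> z0 w; have w8 j : `|omega (D j) (ep j) z| < 8^-1 by apply: le_lt_trans (w j) _; lra.
have h j : exists d, cder (hval (D j) (ep j) (la j) (k j) (a j)) z d.
  have [M aM] := nbd_bounded nbd1 (aA j).
  have aM' : bounded (a j) M by move=> l; have := aM l; rewrite mul1r.
  by have [_ d] := @cder_hval R (D j) (ep j) (la j) (k j) (a j) M z aM' z0 (w8 j); eexists; exact: d.
have [d hd] := choice h.
have hz : cder (fun z : R => (z^-1)%:C) z (- (z ^+ 2)^-1)%:C.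
  split => /=; last exact: is_derive_cst.
  have zn : z != 0 by rewrite gt_eqF.
  have := is_deriveV (f := id) zn (is_derive_id z (1 : R)); move/is_derive_eq; apply.
  by rewrite /GRing.scale /= mulr1.
have h2 : cder (fun z => \sum_j P j * hval (D j) (ep j) (la j) (k j) (a j) z) z (\sum_j P j * d j).
  by apply: (@cder_sum R J (index_enum J) (fun j z => P j * hval (D j) (ep j) (la j) (k j) (a j) z)) => j; exact: cderZ.
by eexists; exact: cderM hz h2.
Qed.

(* [sg] is 1 for the limit at infinity and -1 for the limit at 0. *)
Lemma Phi_limit (sg t1 : R) : sg = 1 \/ sg = -1 -> (forall t, t1 <= t -> om_small 2^-1 (expR (sg * t))) ->
  exists2 eta : R, 0 < eta & forall (t0 : R) (L : C), t1 <= t0 ->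
    cv0 (fun n => Phi (expR (sg * (t0 + n%:R * eta))) - L) -> L = 0.
Proof.
move=> sgE small.
have sg2 : sg * sg = 1 by case: sgE => ->; ring.
(* [omega] stays bounded by 1/2 for all large [t], which excludes an exponent of the growing sign
   unless [D j = 0]. *)
have Dep j : D j = 0 \/ sg * ep j < 0.
  have [->|D0] := eqVneq (D j) 0; [by left|right].
  rewrite ltNge; apply/negP; rewrite le_eqVlt => /orP[|e0].
    rewrite eq_sym mulf_eq0 (negPf (ep0 j)) orbF; case: sgE => -> /eqP; lra.
  have lnD : 0 < `|D j| by rewrite normr_gt0.
  pose t := Num.max t1 ((`|ln `|D j| | + 1) / (sg * ep j)).
  have := small t _ j; rewrite le_max lexx => /(_ isT).
  rewrite /omega normrM (ger0_norm (powR_ge0 _ _)) leNgt => /negP; apply.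
  rewrite -(lnK lnD) /powR gt_eqF ?expR_gt0// expRK -expRD.
  apply: (@lt_le_trans _ _ (expR 0)); first by rewrite expR0; lra.
  rewrite ler_expR.
  have : (`|ln `|D j| | + 1) / (sg * ep j) <= t by rewrite le_max lexx orbT.
  rewrite ler_pdivrMr// (_ : ep j * (sg * t) = t * (sg * ep j)); last by ring.
  have := ler_norm (- ln `|D j|); rewrite normrN; lra.
pose kap j := `|ep j|.
have kap0 j : 0 < kap j by rewrite normr_gt0.
pose JJ := {j : J & 'I_(size (tcoef j))}.
pose tc (p : JJ) := nth (0%N, fun=> 0) (tcoef (tag p)) (tagged p).
pose aa (p : JJ) (l : nat) : C := (tc p).2 l * a (tag p) l.
have /choice[M hM] (p : JJ) : exists M, bounded (aa p) M.
  by apply: nbd_bounded (aA _); apply: prim_nbd => //; exact: nbd1.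
have MM p : bounded (aa p) (\sum_p `|M p|).
  move=> l; have [h1 h2] := hM p l; have hs : `|M p| <= \sum_p `|M p|.
    by rewrite (bigD1 p)//= lerDl; apply: sumr_ge0.
  by have := ler_norm (M p); split; lra.
pose EE (p : JJ) : C := P (tag p) * sg%:C ^+ (tc p).1.
(* The resonance condition of [expsum_limit] amounts to [nu l = 0], unless the power of [D] already
   vanishes; [prim_adm] then applies. *)
have adm p l : sg%:C * la (tag p) = (kap (tag p) * l%:R)%:C -> (tc p).1 = 0%N ->
    EE p * aa p l * (D (tag p) ^+ l)%:C = 0.
  move=> h k0.
  suff [h0|nu0] : D (tag p) ^+ l = 0 \/ nu (ep (tag p)) (la (tag p)) l = 0.
  - by rewrite h0 mulr0.
  - by rewrite /aa /tc (prim_adm (ltn_ord _) nu0 k0) mul0r mulr0 mul0r.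
  have laE : la (tag p) = (sg * kap (tag p) * l%:R)%:C.
    by rewrite -mulrA rmorphM/= -h mulrA -rmorphM/= sg2 mul1r.
  case: l laE {h} => [|l] laE; first by right; rewrite /nu laE !mulr0 addr0.
  have [->|e0] := Dep (tag p); first by left; rewrite exprS mul0r.
  right; rewrite /nu laE -rmorphD/= (_ : _ + _ = 0)// /kap.
  have -> : `|ep (tag p)| = - (sg * ep (tag p)).
    rewrite -ltr0_norm// normrM; case: sgE => ->; rewrite ?normrN normr1 mul1r//.
  by rewrite mulrN mulrA sg2; ring.
have [eta eta0 H] := expsum_limit (la := fun p : JJ => sg%:C * la (tag p)) (E := EE) (k := fun p => (tc p).1)
  (kap := fun p => kap (tag p)) (D := fun p => D (tag p)) (fun p => kap0 _) MM adm.
have omE p t : t1 <= t -> D (tag p) * expR (- kap (tag p) * t) = omega (D (tag p)) (ep (tag p)) (expR (sg * t)).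
  move=> _; rewrite /omega; have [->|e0] := Dep (tag p); first by rewrite !mul0r.
  rewrite /powR gt_eqF ?expR_gt0// expRK; congr (_ * expR _).
  rewrite /kap; have -> : `|ep (tag p)| = - (sg * ep (tag p)).
    rewrite -ltr0_norm// normrM; case: sgE => ->; rewrite ?normrN normr1 mul1r//.
  by ring.
exists eta => // t0 L t10 cvL.
have tn n : t1 <= t0 + n%:R * eta by rewrite (le_trans t10)// lerDl mulr_ge0// ltW.
apply: (H t0 L) => [p n|].
  by rewrite omE//; apply: small.
apply: cv0_eq cvL => n; congr (_ - _); rewrite /Phi.
under eq_bigr => j _ do rewrite (big_nth (0%N, fun=> 0)) big_mkord mulr_sumr.
rewrite sig_big_dep /=; apply: eq_bigr => p _.
rewrite /expval /hval omE// /EE -/(tc p) -/(aa p).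
set t := t0 + _.
rewrite expRK rmorphM/= exprMn -rmorphXn/=.
have -> : cpow (expR (sg * t)) (la (tag p)) = cpow (expR t) (sg%:C * la (tag p)).
  have -> : expR (sg * t) = expR t `^ sg by rewrite /powR gt_eqF ?expR_gt0// expRK.
  by rewrite cpow_powR ?expR_gt0.
by rewrite -[t%:C ^+ _]rmorphXn/=; ring.
Qed.

Variables (s th : R) (f : R -> C).
Hypothesis sE : s = 1 \/ s = -1.

Definition side (d : R) (b : option R) (t : R) : Prop := if b is Some l then 0 < d * (l - t) else True.
Definition Fprim (t : R) : C := s%:C * Phi (s * (t - th)).
(* [0] is the limit of the primitive at an end where [z] tends to 0 or infinity. *)
Definition endval (b : option R) : C := if b is Some l then if 0 < s * (l - th) then Fprim l else 0 else 0.

Lemma side_le d b t t' : 0 <= d * (t - t') -> side d b t -> side d b t'.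
Proof.
case: b => [l|] //= h1 h2; have -> : l - t' = (l - t) + (t - t') by ring.
by rewrite mulrDr ltr_pwDl.
Qed.

Definition good_at t := [/\ 0 < s * (t - th), om_small 32^-1 (s * (t - th)) & f t = phi (s * (t - th))].

Lemma om_le r r' z : r <= r' -> om_small r z -> om_small r' z.
Proof. by move=> rr h j; exact: le_trans (h j) rr. Qed.

Lemma s2 : s * s = 1.
Proof. by case: sE => ->; ring. Qed.

Lemma cder_F t : 0 < s * (t - th) -> om_small 16^-1 (s * (t - th)) -> cder Fprim t (phi (s * (t - th))).
Proof.
move=> z0 w; have := cderZ s%:C (cder_aff (cder_Phi z0 w)).
by move/cder_eq; apply; rewrite mulrA -rmorphM/= s2 mul1r.
Qed.

Section Interval.
Variables (I : set R) (m : R).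
Hypotheses (Ig : forall t, I t -> good_at t) (Im : I m) (Ii : is_interval I) (If : cinteg I f).

Lemma I_FTC (E : set R) (u v : nat -> R) : is_interval E -> E `<=` I -> (forall n, u n < v n) ->
  (forall n, E (u n)) -> (forall n, E (v n)) ->
  (forall t, E t -> exists N, forall n, (N <= n)%N -> u n <= t <= v n) ->
  cv0 (fun n => Fprim (v n) - Fprim (u n) - cint E f).
Proof.
move=> Ji JI uv Ju Jv exh; have mJ : measurable E by exact: is_interval_measurable.
have mI : measurable I by exact: is_interval_measurable.
have h16 t : I t -> 0 < s * (t - th) /\ om_small 16^-1 (s * (t - th)).
  by case/Ig => h1 h2 _; split=> //; apply: om_le h2; lra.
pose g t := phi (s * (t - th)).
have -> : cint E f = cint E g.
  by rewrite /cint; congr (_ +i* _); apply: eq_Rintegral => t; rewrite inE => /JI/Ig[_ _ ->].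
apply: cFTC_seq => //.
- by move=> t /JI/h16[z0 w]; exact: cder_F.
- by move=> t /JI/h16[z0 w]; have [d hd] := cder_phi z0 w; exists (s%:C * d); exact: cder_aff.
- by apply: (cinteg_eq mJ _ (cintegS mI mJ JI If)) => t /JI/Ig[_ _].
- by move=> n t; exact: Ji.
Qed.

(** By [I_FTC] on the part of [I] on the side [d] of [m], the limit is [Fprim m] plus or minus the
    integral over that part; only its existence matters, since [Phi_limit] computes it. *)
Lemma half_limit d (e : nat -> R) : d = 1 \/ d = -1 -> (forall n, I (e n) /\ 0 < d * (e n - m)) ->
  (forall t, I t -> exists N, forall n, (N <= n)%N -> 0 <= d * (e n - t)) ->
  exists L, cv0 (fun n => Fprim (e n) - L).
Proof.
move=> dE eI exh.
pose E := [set t | I t /\ 0 <= d * (t - m)].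
have Jm : E m by split=> //; rewrite subrr mulr0.
have Je n : E (e n) by have [h1 h2] := eI n; split=> //; exact: ltW.
have Ji : is_interval E.
  move=> x y [Ix dx] [Iy dy] z /andP[xz zy]; split; first by apply: (Ii Ix Iy); rewrite xz.
  by move: dx dy; case: dE => ->; lra.
have exh' t : E t -> exists N, forall n, (N <= n)%N -> 0 <= d * (e n - t) by move=> [/exh].
move: dE => [d1|d1].
  have := @I_FTC E (fun=> m) e Ji (fun t Jt => Jt.1) _ (fun=> Jm) Je _; rewrite d1 in eI exh' *.
  move=> h; exists (Fprim m + cint E f); apply: cv0_eq (h _ _) => [n|n|t Jt].
    by move: (Fprim (e n)) (Fprim m) (cint E f) => x1 x2 x3; ring.
    by have [_] := eI n; lra.
  have [N hN] := exh' t Jt; exists N => n /hN; case: Jt => _; rewrite d1; lra.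
have := @I_FTC E e (fun=> m) Ji (fun t Jt => Jt.1) _ Je (fun=> Jm) _; rewrite d1 in eI exh' *.
move=> h; exists (Fprim m - cint E f); apply: cv0_eq (cv0Z (-1) (h _ _)) => [n|n|t Jt].
    by move: (Fprim (e n)) (Fprim m) (cint E f) => x1 x2 x3; ring.
  by have [_] := eI n; lra.
have [N hN] := exh' t Jt; exists N => n /hN; case: Jt => _; rewrite d1; lra.
Qed.

(** Three kinds of ends. At a finite end with [z > 0] the primitive is continuous. At an infinite
    end [z] tends to infinity and at the end [th] it tends to 0; there the limit provided by
    [half_limit] is 0 by [Phi_limit], along an exponential sequence with the step that [Phi_limit]
    prescribes. *)
Lemma endpoint d b b' : d = 1 \/ d = -1 -> (forall t, I t <-> side d b t /\ side (- d) b' t) ->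
  exists e : nat -> R, [/\ forall n, I (e n) /\ 0 < d * (e n - m),
    forall t, I t -> exists N, forall n, (N <= n)%N -> 0 <= d * (e n - t) &
    cv0 (fun n => Fprim (e n) - endval b)].
Proof.
move=> dE IE; have d2 : d * d = 1 by case: dE => ->; ring.
have [sm sm'] := (IE m).1 Im; have [zm _ _] := Ig Im.
have In t : 0 <= d * (t - m) -> side d b t -> I t.
  by move=> h1 h2; apply/IE; split=> //; apply: side_le sm'; move: h1; rewrite mulNr -mulrN opprB.
(* The two kinds of ends with limit 0 are treated together: [sg = s * d] tells whether [z] tends to
   infinity or to 0 when the end is approached in the direction [d]. *)
have expseq sg t1 : sg = 1 \/ sg = -1 -> sg = s * d -> endval b = 0 ->
    (forall t, t1 <= t -> I (th + s * expR (sg * t)) /\ 0 < d * (th + s * expR (sg * t) - m)) ->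
    (forall t, I t -> exists T, forall t', T <= t' -> 0 <= d * (th + s * expR (sg * t') - t)) ->
    exists e : nat -> R, [/\ forall n, I (e n) /\ 0 < d * (e n - m),
    forall t, I t -> exists N, forall n, (N <= n)%N -> 0 <= d * (e n - t) &
    cv0 (fun n => Fprim (e n) - endval b)].
  move=> sgE sgd b0 h1 h2.
  have zE t : s * (th + s * expR (sg * t) - th) = expR (sg * t).
    by rewrite addrAC subrr add0r mulrA s2 mul1r.
  have [|eta eta0 lim] := @Phi_limit sg t1 sgE.
    move=> t /h1[/Ig[_ w _] _]; move: w; rewrite zE; apply: om_le; lra.
  pose e n := th + s * expR (sg * (t1 + n%:R * eta)).
  have tn n : t1 <= t1 + n%:R * eta by rewrite lerDl mulr_ge0// ltW.
  have e1 n : I (e n) /\ 0 < d * (e n - m) by exact: h1.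
  have e2 t : I t -> exists N, forall n, (N <= n)%N -> 0 <= d * (e n - t).
    move=> /h2[T hT]; exists (Num.truncn (`|T - t1| / eta)).+1 => n nN; apply: hT.
    have : `|T - t1| / eta < n%:R by apply: lt_le_trans (truncnS_gt _) _; rewrite ler_nat.
    by rewrite ltr_pdivrMr// => h; have := ler_norm (T - t1); lra.
  exists e; split=> //; have [L hL] := half_limit dE e1 e2.
  suff L0 : L = 0 by rewrite b0 -L0.
  have : s%:C * L = 0.
    apply: (lim t1) => //; apply: cv0_eq (cv0Z s%:C hL) => n.
    by rewrite /Fprim /e zE mulrBr mulrA -rmorphM/= s2 mul1r.
  by move/(congr1 (fun x => s%:C * x)); rewrite mulr0 mulrA -rmorphM/= s2 mul1r.
case: b IE sm In expseq => [l|] IE sm In expseq; last first.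
  (* Otherwise [z] would become negative far out on the unbounded side. *)
  have sd : s * d = 1.
    suff : s * d <> -1 by case: sE dE => -> [] ->; lra.
    move=> sd; pose t := m + d * (s * (m - th)).
    have /Ig[] : I t.
      by apply: In => //; rewrite /t addrAC subrr add0r mulrA d2 mul1r ltW.
    move=> + _ _; rewrite /t (_ : _ * _ = s * (m - th) + (s * d) * (s * (m - th))); last by ring.
    by rewrite sd; lra.
  have dE' : d = s by rewrite -[LHS]mul1r -s2 -mulrA sd mulr1.
  apply: (expseq 1 (`|ln (s * (m - th))| + 1)) => //; [by left|move=> t ht|move=> t It].
    have h : 0 < d * (th + s * expR (1 * t) - m).
      rewrite dE'; have -> : s * (th + s * expR (1 * t) - m) = s * s * expR t - s * (m - th) by rewrite mul1r; ring.
      rewrite s2 mul1r subr_gt0 -{1}(lnK zm) ltr_expR.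
      have := ler_norm (ln (s * (m - th))); lra.
    by split=> //; apply: In => //; exact: ltW.
  have [zt _ _] := Ig It; exists (ln (s * (t - th))) => t' ht.
  rewrite dE'; have -> : s * (th + s * expR (1 * t') - t) = s * s * expR t' - s * (t - th) by rewrite mul1r; ring.
  by rewrite s2 mul1r subr_ge0 -{1}(lnK zt) ler_expR.
pose e n := l - (l - m) / n.+2%:R.
have n2 n : 0 < (n.+2%:R : R)^-1 /\ (n.+2%:R : R)^-1 < 1.
  by rewrite invr_gt0 ltr0n invf_lt1 ?ltr0n// ltr1n.
have e1 n : I (e n) /\ 0 < d * (e n - m).
  have [p1 p2] := n2 n.
  have h : 0 < d * (e n - m).
    rewrite /e (_ : _ * _ = d * (l - m) * (1 - n.+2%:R^-1)); last by ring.
    by rewrite mulr_gt0// subr_gt0.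
  split=> //; apply: In; first exact: ltW.
  rewrite /= /e (_ : _ * _ = d * (l - m) * n.+2%:R^-1); last by ring.
  by rewrite mulr_gt0.
have ecvg : e @ \oo --> l.
  rewrite -[X in _ --> X]subr0; apply: cvgB; [exact: cvg_cst|exact: inv_cvg0].
have ze n : 0 < s * (e n - th) by have [/Ig[]] := e1 n.
have zecvg : (fun n => s * (e n - th)) @ \oo --> s * (l - th).
  by apply: cvgM; [exact: cvg_cst|apply: cvgB => //; exact: cvg_cst].
have zl : 0 <= s * (l - th).
  apply: (cvgr_to_ge zecvg).
  by near=> n; exact/ltW/ze.
have {zl} [zl|zl] : 0 < s * (l - th) \/ l = th.
- move: zl; rewrite le_eqVlt => /orP[/eqP/esym/eqP h0|]; [right|by left].
  move: h0; rewrite mulf_eq0 subr_eq0 => /orP[|/eqP//]; case: sE => ->; by rewrite ?oppr_eq0 oner_eq0.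
- exists e; split=> //.
    move=> t /IE[/= h _]; exists (Num.truncn (d * (l - m) / (d * (l - t)))).+1 => n nN.
    have h1 : d * (l - m) / (d * (l - t)) < n%:R by apply: lt_le_trans (truncnS_gt _) _; rewrite ler_nat.
    have h2 : d * (l - m) / (d * (l - t)) <= n.+2%:R by rewrite (le_trans (ltW h1))// ler_nat -addn2 leq_addr.
    rewrite /e (_ : _ * _ = d * (l - t) - d * (l - m) / n.+2%:R); last by ring.
    by move: h2; rewrite ler_pdivrMr// subr_ge0 ler_pdivrMr ?ltr0n// (mulrC (n.+2%:R)).
  rewrite /= zl; apply: cder_seq ecvg; apply: cder_F => // j.
  apply: (om_endpoint (m := m) zl) => u /andP[u0 u1].
  have It : I (l - u * (l - m)).
    apply: In; last by rewrite /= opprB addrCA subrr addr0 mulrCA mulr_gt0.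
    rewrite (_ : _ * _ = (1 - u) * (d * (l - m))); last by ring.
    by apply: mulr_ge0; [lra|exact: ltW].
  have [_ w _] := Ig It; apply: le_trans (w j) _; lra.
have sd : s * d = -1.
  move: zm sm => /=; rewrite zl; case: sE dE => -> [] ->; lra.
have dE' : d = - s by rewrite -[LHS]mul1r -s2 -mulrA sd mulrN1.
apply: (expseq (-1) (`|ln (s * (m - th))| + 1)) => //; [by right| |move=> t ht|move=> t It].
- by rewrite /= zl subrr mulr0 ltxx.
- have h : 0 < d * (th + s * expR (-1 * t) - m).
    rewrite dE'; have -> : - s * (th + s * expR (-1 * t) - m) = s * (m - th) - s * s * expR (- t) by rewrite mulN1r; ring.
    rewrite s2 mul1r subr_gt0 -{1}(lnK zm) ltr_expR.
    have := ler_norm (- ln (s * (m - th))); rewrite normrN; lra.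
  split=> //; apply: In => //; first exact: ltW.
  rewrite /= zl dE'; have -> : - s * (th - (th + s * expR (-1 * t))) = s * s * expR (-1 * t) by ring.
  by rewrite s2 mul1r expR_gt0.
have [zt _ _] := Ig It; exists (- ln (s * (t - th))) => t' ht.
rewrite dE'; have -> : - s * (th + s * expR (-1 * t') - t) = s * (t - th) - s * s * expR (- t') by rewrite mulN1r; ring.
rewrite s2 mul1r subr_ge0 -{1}(lnK zt) ler_expR; lra.
Unshelve. all: by end_near.
Qed.

Lemma interval_integral lo hi : (forall t, I t <-> side 1 hi t /\ side (-1) lo t) ->
  cint I f = endval hi - endval lo.
Proof.
move=> IE.
have [e [e1 e2 e3]] := @endpoint 1 hi lo (or_introl erefl) IE.
have [|e' [e1' e2' e3']] := @endpoint (-1) lo hi (or_intror erefl).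
  by move=> t; rewrite opprK; split=> [/IE[]|[h1 h2]] //; apply/IE.
have := I_FTC Ii (fun t It => It) (u := e') (v := e).
move=> h; apply: (@cv0_uniq _ (fun n => Fprim (e n) - Fprim (e' n))).
  apply: h => [n|n|n|t It]; [|by have [] := e1' n|by have [] := e1 n|].
    by have [_ h1] := e1 n; have [_ h2] := e1' n; lra.
  have [N1 h1] := e2 t It; have [N2 h2] := e2' t It.
  exists (maxn N1 N2) => n; rewrite geq_max => /andP[/h1 h3 /h2 h4]; lra.
apply: cv0_eq (cv0D e3 (cv0Z (-1) e3')) => n.
by move: (Fprim (e n)) (Fprim (e' n)) (endval hi) (endval lo) => x1 x2 x3 x4; ring.
Qed.

End Interval.

End FiberIntegral.

(** * Integration with respect to the last variable *)

Section Atoms.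
Variables (R : realType) (K : divringClosed R[i]).
Local Notation C := R[i].

(** The expressions of [PC] over a fixed family of atoms, so that an induction keeps the atoms,
    which are prepared simultaneously on one cell. *)
Inductive PCx (Z I : Type) (f : I -> Z -> R) : (Z -> C) -> Prop :=
| PCx_cst c : PCx f (fun=> c)
| PCx_pow i al : al \in K -> PCx f (fun z => cpow (f i z) al)
| PCx_log i : PCx f (fun z => (ln (f i z))%:C)
| PCx_add g h : PCx f g -> PCx f h -> PCx f (fun z => g z + h z)
| PCx_mul g h : PCx f g -> PCx f h -> PCx f (fun z => g z * h z).

Lemma PCx_idx Z I I' (u : I -> I') (f : I' -> Z -> R) h : PCx (fun i => f (u i)) h -> PCx f h.
Proof.
elim=> {h} [c|i al alK|i|g h _ IHg _ IHh|g h _ IHg _ IHh].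
- exact: PCx_cst.
- exact: (PCx_pow f (u i)).
- exact: (PCx_log f (u i)).
- exact: PCx_add.
- exact: PCx_mul.
Qed.

Lemma PC_atoms n (h : 'rV[R]_n -> C) : PC K h -> exists (I : finType) (f : I -> 'rV[R]_n -> R),
  (forall i, Dfun (f i) /\ forall z, 0 < f i z) /\ PCx f h.
Proof.
have two (g k : 'rV[R]_n -> C) : (exists (I : finType) (f : I -> 'rV[R]_n -> R),
    (forall i, Dfun (f i) /\ forall z, 0 < f i z) /\ PCx f g) ->
  (exists (I : finType) (f : I -> 'rV[R]_n -> R),
    (forall i, Dfun (f i) /\ forall z, 0 < f i z) /\ PCx f k) ->
  exists (I : finType) (f : I -> 'rV[R]_n -> R),
    (forall i, Dfun (f i) /\ forall z, 0 < f i z) /\ (PCx f g /\ PCx f k).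
  move=> [I [f [fP fg]]] [I' [f' [fP' fk]]].
  exists (I + I')%type, (fun t => match t with inl i => f i | inr i => f' i end).
  split; first by case.
  by split; [apply: (PCx_idx (u := inl))|apply: (PCx_idx (u := inr))].
elim=> {h} [c|f a Df f0 aK|f Df f0|f h _ IHf _ IHh|f h _ IHf _ IHh].
- by exists void, (fun=> fun=> 1); split; [case|exact: PCx_cst].
- by exists unit, (fun=> f); split=> //; exact: (PCx_pow _ tt).
- by exists unit, (fun=> f); split=> //; exact: (PCx_log _ tt).
- by have [I [g [gP [h1 h2]]]] := two _ _ IHf IHh; exists I, g; split=> //; exact: PCx_add.
- by have [I [g [gP [h1 h2]]]] := two _ _ IHf IHh; exists I, g; split=> //; exact: PCx_mul.
Qed.

Definition cang (T : finType) (V : (T -> R) -> C) :=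
  ang (fun y => complex.Re (V y)) /\ ang (fun y => complex.Im (V y)).

Lemma cangM (T : finType) (V W : (T -> R) -> C) : cang V -> cang W -> cang (fun y => V y * W y).
Proof.
move=> [V1 V2] [W1 W2]; split.
  have := angD (angM V1 W1) (angZ (-1) (angM V2 W2)).
  by apply: (ang_near ltr01) => y _; rewrite cReM mulN1r.
have := angD (angM V1 W2) (angM V2 W1).
by apply: (ang_near ltr01) => y _; rewrite cImM.
Qed.

Lemma cang_real (T : finType) (V : (T -> R) -> R) : ang V -> cang (fun y => (V y)%:C).
Proof. by move=> hV; split => //=; exact: ang_cst. Qed.

Lemma cang1 (T : finType) : cang (fun _ : T -> R => 1).
Proof. exact: cang_real (@ang_cst _ T 1). Qed.

(** The value 1 at the origin makes [ln V] vanish there, as [ang_cos0] and [ang_sin0] require. *)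
Lemma cang_cpow (T : finType) (V : (T -> R) -> R) al : ang V -> V (fun=> 0) = 1 -> cang (fun y => cpow (V y) al).
Proof.
move=> VA V1; have L : ang (fun y => ln (V y)) by apply: ang_ln; rewrite // V1.
have L0 b : b * ln (V (fun=> 0)) = 0 by rewrite V1 ln1 mulr0.
split => /=; apply: angM; [exact/ang_expR/angZ|exact: ang_cos0 (angZ _ L) (L0 _)|exact/ang_expR/angZ|
  exact: ang_sin0 (angZ _ L) (L0 _)].
Qed.

Section Terms.
Variables (n : nat) (T : finType) (zt : 'rV[R]_(n + 1) -> R) (y : 'rV[R]_(n + 1) -> T -> R).
Local Notation X := 'rV[R]_n.
Local Notation Z := 'rV[R]_(n + 1).

Record rterm := RTerm { rt_P : X -> C; rt_la : C; rt_k : nat; rt_V : (T -> R) -> C;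
  rt_PC : PC K rt_P; rt_K : rt_la \in K; rt_A : cang rt_V }.

Definition rt_ev (t : rterm) (z : Z) : C :=
  rt_P t (lsubmx z) * cpow (zt z) (rt_la t) * (ln (zt z))%:C ^+ rt_k t * rt_V t (y z).

Definition rt_mul (t u : rterm) : rterm :=
  @RTerm _ _ (rt_k t + rt_k u) _ (PC_mul (rt_PC t) (rt_PC u)) (rpredD (rt_K t) (rt_K u)) (cangM (rt_A t) (rt_A u)).

Lemma rt_mulE t u z : rt_ev (rt_mul t u) z = rt_ev t z * rt_ev u z.
Proof. by rewrite /rt_ev /= cpowD exprD; ring. Qed.

Variables (I : Type) (f : I -> Z -> R) (a : I -> X -> R) (r : I -> rat) (W : I -> (T -> R) -> R).
Hypotheses (Da : forall i, Dfun (a i)) (WA : forall i, ang (W i) /\ W i (fun=> 0) != 0)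
  (f0 : forall i z, 0 < f i z).

Definition Reg rho (z : Z) := [/\ 0 < zt z, small rho (y z) &
  forall i, f i z = a i (lsubmx z) * zt z `^ ratr (r i) * W i (y z)].

Definition RT (h : Z -> C) := exists rho g, [/\ 0 < rho, fspan rt_ev g & forall z, Reg rho z -> h z = g z].

Lemma Reg_le rho rho' z : rho <= rho' -> Reg rho z -> Reg rho' z.
Proof. by move=> rr [h1 h2 h3]; split=> // t; exact: le_trans (h2 t) rr. Qed.

Lemma RT2 (op : C -> C -> C) g h : (forall u v, fspan rt_ev u -> fspan rt_ev v -> fspan rt_ev (fun z => op (u z) (v z))) ->
  RT g -> RT h -> RT (fun z => op (g z) (h z)).
Proof.
move=> hop [r1 [u [r10 su gu]]] [r2 [v [r20 sv hv]]].
exists (Num.min r1 r2), (fun z => op (u z) (v z)); split; [by rewrite lt_min r10|exact: hop|].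
move=> z Rz; rewrite gu ?hv//; apply: Reg_le Rz; rewrite ge_min lexx ?orbT//.
Qed.

(** Division of [W i] by its value at the origin makes the unit factor 1 there and positive nearby.
    Since the atom is positive, so is the coefficient on the region, and powers and logarithms
    distribute over the three factors. Elsewhere a nonpositive coefficient is replaced by 1. *)
Lemma RT_atom i : exists rho (b : X -> R) (V : (T -> R) -> R), [/\ 0 < rho, Dfun b /\ (forall x, 0 < b x),
  ang V /\ V (fun=> 0) = 1, forall y, small rho y -> 0 < V y &
  forall z, Reg rho z -> f i z = b (lsubmx z) * zt z `^ ratr (r i) * V (y z)].
Proof.
have [hA h0] := WA i; pose V (y : T -> R) := W i y / W i (fun=> 0).
have VA : ang V by have := angZ (W i (fun=> 0))^-1 hA; apply: (ang_near ltr01) => w _; rewrite mulrC.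
have V1 : V (fun=> 0) = 1 by rewrite /V divff.
have V0 : 0 < V (fun=> 0) by rewrite V1.
have [rho rho0 Vp] := ang_pos VA V0.
pose b x := a i x * W i (fun=> 0).
have Db : Dfun b by apply: D_mul (Da i) (D_cst _ _).
exists rho, (fun x => if `[< 0 < b x >] then b x else 1), V; split=> //.
  split; first by apply: Dif => //; [exact: Dset_gt0|exact: D_cst].
  by move=> x; case: asboolP => // _; exact: ltr01.
move=> z [z0 ys fE].
have fb : f i z = b (lsubmx z) * zt z `^ ratr (r i) * V (y z) by rewrite fE /b /V; field.
have := f0 i z; rewrite fb pmulr_lgt0 ?Vp// pmulr_lgt0 ?powR_gt0// => b0.
by rewrite asboolT.
Qed.

Lemma RT_PCx h : PCx f h -> RT h.
Proof.
have spD := @spanD R rterm Z rt_ev; have spM := @spanM R rterm Z rt_ev rt_mul rt_mulE.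
have one P Pk : PC K P -> RT (fun z => P (lsubmx z) * (ln (zt z))%:C ^+ Pk).
  move=> PP; exists 1, (fun z => P (lsubmx z) * (ln (zt z))%:C ^+ Pk); split=> //.
  by apply: (span1 (t := @RTerm P 0 Pk _ PP (rpred0 K) (cang1 T))) => z; rewrite /rt_ev /= cpow0 !mulr1.
elim=> {h} [c|i al alK|i|g h _ IHg _ IHh|g h _ IHg _ IHh].
- have [rho [g [rho0 sg gE]]] := one _ 0%N (@PC_cst R K n c); exists rho, g; split=> // z /gE <-.
  by rewrite mulr1.
- have [rho [b [V [rho0 [Db b0] [VA V1] Vp fE]]]] := RT_atom i.
  have rK : (ratr (r i))%:C * al \in K by apply: rpredM => //; exact: ratC_in.
  exists rho, (rt_ev (@RTerm _ _ 0 _ (PC_pow Db b0 alK) rK (cang_cpow al VA V1))); split=> //.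
    exact: span1.
  move=> z Rz; have [z0 ys _] := Rz; rewrite /rt_ev /= fE// mulr1.
  by rewrite cpowM ?cpowM ?cpow_powR ?mulr_gt0 ?powR_gt0 ?Vp.
- have [rho [b [V [rho0 [Db b0] [VA V1] Vp fE]]]] := RT_atom i.
  have LA : ang (fun y => ln (V y)) by apply: ang_ln; rewrite // V1.
  pose t3 := @RTerm _ _ 0 _ (@PC_cst R K n 1) (rpred0 K) (cang_real LA).
  have R3 : RT (rt_ev t3) by exists 1, (rt_ev t3); split=> //; exact: span1.
  have [rh [g [rh0 sg gE]]] := RT2 spD (RT2 spD (one _ 0%N (PC_log K Db b0)) (one _ 1%N (@PC_cst R K n (ratr (r i))%:C))) R3.
  exists (Num.min rho rh), g; split=> //; first by rewrite lt_min rho0.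
  move=> z Rz; have R1 : Reg rho z by apply: Reg_le Rz; rewrite ge_min lexx.
  have R2 : Reg rh z by apply: Reg_le Rz; rewrite ge_min lexx orbT.
  rewrite -gE// fE// /rt_ev /= cpow0 expr0 expr1 !mulr1 !mul1r; have [z0 ys _] := R1.
  by rewrite !lnM ?posrE ?mulr_gt0 ?powR_gt0 ?Vp// ln_powR !rmorphD rmorphM.
- exact: RT2.
- exact: RT2.
Qed.

End Terms.

(** [double_split] for real and imaginary part at once: they are the two members of a family indexed
    by [bool], so both are cut with the same radii. *)
Lemma split_half (S : finType) (F : bool -> (option (option S) -> R) -> R) : fam F ->
  exists (r1 r2 sg : R) (hP hQ : bool * nat -> (option S -> R) -> R),
  [/\ 0 < r1, 0 < r2, 0 < sg, fam hP /\ fam hQ & forall b (c : S -> R) v u, small sg c -> `|v| <= sg -> `|u| <= sg ->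
   F b (ext (ext c v) u) = usum (fun l => hP (b, l) (ext c (v * u / (r1 * r2))) * (v / r2) ^+ l) +
     u / r1 * usum (fun l => hQ (b, l) (ext c (v * u / (r1 * r2))) * (u / r1) ^+ l)].
Proof.
move=> FF; have [r1 [H1 [r10 H1f H1E]]] := fam_curry FF.
have [r2 [H2 [r20 H2f H2E]]] := fam_curry H1f.
have [sb [C [sb0 HC]]] := fam_bounded H2f.
pose hP (p : bool * nat) := gser (fun j => H2 ((p.1, j), (j + p.2)%N)).
pose hQ (p : bool * nat) := gser (fun j => H2 ((p.1, (j + p.2.+1)%N), j)).
pose sg := Num.min (Num.min r1 r2) (Num.min sb (Num.min (r1 / 2) (r2 / 2))).
have sgP x : x <= sg -> [/\ x <= r1, x <= r2, x <= sb, x <= r1 / 2 & x <= r2 / 2].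
  by rewrite !le_min => /and3P[/andP[? ?] ? /andP[? ?]].
exists r1, r2, sg, hP, hQ; split=> //.
- by rewrite !lt_min r10 r20 sb0 !divr_gt0.
- split.
    by apply: (fam_uncurry (H := fun q => H2 ((q.1.1, q.2), (q.2 + q.1.2)%N))); exact: (fam_idx (fun q : bool * nat * nat => ((q.1.1, q.2), (q.2 + q.1.2)%N)) H2f).
  by apply: (fam_uncurry (H := fun q => H2 ((q.1.1, (q.2 + q.1.2.+1)%N), q.2))); exact: (fam_idx (fun q : bool * nat * nat => ((q.1.1, (q.2 + q.1.2.+1)%N), q.2)) H2f).
move=> b c v u cs vs us; have [v1 v2 v3 v4 v5] := sgP _ vs; have [u1 u2 u3 u4 u5] := sgP _ us.
have vr : `|v / r2| <= 2^-1 by rewrite normrM normfV (gtr0_norm r20) ler_pdivrMr// mulrC.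
have ur : `|u / r1| <= 2^-1 by rewrite normrM normfV (gtr0_norm r10) ler_pdivrMr// mulrC.
rewrite H1E//; last by case=> [t|] //=; have [] := sgP _ (cs t).
rewrite /gser /=.
have := @double_split R (fun j i => H2 ((b, j), i) c) C (v / r2) (u / r1) (fun i j => HC _ _ _) vr ur.
rewrite (_ : v / r2 * (u / r1) = v * u / (r1 * r2)); last by field; rewrite !gt_eqF.
move=> E; rewrite /hP /hQ /gser /= -E; last by move=> t; have [] := sgP _ (cs t).
congr usum; apply/funext => j; congr (_ * _).
by rewrite H2E// => t; have [] := sgP _ (cs t).
Qed.

End Atoms.

(** * Terms with powers of one sign, and definability of their primitives in the parameters *)

Section HalfTerms.
Variables (R : realType) (K : divringClosed R[i]) (n : nat) (T : finType).
Local Notation C := R[i].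
Local Notation X := 'rV[R]_n.

Lemma ang_D (T' : finType) (U : (T' -> R) -> R) : ang U -> exists2 rho, 0 < rho &
  forall c : T' -> X -> R, (forall o, Dfun (c o)) -> exists2 G, Dfun G &
    forall x, (forall o, `|c o x| <= rho) -> G x = U (fun o => c o x).
Proof.
move=> UA; pose U' (x : 'I_#|T'| -> R) := U (fun t => x (enum_rank t)).
have U'A : ang U' by apply: (ang_comp UA) => // t; exact: ang_var.
have [rho [f [rho0 fr fE]]] := ang_restricted U'A; exists rho => // c Dc.
exists (fun x => f (\row_i (c (enum_val i) x / rho))).
  apply: (D_ran fr (g := fun i x => c (enum_val i) x / rho)) => i.
  by apply: D_mul => //; exact: D_cst.
move=> x cs; rewrite (_ : U _ = U' (fun i => c (enum_val i) x)); last first.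
  by congr U; apply/funext => t; rewrite enum_rankK.
by rewrite fE.
Qed.

(** Exponents for which the power of a positive D-function is obtained by a root and possibly an
    inverse, hence is a D-function. *)
Definition rootexp (e : R) := exists p : nat, e = (p.+1%:R)^-1 \/ e = - (p.+1%:R)^-1.

Lemma rootexp_neq0 e : rootexp e -> e != 0.
Proof. by case=> p [] ->; rewrite ?oppr_eq0 invr_eq0 pnatr_eq0. Qed.

Lemma D_powroot e (f : X -> R) : rootexp e -> Dfun f -> (forall x, 0 < f x) -> Dfun (fun x => f x `^ e).
Proof.
move=> [p [] ->] Df f0.
  by apply: Deq (D_root p Df) _ => x; rewrite gtr0_norm.
by apply: Deq (D_inv (D_root p Df)) _ => x; rewrite gtr0_norm// powRN.
Qed.

(* Coefficients and powers of one sign of the exponent [h_ep] in a prepared term;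
   [h_F] is indexed by real and imaginary parts and by the degree. *)
Record hterm := HTerm { h_P : X -> C; h_la : C; h_k : nat; h_D : X -> R; h_ep : R; h_c : T -> X -> R;
  h_F : bool * nat -> (T -> R) -> R;
  h_PC : PC K h_P; h_K : h_la \in K; h_DD : Dfun h_D; h_e : rootexp h_ep;
  h_cD : forall o, Dfun (h_c o); h_A : fam h_F }.

Definition coefC (F : bool * nat -> (T -> R) -> R) (c : T -> R) (l : nat) : C := F (false, l) c +i* F (true, l) c.
Definition h_coef (t : hterm) (x : X) := coefC (h_F t) (fun o => h_c t o x).
Definition h_ev (t : hterm) (x : X) (z : R) : C :=
  h_P t x * hval (h_D t x) (h_ep t) (h_la t) (h_k t) (h_coef t x) z.
Definition h_small rho (t : hterm) (x : X) (z : R) :=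
  (forall o, `|h_c t o x| <= rho) /\ `|omega (h_D t x) (h_ep t) z| <= rho.

Lemma csum_PC (F : bool * nat -> (T -> R) -> R) (q : nat -> C) : fam F -> nbd q ->
  exists2 rho, 0 < rho & forall (c : T -> X -> R) (w : X -> R), (forall o, Dfun (c o)) -> Dfun w ->
    exists2 G, PC K G & forall x, (forall o, `|c o x| <= rho) -> `|w x| <= rho ->
      G x = csum (fun l => q l * coefC F (fun o => c o x) l) (w x).
Proof.
move=> FF [B qB].
have Reb l : `|complex.Re (q l)| <= B by rewrite -lecR; exact: le_trans (Re_le_normC _) (qB l).
have Imb l : `|complex.Im (q l)| <= B by rewrite -lecR; exact: le_trans (Im_le_normC _) (qB l).
have fc (u : nat -> R) : (forall l, `|u l| <= B) -> forall b, fam (fun (p : unit * nat) y => u p.2 * F (b, p.2) y).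
  move=> uB b; apply: famM; first exact: (@fam_cst R _ T (fun p : unit * nat => u p.2) B (fun p => uB p.2)).
  exact: (fam_idx (fun p : unit * nat => (b, p.2)) FF).
pose G1 (p : unit * nat) y := complex.Re (q p.2) * F (false, p.2) y + -1 * (complex.Im (q p.2) * F (true, p.2) y).
pose G2 (p : unit * nat) y := complex.Re (q p.2) * F (true, p.2) y + complex.Im (q p.2) * F (false, p.2) y.
have F1 : fam G1 by apply: famD; [exact: (fc _ Reb)|apply: famZ; exact: (fc _ Imb)].
have F2 : fam G2 by apply: famD; [exact: (fc _ Reb)|exact: (fc _ Imb)].
have [s1 s10 h1] := ang_D (fam_ang tt (fam_uncurry F1)).
have [s2 s20 h2] := ang_D (fam_ang tt (fam_uncurry F2)).
exists (Num.min s1 s2); first by rewrite lt_min s10.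
move=> c w Dc Dw; pose c' (o : option T) : X -> R := if o is Some t then c t else w.
have Dc' o : Dfun (c' o) by case: o.
have [g1 Dg1 E1] := h1 c' Dc'; have [g2 Dg2 E2] := h2 c' Dc'.
exists (fun x => (g1 x)%:C + 'i * (g2 x)%:C).
  by apply: PC_add; [exact: PC_D|apply: PC_mul; [exact: PC_cst|exact: PC_D]].
move=> x cs ws.
have c's s : Num.min s1 s2 <= s -> forall o, `|c' o x| <= s.
  by move=> h [t|] /=; [exact: le_trans (cs t) h|exact: le_trans ws h].
rewrite E1 ?E2; last 2 first.
- by apply: c's; rewrite ge_min lexx ?orbT.
- by apply: c's; rewrite ge_min lexx ?orbT.
apply: complex_eq; rewrite /csum /gser /=.
  rewrite !mul0r !mul1r ?mulr0 subrr ?addr0; congr usum; apply/funext => l.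
  by rewrite cReM /G1 /= mulN1r.
rewrite ?mul0r ?mul1r ?mulr0 ?add0r ?addr0; congr usum; apply/funext => l.
by rewrite cImM /G2 /=.
Qed.

(** Gives the value of the primitive at an end of a cell as a function of [x]; [Zf] is the value of
    [z] at that end. *)
Lemma h_prim_PC (t : hterm) : exists2 rho, 0 < rho & forall Zf : X -> R, Dfun Zf ->
  exists2 G, PC K G & forall x, 0 < Zf x -> h_small rho t x (Zf x) -> G x = h_P t x *
    \sum_(u <- prim (h_ep t) (h_la t) (h_k t) (fun=> 1))
      hval (h_D t x) (h_ep t) (h_la t) u.1 (fun l => u.2 l * h_coef t x l) (Zf x).
Proof.
have ps := @prim_nbd R (h_ep t) (h_la t) (rootexp_neq0 (h_e t)) (h_k t) (fun=> 1) (@nbd1 R).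
elim: (prim _ _ _ _) ps => [|u s IH] ps.
  exists 1 => // Zf DZ'; exists (fun=> 0); first exact: PC_cst.
  by move=> x _ _; rewrite big_nil mulr0.
have [|s1 s10 h1] := IH; first by move=> i si; exact: (ps i.+1).
have [s2 s20 h2] := csum_PC (h_A t) (ps 0%N isT).
exists (Num.min s1 s2); first by rewrite lt_min s10.
move=> Zf DZf; have [G1 P1 E1] := h1 Zf DZf.
(* [PC_pow] and [PC_log] require positivity on the whole space, so [Zf] is changed to 1 where it is
   not positive. *)
pose Z' x := if `[< 0 < Zf x >] then Zf x else 1.
have Z'0 x : 0 < Z' x by rewrite /Z'; case: asboolP => // _; exact: ltr01.
have DZ' : Dfun Z' by apply: Dif => //; [exact: Dset_gt0|exact: D_cst].
pose w x := h_D t x * Z' x `^ h_ep t.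
have Dw : Dfun w by apply: D_mul; [exact: h_DD|apply: D_powroot => //; exact: h_e].
have [G2 P2 E2] := h2 (h_c t) w (h_cD t) Dw.
exists (fun x => G1 x + h_P t x * (cpow (Z' x) (h_la t) * (ln (Z' x))%:C ^+ u.1 * G2 x)).
  apply: PC_add => //; apply: PC_mul; first exact: h_PC.
  by apply: PC_mul => //; apply: PC_mul; [exact: PC_pow (h_K t)|apply: PC_X; exact: PC_log].
move=> x z0 [c1 w1]; have Z'E : Z' x = Zf x by rewrite /Z' asboolT.
have m1 : Num.min s1 s2 <= s1 by rewrite ge_min lexx.
have m2 : Num.min s1 s2 <= s2 by rewrite ge_min lexx orbT.
have w2 : `|w x| <= s2 by rewrite /w Z'E; exact: le_trans w1 m2.
rewrite big_cons mulrDr addrC (E2 x (fun o => le_trans (c1 o) m2) w2) /w Z'E /=; congr (_ + _).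
by apply: E1 => //; split; [move=> o; exact: le_trans (c1 o) m1|exact: le_trans w1 m1].
Qed.

End HalfTerms.

Section CellRep.
Variables (R : realType) (K : divringClosed R[i]) (n : nat).
Local Notation C := R[i].
Local Notation X := 'rV[R]_n.
Local Notation Z := 'rV[R]_(n + 1).

Lemma fam_bool (T : finType) (f g : (T -> R) -> R) : ang f -> ang g -> fam (fun b : bool => if b then f else g).
Proof.
move=> fA gA; have [r [D [r0 h]]] := fam2 (fam_ang_cst unit fA) (fam_ang_cst unit gA).
by exists r, D; split=> // -[]; have [] := h tt.
Qed.

Section Split.
Variables (S : finType) (A B : X -> R) (c : S -> X -> R) (p : nat) (zt : Z -> R).
Hypotheses (DA : Dfun A) (DB' : Dfun B) (Dc : forall t, Dfun (c t)).
Definition yv (z : Z) : option (option S) -> R :=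
  ext (ext (fun t => c t (lsubmx z)) (A (lsubmx z) * zeta zt p.+1%:R z)) (B (lsubmx z) * (zeta zt p.+1%:R z)^-1).

Definition h_rep (J : finType) (H : J -> hterm K n (option S)) (h : Z -> C) := forall rho, 0 < rho ->
  exists2 rho', 0 < rho' & forall z, 0 < zt z -> small rho' (yv z) ->
    (forall j, h_small rho (H j) (lsubmx z) (zt z)) /\ h z = ((zt z)^-1)%:C * \sum_j h_ev (H j) (lsubmx z) (zt z).

(** The two half terms come from [split_half]. Splitting off [z^-1] raises the exponent [la] by 1;
    the factor [u / r1] in front of the second half contributes [B / r1] to its coefficient and
    [- p.+1%:R^-1] to its exponent. *)
Lemma rt_ht (t : rterm K n (option (option S))) : exists H : bool -> hterm K n (option S), h_rep H (rt_ev zt yv t).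
Proof.
have [VR VI] := rt_A t.
have [r1 [r2 [sg [hP [hQ [r10 r20 sg0 [hPf hQf] VE]]]]]] := split_half (fam_bool VI VR).
pose d x := A x * B x / (r1 * r2).
pose c' (o : option S) x := if o is Some s then c s x else d x.
have Dd : Dfun d := D_mul (D_mul DA DB') (D_cst n (r1 * r2)^-1).
have Dc' o : Dfun (c' o) by case: o.
have ep1 : rootexp (p.+1%:R^-1 : R) by exists p; left.
have ep2 : rootexp (- p.+1%:R^-1 : R) by exists p; right.
have K1 : rt_la t + 1 \in K by rewrite rpredD ?rt_K// rpred1.
have pK : (p.+1%:R^-1 : R)%:C \in K.
  by rewrite fmorphV /= rmorph_nat rpredV rpred_nat.
have K2 : rt_la t + 1 - (p.+1%:R^-1 : R)%:C \in K by rewrite rpredB.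
have Dz (f : X -> R) (e : R) : Dfun f -> Dfun (fun x => f x / e) by move=> Df; apply: D_mul => //; exact: D_cst.
pose t1 := HTerm (rt_k t) (rt_PC t) K1 (Dz A r2 DA) ep1 Dc' hPf.
pose t2 := HTerm (rt_k t) (PC_mul (rt_PC t) (PC_D K (Dz B r1 DB'))) K2 (Dz B r1 DB') ep2 Dc' hQf.
exists (fun b : bool => if b then t1 else t2) => rho rho0.
pose rho' := Num.min (Num.min 1 sg) (Num.min (Num.min rho (rho * (r1 * r2))) (Num.min (rho * r1) (rho * r2))).
have rP x : x <= rho' -> [/\ x <= 1, x <= sg, x <= rho & x <= rho * (r1 * r2)] /\ x <= rho * r1 /\ x <= rho * r2.
  by rewrite !le_min => /andP[/andP[? ?] /andP[/andP[? ?] /andP[? ?]]].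
exists rho'; first by rewrite !lt_min ltr01 sg0 rho0 !mulr_gt0.
move=> z z0 ys; set x := lsubmx z; set e := p.+1%:R^-1 : R.
have zeE : zeta zt p.+1%:R z = zt z `^ e by [].
have ze0 : 0 < zt z `^ e by rewrite powR_gt0.
have vs := ys (Some None); have us := ys None; rewrite /yv /= zeE in vs us.
have [[v1 v2 v3 v4] [v5 v6]] := rP _ vs; have [[u1 u2 u3 u4] [u5 u6]] := rP _ us.
have vu : A x * zt z `^ e * (B x * (zt z `^ e)^-1) / (r1 * r2) = d x.
  by rewrite /d; field; rewrite !gt_eqF.
have o1 : omega (h_D t1 x) (h_ep t1) (zt z) = A x * zt z `^ e / r2 by rewrite /omega /=; ring.
have o2 : omega (h_D t2 x) (h_ep t2) (zt z) = B x * (zt z `^ e)^-1 / r1 by rewrite /omega /= powRN; ring.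
have cs o : `|c' o x| <= rho.
  case: o => [s|] /=; first by have [[]] := rP _ (ys (Some (Some s))).
  rewrite -vu normrM normfV (@gtr0_norm _ (r1 * r2)) ?mulr_gt0// ler_pdivrMr ?mulr_gt0// normrM.
  by apply: le_trans v4; rewrite ler_piMr.
split.
  case; split=> //; [rewrite o1 normrM normfV (gtr0_norm r20) ler_pdivrMr//|
    rewrite o2 normrM normfV (gtr0_norm r10) ler_pdivrMr//].
have cE : (fun o => c' o x) = ext (fun s => c s x) (d x) by apply/funext => -[].
have V1 : rt_V t (yv z) = csum (h_coef t1 x) (A x * zt z `^ e / r2) +
    (B x * (zt z `^ e)^-1 / r1)%:C * csum (h_coef t2 x) (B x * (zt z `^ e)^-1 / r1).
  have cs' : small sg (fun s => c s x) by move=> s; have [[]] := rP _ (ys (Some (Some s))).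
  have := VE false _ _ _ cs' v2 u2; have := VE true _ _ _ cs' v2 u2; rewrite vu -/(yv z) => E2 E1.
  apply: complex_eq; rewrite ?cReD ?cImD ?cReM ?cImM /csum /h_coef /coefC /= mul0r ?subr0 ?addr0 cE.
    by rewrite E1.
  by rewrite E2.
rewrite big_bool /= /h_ev /hval o1 o2 /rt_ev V1 /=.
have zC : ((zt z)^-1)%:C * (zt z)%:C = 1 by rewrite -rmorphM/= mulVf// gt_eqF.
have eC : cpow (zt z) (- (e%:C)) = ((zt z `^ e)^-1)%:C.
  rewrite -powRN -(cpow1r (powR_gt0 _ _))// cpow_powR// mulr1; congr cpow.
  by rewrite rmorphN.
rewrite !cpowD (cpow1r z0) eC !rmorphM /=.
set w1 := csum _ _; set w2 := csum _ _.
rewrite -[LHS]mul1r -zC; ring.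
Qed.

Lemma rts_hts (s : seq (rterm K n (option (option S)))) : exists (J : finType) (H : J -> hterm K n (option S)),
  h_rep H (fun z => \sum_(t <- s) rt_ev zt yv t z).
Proof.
elim: s => [|t s [J [H hH]]].
  exists void, (fun v : void => match v with end) => rho rho0; exists 1 => // z z0 _.
  by split; [case|rewrite big_nil big1 ?mulr0// => -[]].
have [H1 hH1] := rt_ht t.
exists (bool + J)%type, (fun o => match o with inl b => H1 b | inr j => H j end) => rho rho0.
have [s1 s10 h1] := hH1 rho rho0; have [s2 s20 h2] := hH rho rho0.
exists (Num.min s1 s2); first by rewrite lt_min s10.
move=> z z0 ys; have [|a1 e1] := h1 z z0.
  by move=> o; rewrite (le_trans (ys o))// ge_min lexx.
have [|a2 e2] := h2 z z0.
  by move=> o; rewrite (le_trans (ys o))// ge_min lexx orbT.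
split; first by case.
by rewrite big_cons e1 e2 big_sumType /= mulrDr.
Qed.

End Split.

Lemma cell_rep (q : set_system Z) (h : Z -> C) : UltraFilter q -> PC K h ->
  (exists2 E, is_gcell E & q E) \/
  exists (T J : finType) (th : X -> R) (s : R) (H : J -> hterm K n T),
    [/\ Dfun th, s = 1 \/ s = -1 & forall rho, 0 < rho -> exists E, [/\ is_ocell E, q E & forall z, E z ->
      let zt := s * (lst z - th (lsubmx z)) in
      [/\ 0 < zt, forall j, h_small rho (H j) (lsubmx z) zt &
          h z = (zt^-1)%:C * \sum_j h_ev (H j) (lsubmx z) zt]]].
Proof.
move=> qU /PC_atoms[I [f [fP hx]]].
have [gc|[th [s [p [A [B [S [c [a [r [W [[Dth DA DB' Dc Da] sE p0 WP hC]]]]]]]]]]]] :=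
  prep_cell qU (fun i => (fP i).1); [by left|right].
pose zt (z : Z) := s * (lst z - th (lsubmx z)).
have [rho1 [g [rho10 [l gE] hg]]] := @RT_PCx R K n (option (option S)) zt (yv A B c p.-1 zt) I f a r W Da WP (fun i => (fP i).2) h hx.
have [J [H hH]] := rts_hts p.-1 zt DA DB' Dc l.
exists (option S), J, th, s, H; split=> // rho rho0.
have [rho' rho'0 hr] := hH rho rho0.
have m0 : 0 < Num.min rho1 rho' by rewrite lt_min rho10.
have [E [oE qE hE]] := hC _ m0; exists E; split=> // z Ez.
have [z0 cs [vs us] fE] := hE z Ez.
have ys : small (Num.min rho1 rho') (yv A B c p.-1 zt z).
  by move=> o; rewrite /yv prednK//; case: o => [[t|]|] /=; [exact: cs|exact: vs|exact: us].
have [|a1 a2] := hr z z0; first by move=> o; rewrite (le_trans (ys o))// ge_min lexx orbT.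
split=> //; rewrite hg ?gE//; split=> //.
  by move=> o; rewrite (le_trans (ys o))// ge_min lexx.
by rewrite /yv prednK.
Qed.

End CellRep.

(** * From cells to the integral over the whole line *)

Section OneVariable.
Variables (R : realType) (K : divringClosed R[i]) (n : nat).
Local Notation C := R[i].
Local Notation X := 'rV[R]_n.
Local Notation Z := 'rV[R]_(n + 1).
Local Notation mu := (@lebesgue_measure R).

Definition fiber (E : set Z) (x : X) : set R := [set t | E (row_mx x t%:M)].
Definition hsec (h : Z -> C) (x : X) (t : R) : C := h (row_mx x t%:M).
Definition mfib (E : set Z) := forall x, measurable (fiber E x).
Definition hasH (h : Z -> C) (E : set Z) :=
  exists2 H, PC K H & forall x, cinteg setT (hsec h x) -> cint (fiber E x) (hsec h x) = H x.

Lemma fin_lower (J : finType) (g : J -> R) : (forall j, 0 < g j) -> exists2 rho, 0 < rho & forall j, rho <= g j.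
Proof.
move=> g0; have s0 : 0 <= \sum_j (g j)^-1 by apply: sumr_ge0 => j _; rewrite invr_ge0 ltW.
have s1 : 0 < \sum_j (g j)^-1 + 1 by rewrite ltr_wpDl.
exists (\sum_j (g j)^-1 + 1)^-1; first by rewrite invr_gt0.
move=> j; rewrite -[leRHS]invrK lef_pV2 ?posrE ?invr_gt0//.
rewrite (bigD1 j)//= -addrA lerDl addr_ge0//.
by apply: sumr_ge0 => i _; rewrite invr_ge0 ltW.
Qed.

Lemma fiber_ocell (B : set X) lo hi x t : fiber (ocell B lo hi) x t <-> [/\ B x, above lo x t & below hi x t].
Proof. by rewrite /fiber /ocell /= row_mxKl lst_row. Qed.

Lemma fiber_gcell (B : set X) th x t : fiber (gcell B th) x t <-> B x /\ t = th x.
Proof. by rewrite /fiber /gcell /= row_mxKl lst_row. Qed.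

Lemma cell_interval (E : set Z) x : is_cell E -> is_interval (fiber E x).
Proof.
move=> [[B [lo [hi [_ _ _ ->]]]]|[B [th [_ _ ->]]]] t1 t2.
  move=> /fiber_ocell[Bx a1 b1] /fiber_ocell[_ a2 b2] t /andP[h1 h2]; apply/fiber_ocell; split=> //.
    by case: lo a1 {a2} => [l|] //= a1; exact: lt_le_trans h1.
  by case: hi b2 {b1} => [l|] //= b2; exact: le_lt_trans b2.
move=> /fiber_gcell[Bx ->] /fiber_gcell[_ ->] t h; apply/fiber_gcell; split=> //.
by apply/le_anti; rewrite andbC.
Qed.

Lemma cell_mfib (E : set Z) : is_cell E -> mfib E.
Proof. by move=> cE x; apply: is_interval_measurable; exact: cell_interval. Qed.

Lemma cint_sub1 (A : set R) (t0 : R) (f : R -> C) : A `<=` [set t0] -> cint A f = 0.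
Proof.
by move=> /subset_set1[->|->]; apply: complex_eq; rewrite /cint /= ?Rintegral_set0 ?Rintegral_set1.
Qed.

Lemma cintU (A B : set R) (f : R -> C) : measurable A -> measurable B -> cinteg setT f ->
  cint (A `|` B) f = cint A f + cint B f - cint (A `&` B) f.
Proof.
move=> mA mB [I1 I2].
have E (g : R -> R) : mu.-integrable setT (EFin \o g) ->
    Rintegral mu (A `|` B) g = Rintegral mu A g + Rintegral mu B g - Rintegral mu (A `&` B) g.
  move=> Ig; have S D : measurable D -> mu.-integrable D (EFin \o g) by move=> mD; exact: integrableS Ig.
  have mBA : measurable (B `\` A) by exact: measurableD.
  have mAB : measurable (A `&` B) by exact: measurableI.
  have -> : A `|` B = A `|` (B `\` A).
    by apply/seteqP; split=> t [At|]; [left| |left|case; right] => //; have [At|nAt] := pselect (A t); [left|right].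
  rewrite Rintegral_setU//; [|by apply: S; exact: measurableU|]; last first.
    by apply/disj_setPS => t [At [_ /(_ At)]].
  have EB : Rintegral mu B g = Rintegral mu (A `&` B) g + Rintegral mu (B `\` A) g.
    rewrite -Rintegral_setU//.
    - by congr (Rintegral _ _ _); apply/seteqP; split=> t => [Bt|[] []//]; have [At|nAt] := pselect (A t); [left|right].
    - by apply: S; exact: measurableU.
    - by apply/disj_setPS => t [[At _] [_ /(_ At)]].
  by rewrite EB; ring.
by apply: complex_eq; rewrite ?cReD ?cImD /cint /= E.
Qed.

Lemma hasH0 h E (th : X -> R) : (forall x, fiber E x `<=` [set th x]) -> hasH h E.
Proof. by move=> hE; exists (fun=> 0); [exact: PC_cst|move=> x _; exact: cint_sub1 (hE x)]. Qed.

(** The property is required of all cells inside [E], so that it is inherited by the intersections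
    occurring in [hasH_union]. *)
Definition good h (E : set Z) := is_cell E /\ forall E', is_cell E' -> E' `<=` E -> hasH h E'.

Lemma good_gcell h E : is_gcell E -> good h E.
Proof.
move=> gE; split; first by right.
move=> E' _ EE; have [B [th [_ _ EE']]] := gE.
by apply: (@hasH0 h E' th) => x t /EE; rewrite EE' => /fiber_gcell[].
Qed.

Lemma good_ocell h E : is_ocell E -> (forall E', is_ocell E' -> E' `<=` E -> hasH h E') -> good h E.
Proof.
move=> oE gE; split; first by left.
by move=> E' [/gE//|gE' _]; have [_] := good_gcell h gE'; apply=> //; right.
Qed.

(** The radius [rho] is fixed before the cell, small enough for the primitives of all terms to be
    definable at the ends and for [interval_integral] to apply. Smaller cells inherit the
    representation, and their integral is the difference of the two end values. *)
Lemma ocell_rep (q : set_system Z) (h : Z -> C) : UltraFilter q -> PC K h -> exists2 E, good h E & q E.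
Proof.
move=> qU Ph; have [[E gE qE]|[T [J [th [s [H [Dth sE rep]]]]]]] := cell_rep qU Ph.
  by exists E => //; exact: good_gcell.
have /choice[rj hj] (j : J) : exists rA : R * R, [/\ 0 < rA.1,
    forall Zf : X -> R, Dfun Zf -> exists2 G, PC K G & forall x, 0 < Zf x -> h_small rA.1 (H j) x (Zf x) ->
      G x = h_P (H j) x * \sum_(u <- prim (h_ep (H j)) (h_la (H j)) (h_k (H j)) (fun=> 1))
      hval (h_D (H j) x) (h_ep (H j)) (h_la (H j)) u.1 (fun l => u.2 l * h_coef (H j) x l) (Zf x) &
    forall x, (forall o, `|h_c (H j) o x| <= rA.1) -> forall l, `|h_coef (H j) x l| <= rA.2%:C].
  have [r1 r10 h1] := h_prim_PC (H j); have [r2 [A [r20 hA]]] := fam_bounded (h_A (H j)).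
  exists (Num.min r1 r2, 2 * A); split => /=; first by rewrite lt_min r10.
    move=> Zf /h1[G PG GE]; exists G => // x z0 [c1 w1]; apply: GE => //; split.
      by move=> o; rewrite (le_trans (c1 o))// ge_min lexx.
    by rewrite (le_trans w1)// ge_min lexx.
  move=> x cs l; apply: le_trans (normC_le _) _; rewrite lecR /h_coef /coefC /= mulr_natl mulr2n.
  have cs2 : small r2 (fun o => h_c (H j) o x) by move=> o; rewrite (le_trans (cs o))// ge_min lexx orbT.
  by apply: lerD; exact: hA.
have rj0 j : 0 < (rj j).1 by case: (hj j).
have [rho0 rho00 rhoj] := fin_lower rj0.
pose rho := Num.min rho0 32^-1.
have rho_gt0 : 0 < rho by rewrite lt_min rho00 invr_gt0 ltr0n.
have r32 : rho <= 32^-1 by rewrite ge_min lexx orbT.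
have rrj j : rho <= (rj j).1 by rewrite (le_trans _ (rhoj j))// ge_min lexx.
have [E [oE qE hE]] := rep rho rho_gt0; exists E => //; apply: good_ocell => // E' oE' EE.
have [B [lo [hi [DB' Dlo Dhi E'E]]]] := oE'.
pose Zf (l : X -> R) x := s * (l x - th x).
have hval_ex (b : bound R n) : Dbound b -> exists2 v : X -> C, PC K v & forall x,
    (if b is Some l then 0 < Zf l x -> forall j, h_small rho (H j) x (Zf l x) else True) ->
    v x = endval (fun j => h_P (H j) x) (fun j => h_D (H j) x) (fun j => h_ep (H j)) (fun j => h_la (H j))
      (fun j => h_k (H j)) (fun j => h_coef (H j) x) s (th x) (if b is Some l then Some (l x) else None).
  case: b => [l|] /= Dl; last by exists (fun=> 0); [exact: PC_cst|].
  have DZ' : Dfun (Zf l) by apply: DZ; exact: DB.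
  have /choice[G hG] (j : J) : exists G, PC K G /\ forall x, 0 < Zf l x -> h_small (rj j).1 (H j) x (Zf l x) ->
      G x = h_P (H j) x * \sum_(u <- prim (h_ep (H j)) (h_la (H j)) (h_k (H j)) (fun=> 1))
      hval (h_D (H j) x) (h_ep (H j)) (h_la (H j)) u.1 (fun l => u.2 l * h_coef (H j) x l) (Zf l x).
    by have [_ /(_ _ DZ')[G PG GE] _] := hj j; exists G.
  have PS : PC K (fun x => \sum_j G j x).
    elim: (index_enum J) => [|j t IH]; first by apply: PC_eq (@PC_cst R K n 0) _ => x; rewrite big_nil.
    by apply: PC_eq (PC_add (hG j).1 IH) _ => x; rewrite big_cons.
  exists (fun x => if `[< 0 < Zf l x >] then s%:C * \sum_j G j x else 0).
    by apply: PC_if; [exact: Dset_gt0|apply: PC_mul => //; exact: PC_cst|exact: PC_cst].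
  move=> x sm; rewrite -/(Zf l x); case: asboolP => [z0|/negP/negPf -> //].
  rewrite z0 /Fprim /Phi; congr (_ * _); apply: eq_bigr => j _.
  rewrite (hG j).2//; have [c1 w1] := sm z0 j.
  by split; [move=> o; exact: le_trans (c1 o) (rrj j)|exact: le_trans w1 (rrj j)].
have [vlo Plo Elo] := hval_ex lo Dlo; have [vhi Phi' Ehi] := hval_ex hi Dhi.
have cE' : is_cell E' by left.
(* Over a point with empty fibre the integral is 0, while the end values have no meaning there. *)
exists (fun x => if `[< dproj E' x >] then vhi x - vlo x else 0).
  apply: PC_if; [exact: proj_cell| |exact: PC_cst].
  by apply: PC_eq (PC_add Phi' (PC_mul (@PC_cst R K n (-1)) Plo)) _ => x; rewrite mulN1r.
move=> x Ih; case: asboolP => [[m Em]|np]; last first.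
  by apply: (@cint_sub1 _ 0) => t Et; exfalso; apply: np; exists t.
pose I := fiber E' x; have Im : I m by [].
have Ii : is_interval I by exact: cell_interval.
have It t : I t -> [/\ 0 < s * (t - th x), forall j, h_small rho (H j) x (s * (t - th x)) &
    hsec h x t = ((s * (t - th x))^-1)%:C * \sum_j h_ev (H j) x (s * (t - th x))].
  by move=> /EE/hE; rewrite /= lst_row row_mxKl.
pose lo' := if lo is Some l then Some (l x) else None; pose hi' := if hi is Some l then Some (l x) else None.
have IE t : I t <-> side 1 hi' t /\ side (-1) lo' t.
  rewrite /I E'E; split.
    move=> /fiber_ocell[_ a b]; split.
      by rewrite /hi'; case: hi b {E'E Dhi Ehi hi'} => [l|] //=; rewrite mul1r subr_gt0.
    by rewrite /lo'; case: lo a {E'E Dlo Elo lo'} => [l|] //=; rewrite mulN1r opprB subr_gt0.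
  move=> [b a]; apply/fiber_ocell; split.
  - by move: Im; rewrite /I E'E => /fiber_ocell[].
  - by move: a; rewrite /lo'; case: lo {E'E Dlo Elo lo'} => [l|] //=; rewrite mulN1r opprB subr_gt0.
  - by move: b; rewrite /hi'; case: hi {E'E Dhi Ehi hi'} => [l|] //=; rewrite mul1r subr_gt0.
have mid (d l : R) : (d = 1 /\ hi' = Some l) \/ (d = -1 /\ lo' = Some l) -> forall u, 0 < u < 1 -> I (l - u * (l - m)).
  have [h1 h2] := (IE m).1 Im.
  case=> -[d1 e1] u /andP[u0 u1]; apply/IE; rewrite e1 /= in h1 h2 *.
    have p : 0 < u * (l - m) by rewrite mulr_gt0//; lra.
    have p' : 0 < (1 - u) * (l - m) by rewrite mulr_gt0//; lra.
    split; first by lra.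
    by move: h2; case: (lo') => [l'|] //=; lra.
  have p : 0 < u * (m - l) by rewrite mulr_gt0//; lra.
  have p' : 0 < (1 - u) * (m - l) by rewrite mulr_gt0//; lra.
  split; last by lra.
  by move: h1; case: (hi') => [l'|] //=; lra.
(* Smallness is known inside the cell only; by continuity it passes to an end where [z > 0]. *)
have endsm (d l : R) : (d = 1 /\ hi' = Some l) \/ (d = -1 /\ lo' = Some l) -> 0 < s * (l - th x) ->
    forall j, h_small rho (H j) x (s * (l - th x)).
  move=> hl z0 j; have [_ sm _] := It m Im; split; first by have [] := sm j.
  apply: (om_endpoint (m := m) z0) => u hu; have [_ /(_ j)[_ h1] _] := It _ (mid d l hl u hu).
  exact: h1.
rewrite Ehi; last by case: hi @hi' {Ehi E'E Dhi} IE mid endsm => [l|] // hi' IE mid endsm; apply: (endsm 1); left.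
rewrite Elo; last by case: lo @lo' {Elo E'E Dlo} IE mid endsm => [l|] // lo' IE mid endsm; apply: (endsm (-1)); right.
apply: (@interval_integral R J (fun j => h_P (H j) x) (fun j => h_D (H j) x) (fun j => h_ep (H j)) (fun j => h_la (H j))
  (fun j => h_k (H j)) (fun j => h_coef (H j) x) (\sum_j `|(rj j).2|) _ _ s (th x) (hsec h x) sE I m _ Im Ii _ lo' hi' IE).
- by move=> j; apply: rootexp_neq0; exact: h_e.
- move=> j l; have [_ sm _] := It m Im; have [_ _ hA] := hj j.
  apply: le_trans (hA x _ l) _; first by move=> o; have [c1 _] := sm j; exact: le_trans (c1 o) (rrj j).
  rewrite lecR (bigD1 j)//=; apply: le_trans (ler_norm _) _; rewrite lerDl; exact: sumr_ge0.
- move=> t /It[z0 sm hE']; split=> //.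
  by move=> j; have [_ w] := sm j; exact: le_trans w r32.
- apply: cintegS Ih => //; exact: is_interval_measurable.
Qed.

Definition Ulist (L : seq (set Z)) : set Z := foldr setU set0 L.

(** Inclusion and exclusion along the list, since intersections of cells are cells whereas
    differences need not be. The induction runs over all cells [F] at once, because [F] is also
    replaced by its intersection with the head of the list. *)
Lemma hasH_union h (L : seq (set Z)) : (forall i, (i < size L)%N -> good h (nth set0 L i)) ->
  forall E, is_cell E -> hasH h (E `&` Ulist L) /\ mfib (E `&` Ulist L).
Proof.
elim: L => [|E L IH] gL F cF.
  rewrite /= setI0; split; first by apply: (@hasH0 h _ (fun=> 0)) => x t.
  by move=> x; rewrite (_ : fiber _ _ = set0)//; apply/seteqP; split.
have [cE gE] := gL 0%N isT.
have {}IH := IH (fun i => gL i.+1).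
have cFE : is_cell (F `&` E) by exact: cellI.
have [H1 P1 E1] := gE _ cFE (@subIsetr _ _ _).
have [[H2 P2 E2] m2] := IH F cF; have [[H3 P3 E3] m3] := IH _ cFE.
have fU x : fiber (F `&` Ulist (E :: L)) x = fiber (F `&` E) x `|` fiber (F `&` Ulist L) x.
  by rewrite /= setIUr.
have m1 := cell_mfib cFE.
split; last by move=> x; rewrite fU; exact: measurableU.
exists (fun x => H1 x + H2 x + -1 * H3 x).
  by apply: PC_add; [exact: PC_add|apply: PC_mul => //; exact: PC_cst].
move=> x Ih; rewrite fU cintU// E1// E2// -E3// mulN1r; congr (_ + _ - cint _ _).
by apply/seteqP; split=> [t [[a b] [c d]]|t [[a b] c]].
Qed.

Lemma one_variable (h : Z -> C) : PC K h -> exists2 H, PC K H &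
  forall x, cinteg setT (hsec h x) -> cint setT (hsec h x) = H x.
Proof.
move=> Ph; have [N [E [gE cov]]] := ultra_cover (CC := good h) (fun q qU => ocell_rep qU Ph).
have [|[H PH HE] _] := @hasH_union h [seq E i | i <- enum 'I_N] _ _ (ocell_lsub (@DsetT R n)).
  move=> i; rewrite size_map => iN; move: (iN); rewrite size_enum_ord => iN'.
  by rewrite (nth_map (Ordinal iN')).
exists H => // x Ih; rewrite -HE//; congr cint; apply/seteqP; split=> // t _.
split=> //; have [i Ei] := cov (row_mx x t%:M).
have : i \in enum 'I_N by rewrite mem_enum.
elim: (enum 'I_N) => //= j l IH; rewrite in_cons => /orP[/eqP <-|/IH]; first by left.
by right.
Qed.

End OneVariable.

(** * Integration with respect to several variables *)

Section SectionMeasurability.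
Variables (R : realType) (K : divringClosed R[i]) (n : nat).
Local Notation Z := 'rV[R]_(n + 1).

(** By [cell_cover] the section is a finite union of sections of cells, which are intervals. *)
Lemma Dset_mfib (S : set Z) : Dset S -> mfib S.
Proof.
move=> DS x; have [N [E [EP cov]]] := cell_cover DS.
rewrite (_ : fiber S x = \bigcup_(i in [set i | E i `<=` S]) fiber (E i) x).
  apply: fin_bigcup_measurable => [|i _]; first exact: finite_finset.
  by apply: cell_mfib; have [] := EP i.
apply/seteqP; split=> t.
  move=> St; have [i Ei] := cov (row_mx x t%:M); exists i => //=.
  by have [_ [//|ES]] := EP i; have := ES _ Ei.
by move=> [i ES Ei]; exact: ES.
Qed.

Lemma Dfun_msection (f : Z -> R) x : Dfun f ->
  measurable_fun [set: measurableTypeR R] (fun t : measurableTypeR R => f (row_mx x t%:M) : measurableTypeR R).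
Proof.
move=> Df; apply: (measurability _ (RGenOInfty.measurableE R)).
move=> _ [_ [r ->] <-]; rewrite setTI.
have := Dset_mfib (Dset_lt (D_cst _ r) Df) x.
by congr (measurable _); apply/seteqP; split=> t /=; rewrite /fiber /= in_itv /= andbT.
Qed.

Definition cmeas d (T : measurableType d) (h : T -> R[i]) :=
  measurable_fun [set: T] (fun t => complex.Re (h t)) /\ measurable_fun [set: T] (fun t => complex.Im (h t)).

Lemma PC_msection (h : Z -> R[i]) x : PC K h ->
  cmeas (hsec h x : measurableTypeR R -> R[i]).
Proof.
have mR (f : R -> R) (g : measurableTypeR R -> R) : measurable_fun setT f -> measurable_fun setT g ->
    measurable_fun setT (fun t => f (g t)).
  by move=> mf mg; exact: (measurableT_comp mf mg).
elim=> {h} [c|f a Df f0 aK|f Df f0|f h _ IHf _ IHh|f h _ IHf _ IHh].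
- by split; exact: measurable_cst.
- have mf := Dfun_msection x Df.
  have ml b : measurable_fun [set: measurableTypeR R] (fun t : measurableTypeR R => b * ln (f (row_mx x t%:M))).
    by apply: measurable_funM; [exact: measurable_cst|apply: mR => //; exact: measurable_ln].
  split; apply: measurable_funM; apply: mR => //; try exact: measurable_expR.
    by apply: continuous_measurable_fun; exact: continuous_cos.
  by apply: continuous_measurable_fun; exact: continuous_sin.
- split; last exact: measurable_cst.
  by apply: mR; [exact: measurable_ln|exact: Dfun_msection].
- have [f1 f2] := IHf; have [h1 h2] := IHh; split.
    rewrite (_ : (fun t => _) = (fun t => complex.Re (hsec f x t)) \+ (fun t => complex.Re (hsec h x t))).
      exact: measurable_funD.
    by apply/funext => t; rewrite /hsec cReD.
  rewrite (_ : (fun t => _) = (fun t => complex.Im (hsec f x t)) \+ (fun t => complex.Im (hsec h x t))).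
    exact: measurable_funD.
  by apply/funext => t; rewrite /hsec cImD.
have [f1 f2] := IHf; have [h1 h2] := IHh; split.
  rewrite (_ : (fun t => _) = (fun t => complex.Re (hsec f x t)) \* (fun t => complex.Re (hsec h x t)) \-
     (fun t => complex.Im (hsec f x t)) \* (fun t => complex.Im (hsec h x t))).
    by apply: measurable_funB; exact: measurable_funM.
  by apply/funext => t; rewrite /hsec cReM.
rewrite (_ : (fun t => _) = (fun t => complex.Re (hsec f x t)) \* (fun t => complex.Im (hsec h x t)) \+
   (fun t => complex.Im (hsec f x t)) \* (fun t => complex.Re (hsec h x t))).
  by apply: measurable_funD; exact: measurable_funM.
by apply/funext => t; rewrite /hsec cImM.
Qed.

End SectionMeasurability.

(** * Fubini for the recursively defined Lebesgue measure on tuples *)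

Section Fubini.
Variable R : realType.
Local Notation MR := (measurableTypeR R).
Local Notation leb := (@lebesgue_measure R).

Lemma cons_integral n (g : n.+1.-tuple MR -> R) :
  (lebesgue_tuple R n.+1).-integrable [set: _] (EFin \o g) ->
  let G := fun p : MR * n.-tuple MR => (g (cons_pair p))%:E in
  (leb \x lebesgue_tuple R n)%E.-integrable [set: _] G /\
  (\int[lebesgue_tuple R n.+1]_t (g t)%:E = \int[(leb \x lebesgue_tuple R n)%E]_p G p)%E.
Proof.
move=> ig G; have mg := measurable_int _ ig; have mc := @measurable_cons_pair R n.
have iG : (leb \x lebesgue_tuple R n)%E.-integrable [set: _] G.
  apply/integrableP; split; first exact: (measurableT_comp mg mc).
  have /integrableP[_] := ig.
  rewrite [X in (X < _)%E -> _](_ : _ = (\int[pushforward (leb \x lebesgue_tuple R n)%E (@cons_pair R n)]_x `|(EFin \o g) x|)%E)//.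
  rewrite (ge0_integral_pushforward mc)//.
  exact: measurableT_comp.
split=> //; exact: (integral_pushforward mc mg iG measurableT).
Qed.

(** Almost every section is integrable, so the partial integral agrees with [F1] almost everywhere;
    measurability of [F1] then lets it replace the partial integral. *)
Lemma fubini_real n (g : n.+1.-tuple MR -> R) (F1 : MR -> R) :
  (lebesgue_tuple R n.+1).-integrable [set: _] (EFin \o g) ->
  measurable_fun [set: MR] F1 ->
  {ae leb, forall t, (lebesgue_tuple R n).-integrable [set: _] (fun y => (g (cons_pair (t, y)))%:E) ->
     Rintegral (lebesgue_tuple R n) setT (fun y => g (cons_pair (t, y))) = F1 t} ->
  leb.-integrable [set: MR] (EFin \o F1) /\
  Rintegral (lebesgue_tuple R n.+1) setT g = Rintegral leb setT F1.
Proof.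
move=> ig mF1 aeF; have [iG EG] := cons_integral ig.
pose G := fun p : MR * n.-tuple MR => (g (cons_pair p))%:E.
pose F := fubini_F (lebesgue_tuple R n) G.
have iF : leb.-integrable [set: MR] F := integrable_fubini_F iG.
have EF : ae_eq leb [set: MR] F (EFin \o F1).
  apply: filterS2 aeF (ae_integrable1 iG) => t ht it _.
  rewrite /F /fubini_F /= -(ht it) /Rintegral fineK//.
  exact: integrable_fin_num it.
have mF := measurable_int _ iF; have mE : measurable_fun [set: MR] (EFin \o F1) by exact/measurable_EFinP.
split.
  apply/integrableP; split=> //; have /integrableP[_] := iF.
  rewrite (@ae_eq_integral _ _ _ leb setT (fun t => `|(EFin \o F1) t|%E))//.
  - exact: measurableT_comp.
  - exact: measurableT_comp.
  - by apply: filterS EF => t /= h tT; rewrite (h tT).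
rewrite /Rintegral EG -(integral12_prod_meas1 iG); congr fine.
exact: ae_eq_integral.
Qed.

End Fubini.

Section Integration.
Variables (R : realType) (K : divringClosed R[i]).
Local Notation MR := (measurableTypeR R).
Local Notation leb := (@lebesgue_measure R).

Lemma row_cons m n (x : 'rV[R]_m) (t : MR) (y : n.-tuple MR) (e : (m + n.+1 = (m + 1) + n)%N) :
  \row_i (row_mx (row_mx x t%:M) (row_of_tuple y)) 0 (cast_ord e i) =
  row_mx x (row_of_tuple (cons_pair (t, y))).
Proof.
apply/rowP => i; rewrite mxE; case: (split_ordP i) => j ->; rewrite ?row_mxEl ?row_mxEr.
  have -> : cast_ord e (lshift n.+1 j) = lshift n (lshift 1 j) by apply/val_inj.
  by rewrite !row_mxEl.
case: (unliftP ord0 j) => [k ->|->].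
  have -> : cast_ord e (rshift m (lift ord0 k)) = rshift (m + 1) k.
    by apply/val_inj; rewrite /= /bump leq0n addnA.
  by rewrite row_mxEr !mxE tnthS.
have -> : cast_ord e (rshift m ord0) = lshift n (rshift m ord0) by apply/val_inj.
by rewrite row_mxEl row_mxEr !mxE eqxx mulr1n.
Qed.

(** The first integration variable is moved to the parameters: the induction hypothesis at [m + 1]
    integrates the others, and [one_variable] integrates the one left. For almost every value of
    that variable the real and imaginary parts of the section are both integrable, as the induction
    hypothesis demands. *)
Lemma PC_integral n : forall m (h : 'rV[R]_(m + n) -> R[i]), PC K h ->
  exists2 H, PC K H & forall x, L1 (fun y : 'rV[R]_n => h (row_mx x y)) ->
    cintegral (fun y : 'rV[R]_n => h (row_mx x y)) = H x.
Proof.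
elim: n => [|n IH] m h Ph.
  (* The measure on empty tuples is a point mass, so the integral is the value at the empty
     tuple. *)
  exists (fun x => h (row_mx x (row_of_tuple [tuple]))).
    pose g (i : 'I_(m + 0)) (x : 'rV[R]_m) := x 0 (cast_ord (addn0 m) i).
    apply: PC_eq (PC_comp (g := g) Ph _) _ => [i|x]; first exact: D_coord.
    congr h; apply/rowP => i; rewrite mxE; case: (split_ordP i) => [j ->|[]//].
    by rewrite row_mxEl; congr (x _ _); apply/val_inj.
  move=> x [I1 I2]; apply: complex_eq; rewrite /cintegral /= /Rintegral /=.
    by have := integral_dirac [tuple] measurableT (measurable_int _ I1); rewrite diracT mul1e /= => ->.
  by have := integral_dirac [tuple] measurableT (measurable_int _ I2); rewrite diracT mul1e /= => ->.
have e : (m + n.+1 = (m + 1) + n)%N by rewrite addnAC addn1 addnS.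
pose h' (w : 'rV[R]_((m + 1) + n)) := h (\row_i w 0 (cast_ord e i)).
have Ph' : PC K h' by apply: (PC_comp (g := fun i w => w 0 (cast_ord e i)) Ph) => i; exact: D_coord.
have [H1 PH1 H1E] := IH (m + 1)%N h' Ph'; have [H PH HE] := one_variable PH1.
exists H => // x [I1 I2]; have [m1 m2] := PC_msection x PH1.
have hE t y : h' (row_mx (row_mx x t%:M) (row_of_tuple y)) = h (row_mx x (row_of_tuple (cons_pair (t, y)))).
  by rewrite /h' row_cons.
have [[iG1 _] [iG2 _]] := (cons_integral I1, cons_integral I2).
have ae1 := ae_integrable1 iG1; have ae2 := ae_integrable1 iG2.
have L t : (lebesgue_tuple R n).-integrable [set: _] (fun y => (complex.Re (h (row_mx x (row_of_tuple (cons_pair (t, y))))))%:E) ->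
   (lebesgue_tuple R n).-integrable [set: _] (fun y => (complex.Im (h (row_mx x (row_of_tuple (cons_pair (t, y))))))%:E) ->
   cintegral (fun y : 'rV[R]_n => h' (row_mx (row_mx x t%:M) y)) = hsec H1 x t.
  move=> J1 J2; apply: H1E; split.
    by apply: eq_integrable J1 => // y _ /=; rewrite hE.
  by apply: eq_integrable J2 => // y _ /=; rewrite hE.
have [|i1 E1] := fubini_real (g := fun t => complex.Re (h (row_mx x (row_of_tuple t)))) I1 m1.
  apply: filterS ae2 => t J2 J1; rewrite -(L t J1 J2) /cintegral /=.
  by apply: eq_Rintegral => y _; rewrite hE.
have [|i2 E2] := fubini_real (g := fun t => complex.Im (h (row_mx x (row_of_tuple t)))) I2 m2.
  apply: filterS ae1 => t J1 J2; rewrite -(L t J1 J2) /cintegral /=.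
  by apply: eq_Rintegral => y _; rewrite hE.
rewrite -HE; last by split.
by apply: complex_eq; rewrite /cintegral /cint /=.
Qed.

Lemma prod_Rn_subanalytic m n (X : set 'rV[R]_m) : subanalytic X -> subanalytic (prod_Rn n X).
Proof.
move=> sX; apply: subanalytic_eq (subanalytic_ren (lshift n) sX) _ => z /=.
by rewrite /prod_Rn /= (_ : \row_i _ = lsubmx z)//; apply/rowP => i; rewrite !mxE.
Qed.

Lemma constructible_real n (X : set 'rV[R]_n) (h : 'rV[R]_n -> R[i]) x : coef_field K <> [set: R[i]] ->
  power_constructible K X h -> X x -> complex.Im (h x) = 0.
Proof.
move=> nT [N [M [c [al [f [g [_ cK aK _ hE]]]]]]] Xx; rewrite hE//.
have [Kr cr] : (forall z, z \in K -> complex.Im z = 0) /\ forall z, coef_field K z -> complex.Im z = 0.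
  by move: nT; rewrite /coef_field; case: asboolP.
rewrite raddf_sum big1 //= => i _; apply: Im_mul; first exact/cr/cK.
elim/big_rec: _ => [//|j y _ y0]; apply: Im_mul => //; apply: Im_mul => //.
by apply: real_cpow; exact/Kr/aK.
Qed.

End Integration.

Theorem theorem2p4 (R : realType) (K : divringClosed R[i]) (m n : nat)
    (X : set 'rV[R]_m) (h : 'rV[R]_(m + n) -> R[i]) :
  subanalytic X -> (1 <= n)%N -> power_constructible K (prod_Rn n X) h ->
  exists H : 'rV[R]_m -> R[i],
    power_constructible K X H /\
    forall x, x \in Int_locus h X ->
      cintegral (fun y : 'rV[R]_n => h (row_mx x y)) = H x.
Proof.
move=> sX _ hc; have [g Pg gE] := constructible_PC (prod_Rn_subanalytic n sX) hc.
have [G PG GE] := PC_integral Pg; have [H cH HE] := PC_constructible sX PG.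
exists H; split=> // x; rewrite inE => -[Xx Lx].
have hg : (fun y : 'rV[R]_n => h (row_mx x y)) = (fun y => g (row_mx x y)).
  by apply/funext => y; apply: gE; rewrite /prod_Rn /= row_mxKl.
have E : cintegral (fun y : 'rV[R]_n => h (row_mx x y)) = G x by move: Lx; rewrite hg; exact: GE.
(* When the coefficients are real, [H] is only known to agree with [G] where [G] is real; here [G]
   is the integral of a real function. *)
rewrite HE//; have [cT|nT] := pselect (coef_field K = [set: R[i]]); [by right|left].
rewrite -E /cintegral /= (_ : Rintegral _ _ _ = Rintegral (lebesgue_tuple R n) setT (fun=> 0)).
  by rewrite /Rintegral integral0.
apply: eq_Rintegral => y _; apply: (constructible_real nT hc).
by rewrite /prod_Rn /= row_mxKl.
Qed.
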